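(* Let $(v,h)$ and $(V,H)$ be weak solutions of the cutoff Westervelt system (each with its own initial data). Assume that the reference solution satisfies $$H\in W^{1,1}(0,T;L^\infty(\Omega)).$$ Then, for every $t\in[0,T]$, $$\frac12\|v(t)-V(t)\|_{L^2(\Omega)}^2+\mathscr R(h(t)\mid H(t))\le\Bigl(\frac12\|v(0)-V(0)\|_{L^2(\Omega)}^2+\mathscr R(h(0)\mid H(0))\Bigr)\exp\Bigl(\frac a\delta\int_0^t\|H_t(s)\|_{L^\infty(\Omega)}\,ds\Bigr).$$ In particular, if the initial data coincide, then $v=V$ and $h=H$ a.e. in $\Omega\times(0,T)$.
   Context: $\Omega\subset\mathbb R^d$, $d\le3$, is a bounded Lipschitz domain, $T>0$, $a,b>0$, $M\in(0,1/a)$ fixed, $\delta:=1-aM$. Set $\mathcal T_M(r):=\max\{-M,\min\{r,M\}\}$, $m(r):=1-a\mathcal T_M(r)$, $\nu(r):=\int_0^r m(s)\,ds$, $\beta:=\nu^{-1}$, $\Psi(s):=\int_0^s\beta(\rho)\,d\rho$. The relative entropy is $$\mathscr R(h\mid H):=\int_\Omega\bigl[\Psi(\nu(h))-\Psi(\nu(H))-H(\nu(h)-\nu(H))\bigr]dx=\int_\Omega\int_H^h(s-H)m(s)\,ds\,dx.$$ $(\cdot,\cdot)$ is the $L^2$ inner product and $\langle\cdot,\cdot\rangle$ the $H^{-1}(\Omega)$–$H_0^1(\Omega)$ duality pairing. The cutoff Westervelt system is $\partial_t v+\nabla h=0$, $\partial_t\nu(h)+\operatorname{div}v=b\Delta h$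 in $(0,T)\times\Omega$, $h=0$ on $(0,T)\times\partial\Omega$, $v(0)=v_0$, $h(0)=h_0$. Weak solution with initial data $v_0\in L^2(\Omega)^d$, $h_0\in L^2(\Omega)$: a pair $(v,h)$ with $v\in L^\infty(0,T;L^2(\Omega)^d)\cap H^1(0,T;L^2(\Omega)^d)$, $h\in L^\infty(0,T;L^2(\Omega))\cap L^2(0,T;H_0^1(\Omega))$, $\nu(h)\in L^2(0,T;H_0^1(\Omega))\cap H^1(0,T;H^{-1}(\Omega))$, such that for a.e. $t\in(0,T)$, $$(\partial_t v(t),\varphi)+(\nabla h(t),\varphi)=0\quad\forall\varphi\in L^2(\Omega)^d,$$ $$\langle\partial_t\nu(h)(t),\xi\rangle-(v(t),\nabla\xi)+b(\nabla h(t),\nabla\xi)=0\quad\forall\xi\in H_0^1(\Omega),$$ and $v(0)=v_0$ in $L^2(\Omega)^d$, $\nu(h)(0)=\nu(h_0)$ in $H^{-1}(\Omega)$. For such solutions $v\in C([0,T];L^2(\Omega)^d)$, and $\nu(h),h\in C([0,T];L^2(\Omega))$ (continuous representatives); pointwise-in-time values refer to these. *)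

(* Defs.v *)
From HB Require Import structures.
From mathcomp Require Import all_boot all_order all_algebra.
From mathcomp Require Import all_classical all_reals all_analysis.

Set Implicit Arguments.
Unset Strict Implicit.
Unset Printing Implicit Defensive.
Import Order.TTheory GRing.Theory Num.Theory.
Import numFieldNormedType.Exports.

Local Open Scope classical_set_scope.
Local Open Scope ring_scope.

(** ** Lebesgue measure on R^d *)

Definition row_display : measure_display. Proof. exact: default_measure_display. Qed.

(* R^n = 'rV[R]_n carries the product sigma-algebra of the Borel sets of R. *)
Section measurable_row.
Context (R : realType) (n : nat).

Definition row_coord (i : 'I_n) (x : 'rV[R]_n) : measurableTypeR R := x 0 i.

Let row_set0 : g_sigma_preimage row_coord set0.
Proof. exact: sigma_algebra0. Qed.

Let row_setC A : g_sigma_preimage row_coord A -> g_sigma_preimage row_coord (~` A).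
Proof. exact: sigma_algebraC. Qed.

Let row_bigcup (F : (set 'rV[R]_n)^nat) : (forall i, g_sigma_preimage row_coord (F i)) ->
  g_sigma_preimage row_coord (\bigcup_i (F i)).
Proof. exact: sigma_algebra_bigcup. Qed.

HB.instance Definition _ := @isMeasurable.Build row_display
  'rV[R]_n (g_sigma_preimage row_coord) row_set0 row_setC row_bigcup.

End measurable_row.

Lemma measurable_row_coord (R : realType) n (i : 'I_n) :
  measurable_fun [set: 'rV[R]_n] (@row_coord R n i).
Proof.
move=> _ Y mY; rewrite setTI; apply: sub_sigma_algebra => /=.
rewrite -bigcup_seq/=; exists i => /=; first by rewrite mem_index_enum.
by exists Y => //; rewrite setTI.
Qed.

Lemma measurable_row (R : realType) d (T : measurableType d) n (f : T -> 'rV[R]_n) :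
  (forall i, measurable_fun [set: T] (@row_coord R n i \o f)) ->
  measurable_fun [set: T] f.
Proof.
move=> mf _ A mA; rewrite setTI.
have : g_sigma_preimage (fun i => @row_coord R n i \o f) `<=` measurable.
  apply: smallest_sub; first exact: sigma_algebra_measurable.
  rewrite -bigcup_seq; apply: bigcup_sub => i _ B [C mC <-]; exact: mf.
apply; rewrite g_sigma_preimage_comp; exists A => //.
by rewrite setTI.
Qed.

Definition row_cons (R : realType) n (p : 'rV[R]_n * measurableTypeR R) : 'rV[R]_n.+1 :=
  \row_i (if unlift ord0 i is Some j then p.1 0 j else p.2).

Lemma measurable_row_cons (R : realType) n :
  measurable_fun [set: 'rV[R]_n * measurableTypeR R] (@row_cons R n).
Proof.
apply: measurable_row => i.
case: (unliftP ord0 i) => [j|] ->.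
  rewrite (_ : _ \o _ = @row_coord R n j \o fst).
    apply: measurableT_comp; [exact: measurable_row_coord|exact: measurable_fst].
  by apply/funext => p; rewrite /= /row_coord mxE liftK.
rewrite (_ : _ \o _ = snd); first exact: measurable_snd.
by apply/funext => p; rewrite /= /row_coord mxE unlift_none.
Qed.

Definition image_measure d1 d2 (T1 : measurableType d1) (T2 : measurableType d2)
    (R : realType) (m : {measure set T1 -> \bar R}) (f : T1 -> T2)
    (mf : measurable_fun [set: T1] f) : {measure set T2 -> \bar R} :=
  measure_function_pushforward__canonical__measure_function_Measure m mf.

(* One point has mass 1 in R^0; the measure on R^(n+1) is the image of the product
   of the measure on R^n and of Lebesgue measure on R. *)
Fixpoint lebesgue_row (R : realType) (n : nat) : {measure set 'rV[R]_n -> \bar R} :=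
  match n with
  | 0 => \d_(0 : 'rV[R]_0)
  | m.+1 => image_measure (lebesgue_row R m \x @lebesgue_measure R)%E
              (@measurable_row_cons R m)
  end.

(** ** Bounded Lipschitz domains *)

(* Near every boundary point, and in suitable rotated coordinates z, Omega is the
   part of a cylinder lying strictly above the graph of a Lipschitz function of the
   coordinates other than z_k. *)
Definition lipschitz_boundary (R : realType) d (Omega : set 'rV[R]_d) : Prop :=
  forall x, (closure Omega `\` interior Omega) x ->
  exists (Q : 'M[R]_d) (k : 'I_d) (g : 'rV[R]_d.-1 -> R^o) (L r s : R),
    [/\ Q *m Q^T = 1%:M, L.-lipschitz g, 0 < r, 0 < s &
      forall y, let z := (y - x) *m Q in
        `|col' k z| < r -> `|z 0 k| < s -> (Omega y <-> g (col' k z) < z 0 k)].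

Definition bounded_lipschitz_domain (R : realType) d (Omega : set 'rV[R]_d) : Prop :=
  [/\ Omega !=set0, open Omega, connected Omega, bounded_set Omega &
      lipschitz_boundary Omega].

(** ** Test functions *)

Definition smooth (R : realType) (V : normedModType R) (f : V -> R^o) : Prop :=
  forall s : seq V, let g := foldr (fun e (h : V -> R^o) => 'D_e h) f s in
    continuous g /\ forall x e, derivable g x e.

Definition test_fun (R : realType) (V : normedModType R) (U : set V) (f : V -> R^o) : Prop :=
  [/\ smooth f, compact (closure [set x | f x != 0]) &
      closure [set x | f x != 0] `<=` U].

(** ** Function spaces *)

(* A seminormed space given by representatives: a subspace member of a vector space with
   a seminorm on it. The normed space it stands for is the quotient of member by the
   elements of zero seminorm; the value of snorm outside member is irrelevant. *)
Record space (R : realType) := Space {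
  vec :> lmodType R;
  member : set vec;
  snorm : vec -> R }.

Arguments member {R} s _.
Arguments snorm {R} s _.

Section spaces.
Context (R : realType) (d : nat) (Omega : set 'rV[R]_d).
Local Notation mu := (lebesgue_row R d).
Implicit Types (u w : 'rV[R]_d -> R^o) (g q : 'rV[R]_d -> 'rV[R]_d).

Definition Lebesgue (p : \bar R) : space R := @Space R ('rV[R]_d -> R^o)
  [set u | u \_ Omega \in Lfun mu p]
  (fun u => fine ('N[mu]_p [EFin \o (u \_ Omega)])).

Definition L2 : space R := Lebesgue 2%:E.

Definition L2vec : space R := @Space R ('rV[R]_d -> 'rV[R]_d)
  [set g | forall i, member L2 (fun x => g x 0 i)]
  (fun g => Num.sqrt (\sum_i (snorm L2 (fun x => g x 0 i)) ^+ 2)).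

Definition ip u w : R := \int[mu]_(x in Omega) (u x * w x).

Definition ipvec g q : R := \int[mu]_(x in Omega) (\sum_i g x 0 i * q x 0 i).

Definition weak_gradient u g : Prop :=
  forall phi, test_fun Omega phi -> forall i,
    \int[mu]_(x in Omega) (u x * 'D_(delta_mx 0 i) phi x) =
    - \int[mu]_(x in Omega) (g x 0 i * phi x).

(* A representative in L^2 of the weak gradient, when there is one. *)
Definition grad u : 'rV[R]_d -> 'rV[R]_d :=
  xget (cst 0) [set g | member L2vec g /\ weak_gradient u g].

Definition H1 : space R := @Space R ('rV[R]_d -> R^o)
  [set u | member L2 u /\ exists g, member L2vec g /\ weak_gradient u g]
  (fun u => Num.sqrt ((snorm L2 u) ^+ 2 + (snorm L2vec (grad u)) ^+ 2)).

Definition H10 : space R := @Space R ('rV[R]_d -> R^o)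
  [set u | member H1 u /\ forall e : R, 0 < e ->
     exists2 phi, test_fun Omega phi & snorm H1 (u - phi) < e]
  (snorm H1).

(* The dual of H10; only the values of a functional on H10 matter. *)
Definition Hm1 : space R := @Space R (('rV[R]_d -> R^o) -> R^o)
  [set F | (forall (c : R) u w, member H10 u -> member H10 w ->
              F (c *: u + w) = c * F u + F w) /\
           exists C : R, forall u, member H10 u -> `|F u| <= C * snorm H10 u]
  (fun F => sup [set `|F u| | u in [set u | member H10 u /\ snorm H10 u <= 1]]).

Definition L2_to_Hm1 u : Hm1 := fun xi => ip u xi.

End spaces.

(** ** Bochner spaces over (0, T) *)

Record simple_map (R : realType) (X : space R) := SimpleMap {
  sm_size : nat;
  sm_set : 'I_sm_size -> set R;
  sm_val : 'I_sm_size -> X;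
  sm_measurable : forall i, measurable (sm_set i);
  sm_mem : forall i, member X (sm_val i) }.

Section Bochner.
Context (R : realType) (X : space R) (T : R).
Local Notation leb := (@lebesgue_measure R).
Local Notation I := (`]0, T[%classic : set R).
Implicit Types (u w : R -> X).

Definition sm_eval (s : simple_map X) (t : R) : X :=
  \sum_i (\1_(sm_set i) t : R) *: sm_val (s := s) i.

Definition sm_integral (s : simple_map X) : X :=
  \sum_i fine (leb (sm_set i `&` I)) *: sm_val (s := s) i.

Definition strongly_measurable u : Prop :=
  {ae leb, forall t, I t -> member X (u t)} /\
  exists s : nat -> simple_map X,
    {ae leb, forall t, I t -> snorm X (u t - sm_eval (s n) t) @[n --> \oo] --> (0 : R)}.

Definition bochner_integral u (y : X) : Prop :=
  [/\ strongly_measurable u, member X y & exists s : nat -> simple_map X,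
    ((\int[leb]_(t in I) (snorm X (u t - sm_eval (s n) t))%:E)%E @[n --> \oo] --> 0%E) /\
    (snorm X (sm_integral (s n) - y) @[n --> \oo] --> (0 : R))].

(* L^p(0, T; X). Lfun consists of Borel functions, whence the representative g. *)
Definition bochner_Lp (p : \bar R) u : Prop :=
  strongly_measurable u /\
  exists2 g : R -> R, g \in Lfun leb p & {ae leb, forall t, I t -> snorm X (u t) = g t}.

(* w is the distributional derivative of u on (0, T), with values in X. *)
Definition weak_time_derivative u w : Prop :=
  forall phi : R -> R, test_fun I (phi : R^o -> R^o) ->
    exists y : X, bochner_integral (fun t => derive1 (phi : R^o -> R^o) t *: u t) y /\
                  bochner_integral (fun t => phi t *: w t) (- y).

(* u is in W^{1,p}(0, T; X) and its derivative is w. *)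
Definition bochner_W1p (p : \bar R) u w : Prop :=
  [/\ bochner_Lp p u, bochner_Lp p w & weak_time_derivative u w].

Definition bochner_C u : Prop :=
  forall t, t \in `[0, T] -> member X (u t) /\
    snorm X (u s - u t) @[s --> within `[0, T]%classic (nbhs t)] --> (0 : R).

Definition continuous_repr u uc : Prop :=
  bochner_C uc /\ {ae leb, forall t, I t -> snorm X (uc t - u t) = 0}.

(* u(0) = x, where u(0) is the value at 0 of the continuous representative. *)
Definition initial_value u (x : X) : Prop :=
  exists2 uc, continuous_repr u uc & snorm X (uc 0 - x) = 0.

End Bochner.

(** ** The cutoff Westervelt system *)

Section Westervelt.
Context (R : realType).

Definition oriented_integral (f : R -> R) (x y : R) : R :=
  if x <= y then \int[@lebesgue_measure R]_(s in `[x, y]) f s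
  else - \int[@lebesgue_measure R]_(s in `[y, x]) f s.

Variables (a b M : R).

Definition cutoff (r : R) : R := Num.max (- M) (Num.min r M).

Definition mcoef (r : R) : R := 1 - a * cutoff r.

Definition nu (r : R) : R := oriented_integral mcoef 0 r.

Definition beta (s : R) : R := xget 0 [set r | nu r = s].

Definition Psi (s : R) : R := oriented_integral beta 0 s.

Context (d : nat) (Omega : set 'rV[R]_d).

Definition rel_entropy (h H : 'rV[R]_d -> R) : R :=
  \int[lebesgue_row R d]_(x in Omega)
    (Psi (nu (h x)) - Psi (nu (H x)) - H x * (nu (h x) - nu (H x))).

Definition weak_solution (T : R) (v0 : 'rV[R]_d -> 'rV[R]_d) (h0 : 'rV[R]_d -> R)
    (v : R -> 'rV[R]_d -> 'rV[R]_d) (h : R -> 'rV[R]_d -> R) : Prop :=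
  let nuh t : 'rV[R]_d -> R := nu \o h t in
  [/\ member (L2vec Omega) v0 /\ member (L2 Omega) h0,
      bochner_Lp (X := L2vec Omega) T +oo%E v,
      [/\ bochner_Lp (X := L2 Omega) T +oo%E h,
          bochner_Lp (X := H10 Omega) T 2%:E h &
          bochner_Lp (X := H10 Omega) T 2%:E nuh],
      exists (dv : R -> L2vec Omega) (dnu : R -> Hm1 Omega),
        [/\ bochner_W1p (X := L2vec Omega) T 2%:E v dv,
            bochner_W1p (X := Hm1 Omega) T 2%:E (fun t => L2_to_Hm1 Omega (nuh t)) dnu &
            {ae @lebesgue_measure R, forall t, `]0, T[%classic t ->
              (forall phi, member (L2vec Omega) phi ->
                 ipvec Omega (dv t) phi + ipvec Omega (grad Omega (h t)) phi = 0) /\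
              (forall xi, member (H10 Omega) xi ->
                 dnu t xi - ipvec Omega (v t) (grad Omega xi) +
                 b * ipvec Omega (grad Omega (h t)) (grad Omega xi) = 0)}] &
      initial_value (X := L2vec Omega) T v v0 /\
      initial_value (X := Hm1 Omega) T (fun t => L2_to_Hm1 Omega (nuh t))
        (L2_to_Hm1 Omega (nu \o h0))].

End Westervelt.

(* Main.v *)
(* Formally, with w = v - V, testing the difference of the first equations with w and that of the
   second ones with h - H gives d/dt (|w|^2 / 2 + R(h | H)) <= (a / delta) |H_t|_oo R(h | H), because
   the only term without a sign is the integral of H_t against nu(h) - nu(H) - m(H) (h - H), which is
   at most a/2 |h - H|^2 in absolute value, while R(h | H) >= delta/2 |h - H|^2 in L^2.

   To avoid a chain rule for R, finite differences are used. For almost all times y < r, convexity of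
   Psi bounds R(r) - R(y) by the increment of nu(h) - nu(H) paired with (h - H)(r), plus a remainder
   controlled by the variation of H. Integrating the second equation over (y, r) and replacing
   nabla (h - H) by - w' turns the pairing into - int_y^r (w(x), w'(r)) dx - b (w(r) - w(y), w'(r)).
   Averaging over r in the cells of a uniform grid replaces w'(r) by difference quotients of w. Summing
   over all y at distance at most n cells, as in a Fejer mean, makes both terms telescope: the first to
   - |w|^2 / 2, the second to a nonpositive quantity, up to errors of order 1/n and of the order of the
   moduli of continuity of w and R. The latter are available because a Lions-Magenes type partition
   argument makes nu(h), hence h, uniformly continuous into L^2 on a conull set of times.

   Gronwall's lemma on the conull set extends to all times by continuity. For uniqueness the energy is
   shown to be small at suitable times close to 0, where only nu(h)(0) = nu(h_0) in H^{-1} is known. *)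

Require Import Defs.
From mathcomp Require Import all_boot all_order all_algebra.
From mathcomp Require Import all_classical all_reals all_analysis.
From mathcomp Require Import measurable_realfun ess_sup_inf.
From mathcomp Require Import zify ring lra.
Import Order.TTheory GRing.Theory Num.Theory.
Import numFieldNormedType.Exports.
Local Open Scope classical_set_scope.
Local Open Scope ring_scope.

Set Implicit Arguments.
Unset Strict Implicit.
Unset Printing Implicit Defensive.

(** * The cutoff nonlinearity *)

Section real_lemmas.
Context (R : realType).
Implicit Types (f : R -> R) (x y r c k : R).

(** In the window average, the viscous pairing of w(t) - w(t - lag) with w'(t) has the Fourier
    symbol omega sin(lag omega), which has no sign for a single lag; integrated over the lags up to
    E it becomes 1 - cos(E omega) >= 0. This is why all lags up to n cells are summed, and how w' in
    L^2 suffices. Two scales result: the window of n cells is fixed first, by the moduli of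
    continuity, and only then does the mesh tend to zero, which removes the terms of relative size
    1/n. The test function (h - H)(r) is frozen while the second equation is integrated from y to r,
    because the time derivative of nu(h) lies only in H^{-1} and no product rule in time pairs it
    with H. Vector-valued functions of time are used through bounded linear forms: a form turns a
    weak time derivative into an integrable real function with a primitive, at the price of a null
    set that depends on the form. *)

Lemma ler_eps x y : (forall e, 0 < e -> x <= y + e) -> x <= y.
Proof. by move=> h; apply/ler_addgt0Pr. Qed.

(* Halving the step improves a quadratic bound c to c / 2 + k / 4, whose fixed point is k / 2. *)
Lemma midpoint_bound (D : R -> R -> R) c k :
  0 <= c -> 0 <= k ->
  (forall x y, D x y <= c * (y - x) ^+ 2) ->
  (forall x y, D x y <= D x ((x + y) / 2) + D ((x + y) / 2) y + k / 4 * (y - x) ^+ 2) ->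
  forall x y, D x y <= k / 2 * (y - x) ^+ 2.
Proof.
move=> c0 k0 Dc Dk.
have H n : forall x y, D x y <= (k / 2 + c / 2 ^+ n) * (y - x) ^+ 2.
  elim: n => [x y|n IH x y].
    apply: (le_trans (Dc x y)); rewrite expr0 divr1.
    by apply: ler_wpM2r; [exact: sqr_ge0|lra].
  apply: (le_trans (Dk x y)).
  have := lerD (IH x ((x + y) / 2)) (IH ((x + y) / 2) y).
  set u := c / 2 ^+ n => h.
  have -> : c / 2 ^+ n.+1 = u / 2.
    by rewrite /u exprS invfM; field; rewrite expf_neq0.
  apply: le_trans (_ : _ <= (k / 2 + u) * ((x + y) / 2 - x) ^+ 2 +
      (k / 2 + u) * (y - (x + y) / 2) ^+ 2 + k / 4 * (y - x) ^+ 2) _.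
    by rewrite lerD2r.
  by rewrite le_eqVlt; apply/orP; left; apply/eqP; field.
move=> x y; apply: ler_eps => e e0.
have [n hn] : exists n : nat, c * (y - x) ^+ 2 / e < n%:R.
  exists (Num.bound (c * (y - x) ^+ 2 / e)); apply: archi_boundP.
  by apply: divr_ge0; [apply: mulr_ge0 => //; exact: sqr_ge0|exact: ltW].
apply: (le_trans (H n x y)); rewrite mulrDl lerD2l.
have n2 : (n%:R : R) <= 2 ^+ n by rewrite -natrX ler_nat ltnW// ltn_expl.
rewrite mulrAC ler_pdivrMr ?exprn_gt0// [e * _]mulrC -ler_pdivrMr//.
by rewrite (le_trans (ltW hn)).
Qed.

Lemma continuous_itv_integrable f x y : continuous f ->
  (@lebesgue_measure R).-integrable `[x, y] (EFin \o f).
Proof.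
move=> cf; apply: continuous_compact_integrable; first exact: segment_compact.
exact: continuous_subspaceT.
Qed.

Lemma Rintegral_itv_cat f x y r : continuous f -> x <= y -> y <= r ->
  \int[@lebesgue_measure R]_(s in `[x, r]) f s =
  \int[@lebesgue_measure R]_(s in `[x, y]) f s +
  \int[@lebesgue_measure R]_(s in `[y, r]) f s.
Proof.
move=> cf xy yr.
have := @Rintegral_itvB _ f (BLeft x) (BRight r) y (continuous_itv_integrable x r cf).
rewrite !bnd_simp => /(_ xy yr) /eqP; rewrite subr_eq => /eqP ->.
rewrite addrC; congr (_ + _); apply: Rintegral_itv_obnd_cbnd.
apply: integrableS (continuous_itv_integrable y r cf) => //.
by apply: subset_itvr; rewrite bnd_simp.
Qed.

Lemma oriented_integralB f x y : continuous f -> x <= y ->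
  oriented_integral f 0 y - oriented_integral f 0 x =
  \int[@lebesgue_measure R]_(s in `[x, y]) f s.
Proof.
move=> cf xy; rewrite /oriented_integral.
case: (leP 0 x) => x0; case: (leP 0 y) => y0.
- by rewrite (Rintegral_itv_cat cf x0 xy) addrAC subrr add0r.
- by lra.
- by rewrite opprK addrC -Rintegral_itv_cat// ltW.
- rewrite opprK addrC (@Rintegral_itv_cat f x y 0)// ?(ltW y0)//.
  by rewrite -addrA subrr addr0.
Qed.

Lemma Rintegral_itv_bounds f x y c k : continuous f -> x <= y ->
  (forall s, x <= s <= y -> c <= f s <= k) ->
  c * (y - x) <= \int[@lebesgue_measure R]_(s in `[x, y]) f s <= k * (y - x).
Proof.
move=> cf xy fb.
have E r : \int[@lebesgue_measure R]_(s in `[x, y]) r = r * (y - x).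
  rewrite Rintegral_cst//= lebesgue_measure_itv/= lte_fin.
  by case: ltP => //= yx; have -> : y = x; [lra|rewrite subrr].
have ci r : (@lebesgue_measure R).-integrable `[x, y] (EFin \o cst r).
  exact: (continuous_itv_integrable x y (@cst_continuous _ _ r)).
apply/andP; split.
- rewrite -E; apply: le_Rintegral => //; [exact: ci|exact: continuous_itv_integrable|].
  by move=> s /=; rewrite in_itv/= => /fb/andP[].
- rewrite -E; apply: le_Rintegral => //; [exact: continuous_itv_integrable|exact: ci|].
  by move=> s /=; rewrite in_itv/= => /fb/andP[].
Qed.

Lemma lipschitz_continuous f c : (forall x y, `|f x - f y| <= c * `|x - y|) -> continuous f.
Proof.
move=> fc x; apply/cvgrPdist_lt => e e0.
near=> y; apply: (le_lt_trans (fc x y)).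
have c1 : 0 < `|c| + 1 by rewrite ltr_wpDl.
apply: (@le_lt_trans _ _ ((`|c| + 1) * `|x - y|)).
  by rewrite ler_wpM2r// (le_trans (ler_norm c))// lerDl.
rewrite mulrC -ltr_pdivlMr//; near: y.
by apply: cvgr_dist_lt => //; rewrite divr_gt0.
Unshelve. all: by end_near. Qed.

End real_lemmas.

Section nonlinearity.
Context (R : realType) (a M : R).
Hypotheses (a0 : 0 < a) (M0 : 0 < M) (aM : a * M < 1).
Implicit Types (x y r : R).
Local Notation m := (mcoef a M).
Local Notation nu := (nu a M).
Local Notation beta := (beta a M).
Local Notation Psi := (Psi a M).
Local Notation delta := (1 - a * M).

Lemma delta_gt0 : 0 < delta. Proof. by rewrite subr_gt0. Qed.

Lemma aM_ge0 : 0 <= a * M. Proof. by rewrite mulr_ge0// ltW. Qed.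

Lemma cutoff_lip x y : `|cutoff M x - cutoff M y| <= `|x - y|.
Proof.
rewrite /cutoff /Num.max /Num.min; move: M0 => ?.
have [lx ux] : x - y <= `|x - y| /\ y - x <= `|x - y|.
  by rewrite ler_norm distrC ler_norm.
rewrite ler_norml; case: (ltP x M) => ?; case: (ltP y M) => ?;
  do 2?case: ltP => ?; apply/andP; split; lra.
Qed.

Lemma mcoef_bounds x : delta <= m x <= 1 + a * M.
Proof.
have : - M <= cutoff M x <= M.
  rewrite /cutoff /Num.max /Num.min; move: M0 => ?; case: (ltP x M) => ?.
    by case: ltP => ?; apply/andP; split; lra.
  by case: ltP => ?; apply/andP; split; lra.
rewrite /mcoef => /andP[l u]; apply/andP; split.
  by rewrite lerD2l lerN2 ler_pM2l.
by rewrite lerD2l -mulrN ler_pM2l// lerNl.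
Qed.

Lemma mcoef_lip x y : `|m x - m y| <= a * `|x - y|.
Proof.
have -> : m x - m y = - a * (cutoff M x - cutoff M y) by rewrite /mcoef; ring.
by rewrite normrM normrN (gtr0_norm a0) ler_pM2l// cutoff_lip.
Qed.

Lemma mcoef_continuous : continuous m.
Proof. exact: lipschitz_continuous mcoef_lip. Qed.

Lemma nuB x y : x <= y ->
  nu y - nu x = \int[@lebesgue_measure R]_(s in `[x, y]) m s.
Proof. by move=> xy; rewrite -oriented_integralB//; exact: mcoef_continuous. Qed.

Lemma nuB_bounds x y : x <= y ->
  delta * (y - x) <= nu y - nu x <= (1 + a * M) * (y - x).
Proof.
move=> xy; rewrite nuB//; apply: Rintegral_itv_bounds => //.
  exact: mcoef_continuous.
by move=> s _; exact: mcoef_bounds.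
Qed.

Lemma nu0 : nu 0 = 0.
Proof.
by rewrite /nu /Defs.nu /oriented_integral lexx set_itv1 Rintegral_set1.
Qed.

Lemma nu_lip x y : `|nu x - nu y| <= (1 + a * M) * `|x - y|.
Proof.
have := delta_gt0; have := aM_ge0 => ? ?.
wlog xy : x y / x <= y => [H|].
  by case: (leP x y) => [/H//|/ltW /H]; rewrite distrC (distrC y).
have /andP[l u] := nuB_bounds xy.
rewrite distrC (distrC x) ger0_norm; last first.
  by apply: le_trans l; rewrite mulr_ge0 ?subr_ge0// ltW.
by rewrite ger0_norm// subr_ge0.
Qed.

Lemma nu_lower x y : delta * `|x - y| <= `|nu x - nu y|.
Proof.
have := delta_gt0 => ?.
wlog xy : x y / x <= y => [H|].
  by case: (leP x y) => [/H//|/ltW /H]; rewrite distrC (distrC (nu y)).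
have /andP[l u] := nuB_bounds xy.
rewrite distrC (distrC (nu x)) ger0_norm ?subr_ge0//.
exact: le_trans l (ler_norm _).
Qed.

Lemma nu_mono x y : (nu x <= nu y) = (x <= y).
Proof.
have := delta_gt0 => d0.
apply/idP/idP => h; last first.
  have /andP[l _] := nuB_bounds h.
  by rewrite -subr_ge0; apply: le_trans l; rewrite mulr_ge0 ?subr_ge0// ltW.
rewrite leNgt; apply/negP => yx.
have /andP[l _] := nuB_bounds (ltW yx).
have : 0 < delta * (x - y) by rewrite mulr_gt0// subr_gt0.
by move=> ?; lra.
Qed.

Lemma nu_continuous : continuous nu.
Proof. exact: lipschitz_continuous nu_lip. Qed.

(** Coercivity: [delta * k <= nu k] with k = |s| / delta gives [nu (- k) <= s <= nu k], and the
    intermediate value theorem applies. *)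
Lemma nu_surj s : exists r, nu r = s.
Proof.
have d0 := delta_gt0; pose k := `|s| / delta.
have k0 : 0 <= k by rewrite divr_ge0// ltW.
have dk : delta * k = `|s| by rewrite /k; field; rewrite lt0r_neq0.
have /andP[l1 _] := nuB_bounds k0.
have := nuB_bounds (_ : - k <= 0); rewrite oppr_le0 => /(_ k0)/andP[l2 _].
move: l1 l2; rewrite nu0 subr0 opprK add0r dk => l1 l2.
have sl : s <= nu k by apply: le_trans (ler_norm s) _; lra.
have sg : nu (- k) <= s.
  have : - s <= `|s| by rewrite -normrN ler_norm.
  lra.
have kk : - k <= k by lra.
have [|c _ ncs] := @IVT _ nu (- k) k s kk (continuous_subspaceT nu_continuous).
  by rewrite minElt maxElt; case: ltP => h; apply/andP; split => //; lra.
by exists c.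
Qed.

Lemma nu_inj : injective nu.
Proof. by move=> x y e; apply/eqP; rewrite eq_le -(nu_mono x) -(nu_mono y) e lexx. Qed.

Lemma betaK r : beta (nu r) = r.
Proof.
rewrite /beta /Defs.beta; case: xgetP => [x _ /= /nu_inj //|/(_ r)].
by case.
Qed.

(** Makes [beta] continuous, so that the integral defining [Psi] obeys the usual rules. *)
Lemma beta_lip x y : `|beta x - beta y| <= delta^-1 * `|x - y|.
Proof.
have [p <-] := nu_surj x; have [q <-] := nu_surj y; rewrite !betaK.
by rewrite mulrC ler_pdivlMr ?delta_gt0// mulrC nu_lower.
Qed.

(** The derivative of [Psi] is [beta], which is increasing and takes the value [x] at [nu x]; its
    values between [nu x] and [nu y] therefore lie between [x] and [y]. In this form convexity of
    [Psi] enters everything that follows. *)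
Lemma Psi_subgradient x y :
  x * (nu y - nu x) <= Psi (nu y) - Psi (nu x) <= y * (nu y - nu x).
Proof.
have cb : continuous beta := lipschitz_continuous beta_lip.
wlog xy : x y / x <= y => [H|].
  case: (leP x y) => [/H//|/ltW /H].
  move: (nu x) (nu y) => k l; move: (Psi k) (Psi l) => p q /andP[h1 h2].
  by apply/andP; split; lra.
rewrite (@oriented_integralB _ beta (nu x) (nu y))// ?nu_mono//.
apply: Rintegral_itv_bounds; rewrite ?nu_mono// => s.
by have [r <-] := nu_surj s; rewrite !nu_mono betaK.
Qed.

Lemma nu_mean x y c k : x <= y -> (forall s, x <= s <= y -> c <= m s <= k) ->
  c * (y - x) <= nu y - nu x <= k * (y - x).
Proof.
by move=> xy h; rewrite nuB//; apply: Rintegral_itv_bounds => //; exact: mcoef_continuous.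
Qed.

End nonlinearity.

(* law_mean says that m = nu', without mentioning derivatives. *)
Record cutoff_law (R : realType) (a delta L : R) (nu m Psi : R -> R) : Prop := CutoffLaw {
  law_a0 : 0 < a;
  law_d0 : 0 < delta;
  law_0 : nu 0 = 0;
  law_bounds : forall x, delta <= m x <= L;
  law_lip : forall x y, `|m x - m y| <= a * `|x - y|;
  law_mean : forall x y c k, x <= y -> (forall s, x <= s <= y -> c <= m s <= k) ->
    c * (y - x) <= nu y - nu x <= k * (y - x);
  law_Psi : forall x y,
    x * (nu y - nu x) <= Psi (nu y) - Psi (nu x) <= y * (nu y - nu x)
}.

Lemma cutoff_lawP (R : realType) (a M : R) : 0 < a -> 0 < M -> a * M < 1 ->
  cutoff_law a (1 - a * M) (1 + a * M) (nu a M) (mcoef a M) (Psi a M).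
Proof.
move=> a0 M0 aM; split => //.
- exact: delta_gt0.
- exact: nu0.
- exact: mcoef_bounds.
- exact: mcoef_lip.
- exact: nu_mean.
- exact: Psi_subgradient.
Qed.

(** * Inequalities for the nonlinearity and the entropy density *)

Section law.
Context (R : realType) (a delta L : R) (nu m Psi : R -> R).
Hypothesis law : cutoff_law a delta L nu m Psi.
Implicit Types (x y r : R).

Let a0 := law_a0 law.
Let d0 := law_d0 law.

Lemma L_gt0 : 0 < L.
Proof. by have /andP[] := law_bounds law 0; have := d0; lra. Qed.

Lemma nu_bounds x y : x <= y -> delta * (y - x) <= nu y - nu x <= L * (y - x).
Proof. by move=> xy; apply: (law_mean law) => // s _; exact: law_bounds law s. Qed.

Lemma law_nu_lip x y : `|nu x - nu y| <= L * `|x - y|.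
Proof.
wlog xy : x y / x <= y => [H|].
  by case: (leP x y) => [/H//|/ltW /H]; rewrite distrC (distrC y).
have /andP[l u] := nu_bounds xy.
rewrite distrC (distrC x) ger0_norm; last first.
  by apply: le_trans l; rewrite mulr_ge0 ?subr_ge0// ltW.
by rewrite ger0_norm// subr_ge0.
Qed.

Lemma law_nu_lower x y : delta * `|x - y| <= `|nu x - nu y|.
Proof.
wlog xy : x y / x <= y => [H|].
  by case: (leP x y) => [/H//|/ltW /H]; rewrite distrC (distrC (nu y)).
have /andP[l u] := nu_bounds xy.
rewrite distrC (distrC (nu x)) ger0_norm ?subr_ge0//.
exact: le_trans l (ler_norm _).
Qed.

Lemma law_nu_le x y : x <= y -> nu x <= nu y.
Proof.
move=> h; have /andP[l _] := nu_bounds h.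
by rewrite -subr_ge0; apply: le_trans l; rewrite mulr_ge0 ?subr_ge0// ltW.
Qed.

Lemma law_nu_continuous : continuous nu.
Proof. exact: lipschitz_continuous law_nu_lip. Qed.

(** The mean value bound gives the constant [a] at once, and [midpoint_bound] improves it to
    [a / 2]: with c the midpoint, the defect of the remainder under halving is (m c - m x) (y - c),
    at most a/4 (y - x)^2 because [m] is Lipschitz with constant [a]. *)
Lemma nu_taylor x y : `|nu y - nu x - m x * (y - x)| <= a / 2 * (y - x) ^+ 2.
Proof.
have ub (z w : R) : `|nu w - nu z - m z * (w - z)| <= a * (w - z) ^+ 2.
  have mz s : `|s - z| <= `|w - z| -> m z - a * `|w - z| <= m s <= m z + a * `|w - z|.
    move=> h; have := law_lip law s z.
    move=> /le_trans /(_ (ler_wpM2l (ltW a0) h)); rewrite ler_norml => /andP[? ?].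
    by apply/andP; split; lra.
  rewrite -real_normK ?num_real// expr2.
  case: (leP z w) => zw.
  - have := law_mean law (c := m z - a * `|w - z|) (k := m z + a * `|w - z|) zw.
    move=> /(_ _)/andP[|l u].
      by move=> s /andP[zs sw]; apply: mz; rewrite !ger0_norm; lra.
    have E : `|w - z| = w - z by rewrite ger0_norm//; lra.
    by move: l u; rewrite E ler_norml => l u; apply/andP; split; lra.
  - have := law_mean law (c := m z - a * `|w - z|) (k := m z + a * `|w - z|) (ltW zw).
    move=> /(_ _)/andP[|l u].
      by move=> s /andP[zs sw]; apply: mz; rewrite !ler0_norm; lra.
    have E : `|w - z| = z - w by rewrite ler0_norm//; lra.
    by move: l u; rewrite E ler_norml => l u; apply/andP; split; lra.
have mk (z w : R) : `|m ((z + w) / 2) - m z| * `|w - (z + w) / 2| <= a / 4 * (w - z) ^+ 2.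
  have h := law_lip law ((z + w) / 2) z.
  apply: (le_trans (ler_wpM2r (normr_ge0 _) h)).
  have -> : (z + w) / 2 - z = (w - z) / 2 by field.
  have -> : w - (z + w) / 2 = (w - z) / 2 by field.
  set u := (w - z) / 2; have -> : a * `|u| * `|u| = a * `|u| ^+ 2 by ring.
  rewrite real_normK ?num_real// /u.
  by rewrite le_eqVlt; apply/orP; left; apply/eqP; field.
rewrite ler_norml; apply/andP; split; last first.
  apply: (@midpoint_bound _ (fun x y => nu y - nu x - m x * (y - x)) a a) => //; try exact: ltW.
  - by move=> z w; exact: le_trans (ler_norm _) (ub z w).
  - move=> z w; have := mk z w; rewrite -normrM => /(le_trans (ler_norm _)) h.
    by lra.
rewrite lerNl.
apply: (@midpoint_bound _ (fun x y => - (nu y - nu x - m x * (y - x))) a a) => //; try exact: ltW.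
- by move=> z w; apply: le_trans (ub z w); rewrite -normrN; exact: ler_norm.
- move=> z w; have := mk z w; rewrite -normrM -normrN => /(le_trans (ler_norm _)) h.
  by lra.
Qed.

(** The subgradient inequalities at [x] and [y] bound the increment by the larger of |x| and |y|
    times the increment of [nu]. *)
Lemma law_Psi_continuous : continuous (Psi \o nu).
Proof.
move=> x; apply/cvgrPdist_lt => e e0; have L0 := L_gt0.
have k0 : 0 < (`|x| + 1) * L + 1.
  by rewrite ltr_wpDl// mulr_ge0 ?addr_ge0// ltW.
near=> y => /=.
have y1 : `|x - y| < 1 by near: y; apply: cvgr_dist_lt.
have ye : `|x - y| < e / ((`|x| + 1) * L + 1).
  by near: y; apply: cvgr_dist_lt => //; rewrite divr_gt0.
have b z : `|z| <= `|x| + 1 -> `|z * (nu x - nu y)| <= (`|x| + 1) * L * `|x - y|.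
  move=> zx; rewrite normrM -mulrA; apply: ler_pM => //; exact: law_nu_lip.
have by_ : `|y| <= `|x| + 1.
  have -> : y = x - (x - y) by ring.
  by apply: (le_trans (ler_normB _ _)); rewrite lerD2l ltW.
have bx : `|x| <= `|x| + 1 by rewrite lerDl.
apply: (@le_lt_trans _ _ ((`|x| + 1) * L * `|x - y|)); last first.
  apply: (@le_lt_trans _ _ (((`|x| + 1) * L + 1) * `|x - y|)).
    by rewrite ler_wpM2r// lerDl.
  by rewrite mulrC -ltr_pdivlMr.
have /andP[h1 h2] := law_Psi law y x.
have := b _ by_; have := b _ bx.
rewrite !ler_norml => /andP[? ?] /andP[? ?].
by apply/andP; split; lra.
Unshelve. all: by end_near. Qed.

(** The Bregman distance of [Psi] between [nu x] and [nu y], since the derivative of [Psi] at [nu y]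
    is [y]. *)
Definition entropy x y : R := Psi (nu x) - Psi (nu y) - y * (nu x - nu y).

Lemma entropy_ge0 x y : 0 <= entropy x y.
Proof. by rewrite subr_ge0; have /andP[] := law_Psi law y x. Qed.

Lemma nu_sign x y : 0 <= (x - y) * (nu x - nu y).
Proof.
case: (leP x y) => h; first by rewrite mulr_le0// subr_le0// law_nu_le.
by rewrite mulr_ge0// subr_ge0 ?law_nu_le// ltW.
Qed.

Lemma nu_monotone x y : delta * (x - y) ^+ 2 <= (x - y) * (nu x - nu y).
Proof.
rewrite -(ger0_norm (nu_sign x y)) normrM -real_normK ?num_real// expr2 mulrCA.
by apply: ler_wpM2l => //; exact: law_nu_lower.
Qed.

(** Halving again: with c the midpoint, entropy(x, y) - entropy(x, c) - entropy(c, y) = (x - c) (nu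
    x - nu c), which is at least delta/4 (x - y)^2. The starting constant [delta] comes from
    nonnegativity alone. *)
Lemma entropy_ge x y : delta / 2 * (x - y) ^+ 2 <= entropy x y.
Proof.
rewrite -lerN2 -[X in - X]opprK -!mulNr opprK.
have -> : (x - y) ^+ 2 = (y - x) ^+ 2 by ring.
suff: - entropy x y <= delta / 2 * 0 - delta / 2 * (y - x) ^+ 2 by lra.
rewrite mulr0 sub0r lerN2.
have := @midpoint_bound _ (fun x y => - entropy x y + delta * (y - x) ^+ 2) delta delta
  (ltW _) (ltW _) _ _ x y.
move=> /(_ d0 d0) H.
suff: - entropy x y + delta * (y - x) ^+ 2 <= delta / 2 * (y - x) ^+ 2 by lra.
apply: H => z w; first by have := entropy_ge0 z w; lra.
have := nu_monotone z ((z + w) / 2).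
rewrite /entropy.
have -> : z - (z + w) / 2 = (z - w) / 2 by field.
have -> : (w - (z + w) / 2) = (w - z) / 2 by field.
have -> : ((z + w) / 2 - z) = (w - z) / 2 by field.
set k := nu ((z + w) / 2).
by move=> h; lra.
Qed.

Lemma entropy_le x y : entropy x y <= L * (x - y) ^+ 2.
Proof.
have /andP[_ h] := law_Psi law y x.
apply: (@le_trans _ _ ((x - y) * (nu x - nu y))); first by rewrite /entropy; lra.
apply: (le_trans (ler_norm _)); rewrite normrM -(real_normK (num_real (x - y))) expr2.
by rewrite mulrCA ler_wpM2l// law_nu_lip.
Qed.

(** Convexity of [Psi] is used at the new value for [h] and at the old value for [H]. The first
    product is what the equations control; the rest is of the order of the increments of [H]. *)
Lemma entropy_step h H h' H' :
  entropy h' H' - entropy h H <=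
  (h' - H') * ((nu h' - nu h) - (nu H' - nu H)) +
  ((h' - H') * (nu H' - nu H) + (H' - H) * (nu H' - nu h)).
Proof.
have /andP[_ h1] := law_Psi law h h'.
have /andP[h2 _] := law_Psi law H H'.
by rewrite /entropy; lra.
Qed.

(* With division by zero giving 0, (H' - H) * entropy_quot is the remainder of entropy_step
   also where H' = H. *)
Definition entropy_quot h H h' H' : R :=
  ((h' - H') * (nu H' - nu H) + (H' - H) * (nu H' - nu h)) / (H' - H).

Lemma entropy_quotE h H h' H' : (H' - H) * entropy_quot h H h' H' =
  (h' - H') * (nu H' - nu H) + (H' - H) * (nu H' - nu h).
Proof.
rewrite /entropy_quot; have [->|n] := eqVneq H' H; last by field; rewrite subr_eq0.
by rewrite !subrr; ring.
Qed.

(** Both [nu h'] and [nu H] are expanded around [H']. The terms with slope [m H'] cancel, which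
    leaves the quadratic remainder of the formal computation; the two other terms vanish with the
    time step. *)
Lemma entropy_quot_le h H h' H' : `|entropy_quot h H h' H'| <=
  a / 2 * (h' - H') ^+ 2 + a / 2 * `|H' - H| * `|h' - H'| + `|nu h' - nu h|.
Proof.
rewrite /entropy_quot; have [->|n] := eqVneq H' H.
  rewrite (subrr H) invr0 mulr0 normr0 mulr0 mul0r addr0.
  by rewrite addr_ge0// mulr_ge0 ?sqr_ge0// divr_ge0// ltW.
have d : H' - H != 0 by rewrite subr_eq0.
have t1 := nu_taylor H' h'; have t2 := nu_taylor H' H.
have -> : ((h' - H') * (nu H' - nu H) + (H' - H) * (nu H' - nu h)) / (H' - H) =
  - (nu h' - nu H' - m H' * (h' - H')) - (h' - H') * ((nu H - nu H' - m H' * (H - H')) / (H' - H))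
  + (nu h' - nu h) by field.
apply: (le_trans (ler_normD _ _)); rewrite lerD2r.
apply: (le_trans (ler_normB _ _)); rewrite normrN; apply: lerD => //.
rewrite normrM mulrC; apply: ler_wpM2r => //.
rewrite normrM normfV ler_pdivrMr ?normr_gt0//; apply: (le_trans t2).
rewrite -(real_normK (num_real (H - H'))) distrC.
by rewrite le_eqVlt; apply/orP; left; apply/eqP; ring.
Qed.

End law.

(** * A discrete energy inequality *)

Section discrete.
Context (R : realType).
Implicit Types (f r k q : nat -> R) (c : nat -> nat -> R).

(** The ranges shifted by [p] and by [m] overlap, and only windows at the two ends survive; [m <= n]
    makes the truncated subtraction exact. *)
Lemma telescope_shift f n J m p : (m <= n)%N -> (n <= J)%N ->
  \sum_(n <= j < J) (f (j + p)%N - f (j - m)%N) =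
  \sum_(J - m <= j < J + p) f j - \sum_(n - m <= j < n + p) f j.
Proof.
move=> mn nJ; rewrite big_split/= sumrN.
have -> : \sum_(n <= j < J) f (j + p)%N = \sum_(n + p <= j < J + p) f j.
  by rewrite [RHS]big_addn addnK.
have -> : \sum_(n <= j < J) f (j - m)%N = \sum_(n - m <= j < J - m) f j.
  rewrite -[n in LHS](subnK mn) big_addn.
  by apply: eq_bigr => i _; rewrite addnK.
have h1 : \sum_(n - m <= j < J + p) f j =
   \sum_(n - m <= j < n + p) f j + \sum_(n + p <= j < J + p) f j.
  by rewrite -big_cat_nat//= ?leq_add2r// (leq_trans (leq_subr _ _)) ?leq_addr.
have h2 : \sum_(n - m <= j < J + p) f j =
   \sum_(n - m <= j < J - m) f j + \sum_(J - m <= j < J + p) f j.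
  by rewrite -big_cat_nat//= ?leq_sub2r// (leq_trans (leq_subr _ _)) ?leq_addr.
by move: h1; rewrite h2 => h1; lra.
Qed.

(** |w i - w j|^2 when [c i j] is the inner product of [w i] and [w j]. Only the Gram matrix enters,
    so that the discrete argument is about reals. *)
Definition gramd c i j : R := c i i - c i j *+ 2 + c j j.

Let pot c n j : R := \sum_(1 <= m < n.+1) gramd c j (j - m)%N.

(* For c i j = (w i, w j) the potential j |-> sum_m |w j - w (j - m)|^2 / 2 makes the sum over
   m of (w j - w (j - m), w j.+1 - w j) telescope up to a nonnegative term. *)
Lemma fejer_identity c n j : (forall i l, c i l = c l i) -> (n <= j)%N ->
  (\sum_(1 <= m < n.+1) (c j j.+1 - c j j - c (j - m)%N j.+1 + c (j - m)%N j)) *+ 2 =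
  pot c n j.+1 - pot c n j + gramd c j.+1 (j - n)%N - (n.+1)%:R * gramd c j j.+1.
Proof.
move=> cs nj.
(* Lag m + 1 at [j.+1] is lag m seen from [j]; next, the new lag 0 and the lost lag [n] are split
   off. *)
have -> : pot c n j.+1 = \sum_(0 <= m < n) gramd c j.+1 (j - m)%N.
  rewrite /pot big_add1/=; apply: eq_bigr => m _; by rewrite subSS.
have -> : \sum_(0 <= m < n) gramd c j.+1 (j - m)%N =
    \sum_(1 <= m < n.+1) gramd c j.+1 (j - m)%N + gramd c j.+1 j - gramd c j.+1 (j - n)%N.
  rewrite big_add1/=.
  have h1 : \sum_(0 <= m < n.+1) gramd c j.+1 (j - m)%N =
      \sum_(0 <= m < n) gramd c j.+1 (j - m)%N + gramd c j.+1 (j - n)%N.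
    by rewrite big_nat_recr.
  move: h1; rewrite big_nat_recl//= subn0 => h1; lra.
have -> : (n.+1)%:R * gramd c j j.+1 = \sum_(1 <= m < n.+1) gramd c j j.+1 + gramd c j j.+1.
  by rewrite sumr_const_nat subn1/= -natr1 mulrDl mul1r mulr_natl.
have -> : gramd c j.+1 j = gramd c j j.+1 by rewrite /gramd (cs j.+1 j); ring.
suff: (\sum_(1 <= m < n.+1) (c j j.+1 - c j j - c (j - m)%N j.+1 + c (j - m)%N j)) *+ 2 =
   \sum_(1 <= m < n.+1) gramd c j.+1 (j - m)%N - pot c n j - \sum_(1 <= m < n.+1) gramd c j j.+1.
  by move=> ->; ring.
rewrite /pot -!sumrN -!big_split/= -sumrMnl; apply: eq_bigr => m _.
by rewrite /gramd (cs j.+1 (j - m)%N) (cs j (j - m)%N); ring.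
Qed.

Lemma sum_id_nat n : \sum_(1 <= m < n.+1) (m%:R : R) = n%:R * n.+1%:R / 2.
Proof.
elim: n => [|n IH]; first by rewrite big_geq// mul0r mul0r.
by rewrite big_nat_recr//= IH -!natr1; field.
Qed.

(** The hypothesis is summed over the grid points [j] and all lags [m] from 1 to [n], and divided by
    [P], the sum of the [m * eta]. [D0] bounds the quadratic variation per unit of mesh, [D1] the
    oscillation in the first window, and [A] bounds from below the increment of [r] between the two
    end windows. *)
Lemma discrete_step r k q c (n J : nat) (eta b th th' C A D0 D1 : R) :
  (0 < n <= J)%N -> 0 < eta -> 0 <= b -> 0 <= C ->
  (forall i l, c i l = c l i) -> (forall i l, 0 <= gramd c i l) ->
  {homo k : i j / (i <= j)%N >-> i <= j} ->
  (forall j m, (n <= j < J)%N -> (1 <= m < n.+1)%N ->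
     eta * (r j - r (j - m)%N) <= - (m%:R * eta) * (c j j.+1 - c j j)
       - b * (c j j.+1 - c j j - c (j - m)%N j.+1 + c (j - m)%N j)
       + th * (m%:R * eta) * (q j.+1 - q j) + eta * (k j.+1 - k (j - m)%N) * C
       + th' * (q j.+1 - q j)) ->
  (forall i j, (i <= n)%N -> (J - n <= j <= J)%N -> A <= r j - r i) ->
  \sum_(n <= j < J) gramd c j j.+1 <= eta * D0 ->
  (forall m, (1 <= m < n.+1)%N -> gramd c n (n - m)%N <= (m%:R * eta) * D1) ->
  A <= - (c J J - c n n) / 2 + eta * D0 / 2 + b * D1 / 2 + b * D0 / n%:R
       + th * (q J - q n) + C * (k J - k 0%N) * (1 + 2 / n.+1%:R)
       + 2 * th' * (q J - q n) / (n.+1%:R * eta).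
Proof.
move=> /andP[n0 nJ] eta0 b0 C0 cs cp kn step rA cD0 cD1.
have nR : 0 < n%:R :> R by rewrite ltr0n.
have n1R : 0 < n.+1%:R :> R by rewrite ltr0n.
set P := eta * (n%:R * n.+1%:R / 2).
have P0 : 0 < P by rewrite mulr_gt0// divr_gt0// mulr_gt0.
rewrite -(ler_pM2l P0).
have sumP : \sum_(1 <= m < n.+1) (m%:R * eta) = P.
  by rewrite -mulr_suml sum_id_nat mulrC.
pose S F : R := \sum_(n <= j < J) \sum_(1 <= m < n.+1) F j m.
have HS : S (fun j m => eta * (r j - r (j - m)%N)) <=
  S (fun j m => - (m%:R * eta) * (c j j.+1 - c j j)) +
  - b * S (fun j m => c j j.+1 - c j j - c (j - m)%N j.+1 + c (j - m)%N j) +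
  S (fun j m => th * (m%:R * eta) * (q j.+1 - q j)) +
  S (fun j m => eta * (k j.+1 - k (j - m)%N) * C) + S (fun j m => th' * (q j.+1 - q j)).
  rewrite /S mulr_sumr; under [X in _ + X + _ + _ + _]eq_bigr do rewrite mulr_sumr.
  rewrite -!big_split/=; apply: ler_sum_nat => j nj.
  rewrite -!big_split/=; apply: ler_sum_nat => m m1.
  by have := step j m nj m1; rewrite [- b * _]mulNr.
(* For each lag the sum over [j] leaves the last [m] values minus the [m] values before index [n];
   they are matched one to one, and each difference is at least [A]. *)
have L1 : P * A <= S (fun j m => eta * (r j - r (j - m)%N)).
  rewrite /S exchange_big/= -sumP mulr_suml; apply: ler_sum_nat => m /andP[m1 mn].
  rewrite -mulr_sumr mulrAC mulrC; apply: ler_wpM2l; first exact: ltW.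
  have := @telescope_shift r n J m 0 mn nJ; under eq_bigr do rewrite addn0.
  move=> ->; rewrite !addn0.
  have -> : \sum_(J - m <= j < J) r j = \sum_(0 <= i < m) r (J - m + i)%N.
    rewrite -[X in \sum_(X <= _ < _) _]add0n big_addn subKn; last by lia.
    by apply: eq_bigr => i _; rewrite addnC.
  have -> : \sum_(n - m <= j < n) r j = \sum_(0 <= i < m) r (n - m + i)%N.
    rewrite -[X in \sum_(X <= _ < _) _]add0n big_addn subKn//.
    by apply: eq_bigr => i _; rewrite addnC.
  rewrite -sumrB mulr_natl -[m in A *+ m]subn0 -sumr_const_nat.
  apply: ler_sum_nat => i /andP[_ im]; apply: rA; first lia.
  by apply/andP; split; lia.
(* Polarization: 2 (w j, w j.+1 - w j) is the increment of |w|^2 minus |w j.+1 - w j|^2, and these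
   squares sum to at most [eta * D0]. *)
have R1 : S (fun j m => - (m%:R * eta) * (c j j.+1 - c j j)) <=
    P * (- (c J J - c n n) / 2 + eta * D0 / 2).
  have -> : S (fun j m => - (m%:R * eta) * (c j j.+1 - c j j)) =
      - P * \sum_(n <= j < J) (c j j.+1 - c j j).
    rewrite mulr_sumr; apply: eq_bigr => j _; rewrite -mulr_suml; congr (_ * _).
    by rewrite sumrN sumP.
  have E : \sum_(n <= j < J) (c j j.+1 - c j j) =
     (c J J - c n n) / 2 - (\sum_(n <= j < J) gramd c j j.+1) / 2.
    rewrite -(telescope_sumr (fun j => c j j))// !mulr_suml -sumrB.
    by apply: eq_bigr => j _; rewrite /gramd; field.
  rewrite E mulNr -mulrN ler_pM2l//; lra.
(* After [fejer_identity] the final potential and the squares of lag [n] have the good sign and are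
   dropped. The initial potential costs [D1], the consecutive squares [D0 / n]. *)
have R2 : - b * S (fun j m => c j j.+1 - c j j - c (j - m)%N j.+1 + c (j - m)%N j) <=
    P * (b * D1 / 2 + b * D0 / n%:R).
  have E : S (fun j m => c j j.+1 - c j j - c (j - m)%N j.+1 + c (j - m)%N j) *+ 2 =
     pot c n J - pot c n n + \sum_(n <= j < J) gramd c j.+1 (j - n)%N -
     n.+1%:R * \sum_(n <= j < J) gramd c j j.+1.
    rewrite -(telescope_sumr (pot c n))// mulr_sumr -big_split/= -sumrB -sumrMnl.
    by apply: eq_big_nat => j /andP[nj _]; rewrite fejer_identity.
  have p0 : 0 <= pot c n J by apply: sumr_ge0 => m _; exact: cp.
  have p1 : 0 <= \sum_(n <= j < J) gramd c j.+1 (j - n)%N by apply: sumr_ge0 => m _; exact: cp.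
  have p2 : pot c n n <= P * D1.
    by rewrite -sumP mulr_suml; apply: ler_sum_nat => m mm; exact: cD1.
  have p3 : n.+1%:R * \sum_(n <= j < J) gramd c j j.+1 <= n.+1%:R * (eta * D0).
    by rewrite ler_pM2l.
  have -> : P * (b * D1 / 2 + b * D0 / n%:R) = b * (P * D1 / 2 + n.+1%:R * (eta * D0) / 2).
    by rewrite /P; field; rewrite lt0r_neq0.
  rewrite mulNr -mulrN; apply: ler_wpM2l => //; lra.
have R3 : S (fun j m => th * (m%:R * eta) * (q j.+1 - q j)) = P * (th * (q J - q n)).
  rewrite -(telescope_sumr q)// mulrA mulr_sumr; apply: eq_bigr => j _.
  by rewrite -mulr_suml -mulr_sumr sumP (mulrC th).
(* For lag [m] the telescoped windows have m + 1 terms, one of them due to the shift to [j.+1];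
   summing m + 1 instead of m gives the factor 1 + 2 / (n + 1). *)
have R4 : S (fun j m => eta * (k j.+1 - k (j - m)%N) * C) <=
    P * (C * (k J - k 0%N) * (1 + 2 / n.+1%:R)).
  have -> : P * (C * (k J - k 0%N) * (1 + 2 / n.+1%:R)) =
      \sum_(1 <= m < n.+1) (eta * C * ((m%:R + 1) * (k J - k 0%N))).
    rewrite -mulr_sumr -mulr_suml big_split/= sum_id_nat sumr_const_nat subn1/=.
    by rewrite /P; field; rewrite lt0r_neq0.
  rewrite /S exchange_big/=; apply: ler_sum_nat => m /andP[m1 mn].
  rewrite -mulr_suml -mulr_sumr mulrAC; apply: ler_wpM2l; first by rewrite mulr_ge0// ltW.
  have := @telescope_shift k n J m 1 mn nJ; under eq_bigr do rewrite addn1.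
  move=> ->; rewrite mulrBr; apply: lerB.
  - apply: (@le_trans _ _ (\sum_(J - m <= j < J + 1) k J)).
      by apply: ler_sum_nat => j /andP[_ jJ]; apply: kn; lia.
    rewrite sumr_const_nat natr1 mulr_natl; rewrite le_eqVlt; apply/orP; left; apply/eqP; congr (_ *+ _); lia.
  - apply: (@le_trans _ _ (\sum_(n - m <= j < n + 1) k 0%N)).
      rewrite sumr_const_nat natr1 mulr_natl; rewrite le_eqVlt; apply/orP; left; apply/eqP; congr (_ *+ _); lia.
    by apply: ler_sum_nat => j _; apply: kn.
have R5 : S (fun j m => th' * (q j.+1 - q j)) =
    P * (2 * th' * (q J - q n) / (n.+1%:R * eta)).
  have -> : S (fun j m => th' * (q j.+1 - q j)) = n%:R * (th' * (q J - q n)).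
    rewrite -(telescope_sumr q)// !mulr_sumr; apply: eq_bigr => j _.
    by rewrite sumr_const_nat subn1/= mulr_natl.
  by rewrite /P; field; rewrite !lt0r_neq0.
apply: (le_trans L1); apply: (le_trans HS); rewrite R3 R5.
have := lerD (lerD (lerD (lerD R1 R2) (lexx (P * (th * (q J - q n))))) R4)
  (lexx (P * (2 * th' * (q J - q n) / (n.+1%:R * eta)))).
by move=> /le_trans; apply; rewrite -!mulrDr !addrA.
Qed.

End discrete.

(** * From the grid to continuous time *)

Section continuous.
Context (R : realType).
Implicit Types (f r k q g : R -> R) (c : R -> R -> R).

Definition ucont f (s t : R) := forall e, 0 < e -> exists2 d, 0 < d &
  forall x y, s <= x <= t -> s <= y <= t -> `|x - y| < d -> `|f x - f y| <= e.

Definition gram c x y : R := c x x - c x y *+ 2 + c y y.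

Lemma exists_natr_gt (x : R) : exists n : nat, x < n%:R.
Proof.
exists (Num.bound `|x|); apply: le_lt_trans (ler_norm x) _.
by apply: archi_boundP.
Qed.

(** The parameters follow the quantifiers: [th]; then the window [eps], below [d] and the moduli of
    [r], [c] and [g]; then [th']; then the number [n] of cells per window, which brings the mesh
    below [d']. The monotone functions [k], [q], [g] stand for primitives of norms. *)
Lemma energy_step r k q g c (s t b C : R) : s < t -> 0 <= b -> 0 <= C ->
  (forall x y, c x y = c y x) -> (forall x y, 0 <= gram c x y) ->
  (forall x y, s <= x -> x <= y -> y <= t -> [/\ k x <= k y, q x <= q y & g x <= g y]) ->
  (forall x y, s <= x -> x <= y -> y <= t -> gram c x y <= (y - x) * (g y - g x)) ->
  ucont r s t -> ucont (fun x => c x x) s t -> ucont g s t ->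
  (forall th, 0 < th -> exists2 d, 0 < d & forall th', 0 < th' -> exists2 d', 0 < d' &
    forall x a a', s <= x -> x < a -> a < a' -> a' <= t -> a - x < d -> a' - a < d' ->
    (a' - a) * (r a - r x) <= - (a - x) * (c a a' - c a a)
      - b * (c a a' - c a a - c x a' + c x a) + th * (a - x) * (q a' - q a)
      + (a' - a) * (k a' - k x) * (C + th) + th' * (q a' - q a)) ->
  r t + c t t / 2 <= r s + c s s / 2 + C * (k t - k s).
Proof.
move=> st b0 C0 cs cp mono cg ur uc ug H.
have [mk mq mg] := mono s t (lexx s) (ltW st) (lexx t).
set Dk := k t - k s; set Dq := q t - q s; set D0 := g t - g s.
have [Dk0 Dq0 D00] : [/\ 0 <= Dk, 0 <= Dq & 0 <= D0] by rewrite !subr_ge0.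
(* Errors in units of [th]: 2 from the end windows of [r], 1/2 each from [c] in the first window and
   from [eta * D0], 1 each from [c3], [c5] and [c6]; the remaining ones carry [b / 2], [Dq] and
   [Dk]. *)
suff main th : 0 < th -> r t - r s <= - (c t t - c s s) / 2 + C * Dk +
    th * (6 + b / 2 + Dq + Dk).
  have X0 : 0 < 6 + b / 2 + Dq + Dk by lra.
  apply: ler_eps => e e0; have := main _ (divr_gt0 e0 X0).
  by rewrite mulfVK ?lt0r_neq0// => ?; lra.
move=> th0; have [d d0 {}H] := H th th0.
have [dr dr0 {}ur] := ur th th0; have [dc dc0 {}uc] := uc th th0.
have [dg dg0 {}ug] := ug th th0.
have [L HL] := exists_natr_gt ((t - s) / d + (t - s) / dr + (t - s) / dc + (t - s) / dg).
have ts0 : 0 < t - s by rewrite subr_gt0.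
have [q1 q2 q3 q4] : [/\ 0 < (t - s) / d, 0 < (t - s) / dr, 0 < (t - s) / dc & 0 < (t - s) / dg].
  by rewrite !divr_gt0.
have L0 : (0 < L)%N by rewrite -(ltr0n R); lra.
have LR : 0 < L%:R :> R by rewrite ltr0n.
set eps := (t - s) / L%:R.
have eps0 : 0 < eps by rewrite divr_gt0.
have epsd x : 0 < x -> (t - s) / x < L%:R -> eps < x.
  by move=> x0; rewrite /eps ltr_pdivrMr// ltr_pdivrMr// mulrC.
have [e1 e2 e3 e4] : [/\ eps < d, eps < dr, eps < dc & eps < dg].
  by split; apply: epsd => //; lra.
(* The last error is not weighted by the lag, so dividing by the weights leaves 2 th' / ((n + 1)
   eta), about 2 th' / eps: hence the factor [eps]. *)
set th' := th * eps / (2 * (Dq + 1)).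
have th'0 : 0 < th' by apply: divr_gt0; apply: mulr_gt0 => //; lra.
have [d' d'0 {}H] := H th' th'0.
have [n Hn] := exists_natr_gt (eps / d' + eps * D0 / th + b * D0 / th + 2 * (C + th) * Dk / th + 1).
have [p1 p2 p3 p4] : [/\ 0 < eps / d', 0 <= eps * D0 / th, 0 <= b * D0 / th &
    0 <= 2 * (C + th) * Dk / th].
  split; first exact: divr_gt0.
  - by rewrite divr_ge0 ?mulr_ge0// ltW.
  - by rewrite divr_ge0 ?mulr_ge0// ltW.
  - by apply: divr_ge0; [apply: mulr_ge0 => //; lra|exact: ltW].
have [N0 [N1 N2 N3 N4]] : 0 < n%:R :> R /\ [/\ eps / d' < n%:R, eps * D0 / th <= n%:R,
    b * D0 / th <= n%:R & 2 * (C + th) * Dk / th <= n%:R].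
  move: Hn p1 p2 p3 p4.
  move: (eps / d') (eps * D0 / th) (b * D0 / th) (2 * (C + th) * Dk / th) (n%:R : R).
  by clear; move=> x y z w v *; do ?split; lra.
have n0 : (0 < n)%N by rewrite -(ltr0n R).
have nR : 0 < n%:R :> R by rewrite ltr0n.
have n1R : 0 < n.+1%:R :> R by rewrite ltr0n.
set J := (n * L)%N; set eta := eps / n%:R.
have eta0 : 0 < eta by rewrite divr_gt0.
have nJ : (n <= J)%N by rewrite leq_pmulr.
have Jeta : J%:R * eta = t - s.
  by rewrite /J /eta /eps natrM; field; rewrite !lt0r_neq0.
have neta : n%:R * eta = eps by rewrite /eta; field; rewrite lt0r_neq0.
(* Clamping at [J] keeps every grid point in [s, t], so that monotonicity holds for all indices. *)
pose a j : R := s + (minn j J)%:R * eta.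
have aE j : (j <= J)%N -> a j = s + j%:R * eta by move=> jJ; rewrite /a (minn_idPl jJ).
have as_ j : s <= a j by rewrite lerDl mulr_ge0// ltW.
have at_ j : a j <= t.
  have : (minn j J)%:R * eta <= J%:R * eta by rewrite ler_pM2r// ler_nat geq_minr.
  by rewrite /a Jeta; lra.
have am i j : (i <= j)%N -> a i <= a j.
  by move=> ij; rewrite /a lerD2l ler_pM2r// ler_nat; move: (J) ij; clear; lia.
have aJ : a J = t by rewrite aE// Jeta; lra.
have a0 : a 0%N = s by rewrite aE// mul0r addr0.
have aB i j : (i <= j)%N -> (j <= J)%N -> a j - a i = (j - i)%:R * eta.
  by move=> ij jJ; rewrite !aE// ?(leq_trans ij)// natrB//; ring.
have an : a n - s = eps by rewrite -a0 aB// subn0 neta.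
have ast j : s <= a j <= t by rewrite as_ at_.
have sst : s <= s <= t by rewrite lexx ltW.
have tst : s <= t <= t by rewrite lexx ltW.
have etad' : eta < d'.
  by rewrite /eta ltr_pdivrMr// mulrC -ltr_pdivrMr.
have := @discrete_step R (r \o a) (k \o a) (q \o a) (fun i j => c (a i) (a j)) n J eta b th th'
  (C + th) (r t - r s - 2 * th) D0 th.
rewrite /= n0 nJ => /(_ isT eta0 b0 _ _ _ _ _ _ _ _).
rewrite aJ a0 => K; have {}K : r t - r s - 2 * th <=
  - (c t t - c (a n) (a n)) / 2 + eta * D0 / 2 + b * th / 2 + b * D0 / n%:R +
  th * (q t - q (a n)) + (C + th) * (k t - k s) * (1 + 2 / n.+1%:R) +
  2 * th' * (q t - q (a n)) / (n.+1%:R * eta).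
  apply: K => //.
  - lra.
  - by move=> i l; exact: cp.
  - by move=> i j ij; have [] := mono (a i) (a j) (as_ i) (am _ _ ij) (at_ j).
  - move=> j m /andP[nj jJ] /andP[m1 mn].
    have E1 : a j - a (j - m)%N = m%:R * eta by rewrite aB ?leq_subr// 1?ltnW// subKn//; move: nj m1 mn; clear; lia.
    have E2 : a j.+1 - a j = eta by rewrite aB// subSn// subnn mul1r.
    have m0 : 0 < m%:R * eta by rewrite mulr_gt0// ltr0n.
    have me : m%:R * eta <= eps by rewrite -neta ler_pM2r// ler_nat.
    have lt1 : a (j - m)%N < a j by rewrite -subr_gt0 E1.
    have lt2 : a j < a j.+1 by rewrite -subr_gt0 E2.
    have := H _ _ _ (as_ _) lt1 lt2 (at_ _).
    by rewrite E1 E2; apply => //; exact: le_lt_trans me e1.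
  - move=> i j i_n /andP[Jj jJ].
    have iJ : (i <= J)%N by exact: leq_trans nJ.
    have := ur (a i) s (ast _) sst; have := ur (a j) t (ast _) tst.
    have -> : a j - t = - ((J - j)%:R * eta) by rewrite -aJ -(aB j J)//; lra.
    have -> : a i - s = i%:R * eta by rewrite aE//; lra.
    have nn (l : nat) : `|l%:R * eta| = l%:R * eta by rewrite ger0_norm// mulr_ge0// ltW.
    rewrite normrN !nn.
    have h1 : (J - j)%:R * eta <= eps by rewrite -neta ler_pM2r// ler_nat; move: Jj; clear; lia.
    have h2 : i%:R * eta <= eps by rewrite -neta ler_pM2r// ler_nat.
    move=> /(_ (le_lt_trans h1 e2)) + /(_ (le_lt_trans h2 e2)).
    by rewrite !ler_norml => /andP[? ?] /andP[? ?]; lra.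
  - have -> : eta * D0 = \sum_(n <= j < J) eta * (g (a j.+1) - g (a j)) + eta * (g (a n) - g s).
      by rewrite -mulr_sumr (telescope_sumr (g \o a))//= aJ -mulrDr; congr (_ * _); rewrite /D0; ring.
    apply: (@le_trans _ _ (\sum_(n <= j < J) eta * (g (a j.+1) - g (a j)))).
      apply: ler_sum_nat => j /andP[_ jJ].
      have E2 : a j.+1 - a j = eta by rewrite aB// subSn// subnn mul1r.
      by have := cg (a j) (a j.+1) (as_ _) (am _ _ (leqnSn _)) (at_ _); rewrite E2.
    rewrite lerDl mulr_ge0 ?(ltW eta0)// subr_ge0.
    by have [] := mono s (a n) (lexx s) (as_ n) (at_ n).
  - move=> m /andP[m1 mn].
    have E1 : a n - a (n - m)%N = m%:R * eta by rewrite aB ?leq_subr// subKn.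
    have := cg (a (n - m)%N) (a n) (as_ _) (am _ _ (leq_subr _ _)) (at_ _).
    rewrite E1 /gramd /gram (cs (a n)) => h.
    apply: (@le_trans _ _ (m%:R * eta * (g (a n) - g (a (n - m)%N)))); first by lra.
    apply: ler_wpM2l; first by rewrite mulr_ge0// ltW.
    have := ug (a n) (a (n - m)%N) (ast _) (ast _).
    have me : m%:R * eta <= eps by rewrite -neta ler_pM2r// ler_nat.
    have nn : `|m%:R * eta| = m%:R * eta by rewrite ger0_norm// mulr_ge0// ltW.
    rewrite E1 nn => /(_ (le_lt_trans me e4)).
    by apply: le_trans; exact: ler_norm.
have c1 : c (a n) (a n) <= c s s + th.
  have := uc (a n) s (ast _) sst; rewrite an (ger0_norm (ltW eps0)) => /(_ e3).
  by rewrite ler_norml => /andP[? ?]; lra.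
have c2 : eta * D0 <= th.
  by rewrite /eta mulrAC ler_pdivrMr// [th * _]mulrC -ler_pdivrMr.
have c3 : b * D0 / n%:R <= th by rewrite ler_pdivrMr// [th * _]mulrC -ler_pdivrMr.
have qn : 0 <= q t - q (a n) <= Dq.
  have [_ ? _] := mono s (a n) (lexx s) (as_ n) (at_ n).
  have [_ ? _] := mono (a n) t (as_ n) (at_ n) (lexx t).
  by rewrite /Dq; apply/andP; split; lra.
have {qn}[qn0 qn1] := andP qn.
have c4 : th * (q t - q (a n)) <= th * Dq by rewrite ler_pM2l.
have c5 : (C + th) * Dk * (1 + 2 / n.+1%:R) <= C * Dk + th * Dk + th.
  suff : 2 * (C + th) * Dk / n.+1%:R <= th.
    by move: (n.+1%:R^-1 : R) (C) (Dk) (th); clear; move=> w x y z; lra.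
  rewrite ler_pdivrMr// [th * _]mulrC -ler_pdivrMr//.
  by apply: (le_trans N4); rewrite ler_nat.
have c6 : 2 * th' * (q t - q (a n)) / (n.+1%:R * eta) <= th.
  have E : eps <= n.+1%:R * eta by rewrite -neta ler_pM2r// ler_nat.
  rewrite ler_pdivrMr; last exact: mulr_gt0.
  apply: (@le_trans _ _ (th * eps)); last by rewrite ler_pM2l.
  have -> : th * eps = 2 * th' * (Dq + 1).
    by rewrite /th'; field; rewrite lt0r_neq0// ltr_wpDl.
  apply: ler_wpM2l; first by apply: mulr_ge0 => //; exact: ltW.
  by apply: (le_trans qn1); rewrite lerDl.
rewrite -/Dk in K; move: K c1 c2 c3 c4 c5 c6.
move: (2 * th' * (q t - q (a n)) / _)=> A1.
move: ((C + th) * Dk * _) (b * D0 / n%:R) (th * (q t - q (a n))) (eta * D0) => A3 A4 A5 A6.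
move: (c t t) (c s s) (c (a n) (a n)) (r t) (r s) (C) (Dk) (Dq) (th) (b).
by clear; move=> x1 x2 x3 x4 x5 x6 x7 x8 x9 x10; rewrite !mulrDr; lra.
Qed.

End continuous.

(** * Gronwall on a dense set *)

Section gronwall.
Context (R : realType).
Implicit Types (G : set R) (f E K : R -> R).

Definition dense_in G (s t : R) := forall x y, s <= x -> x < y -> y <= t ->
  exists z, [/\ G z, x < z & z < y].

Definition ucont_on G f (s t : R) := forall e, 0 < e -> exists2 d, 0 < d &
  forall x y, G x -> G y -> s <= x <= t -> s <= y <= t -> `|x - y| < d -> `|f x - f y| <= e.

(** Points of [G] are sought to the right of [x], and to the left when [x] is the right endpoint. *)
Lemma dense_in_ball G (s t x d : R) : dense_in G s t -> s < t -> s <= x <= t -> 0 < d ->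
  exists z, [/\ G z, s <= z <= t & `|x - z| < d].
Proof.
move=> Gd st /andP[sx xt] d0; case: (ltP x t) => [xt'|tx].
  have [||z [Gz xz zy]] := Gd x (Num.min t (x + d)) sx.
  - by rewrite lt_min xt' ltrDl.
  - by rewrite ge_min lexx.
  move: zy; rewrite lt_min => /andP[zt zd]; exists z; split => //.
    by apply/andP; split; lra.
  by rewrite distrC ger0_norm; lra.
have [|||z [Gz xz zy]] := Gd (Num.max s (t - d)) t.
- by rewrite le_max lexx.
- by rewrite gt_max st ltrBlDr ltrDl.
- exact: lexx.
move: xz; rewrite gt_max => /andP[sz zd]; exists z; split => //.
  by apply/andP; split; lra.
by rewrite ger0_norm; lra.
Qed.

(** The values of [f] along [G] near [x] form a Cauchy filter, whose limit is taken. The extension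
    serves [energy_step], which samples its function at every grid point, whereas the entropy is
    controlled at almost all times. *)
Lemma ucont_extension G f (s t : R) : dense_in G s t -> s < t -> ucont_on G f s t ->
  exists ft : R -> R, forall e, 0 < e -> exists2 d, 0 < d &
    forall x y, s <= x <= t -> G y -> s <= y <= t -> `|x - y| < d -> `|ft x - f y| <= e.
Proof.
move=> Gd st uf; pose A := [set y | G y /\ s <= y <= t].
have Fp x : s <= x <= t -> ProperFilter (f @ within A (nbhs x)).
  move=> sxt; apply: fmap_proper_filter; apply: within_nbhs_proper => U.
  move=> /nbhs_ballP[d /= d0 dU]; have [z [Gz sz xz]] := dense_in_ball Gd st sxt d0.
  by exists z; split => //; exact: dU.
have near_of x d : 0 < d -> within A (nbhs x) [set y | G y /\ s <= y <= t /\ `|x - y| < d].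
  by move=> d0; rewrite /within/=; apply/nbhs_ballP; exists d => // y yd [Gy sy].
have cf x : s <= x <= t -> cvg (f @ within A (nbhs x)).
  move=> sxt; have ? := Fp x sxt; apply/cauchy_cvgP; apply/cauchy_ballP => e e0.
  have [d d0 H] := uf _ (divr_gt0 e0 (ltr0n _ 2)).
  exists (f @` [set y | G y /\ s <= y <= t /\ `|x - y| < d / 2],
          f @` [set y | G y /\ s <= y <= t /\ `|x - y| < d / 2]) => /=.
    split; apply: filterS (near_of x (d / 2) (divr_gt0 d0 (ltr0n _ 2))) => y hy; by exists y.
  move=> [_ _] [/= [y [Gy [sy xy]] <-] [z [Gz [sz xz]] <-]] /=.
  rewrite /ball/=; apply: (@le_lt_trans _ _ (e / 2)); last by lra.
  apply: H => //; have -> : y - z = (x - z) - (x - y) by ring.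
  by apply: (le_lt_trans (ler_normB _ _)); lra.
exists (fun x => lim (f @ within A (nbhs x))) => e e0.
have [d d0 H] := uf e e0; exists (d / 2); first by rewrite divr_gt0.
move=> x y sxt Gy sy xy; have ? := Fp x sxt.
have c1 : f z - f y @[z --> within A (nbhs x)] --> lim (f @ within A (nbhs x)) - f y.
  by apply: cvgB; [exact: cf|exact: cvg_cst].
have c2 : `|f z - f y| @[z --> within A (nbhs x)] --> `|lim (f @ within A (nbhs x)) - f y|.
  exact: cvg_norm c1.
have FA : ProperFilter (within A (nbhs x)).
  apply: within_nbhs_proper => U.
  move=> /nbhs_ballP[d' /= d'0 dU]; have [z [Gz sz xz]] := dense_in_ball Gd st sxt d'0.
  by exists z; split => //; exact: dU.
rewrite -(cvg_lim (@Rhausdorff R) c2); apply: limr_le; first by apply/cvg_ex; eexists; exact: c2.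
apply: filterS (near_of x (d / 2) (divr_gt0 d0 (ltr0n _ 2))) => z [Gz [sz xz]].
apply: H => //; have -> : z - y = (x - y) - (x - z) by ring.
by apply: (le_lt_trans (ler_normB _ _)); lra.
Qed.

(** On an interval where [C] times the increment of [K], say k, is at most [th], the supremum S of
    [E] satisfies S <= E x + k S, whence S <= E x / (1 - k) <= E x exp(k / (1 - th)). Such intervals
    are chained at points of [G], and then [th] tends to 0. *)
Lemma gronwall_on G E K (s t C : R) : G s -> G t -> s < t -> 0 <= C ->
  dense_in G s t ->
  (forall x, G x -> s <= x <= t -> 0 <= E x) ->
  (exists B, forall x, G x -> s <= x <= t -> E x <= B) ->
  (forall x y, s <= x -> x <= y -> y <= t -> K x <= K y) ->
  ucont K s t ->
  (forall x y S, G x -> G y -> s <= x -> x < y -> y <= t -> 0 <= S ->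
     (forall r, G r -> x <= r <= y -> E r <= S) -> E y <= E x + C * (K y - K x) * S) ->
  E t <= E s * expR (C * (K t - K s)).
Proof.
move=> Gs Gt st C0 Gd E0 [B EB] Km Ku step.
have short x y th : G x -> G y -> s <= x -> x < y -> y <= t -> 0 < th < 1 ->
    C * (K y - K x) <= th -> E y <= E x * expR (C / (1 - th) * (K y - K x)).
  move=> Gx Gy sx xy yt /andP[th0 th1] Cth.
  pose A := [set E r | r in [set r | G r /\ x <= r <= y]].
  have AB : has_sup A.
    split; first by exists (E x), x => //; split=> //; rewrite lexx ltW.
    exists B => _ [r [Gr /andP[xr ry]] <-]; apply: EB => //.
    by rewrite (le_trans sx)// (le_trans ry).
  have Kxy : 0 <= K y - K x by rewrite subr_ge0 Km// ltW.
  have Asup r : G r -> x <= r <= y -> E r <= sup A.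
    by move=> Gr xry; apply: sup_upper_bound => //; exists r.
  have Ex0 : 0 <= E x by apply: E0 => //; rewrite sx (le_trans (ltW xy)).
  have S0 : 0 <= sup A by apply: le_trans (Asup x Gx _) => //; rewrite lexx ltW.
  set k := C * (K y - K x) in Cth *.
  have k0 : 0 <= k by rewrite mulr_ge0.
  have SE : sup A <= E x + k * sup A.
    apply: ge_sup; first by case: AB.
    move=> _ [r [Gr /andP[xr ry]] <-].
    move: xr; rewrite [in X in X -> _]le_eqVlt => /orP[/eqP <-|xr]; first by rewrite lerDl mulr_ge0.
    apply: (le_trans (step x r (sup A) Gx Gr sx xr (le_trans ry yt) S0 _)).
      by move=> q Gq /andP[xq qr]; apply: Asup => //; rewrite xq (le_trans qr).
    rewrite lerD2l; apply: ler_wpM2r => //; apply: ler_wpM2l => //.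
    by rewrite lerD2r Km// (le_trans sx)// ltW.
  have k1 : 0 < 1 - k by lra.
  apply: (le_trans (Asup y Gy _)); first by rewrite lexx ltW.
  have : sup A <= E x / (1 - k) by rewrite ler_pdivlMr//; lra.
  move=> /le_trans; apply; apply: ler_wpM2l => //.
  have -> : (1 - k)^-1 = 1 + k / (1 - k) by field; rewrite lt0r_neq0.
  apply: (le_trans (expR_ge1Dx _)); rewrite ler_expR.
  have -> : C / (1 - th) * (K y - K x) = k / (1 - th) by rewrite /k; ring.
  by apply: ler_wpM2l => //; rewrite lef_pV2 ?posrE; lra.
have Kst : 0 <= K t - K s by rewrite subr_ge0 Km// ltW.
have main th : 0 < th < 1 -> E t <= E s * expR (C / (1 - th) * (K t - K s)).
  move=> /[dup] th01 /andP[th0 th1].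
  have [d d0 Hd] := Ku (th / (C + 1)) (divr_gt0 th0 (ltr_wpDl C0 ltr01)).
  pose eta := d / 3; have eta0 : 0 < eta by rewrite divr_gt0.
  have kd x y : s <= x -> x <= y -> y <= t -> y - x < d -> C * (K y - K x) <= th.
    move=> sx xy yt yxd; have := Hd x y; rewrite sx yt (le_trans xy)// (le_trans sx)//.
    rewrite distrC ger0_norm ?subr_ge0// => /(_ isT isT yxd); rewrite distrC => h.
    have h2 : K y - K x <= th / (C + 1) by apply: le_trans h; exact: ler_norm.
    apply: (le_trans (ler_wpM2l C0 h2)).
    by rewrite mulrCA ger_pMr// ler_pdivrMr ?mul1r ?lerDl// ltr_wpDl.
  (* A predecessor [z] in [G] is taken between [r - 2 * eta] and [r - eta]: each step gains at least
     [eta] and is shorter than [d], since [eta] is [d / 3]. *)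
  have claim n : forall r, G r -> s <= r -> r <= t -> r - s <= n%:R * eta ->
      E r <= E s * expR (C / (1 - th) * (K r - K s)).
    elim: n => [|n IH] r Gr sr rt rn.
      have -> : r = s by move: rn; rewrite mul0r; lra.
      by rewrite subrr mulr0 expR0 mulr1.
    case: (leP (r - s) (2 * eta)) => r2.
      move: sr; rewrite [in X in X -> _]le_eqVlt => /orP[/eqP <-|sr].
        by rewrite subrr mulr0 expR0 mulr1.
      by apply: short => //; apply: kd => //; [exact: ltW|rewrite /eta in r2 eta0; lra].
    have [| | |z [Gz z1 z2]] := Gd (r - 2 * eta) (r - eta); try lra.
    have zr : z < r by lra.
    have zE : E z <= E s * expR (C / (1 - th) * (K z - K s)).
      by apply: IH => //; move: rn; rewrite -natr1 mulrDl mul1r; lra.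
    apply: (@le_trans _ _ (E z * expR (C / (1 - th) * (K r - K z)))).
      by apply: short => //; [lra|apply: kd; rewrite /eta in r2 eta0 z1 z2 *; lra].
    apply: (le_trans (ler_wpM2r (expR_ge0 _) zE)).
    rewrite -(mulrA (E s)) -expRD -mulrDr.
    by have -> : K z - K s + (K r - K z) = K r - K s by ring.
  have [n Hn] := exists_natr_gt ((t - s) / eta).
  by apply: (claim n) => //; [exact: ltW|rewrite -ler_pdivrMr// ltW].
set X := C * (K t - K s); have X0 : 0 <= X by rewrite mulr_ge0.
have Es0 : 0 <= E s by apply: E0 => //; rewrite lexx ltW.
have Et0 : 0 <= E t by apply: E0 => //; rewrite lexx ltW.
have main2 e : 0 < e -> E t <= E s * expR (X + e).
  move=> e0; have Xe : 0 < X + e + 1 by lra.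
  (* For this value of th, 1 / (1 - th) = (X + e + 1) / (X + 1), so that the exponent X / (1 - th)
     is at most X + e. *)
  have th01 : 0 < e / (X + e + 1) < 1.
    by rewrite divr_gt0//= ltr_pdivrMr// mul1r; lra.
  apply: (le_trans (main _ th01)); apply: ler_wpM2l => //; rewrite ler_expR.
  have -> : C / (1 - e / (X + e + 1)) * (K t - K s) = X * ((X + e + 1) / (X + 1)).
    by rewrite /X; field; rewrite -/X; apply/andP; split; apply: lt0r_neq0; lra.
  have -> : X * ((X + e + 1) / (X + 1)) = X + e * (X / (X + 1)).
    by field; apply: lt0r_neq0; lra.
  rewrite lerD2l ger_pMr// ler_pdivrMr; lra.
apply: ler_eps => e e0; have Y0 : 0 < E t + 1 by lra.
(* With this error e' in the exponent, E t exp(- e') >= E t (1 - e') >= E t - e. *)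
have e' : 0 < e / (E t + 1) by rewrite divr_gt0.
have := main2 _ e'; rewrite expRD mulrA => h.
have h2 : E t * expR (- (e / (E t + 1))) <= E s * expR X.
  by rewrite expRN ler_pdivrMr ?expR_gt0.
apply: (@le_trans _ _ (E t * (1 - e / (E t + 1)) + e)).
  have : E t * (e / (E t + 1)) <= e.
    by rewrite mulrCA ger_pMr// ler_pdivrMr// mul1r lerDl.
  lra.
rewrite lerD2r; apply: le_trans h2; apply: ler_wpM2l => //.
exact: expR_ge1Dx.
Qed.

End gronwall.

(** * Square-integrable functions on a set *)

Section lower_integral.
Import HBNNSimple.
Context d (T : measurableType d) (R : realType) (mu : {measure set T -> \bar R}).
Local Open Scope ereal_scope.
Implicit Types (f g : T -> \bar R) (D A : set T).

(* The integral of a nonnegative function is the supremum over the simple functions below it,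
   which makes sense, and is monotone, without measurability. *)
Lemma ge0_le_integral_nonmeas D f g : (forall x, D x -> 0 <= f x) ->
  (forall x, D x -> f x <= g x) -> \int[mu]_(x in D) f x <= \int[mu]_(x in D) g x.
Proof.
move=> f0 fg; have g0 x : D x -> 0 <= g x by move=> Dx; apply: le_trans (f0 x Dx) (fg x Dx).
rewrite !ge0_integralE //=; apply: ge_ereal_sup => _ [h/= hf] <-.
apply: le_ereal_sup_tmp; exists (sintegral mu h) => //; exists h => // x.
apply: (le_trans (hf x)); rewrite !patchE; case: ifPn => //; rewrite inE; exact: fg.
Qed.

Lemma ge0_subset_integral_nonmeas A D f : A `<=` D -> (forall x, D x -> 0 <= f x) ->
  \int[mu]_(x in A) f x <= \int[mu]_(x in D) f x.
Proof.
move=> AD f0; rewrite integral_mkcond [leRHS]integral_mkcond.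
apply: ge0_le_integral_nonmeas => x _; rewrite !patchE.
  by case: ifPn => //; rewrite inE => /AD /f0.
case: ifPn => [|_]; first by rewrite inE => /AD xD; rewrite (mem_set xD).
by case: ifPn => //; rewrite inE => /f0.
Qed.

(** Only [g] is measurable: a simple function below [f] lies below [g] off the null set. Norms of
    vector-valued functions of time, not known to be measurable, are handled in this way. *)
Lemma ge0_ae_eq_integral_nonmeas D f g : measurable D -> measurable_fun D g ->
  (forall x, D x -> 0 <= f x) -> (forall x, D x -> 0 <= g x) ->
  {ae mu, forall x, D x -> f x = g x} ->
  \int[mu]_(x in D) f x = \int[mu]_(x in D) g x.
Proof.
move=> mD mg f0 g0 [N [mN N0 Nfg]].
have fgN x : (D `\` N) x -> f x = g x.
  by move=> [Dx Nx]; apply: contrapT => h; apply: Nx; apply: Nfg => /= /(_ Dx).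
have mDN : measurable (D `\` N) by exact: measurableD.
have E : \int[mu]_(x in D) g x = \int[mu]_(x in D `\` N) f x.
  rewrite (ge0_negligible_integral mN)//; apply: eq_integral => x; rewrite inE => /fgN -> //.
apply/eqP; rewrite eq_le; apply/andP; split; last first.
  by rewrite E; apply: ge0_subset_integral_nonmeas => // x [].
rewrite E [leLHS]ge0_integralE//; apply: ge_ereal_sup => _ [h/= hf] <-.
have -> : sintegral mu h = \int[mu]_x (h x)%:E.
  by rewrite integral_nnsfun// patch_setT.
have h0 x : [set: T] x -> 0 <= (h x)%:E by rewrite lee_fin.
rewrite (ge0_negligible_integral mN)//; last exact/measurable_EFinP.
rewrite integral_mkcond [leRHS]integral_mkcond; apply: ge0_le_integral_nonmeas => x _.
  by rewrite patchE; case: ifPn => // _; rewrite lee_fin.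
rewrite !patchE; have [Nx|Nx] := pselect (N x).
  by rewrite !memNset// => -[].
rewrite mem_set//; have := hf x; rewrite patchE; have [Dx|Dx] := pselect (D x).
  by rewrite !mem_set.
by rewrite memNset// memNset// => -[].
Qed.

End lower_integral.

Section on_set.
Context d (T : measurableType d) (R : realType) (mu : {measure set T -> \bar R}) (D : set T).
Implicit Types (u w f g : T -> R).

(* D need not be measurable: a function on D is identified with its extension by zero. *)
Definition int_on f := mu.-integrable setT (EFin \o (f \_ D)).

Definition l2 u : Prop := u \_ D \in Lfun mu 2%:E.

Lemma patch0 (f : T -> R) x : ~ D x -> (f \_ D) x = 0.
Proof. by move=> Dx; rewrite patchE memNset. Qed.

Lemma patch1 (f : T -> R) x : D x -> (f \_ D) x = f x.
Proof. by move=> Dx; rewrite patchE mem_set. Qed.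

Lemma patch_map2 (op : R -> R -> R) f g : op 0 0 = 0 ->
  (fun x => op (f x) (g x)) \_ D = (fun x => op ((f \_ D) x) ((g \_ D) x)).
Proof.
move=> o0; apply/funext => x; have [Dx|Dx] := pselect (D x); first by rewrite !patch1.
by rewrite !patch0.
Qed.

Lemma patch_map (op : R -> R) f : op 0 = 0 ->
  (fun x => op (f x)) \_ D = (fun x => op ((f \_ D) x)).
Proof. by move=> o0; exact: (patch_map2 (op := fun x _ => op x) f f). Qed.

Lemma int_onD f g : int_on f -> int_on g -> int_on (fun x => f x + g x).
Proof.
rewrite /int_on => hf hg; rewrite (patch_map2 (op := +%R))/= ?addr0//.
exact: (integrableD measurableT hf hg).
Qed.

Lemma int_onZ k f : int_on f -> int_on (fun x => k * f x).
Proof.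
rewrite /int_on => hf; rewrite (patch_map (op := *%R k))/= ?mulr0//.
exact: (integrableZl measurableT k hf).
Qed.

Lemma int_onN f : int_on f -> int_on (fun x => - f x).
Proof.
by move=> /(int_onZ (-1)); apply: eq_ind; congr int_on; apply/funext => x; rewrite mulN1r.
Qed.

Lemma int_onB f g : int_on f -> int_on g -> int_on (fun x => f x - g x).
Proof. by move=> hf hg; exact: int_onD hf (int_onN hg). Qed.

Lemma int_on_norm f : int_on f -> int_on (fun x => `|f x|).
Proof.
rewrite /int_on => hf; rewrite (patch_map (op := Num.norm)) ?normr0//.
exact: integrable_norm hf.
Qed.

Lemma int_on_le f g : measurable_fun setT (f \_ D) -> int_on g ->
  (forall x, D x -> `|f x| <= g x) -> int_on f.
Proof.
move=> mf hg fg; apply: le_integrable hg => //; first exact/measurable_EFinP.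
move=> x _ /=; rewrite lee_fin; have [Dx|Dx] := pselect (D x); last by rewrite !patch0.
by rewrite !patch1// (le_trans (fg x Dx))// ler_norm.
Qed.

Local Notation I f := (\int[mu]_(x in D) f x).

Lemma IonD f g : int_on f -> int_on g -> I (fun x => f x + g x) = I f + I g.
Proof.
move=> hf hg; rewrite Rintegral_mkcond (patch_map2 (op := +%R))/= ?addr0//.
by rewrite RintegralD//= -!Rintegral_mkcond.
Qed.

Lemma IonZ k f : int_on f -> I (fun x => k * f x) = k * I f.
Proof.
move=> hf; rewrite Rintegral_mkcond (patch_map (op := *%R k))/= ?mulr0//.
by rewrite RintegralZl//= -!Rintegral_mkcond.
Qed.

Lemma IonN f : int_on f -> I (fun x => - f x) = - I f.
Proof.
by move=> hf; rewrite -mulN1r -IonZ//; apply: eq_Rintegral => x _; rewrite mulN1r.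
Qed.

Lemma IonB f g : int_on f -> int_on g -> I (fun x => f x - g x) = I f - I g.
Proof. by move=> hf hg; rewrite IonD ?IonN//; exact: int_onN. Qed.

Lemma Ion_le f g : int_on f -> int_on g -> (forall x, D x -> f x <= g x) -> I f <= I g.
Proof.
move=> hf hg fg; rewrite Rintegral_mkcond [leRHS]Rintegral_mkcond; apply: le_Rintegral => // x _.
have [Dx|Dx] := pselect (D x); first by rewrite !patch1// fg.
by rewrite !patch0.
Qed.

Lemma Ion_ge0 f : (forall x, D x -> 0 <= f x) -> 0 <= I f.
Proof. exact: Rintegral_ge0. Qed.

Lemma Ion_norm f : int_on f -> `|I f| <= I (fun x => `|f x|).
Proof.
move=> hf; rewrite Rintegral_mkcond [leRHS]Rintegral_mkcond (patch_map (op := Num.norm)) ?normr0//.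
exact: le_normr_Rintegral.
Qed.

Lemma l2P u : l2 u <-> measurable_fun setT (u \_ D) /\ int_on (fun x => u x ^+ 2).
Proof.
rewrite /int_on (patch_map (op := fun r => r ^+ 2)) ?expr0n//; split=> [l|[mu' hu]].
  split; first by move: l; rewrite /l2 inE => /andP[/[!inE]].
  exact: Lfun2_integrable_sqr l.
rewrite /l2 inE; apply/andP; split; rewrite inE//= /finite_norm unlock poweR_lty//.
case/integrableP : hu => _; congr (_ < _)%E; apply: eq_integral => x _.
rewrite /= ger0_norm ?sqr_ge0//.
by rewrite (powR_mulrn 2 (normr_ge0 _)) real_normK ?num_real.
Qed.

Lemma l2_measurable u : l2 u -> measurable_fun setT (u \_ D).
Proof. by move=> /l2P[]. Qed.

Lemma l2_mul u w : l2 u -> l2 w -> int_on (fun x => u x * w x).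
Proof.
move=> lu lw; have /Lfun1_integrable := Lfun2_mul_Lfun1 lu lw.
by rewrite /int_on (patch_map2 (op := *%R)) ?mulr0.
Qed.

Lemma l2D u w : l2 u -> l2 w -> l2 (fun x => u x + w x).
Proof.
move=> lu lw; rewrite /l2 (patch_map2 (op := +%R)) ?addr0//.
by have [_] := Lfun_addr_closed mu (lee1n 2); apply.
Qed.

Lemma l2Z k u : l2 u -> l2 (fun x => k * u x).
Proof.
move=> lu; rewrite /l2 (patch_map (op := *%R k)) ?mulr0//.
have [l0 cl] := Lfun_submod_closed mu (lee1n 2).
by rewrite -[X in X \in _]addr0; apply: cl.
Qed.

Lemma l2_0 : l2 (fun=> 0).
Proof.
have [l0 _] := Lfun_addr_closed mu (lee1n 2).
rewrite /l2 (_ : _ \_ _ = 0)//; apply/funext => x.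
by rewrite patchE; case: ifP.
Qed.

Lemma l2N u : l2 u -> l2 (fun x => - u x).
Proof.
move=> /(l2Z (-1)); rewrite (_ : (fun x => -1 * u x) = (fun x => - u x))//.
by apply/funext => x; rewrite mulN1r.
Qed.

Lemma l2B u w : l2 u -> l2 w -> l2 (fun x => u x - w x).
Proof. by move=> lu lw; exact: l2D lu (l2N lw). Qed.

Lemma l2_le u w : measurable_fun setT (u \_ D) -> l2 w ->
  (forall x, D x -> `|u x| <= `|w x|) -> l2 u.
Proof.
move=> mu' lw uw; apply/l2P; split=> //; have [_ w2] := (l2P w).1 lw.
apply: int_on_le w2 _.
  by rewrite (patch_map (op := fun r => r ^+ 2)) ?expr0n//; exact: measurable_funX.
by move=> x Dx; rewrite normrX -(real_normK (num_real (w x))) lerXn2r ?nnegrE// uw.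
Qed.

Lemma l2_norm u : l2 u -> l2 (fun x => `|u x|).
Proof.
move=> lu; apply: (l2_le _ lu) => [|x _]; last by rewrite normr_id.
rewrite (patch_map (op := Num.norm)) ?normr0//.
by apply: measurableT_comp => //; exact: l2_measurable.
Qed.

Lemma l2_lip (k : R -> R) L u : continuous k -> k 0 = 0 -> 0 <= L ->
  (forall x, `|k x| <= L * `|x|) -> l2 u -> l2 (k \o u).
Proof.
move=> ck k0 L0 kL lu; apply: (l2_le (w := fun x => L * u x)).
- rewrite /comp (patch_map (op := k))//; apply: measurableT_comp (l2_measurable lu).
  exact: continuous_measurable_fun.
- exact: l2Z.
- by move=> x _; rewrite /= normrM (ger0_norm L0).
Qed.

Lemma fine_Lnorm2 u : l2 u -> fine ('N[mu]_2%:E [EFin \o (u \_ D)]) ^+ 2 = I (fun x => u x * u x).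
Proof.
move=> lu.
have fn : ('N[mu]_2%:E [EFin \o (u \_ D)])%E \is a fin_num.
  rewrite ge0_fin_numE ?Lnorm_ge0//.
  by move: lu; rewrite /l2 inE => /andP[_]; rewrite inE.
have := @poweR_Lnorm _ _ _ mu (EFin \o (u \_ D)) 2 (lt0r_neq0 (ltr0n _ 2)).
rewrite -(fineK fn) poweR_EFin powR_mulrn ?fine_ge0 ?Lnorm_ge0// => E.
rewrite Rintegral_mkcond /Rintegral -[LHS]/(fine (_%:E)) E; congr fine.
apply: eq_integral => x _; rewrite (patch_map2 (op := *%R)) ?mulr0//=.
by rewrite (powR_mulrn 2 (normr_ge0 _)) real_normK ?num_real// expr2.
Qed.

Lemma l2_ae0 u : l2 u -> I (fun x => u x * u x) = 0 -> {ae mu, forall x, D x -> u x = 0}.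
Proof.
move=> lu; rewrite Rintegral_mkcond (patch_map2 (op := *%R)) ?mulr0// => I0.
have iu : mu.-integrable setT (EFin \o (fun x => (u \_ D) x * (u \_ D) x)).
  by have := l2_mul lu lu; rewrite /int_on (patch_map2 (op := *%R)) ?mulr0.
have f0 : (\int[mu]_x `|((u \_ D) x * (u \_ D) x)%:E| = 0)%E.
  transitivity (\int[mu]_x ((u \_ D) x * (u \_ D) x)%:E)%E.
    by apply: eq_integral => x _; rewrite /= ger0_norm// -expr2 sqr_ge0.
  rewrite -[LHS]fineK; last exact: integrable_fin_num iu.
  by congr EFin.
have /(ae_eq_integral_abs mu measurableT) := measurable_int mu iu.
move=> /iffLR /(_ f0); apply: filterS => x /(_ Logic.I)/= /eqP + Dx.
by rewrite patch1// eqe mulf_eq0 orbb => /eqP.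
Qed.

Lemma ae_Ion0 f : measurable_fun setT (f \_ D) -> {ae mu, forall x, D x -> f x = 0} -> I f = 0.
Proof.
move=> mf f0; rewrite Rintegral_mkcond /Rintegral.
rewrite (@ae_eq_integral _ _ _ mu setT (cst 0%E))//; last 2 first.
- exact/measurable_EFinP.
- apply: filterS f0 => x xf _ /=; have [Dx|Dx] := pselect (D x); last by rewrite patch0.
  by rewrite patch1// xf.
by rewrite integral0.
Qed.

End on_set.

(** * Positive semidefinite inner products *)

Section semi_inner.
Context (R : realType) (V : lmodType R).

(** Definiteness is absent because functions are not identified when equal almost everywhere.
    Linearity is restricted to [A] because an integral is additive on integrable functions only;
    symmetry and positivity of the integral products hold for all functions. *)
Record semi_inner (A : set V) (B : V -> V -> R) : Prop := SemiInner {
  si_0 : A 0;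
  si_lin : forall (k : R) x y, A x -> A y -> A (k *: x + y);
  si_sym : forall x y, B x y = B y x;
  si_linl : forall (k : R) x y z, A x -> A y -> A z -> B (k *: x + y) z = k * B x z + B y z;
  si_ge0 : forall x, 0 <= B x x }.

Variables (A : set V) (B : V -> V -> R).
Hypothesis si : semi_inner A B.

Lemma siD x y : A x -> A y -> A (x + y).
Proof. by move=> Ax Ay; rewrite -[x]scale1r; exact: (si_lin si). Qed.

Lemma siZ k x : A x -> A (k *: x).
Proof. by move=> Ax; rewrite -[_ *: _]addr0; apply: (si_lin si) => //; exact: si_0 si. Qed.

Lemma siN x : A x -> A (- x).
Proof. by move=> Ax; rewrite -scaleN1r; exact: siZ. Qed.

Lemma siB x y : A x -> A y -> A (x - y).
Proof. by move=> Ax Ay; apply: siD => //; exact: siN. Qed.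

Lemma siDl x y z : A x -> A y -> A z -> B (x + y) z = B x z + B y z.
Proof. by move=> Ax Ay Az; rewrite -[x]scale1r (si_linl si)// mul1r scale1r. Qed.

Lemma si0l z : A z -> B 0 z = 0.
Proof.
move=> Az; have A0 := si_0 si; have := siDl A0 A0 Az; rewrite addr0 => h; lra.
Qed.

Lemma siZl k x z : A x -> A z -> B (k *: x) z = k * B x z.
Proof.
by move=> Ax Az; rewrite -[_ *: _]addr0 (si_linl si)//; [rewrite si0l// addr0|exact: si_0 si].
Qed.

Lemma siNl x z : A x -> A z -> B (- x) z = - B x z.
Proof. by move=> Ax Az; rewrite -scaleN1r siZl// mulN1r. Qed.

Lemma siBl x y z : A x -> A y -> A z -> B (x - y) z = B x z - B y z.
Proof. by move=> Ax Ay Az; rewrite siDl ?siNl//; exact: siN. Qed.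

Lemma siDr x y z : A x -> A y -> A z -> B z (x + y) = B z x + B z y.
Proof. by move=> Ax Ay Az; rewrite (si_sym si) siDl// !(si_sym si z). Qed.

Lemma siBr x y z : A x -> A y -> A z -> B z (x - y) = B z x - B z y.
Proof. by move=> Ax Ay Az; rewrite (si_sym si) siBl// !(si_sym si z). Qed.

Lemma siZr k x z : A x -> A z -> B z (k *: x) = k * B z x.
Proof. by move=> Ax Az; rewrite (si_sym si) siZl// (si_sym si z). Qed.

Lemma siNr x z : A x -> A z -> B z (- x) = - B z x.
Proof. by move=> Ax Az; rewrite (si_sym si) siNl// (si_sym si z). Qed.

Definition sinorm x := Num.sqrt (B x x).

Lemma sinorm_ge0 x : 0 <= sinorm x. Proof. exact: sqrtr_ge0. Qed.

Lemma sinorm2 x : sinorm x ^+ 2 = B x x.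
Proof. by rewrite sqr_sqrtr// (si_ge0 si). Qed.

Lemma si_cs x y : A x -> A y -> `|B x y| <= sinorm x * sinorm y.
Proof.
move=> Ax Ay.
have quad (k : R) : 0 <= k ^+ 2 * B x x + 2 * k * B x y + B y y.
  have := si_ge0 si (k *: x + y); rewrite (si_linl si)//; last exact: (si_lin si).
  rewrite (si_sym si x) (si_sym si y) !(si_linl si)// (si_sym si y x) => h.
  by apply: le_trans h _; rewrite le_eqVlt; apply/orP; left; apply/eqP; ring.
rewrite -(@ler_pXn2r _ 2)// ?nnegrE ?mulr_ge0 ?sinorm_ge0//.
rewrite exprMn !sinorm2 real_normK ?num_real//.
have := si_ge0 si x; rewrite le_eqVlt => /orP[/eqP x0|x0].
  rewrite -x0 mul0r; have [->|b0] := eqVneq (B x y) 0; first by rewrite expr0n.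
  (* For [B x x = 0] the quadratic is affine in [k], and this [k] would give it the value -1. *)
  have := quad (- (B y y + 1) / (2 * B x y)); rewrite -x0 mulr0 add0r.
  have -> : 2 * (- (B y y + 1) / (2 * B x y)) * B x y = - (B y y + 1) by field.
  lra.
have := quad (- B x y / B x x).
have -> : (- B x y / B x x) ^+ 2 * B x x + 2 * (- B x y / B x x) * B x y + B y y =
  (B x x * B y y - B x y ^+ 2) / B x x by field; exact: lt0r_neq0.
by rewrite pmulr_lge0 ?invr_gt0// subr_ge0.
Qed.

Lemma si_le x y : A x -> A y -> B x y <= sinorm x * sinorm y.
Proof. by move=> Ax Ay; apply: le_trans (si_cs Ax Ay); exact: ler_norm. Qed.

Lemma sinormD x y : A x -> A y -> sinorm (x + y) <= sinorm x + sinorm y.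
Proof.
move=> Ax Ay; rewrite -(@ler_pXn2r _ 2)// ?nnegrE ?addr_ge0 ?sinorm_ge0//.
rewrite sinorm2 siDl ?siDr//; [|exact: siD..].
have := si_le Ax Ay; rewrite (si_sym si y x) sqrrD !sinorm2 => h; lra.
Qed.

Lemma sinormN x : A x -> sinorm (- x) = sinorm x.
Proof. by move=> Ax; rewrite /sinorm siNl ?siNr ?opprK//; exact: siN. Qed.

Lemma sinormC x y : A x -> A y -> sinorm (x - y) = sinorm (y - x).
Proof. by move=> Ax Ay; rewrite -opprB sinormN//; exact: siB. Qed.

Lemma sinormB x y : A x -> A y -> sinorm (x - y) <= sinorm x + sinorm y.
Proof. by move=> Ax Ay; rewrite -(sinormN Ay); apply: sinormD => //; exact: siN. Qed.

Lemma sinorm_dist x y : A x -> A y -> `|sinorm x - sinorm y| <= sinorm (x - y).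
Proof.
move=> Ax Ay; have Axy := siB Ax Ay; have Ayx := siB Ay Ax.
have := sinormD Axy Ay; have := sinormD Ayx Ax; rewrite !subrK (sinormC Ay Ax).
by rewrite ler_norml => ? ?; apply/andP; split; lra.
Qed.

Lemma sinormZ k x : A x -> sinorm (k *: x) = `|k| * sinorm x.
Proof.
move=> Ax; rewrite /sinorm siZl ?siZr//; last exact: siZ.
by rewrite mulrA -expr2 sqrtrM ?sqr_ge0// sqrtr_sqr.
Qed.

Lemma gram_sinorm x y : A x -> A y -> B x x - B x y *+ 2 + B y y = sinorm (x - y) ^+ 2.
Proof.
move=> Ax Ay; rewrite sinorm2 siBl ?siBr//; [|exact: siB..].
by rewrite (si_sym si y x); ring.
Qed.

End semi_inner.

(** * Bump functions and the fundamental lemma *)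

Section flat_function.
Context (R : realType).
Implicit Types (p : {poly R}) (x y : R).

(** The polynomial factor closes the family of exp(-1/x) under differentiation, so that a single
    derivative formula yields smoothness. *)
Definition flat p x : R := if 0 < x then p.[x^-1] * expR (- x^-1) else 0.

Definition flat_deriv p : {poly R} := 'X^2 * (p - p^`()).

(** Each power satisfies y^i <= i! exp y, by the exponential series. *)
Lemma poly_expR_bounded p : exists C, forall y, 0 <= y -> `|p.[y]| <= C * expR y.
Proof.
exists (\sum_(i < size p) `|p`_i| * i`!%:R) => y y0.
rewrite horner_coef mulr_suml; apply: (le_trans (ler_norm_sum _ _ _)).
apply: ler_sum => i _; rewrite normrM -mulrA ler_wpM2l// ger0_norm ?exprn_ge0//.
case: (nat_of_ord i) => [|n].
  by rewrite expr0 fact0 mul1r; apply: le_trans (expR_ge1Dx y); rewrite lerDl.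
rewrite mulrC -ler_pdivrMr ?ltr0n ?fact_gt0//.
by apply: le_trans (expR_ge1Dxn n y0); rewrite lerDr.
Qed.

(** The bound of ['X^2 * p] by the exponential, read at 1/x. Quadratic decay makes the difference
    quotients at 0 tend to 0. *)
Lemma flat_bound p : exists2 C, 0 <= C & forall x, `|flat p x| <= C * x ^+ 2.
Proof.
have [C HC] := poly_expR_bounded ('X^2 * p).
have C0 : 0 <= C by have := HC 0 (lexx _); rewrite expR0 mulr1; apply: le_trans.
exists C => // x; rewrite /flat; case: ltP => x0; last by rewrite normr0 mulr_ge0 ?sqr_ge0.
have xn := lt0r_neq0 x0; have y0 : 0 <= x^-1 by rewrite invr_ge0 ltW.
have := HC _ y0; rewrite hornerM hornerXn normrM (ger0_norm (exprn_ge0 _ y0)) => h.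
rewrite normrM (ger0_norm (expR_ge0 _)) expRN ler_pdivrMr ?expR_gt0//.
have -> : `|p.[x^-1]| = x ^+ 2 * (x^-1 ^+ 2 * `|p.[x^-1]|) by field.
apply: (le_trans (ler_wpM2l (sqr_ge0 x) h)).
by rewrite le_eqVlt; apply/orP; left; apply/eqP; ring.
Qed.

Lemma is_derive_flat p x : is_derive x (1 : R) (flat p) (flat (flat_deriv p) x).
Proof.
case: (ltgtP x 0) => x0.
- apply: (@near_eq_is_derive _ _ _ (cst 0)).
    near=> y; rewrite /flat ltNge; have -> // : y <= 0.
    by apply/ltW; near: y; exact: lt_nbhsl.
  by rewrite /flat ltNge (ltW x0)/=; exact: is_derive_cst.
- have xn := lt0r_neq0 x0.
  apply: (@near_eq_is_derive _ _ _ (fun y => p.[y^-1] * expR (- y^-1))).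
    near=> y; rewrite /flat; have -> // : 0 < y by near: y; exact: lt_nbhsr.
  have i1 : is_derive x (1 : R) (fun y : R => y^-1) (- x ^- 2 *: 1).
    exact: is_deriveV.
  have i2 : is_derive x (1 : R) (horner p \o (fun y => y^-1)) (p^`().[x^-1] * (- x ^- 2 *: 1)).
    exact: is_derive1_comp.
  have i3 : is_derive x (1 : R) (fun y : R => - y^-1) (- (- x ^- 2 *: 1)) by exact: is_deriveN.
  have i4 : is_derive x (1 : R) (expR \o (fun y => - y^-1))
      (expR (- x^-1) * (- (- x ^- 2 *: 1))) by exact: is_derive1_comp.
  apply: (is_derive_eq (is_deriveM i2 i4)).
  rewrite /flat x0 /flat_deriv hornerM hornerXn hornerD hornerN /=.
  by rewrite /GRing.scale/=; field.
- have [C C0 HC] := flat_bound p; rewrite x0.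
  have F0 q : flat q 0 = 0 by rewrite /flat ltxx.
  have c0 : h^-1 *: (flat p (h *: (1 : R) + 0) - flat p 0) @[h --> 0^'] --> (0 : R).
    apply/cvgr0Pnorm_le => e e0; near=> h; rewrite F0 subr0 addr0.
    have hn : h != 0 by near: h; exact: nbhs_dnbhs_neq.
    rewrite /GRing.scale/= mulr1 normrM normfV ler_pdivrMl ?normr_gt0//.
    apply: (le_trans (HC h)); rewrite -real_normK ?num_real// expr2 mulrCA.
    rewrite ler_pM2l ?normr_gt0//.
    apply: (@le_trans _ _ ((C + 1) * `|h|)); first by rewrite ler_wpM2r// lerDl.
    rewrite mulrC -ler_pdivlMr ?ltr_wpDl//.
    by near: h; apply: dnbhs0_le; rewrite divr_gt0// ltr_wpDl.
  apply: DeriveDef; first by apply/cvg_ex; exists 0.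
  by rewrite F0; apply/cvg_lim => //; exact: Rhausdorff.
Unshelve. all: by end_near. Qed.

Lemma flat1E n x : 0 < x -> flat 1 (n.+1%:R * x) = expR (- (n.+1%:R * x)^-1).
Proof. by move=> x0; rewrite /flat mulr_gt0// hornerC mul1r. Qed.

Lemma flat_ge0 x : 0 <= flat 1 x <= 1.
Proof.
rewrite /flat; case: ltP => x0; last by rewrite lexx ler01.
rewrite hornerC mul1r expR_ge0/= -[leRHS]expR0 ler_expR oppr_le0 invr_ge0 ltW//.
Qed.

Lemma flat_eq0 x : (flat 1 x == 0) = (x <= 0).
Proof.
rewrite /flat; case: ltP => x0; last by rewrite eqxx.
by rewrite hornerC mul1r; apply/negbTE/lt0r_neq0/expR_gt0.
Qed.

Lemma flat_cvg x : 0 < x -> flat 1 (n.+1%:R * x) @[n --> \oo] --> (1 : R).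
Proof.
move=> x0; under eq_fun do rewrite flat1E//.
have c : (x^-1 : R) @[n --> \oo] --> x^-1 by exact: cvg_cst.
have c1 : (n.+1%:R * x)^-1 @[n --> \oo] --> (0 : R).
  under eq_fun do rewrite invfM.
  by have := cvgM (@cvg_harmonic R) c; rewrite mul0r; apply.
have c2 : - (n.+1%:R * x)^-1 @[n --> \oo] --> (- 0 : R) by exact: cvgN.
have := cvg_comp _ expR c2 (@continuous_expR R (- 0)).
by rewrite oppr0 expR0; apply.
Qed.

End flat_function.

Section smooth_class.
Context (R : realType) (V : normedModType R).
Implicit Types (f g : V -> R^o).

(** A class closed under directional derivatives, so that membership yields all iterated derivatives
    at once. In the first case [l] is affine with linear part [L], and differentiation along [v]
    brings out the constant [L v]. *)
Inductive smooth_class : (V -> R^o) -> Prop :=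
| sc_flat p (l : V -> R) (L : V -> R) : continuous l ->
    (forall h v x, l (h *: v + x) = l x + h * L v) -> smooth_class (fun x => flat p (l x))
| sc_cst c : smooth_class (cst c)
| sc_add f g : smooth_class f -> smooth_class g -> smooth_class (fun x => f x + g x)
| sc_mul f g : smooth_class f -> smooth_class g -> smooth_class (fun x => f x * g x).

(** Reduction to one real variable: the difference quotients along [v] are those of the restriction
    to a line. *)
Lemma is_derive1P f x v (df : R) :
  is_derive (0 : R) (1 : R) (fun h : R => f (h *: v + x)) df -> is_derive x v f df.
Proof.
set F := fun h : R => f (h *: v + x) => -[dF DF].
have E : (fun h : R => h^-1 *: ((F \o shift 0) (h *: (1 : R)) - F 0)) =
    (fun h : R => h^-1 *: ((f \o shift x) (h *: v) - f x)).
  by rewrite funeqE /F => h /=; rewrite addr0 scale0r add0r [_%:A]mulr1.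
by split; [move: dF|move: DF]; rewrite /derivable /derive E.
Qed.

Lemma is_derive_flat_affine p (l L : V -> R) x v :
  (forall h v x, l (h *: v + x) = l x + h * L v) ->
  is_derive x v (fun x => flat p (l x) : R^o) (L v * flat (flat_deriv p) (l x)).
Proof.
move=> hl; apply: is_derive1P.
have -> : (fun h : R => flat p (l (h *: v + x)) : R^o) = flat p \o (fun h : R => L v * h + l x).
  by apply/funext => h /=; rewrite hl addrC mulrC.
have i1 : is_derive (0 : R) (1 : R) (fun h : R => L v * h + l x) (L v).
  have j1 : is_derive (0 : R) (1 : R) (fun h : R => L v *: h) (L v *: 1) by exact: is_deriveZ.
  apply: (is_derive_eq (is_deriveD j1 (is_derive_cst (l x) (0 : R) (1 : R)))).
  by rewrite addr0 /GRing.scale/= mulr1.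
have := @is_derive1_comp _ (flat p) (fun h : R => L v * h + l x) 0 _ _
  (is_derive_flat p (L v * 0 + l x)) i1.
by rewrite mulr0 add0r mulrC.
Qed.

Lemma smooth_class_derive f : smooth_class f -> forall v, (forall x, derivable f x v) /\
  smooth_class ('D_v f : V -> R^o).
Proof.
elim=> [p l L cl hl|c|{}f g sf Hf sg Hg|{}f g sf Hf sg Hg] v.
- split=> [x|]; first by have [] := is_derive_flat_affine p x v hl.
  rewrite (_ : 'D_v _ = (fun x => cst (L v) x * flat (flat_deriv p) (l x))).
    by apply: sc_mul; [exact: sc_cst|exact: sc_flat hl].
  by apply/funext => x; have [_ ->] := is_derive_flat_affine p x v hl.
- split=> [x|]; first exact: derivable_cst.
  rewrite (_ : 'D_v _ = cst 0); first exact: sc_cst.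
  by apply/funext => x; exact: derive_cst.
- have [df Df] := Hf v; have [dg Dg] := Hg v.
  split=> [x|]; first exact: derivableD.
  rewrite (_ : 'D_v _ = (fun x => 'D_v f x + 'D_v g x)); first exact: sc_add.
  by apply/funext => x; exact: deriveD.
- have [df Df] := Hf v; have [dg Dg] := Hg v.
  split=> [x|]; first exact: (derivableM (df x) (dg x)).
  rewrite (_ : 'D_v _ = (fun x => f x * 'D_v g x + g x * 'D_v f x)).
    by apply: sc_add; exact: sc_mul.
  by apply/funext => x; exact: (deriveM (df x) (dg x)).
Qed.

Lemma smooth_class_continuous f : smooth_class f -> continuous f.
Proof.
elim=> [p l L cl hl|c|{}f g _ Hf _ Hg|{}f g _ Hf _ Hg].
- move=> x; apply: (continuous_comp (f := l) (g := flat p)); first exact: cl.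
  have [d _] := is_derive_flat p (l x).
  exact/differentiable_continuous/derivable1_diffP.
- exact: cst_continuous.
- by move=> x; apply: continuousD; [exact: Hf|exact: Hg].
- by move=> x; apply: continuousM; [exact: Hf|exact: Hg].
Qed.

Lemma smoothP f : continuous f -> (forall x v, derivable f x v) ->
  (forall v, smooth ('D_v f : V -> R^o)) -> smooth f.
Proof.
(* [foldr] applies the last direction of the list first, hence the case analysis from the end. *)
move=> cf df sf; elim/last_ind => [|s v _]; first by split.
by rewrite foldr_rcons; exact: sf.
Qed.

Lemma smooth_class_smooth f : smooth_class f -> smooth f.
Proof.
move=> sf s; elim/last_ind: s f sf => [|s v IH] f sf /=.
  split; first exact: smooth_class_continuous.
  by move=> x e; have [] := smooth_class_derive sf e.
by rewrite foldr_rcons; apply: IH; have [] := smooth_class_derive sf v.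
Qed.

Lemma smooth_class_prod I (s : seq I) (F : I -> V -> R^o) :
  (forall i, smooth_class (F i)) -> smooth_class (fun x => \prod_(i <- s) F i x).
Proof.
move=> h; elim: s => [|i s IH].
  by rewrite (_ : (fun _ => _) = cst 1); [exact: sc_cst|apply/funext => x; rewrite big_nil].
rewrite (_ : (fun _ => _) = (fun x => F i x * \prod_(j <- s) F j x)); first exact: sc_mul.
by apply/funext => x; rewrite big_cons.
Qed.

End smooth_class.

Section bump.
Context (R : realType).

(* As n grows, bump n a b increases to the indicator function of ]a, b[. *)
Definition bump (n : nat) (a b x : R) : R :=
  flat 1 (n.+1%:R * (x - a)) * flat 1 (n.+1%:R * (b - x)).

Lemma bump_bounds n a b x : 0 <= bump n a b x <= 1.
Proof.
have /andP[f0 f1] := flat_ge0 (n.+1%:R * (x - a)).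
have /andP[g0 g1] := flat_ge0 (n.+1%:R * (b - x)).
by rewrite /bump mulr_ge0//= mulr_ile1.
Qed.

Lemma bump_eq0 n a b x : (bump n a b x != 0) = (a < x < b).
Proof.
by rewrite /bump mulf_eq0 negb_or !flat_eq0 -!ltNge !pmulr_rgt0// !subr_gt0.
Qed.

Lemma bump_cvg a b x :
  bump n a b x @[n --> \oo] --> (\1_[set y | a < y < b] x : R).
Proof.
have [/[dup] h /andP[ax xb]|h] := boolP (a < x < b).
  rewrite indicE mem_set//.
  have c1 : flat 1 (n.+1%:R * (x - a)) @[n --> \oo] --> (1 : R) by apply: flat_cvg; rewrite subr_gt0.
  have c2 : flat 1 (n.+1%:R * (b - x)) @[n --> \oo] --> (1 : R) by apply: flat_cvg; rewrite subr_gt0.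
  by have := cvgM c1 c2; rewrite (mulr1 1); apply.
rewrite indicE memNset; last exact/negP.
rewrite (_ : (fun n => bump n a b x) = cst 0); first exact: cvg_cst.
by apply/funext => n; apply/eqP; apply: contraNT h; rewrite bump_eq0.
Qed.

Lemma bump_smooth_class (V : normedModType R) (l L : V -> R) n a b :
  continuous l -> (forall h v x, l (h *: v + x) = l x + h * L v) ->
  smooth_class (fun x : V => bump n a b (l x)).
Proof.
move=> cl hl; apply: sc_mul.
- apply: (@sc_flat _ _ 1 (fun x => n.+1%:R * (l x - a)) (fun x => n.+1%:R * L x)).
    by move=> x; apply: cvgM; [exact: cvg_cst|]; apply: cvgB; [exact: cl|exact: cvg_cst].
  by move=> h v x; rewrite hl; ring.
- apply: (@sc_flat _ _ 1 (fun x => n.+1%:R * (b - l x)) (fun x => - (n.+1%:R * L x))).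
    by move=> x; apply: cvgM; [exact: cvg_cst|]; apply: cvgB; [exact: cvg_cst|exact: cl].
  by move=> h v x; rewrite hl; ring.
Qed.

Lemma bump_continuous n a b : continuous (bump n a b).
Proof.
apply: (@smooth_class_continuous R R^o); apply: (@bump_smooth_class R^o id id).
  by move=> x; exact: cvg_id.
by move=> h v x; exact: (addrC (h * v : R) x).
Qed.

Lemma bump_measurable n a b : measurable_fun setT (bump n a b).
Proof. exact: continuous_measurable_fun (@bump_continuous n a b). Qed.

End bump.

Section fundamental_lemma.
Context d (T : measurableType d) (R : realType) (mu : {measure set T -> \bar R}).

(* The sets A with vanishing integral over A `&` B form a Dynkin class. *)
Lemma integral_zero_ae (G : set (set T)) (B : set T) (k : T -> R) :
  d.-measurable = <<s G >> -> setI_closed G -> d.-measurable B ->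
  mu.-integrable B (EFin \o k) ->
  (forall A, G A -> (\int[mu]_(x in A `&` B) (k x)%:E = 0)%E) ->
  (\int[mu]_(x in B) (k x)%:E = 0)%E ->
  {ae mu, forall x, B x -> k x = 0}.
Proof.
move=> mG GI mB ik kA kB.
have mk : measurable_fun B (EFin \o k) := measurable_int mu ik.
pose H := [set A | d.-measurable A /\ (\int[mu]_(x in A `&` B) (k x)%:E = 0)%E].
have dH : dynkin H.
  split.
  - by split=> //; rewrite setTI.
  - move=> A [mA A0]; split; first exact: measurableC.
    have mAB : d.-measurable (A `&` B) by exact: measurableI.
    have mCAB : d.-measurable (~` A `&` B) by apply: measurableI => //; exact: measurableC.
    have E : B = (A `&` B) `|` (~` A `&` B) by rewrite -setIUl setUv setTI.
    have := kB; rewrite {1}E integral_setU// -?E//; last first.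
      by rewrite disj_set2E; apply/eqP; rewrite setIACA setICr set0I.
    by rewrite A0 add0e.
  - move=> F tF HF; split; first by apply: bigcup_measurable => n _; exact: (HF n).1.
    rewrite setI_bigcupl integral_bigcup//.
    + by rewrite eseries0// => i _ _; exact: (HF i).2.
    + by move=> i j _ _ [x [[? _] [? _]]]; apply: tF => //; exists x.
    + by move=> n; apply: measurableI => //; exact: (HF n).1.
    + apply: integrableS ik => //; last by move=> x [n _ []].
      by apply: bigcup_measurable => n _; apply: measurableI => //; exact: (HF n).1.
have sub : d.-measurable `<=` H.
  rewrite mG -(setI_closed_g_dynkin_g_sigma_algebra GI); apply: smallest_sub => //.
  by move=> A GA; split; [rewrite mG; exact: sub_sigma_algebra|exact: kA].
have : ae_eq mu B (EFin \o k) (cst 0%E).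
  apply: integral_ae_eq => // E EB mE; rewrite integral0.
  by have [_] := sub E mE; rewrite setIidl.
by apply: filterS => x h /h /= [].
Qed.

(** Dominated convergence with majorant |k| turns smooth test functions into indicators. *)
Lemma integral_bump_limit (A : set T) (k : T -> R) (phi : nat -> T -> R) :
  d.-measurable A -> mu.-integrable setT (EFin \o k) ->
  (forall n, measurable_fun setT (phi n)) -> (forall n x, 0 <= phi n x <= 1) ->
  (forall x, phi n x @[n --> \oo] --> (\1_A x : R)) ->
  (forall n, \int[mu]_x (k x * phi n x) = 0) ->
  (\int[mu]_(x in A) (k x)%:E = 0)%E.
Proof.
move=> mA ik mphi phi01 phic k0.
have mk := measurable_int mu ik; have mk' : measurable_fun setT k by exact/measurable_EFinP.
have ikp n : mu.-integrable setT (EFin \o (fun x => k x * phi n x)).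
  apply: le_integrable ik => //; first by apply/measurable_EFinP; exact: measurable_funM.
  move=> x _ /=; rewrite lee_fin normrM; have /andP[p0 p1] := phi01 n x.
  by rewrite (ger0_norm p0) ler_piMr.
have E n : (\int[mu]_x (k x * phi n x)%:E = 0)%E.
  rewrite -[LHS]fineK; last exact: integrable_fin_num (ikp n).
  by congr EFin; exact: k0.
have mkA : measurable_fun setT (fun x => (k x * \1_A x)%:E).
  by apply/measurable_EFinP; apply: measurable_funM => //; exact: measurable_indic.
have [|||_ _] := @dominated_convergence _ _ _ mu _ measurableT
  (fun n x => (k x * phi n x)%:E) (fun x => (k x * \1_A x)%:E) (fun x => `|k x|%:E)
  (fun n => measurable_int mu (ikp n)) mkA.
- apply: aeW => x _; apply: cvg_EFin; first by apply: nearW.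
  by apply: cvgM; [exact: cvg_cst|exact: phic].
- exact: integrable_norm ik.
- apply: aeW => x n _ /=; rewrite lee_fin normrM; have /andP[p0 p1] := phi01 n x.
  by rewrite (ger0_norm p0) ler_piMr.
rewrite (_ : [sequence _]_n = cst 0%E); last by apply/funext => n; exact: E.
have -> : (\int[mu]_(x in A) (k x)%:E = \int[mu]_x (k x * \1_A x)%:E)%E.
  rewrite integral_mkcond; apply: eq_integral => x _.
  by rewrite patchE indicE; case: ifP => _ /=; rewrite ?mulr1 ?mulr0.
by move=> /cvg_lim; rewrite lim_cst// => /(_ (@ereal_hausdorff _)) <-.
Qed.

End fundamental_lemma.

Section boxes.
Context (R : realType) (n : nat).
Implicit Types (a b : 'I_n -> R) (x : 'rV[R]_n) (Omega : set 'rV[R]_n).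

Definition box a b : set 'rV[R]_n := [set x | forall i, a i < x ord0 i < b i].
Definition cbox a b : set 'rV[R]_n := [set x | forall i, a i <= x ord0 i <= b i].
Definition boxes : set (set 'rV[R]_n) := [set A | exists a b, A = box a b].

Lemma boxI a b a' b' : box a b `&` box a' b' =
  box (fun i => Num.max (a i) (a' i)) (fun i => Num.min (b i) (b' i)).
Proof.
apply/seteqP; split => x.
  move=> [h h'] i; have /andP[? ?] := h i; have /andP[? ?] := h' i.
  by rewrite gt_max lt_min; apply/andP; split; apply/andP.
move=> h; split=> i; have := h i; rewrite gt_max lt_min.
  by move=> /andP[/andP[-> _] /andP[-> _]].
by move=> /andP[/andP[_ ->] /andP[_ ->]].
Qed.

Lemma boxes_setI_closed : setI_closed boxes.
Proof. by move=> _ _ [a [b ->]] [a' [b' ->]]; rewrite boxI; eexists; eexists. Qed.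

Lemma measurable_box a b : measurable (box a b).
Proof.
have -> : box a b = \bigcap_(i in [set: 'I_n]) (row_coord i @^-1` `]a i, b i[).
  apply/seteqP; split=> x h i; first by move=> _ /=; rewrite in_itv/=; exact: h.
  by have := h i Logic.I; rewrite /= in_itv.
apply: fin_bigcap_measurable => [|i _]; first exact: finite_finset.
by rewrite -[X in measurable X]setTI; exact: measurable_row_coord.
Qed.

(** A half-space in one coordinate is a countable union of boxes whose other sides grow. Boxes are
    stable under intersection, as the Dynkin argument of [integral_zero_ae] requires. *)
Lemma measurable_boxesE : (measurable : set (set 'rV[R]_n)) = <<s boxes >>.
Proof.
apply/seteqP; split; last first.
  apply: smallest_sub; first exact: sigma_algebra_measurable.
  by move=> _ [a [b ->]]; exact: measurable_box.
apply: smallest_sub; first exact: smallest_sigma_algebra.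
have key (i : 'I_n) : measurable_fun [set: g_sigma_algebraType boxes]
    (row_coord i : g_sigma_algebraType boxes -> measurableTypeR R).
  apply: (@measurability _ _ _ _ _ _ (@RGenOInfty.G R)); first exact: RGenOInfty.measurableE.
  move=> _ [_ [r ->] <-]; rewrite setTI.
  have -> : row_coord i @^-1` `]r, +oo[ = \bigcup_N
      box (fun j => if j == i then r else - N%:R) (fun=> N%:R).
    apply/seteqP; split => [x|x [N _ /(_ i)]]; last first.
      by rewrite /= in_itv/= eqxx andbT => /andP[].
    rewrite /= in_itv/= andbT => rx.
    pose S := \sum_j `|x ord0 j|.
    have xS j : `|x ord0 j| <= S by rewrite /S (bigD1 j)//= lerDl sumr_ge0.
    exists (Num.bound S) => // j; have := xS j.
    have := @archi_boundP _ S (sumr_ge0 _ (fun _ _ => normr_ge0 _)).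
    rewrite ler_norml => SN /andP[h1 h2].
    case: eqP => [->|_]; last by apply/andP; split; lra.
    apply/andP; split; first exact: rx.
    have := xS i; rewrite ler_norml => /andP[_ h3]; lra.
  apply: bigcupT_measurable => N; apply: sub_sigma_algebra.
  by eexists; eexists.
rewrite -bigcup_seq => A [i _ [B mB <-]].
exact: (key i measurableT B mB).
Qed.

Definition box_bump (k : nat) a b x : R := \prod_i bump k (a i) (b i) (x ord0 i).

Lemma box_bump_bounds k a b x : 0 <= box_bump k a b x <= 1.
Proof.
rewrite /box_bump; elim/big_ind : _ => [|u w /andP[? ?] /andP[? ?]|i _].
- by rewrite ler01 lexx.
- by rewrite mulr_ge0//= mulr_ile1.
- exact: bump_bounds.
Qed.

Lemma box_bump_neq0 k a b x : (box_bump k a b x != 0) <-> box a b x.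
Proof.
rewrite /box_bump prodf_seq_neq0; split => [/allP h i|h].
  by have := h i (mem_index_enum i); rewrite bump_eq0.
by apply/allP => i _; rewrite bump_eq0; exact: h.
Qed.

Lemma cvg_prod_ord I (s : seq I) (f : nat -> I -> R) (l : I -> R) :
  (forall i, f k i @[k --> \oo] --> l i) ->
  \prod_(i <- s) f k i @[k --> \oo] --> \prod_(i <- s) l i.
Proof.
move=> h; elim: s => [|i s IH].
  rewrite big_nil (_ : (fun _ => _) = cst 1); first exact: cvg_cst.
  by apply/funext => k; rewrite big_nil.
rewrite big_cons (_ : (fun _ => _) = (fun k => f k i * \prod_(j <- s) f k j)).
  by apply: cvgM.
by apply/funext => k; rewrite big_cons.
Qed.

Lemma box_bump_cvg a b x : box_bump k a b x @[k --> \oo] --> (\1_(box a b) x : R).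
Proof.
have -> : (\1_(box a b) x : R) = \prod_i (\1_[set y | a i < y < b i] (x ord0 i)).
  rewrite indicE; have [xb|xb] := pselect (box a b x).
    rewrite mem_set// big1// => i _; rewrite indicE mem_set//; exact: xb.
  rewrite memNset//; have [i hi] : exists i, ~~ (a i < x ord0 i < b i).
    by apply/existsP; rewrite -negb_forall; apply/negP => /forallP h; apply: xb => i; exact: h.
  by rewrite (bigD1 i)//= indicE memNset ?mul0r//; exact/negP.
by apply: cvg_prod_ord => i; exact: bump_cvg.
Qed.

Lemma box_bump_measurable k a b : measurable_fun setT (box_bump k a b).
Proof.
apply: measurable_prod => i _; apply: measurableT_comp; first exact: bump_measurable.
exact: measurable_row_coord.
Qed.

Lemma closed_cbox a b : closed (cbox a b).
Proof.
have -> : cbox a b = \bigcap_i ((fun x : 'rV[R]_n => x ord0 i) @^-1` `[a i, b i]).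
  apply/seteqP; split=> x h i; first by move=> _ /=; rewrite in_itv/=; exact: h.
  by have := h i Logic.I; rewrite /= in_itv.
apply: closed_bigI => i _; apply: closed_comp; last exact: itv_closed.
by move=> x _; exact: coord_continuous.
Qed.

Lemma compact_cbox a b : compact (cbox a b).
Proof.
have -> : cbox a b = [set v | forall i, `[a i, b i]%classic (v ord0 i)].
  by apply/seteqP; split=> x h i; have := h i; rewrite /= in_itv.
exact: (@rV_compact R n (fun i => `[a i, b i]%classic) (fun i => @segment_compact R (a i) (b i))).
Qed.

Lemma box_bump_test Omega k a b : cbox a b `<=` Omega -> test_fun Omega (box_bump k a b).
Proof.
move=> cO; have cl : closure [set x | box_bump k a b x != 0] `<=` cbox a b.
  rewrite [X in _ `<=` X](closure_id _).1; last exact: closed_cbox.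
  apply: closure_subset => x /= /box_bump_neq0 h i; have /andP[? ?] := h i.
  by rewrite !ltW.
split.
- apply: smooth_class_smooth; apply: smooth_class_prod => i.
  apply: (@bump_smooth_class _ _ (fun x : 'rV[R]_n => x ord0 i) (fun x => x ord0 i)).
    exact: coord_continuous.
  by move=> h v x; rewrite !mxE addrC.
- apply: (subclosed_compact _ (@compact_cbox a b) cl); exact: closed_closure.
- exact: subset_trans cl cO.
Qed.

(** Bumps on a box whose closed version lies in the open set are test functions, so the function
    vanishes almost everywhere on that box; countably many boxes with rational corners cover the
    set. *)
Lemma test_fun_ae0 Omega (k : 'rV[R]_n -> R) : open Omega ->
  int_on (lebesgue_row R n) Omega k ->
  (forall phi, test_fun Omega phi -> \int[lebesgue_row R n]_(x in Omega) (k x * phi x) = 0) ->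
  {ae lebesgue_row R n, forall x, Omega x -> k x = 0}.
Proof.
move=> oO ik k0; set mu := lebesgue_row R n in ik k0 *.
set K := k \_ Omega.
have Kbox a b : cbox a b `<=` Omega -> (\int[mu]_(x in box a b) (K x)%:E = 0)%E.
  move=> cO; apply: (integral_bump_limit (phi := fun m => box_bump m a b)) => //.
  - exact: measurable_box.
  - by move=> m; exact: box_bump_measurable.
  - by move=> m x; exact: box_bump_bounds.
  - by move=> x; exact: box_bump_cvg.
  - move=> m; rewrite -[RHS](k0 _ (box_bump_test m cO)) [RHS]Rintegral_mkcond.
    apply: eq_Rintegral => x _; rewrite /K; have [Ox|Ox] := pselect (Omega x).
      by rewrite !patch1.
    by rewrite !patch0// mul0r.
have Kae a b : cbox a b `<=` Omega -> {ae mu, forall x, box a b x -> K x = 0}.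
  move=> cO; apply: (integral_zero_ae measurable_boxesE boxes_setI_closed).
  - exact: measurable_box.
  - by apply: integrableS ik => //; exact: measurable_box.
  - move=> _ [a' [b' ->]]; rewrite boxI; apply: Kbox => x h; apply: cO => i.
    have := h i; rewrite ge_max le_min => /andP[/andP[_ ->] /andP[_ ->]] //.
  - exact: Kbox.
pose ra (f : {ffun 'I_n -> rat * rat}) i : R := ratr (f i).1.
pose rb (f : {ffun 'I_n -> rat * rat}) i : R := ratr (f i).2.
have cover x : Omega x -> exists f, cbox (ra f) (rb f) `<=` Omega /\ box (ra f) (rb f) x.
  move=> Ox; have /nbhs_ballP[e /= e0 he] : nbhs x Omega by move: oO; rewrite openE; apply.
  have ex i : exists q : rat * rat,
      [/\ x ord0 i - e < ratr q.1, (ratr q.1 : R) < x ord0 i,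
          x ord0 i < ratr q.2 & (ratr q.2 : R) < x ord0 i + e].
    have [|q1] := @rat_in_itvoo R (x ord0 i - e) (x ord0 i); first by rewrite ltrBlDr ltrDl.
    have [|q2] := @rat_in_itvoo R (x ord0 i) (x ord0 i + e); first by rewrite ltrDl.
    by rewrite !in_itv/= => /andP[? ?] /andP[? ?]; exists (q1, q2).
  have [F HF] := choice ex; exists [ffun i => F i]; split.
    move=> y hy; apply: he; split=> // j i; rewrite (ord1 j) /ball/=.
    have := hy i; rewrite /ra /rb ffunE; have [? ? ? ?] := HF i => /andP[? ?].
    by rewrite ltr_norml; apply/andP; split; lra.
  by move=> i; rewrite /ra /rb ffunE; have [_ -> -> _] := HF i.
have : {ae mu, forall x m f, unpickle m = Some f -> cbox (ra f) (rb f) `<=` Omega ->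
    box (ra f) (rb f) x -> K x = 0}.
  apply/ae_foralln => m; case E : (unpickle m) => [f|]; last by apply: aeW.
  have [cO|ncO] := pselect (cbox (ra f) (rb f) `<=` Omega); last first.
    by apply: aeW => x g [<-].
  by apply: filterS (Kae _ _ cO) => x h g [<-] _; exact: h.
apply: filterS => x h Ox; have [f [cO bx]] := cover x Ox.
by have := h (pickle f) f (pickleK f) cO bx; rewrite /K patch1.
Qed.

End boxes.

(** * Weak derivatives in time *)

#[global] Instance ae_lebesgue_filter (R : realType) :
  Filter (almost_everywhere (@lebesgue_measure R)).
Proof. exact: (@ae_filter_ringOfSetsType _ (measurableTypeR R)). Qed.

Section time.
Context (R : realType) (T : R).
Local Notation leb := (@lebesgue_measure R).
Local Notation I := (`]0, T[%classic : set R).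
Implicit Types (f g q k phi : R -> R) (a b s t : R).

Lemma bump_integrable n a b : leb.-integrable setT (EFin \o bump n a b).
Proof.
have := @integrable_indic_itv R a b true false.
apply: le_integrable => //; first by apply/measurable_EFinP; exact: bump_measurable.
move=> x _ /=; rewrite lee_fin; have /andP[b0 b1] := bump_bounds n a b x.
rewrite ger0_norm// ger0_norm; last by rewrite indicE.
rewrite indicE; have [xab|xab] := boolP (a < x < b).
  by rewrite mem_set//= in_itv/=; case/andP: xab => /ltW -> /ltW ->.
by have := bump_eq0 n a b x; rewrite (negbTE xab) => /negbFE/eqP ->.
Qed.

Lemma bump_ae0 k : leb.-integrable I (EFin \o k) ->
  (forall n a b, 0 < a -> a < b -> b < T -> \int[leb]_(t in I) (k t * bump n a b t) = 0) ->
  {ae leb, forall t, I t -> k t = 0}.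
Proof.
move=> ik k0; set K := k \_ I.
have iK : leb.-integrable setT (EFin \o K).
  by rewrite -restrict_EFin; apply/integrable_restrict => //; rewrite setTI.
have Kab a b : 0 < a -> b < T -> (\int[leb]_(x in `]a, b[) (K x)%:E = 0)%E.
  move=> a0 bT; have [ab|ba] := ltP a b; last first.
    by rewrite set_itv_ge ?integral_set0// bnd_simp -leNgt.
  apply: (@integral_bump_limit _ (measurableTypeR R) R leb `]a, b[%classic K (fun n => bump n a b)) => //.
  - by move=> n; exact: bump_measurable.
  - by move=> n x; exact: bump_bounds.
  - move=> x; rewrite (_ : `]a, b[%classic = [set y | a < y < b]); first exact: bump_cvg.
    by apply/seteqP; split=> y /=; rewrite in_itv.
  - move=> n; rewrite -[RHS](k0 n a b a0 ab bT) [RHS]Rintegral_mkcond.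
    apply: eq_Rintegral => x _; rewrite /K; have [Ix|Ix] := pselect (I x).
      by rewrite !patch1.
    by rewrite !patch0// mul0r.
have Kae a b : 0 < a -> b < T -> {ae leb, forall x, `]a, b[%classic x -> K x = 0}.
  move=> a0 bT; apply: (@integral_zero_ae _ (measurableTypeR R) R leb (@RGenOpens.G R) `]a, b[%classic K).
  - exact: RGenOpens.measurableE.
  - move=> _ _ [x [y ->]] [x' [y' ->]]; exists (Num.max x x'), (Num.min y y').
    apply/seteqP; split=> z /=; rewrite !in_itv/= gt_max lt_min.
      by move=> [/andP[-> ->] /andP[-> ->]].
    by move=> /andP[/andP[-> ->] /andP[-> ->]].
  - by [].
  - by apply: integrableS iK.
  - move=> _ [x [y ->]].
    rewrite (_ : _ `&` _ = `]Num.max x a, Num.min y b[%classic).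
      by apply: Kab; rewrite ?lt_max ?gt_min ?a0 ?bT ?orbT.
    apply/seteqP; split=> z /=; rewrite !in_itv/= gt_max lt_min.
      by move=> [/andP[-> ->] /andP[-> ->]].
    by move=> /andP[/andP[-> ->] /andP[-> ->]].
  - exact: Kab.
have : {ae leb, forall x n, `](n.+1%:R^-1), (T - n.+1%:R^-1)[%classic x -> K x = 0}.
  apply/ae_foralln => n; apply: Kae => //.
  by rewrite ltrBlDr ltrDl.
apply: filterS => x h /[dup] Ix; rewrite /= in_itv/= => /andP[x0 xT].
have m0 : 0 < Num.min x (T - x) by rewrite lt_min x0 subr_gt0.
have [n hn] : exists n : nat, n.+1%:R^-1 < Num.min x (T - x).
  exists (Num.bound (Num.min x (T - x))^-1); rewrite invf_plt ?posrE//.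
  apply: lt_trans (archi_boundP _) _; first by rewrite invr_ge0 ltW.
  by rewrite ltr_nat.
rewrite -(patch1 k Ix); apply: (h n); rewrite /= in_itv/=.
by move: hn; rewrite lt_min => /andP[-> ?]/=; rewrite ltrBrDr addrC -ltrBrDr.
Qed.

(** Otherwise all the bumps would integrate to 0, and so would their limit, the indicator of the
    interval. *)
Lemma bump_integral_neq0 a b : a < b -> exists n, \int[leb]_t bump n a b t != 0.
Proof.
move=> ab; apply: contrapT => h.
have : (\int[leb]_(x in `]a, b[) ((\1_`]a, b[ x : R))%:E = 0)%E.
  apply: (@integral_bump_limit _ (measurableTypeR R) R leb `]a, b[%classic (\1_`]a, b[) (fun n => bump n a b)) => //.
  - exact: integrable_indic_itv.
  - by move=> n; exact: bump_measurable.
  - by move=> n x; exact: bump_bounds.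
  - move=> x; rewrite (_ : `]a, b[%classic = [set y | a < y < b]); first exact: bump_cvg.
    by apply/seteqP; split=> y /=; rewrite in_itv.
  - move=> n; transitivity (\int[leb]_t bump n a b t); last first.
      by apply/eqP; apply: contrapT => /negP ne; apply: h; exists n.
    apply: eq_Rintegral => x _; rewrite indicE.
    have [xab|xab] := boolP (a < x < b).
      by rewrite mem_set ?mul1r//= in_itv.
    have := bump_eq0 n a b x; rewrite (negbTE xab) => /negbFE/eqP ->.
    by rewrite mulr0.
rewrite integral_indic// setIid => e.
have := @lebesgue_measure_itv R `]a, b[; rewrite e/= lte_fin ab => /esym/eqP.
by rewrite -EFinB eqe subr_eq0 (gt_eqF ab).
Qed.

Definition tail_integral q s := \int[leb]_(t in `[s, +oo[) q t.

Definition head_integral g t := \int[leb]_(s in `]-oo, t]) g s.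

(** Integration by parts for integrable functions: Fubini on the triangle s <= t. *)
Lemma fubini_primitive g q : leb.-integrable setT (EFin \o g) -> leb.-integrable setT (EFin \o q) ->
  \int[leb]_t (head_integral g t * q t) = \int[leb]_s (g s * tail_integral q s).
Proof.
move=> ig iq.
have mg : measurable_fun setT g by apply/measurable_EFinP; exact: measurable_int ig.
have mq : measurable_fun setT q by apply/measurable_EFinP; exact: measurable_int iq.
pose J (z : R * R) : R := \1_[set z : R * R | z.1 <= z.2] z.
have mJ : measurable_fun setT (J : measurableTypeR R * measurableTypeR R -> R).
  apply: measurable_indic.
  have := @measurable_fun_ler _ _ _ setT (fst : measurableTypeR R * measurableTypeR R -> R) snd
    measurable_fst measurable_snd measurableT [set true] Logic.I.
  by rewrite setTI; congr measurable; apply/seteqP; split=> z /=.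
pose F (z : R * R) : \bar R := (g z.1 * J z * q z.2)%:E.
have mF : measurable_fun setT (F : measurableTypeR R * measurableTypeR R -> \bar R).
  apply/measurable_EFinP; apply: measurable_funM; first apply: measurable_funM => //.
  - exact: measurableT_comp mg measurable_fst.
  - exact: measurableT_comp mq measurable_snd.
have J01 z : 0 <= J z <= 1 by rewrite /J indicE; case: (_ \in _); rewrite /= ?lexx ?ler01.
have FJ s t : `|g s * J (s, t) * q t| <= `|g s| * `|q t|.
  have /andP[j0 j1] := J01 (s, t); rewrite !normrM (ger0_norm j0).
  by rewrite -mulrA ler_wpM2l// ler_piMl.
have iF : (leb \x leb)%E.-integrable setT F.
  apply/integrable12ltyP => //.
  apply: (@le_lt_trans _ _ (\int[leb]_s (`|g s|%:E * \int[leb]_t `|q t|%:E))%E).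
    apply: ge0_le_integral_nonmeas => s _; first by apply: integral_ge0 => t _; exact: abse_ge0.
    rewrite -ge0_integralZl_EFin//; last by apply/measurable_EFinP; exact: measurableT_comp.
    apply: ge0_le_integral_nonmeas => t _; first exact: abse_ge0.
    by rewrite /F/= lee_fin FJ.
  have /integrableP[_ qoo] := iq; have /integrableP[_ goo] := ig.
  rewrite ge0_integralZr//; last 2 first.
    by apply/measurable_EFinP; exact: measurableT_comp.
    by apply: integral_ge0.
  by rewrite lte_mul_pinfty// ?integral_ge0// ge0_fin_numE ?integral_ge0.
have E1 t : (\int[leb]_s F (s, t) = (head_integral g t * q t)%:E)%E.
  have ih : leb.-integrable `]-oo, t] (EFin \o g) by exact: integrableS ig.
  rewrite EFinM /head_integral /Rintegral fineK; last exact: integrable_fin_num ih.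
  rewrite integral_mkcond -integralZr//; last by rewrite -integrable_mkcond.
  apply: eq_integral => s _; rewrite /F/= patchE /J indicE.
  case: ifPn => h; first by rewrite mem_set ?mulr1//=; move: h; rewrite inE/= in_itv.
  by rewrite memNset ?mulr0 ?mul0r ?mul0e//= => st; move/negP: h; apply; rewrite inE/= in_itv.
have E2 s : (\int[leb]_t F (s, t) = (g s * tail_integral q s)%:E)%E.
  have ih : leb.-integrable `[s, +oo[ (EFin \o q) by exact: integrableS iq.
  rewrite EFinM /tail_integral /Rintegral fineK; last exact: integrable_fin_num ih.
  rewrite integral_mkcond -integralZl//; last by rewrite -integrable_mkcond.
  apply: eq_integral => t _; rewrite /F/= patchE /J indicE.
  case: ifPn => h; first by rewrite mem_set ?mulr1//=; move: h; rewrite inE/= in_itv/= andbT.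
  by rewrite memNset ?mulr0 ?mul0r ?mule0//= => st; move/negP: h; apply; rewrite inE/= in_itv/= andbT.
rewrite /Rintegral; congr fine.
under eq_integral do rewrite -E1; under [RHS]eq_integral do rewrite -E2.
by symmetry; exact: (Fubini iF).
Qed.

(** The primitive vanishes to the left of [a] by the support of [g], and to the right of [b] because
    [g] has mean zero. This produces test functions with a prescribed derivative. *)
Lemma head_integral_test g a b : smooth_class (g : R^o -> R^o) ->
  leb.-integrable setT (EFin \o g) -> 0 < a -> b < T ->
  (forall x, g x != 0 -> a <= x <= b) -> \int[leb]_x g x = 0 ->
  test_fun I (head_integral g : R^o -> R^o) /\
  derive1 (head_integral g : R^o -> R^o) = g.
Proof.
move=> sg ig a0 bT gab g0; set phi := head_integral g.
have dphi x : derivable (phi : R^o -> R^o) x 1 /\ derive1 (phi : R^o -> R^o) x = g x.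
  apply: (@continuous_FTC1 _ g -oo%O x (x + 1)).
  - by rewrite ltrDl.
  - exact: integrableS ig.
  - exact: ltNyr.
  - by have := @smooth_class_continuous _ _ _ sg; apply.
have isd x : is_derive (x : R^o) (1 : R^o) (phi : R^o -> R^o) (g x).
  by have [d <-] := dphi x; rewrite derive1E; exact: derivableP.
have dv x v : is_derive x v (phi : R^o -> R^o) (v * g x).
  apply: is_derive1P.
  have i1 : is_derive (0 : R) (1 : R) (fun h : R => v * h + x) v.
    have j1 : is_derive (0 : R) (1 : R) (fun h : R => v *: h) (v *: 1) by exact: is_deriveZ.
    apply: (is_derive_eq (is_deriveD j1 (is_derive_cst x (0 : R) (1 : R)))).
    by rewrite addr0 /GRing.scale/= mulr1.
  have := @is_derive1_comp _ (phi : R^o -> R^o) (fun h : R => v * h + x) 0 _ _ (isd (v * 0 + x)) i1.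
  rewrite mulr0 add0r mulrC; congr (is_derive _ _ _ _).
  by apply/funext => h /=; rewrite mulrC.
have phi0 x : x < a -> phi x = 0.
  move=> xa; rewrite /phi /head_integral /Rintegral integral0_eq// => s /=.
  rewrite in_itv/= => sx; congr EFin; apply/eqP; apply: contraT => /gab/andP[? _]; lra.
have phi1 x : b < x -> phi x = 0.
  move=> bx; rewrite -[RHS]g0 /phi /head_integral Rintegral_mkcond.
  apply: eq_Rintegral => s _; rewrite patchE; case: ifPn => // h.
  symmetry; apply/eqP; apply: contraT => /gab/andP[_ sb]; move/negP: h => []; rewrite inE/= in_itv/=; lra.
have cl : closure [set x | phi x != 0] `<=` `[a, b]%classic.
  rewrite [X in _ `<=` X](closure_id _).1; last exact: itv_closed.
  apply: closure_subset => x /= h; rewrite in_itv/=.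
  by apply/andP; split; rewrite leNgt; apply: contra h; [move/phi0 => ->|move/phi1 => ->].
split; last by apply/funext => x; have [] := dphi x.
split.
- apply: smoothP.
  + move=> x; apply/differentiable_continuous/derivable1_diffP.
    by have [] := dphi x.
  + by move=> x v; have [] := dv x v.
  + move=> v; rewrite (_ : 'D_v _ = (fun x : R^o => cst v x * g x : R^o)).
      by apply: smooth_class_smooth; apply: sc_mul => //; exact: sc_cst.
    by apply/funext => x; have [_ ->] := dv x v.
- by apply: (subclosed_compact _ (@segment_compact R a b) cl); exact: closed_closure.
- apply: (subset_trans cl) => x /=; rewrite !in_itv/= => /andP[? ?].
  by apply/andP; split; lra.
Qed.

Lemma integrable_mulr_bounded g k (B : R) : leb.-integrable setT (EFin \o g) ->
  measurable_fun setT k -> (forall x, `|k x| <= B) ->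
  leb.-integrable setT (EFin \o (fun x => g x * k x)).
Proof.
move=> ig mk kB; have mg : measurable_fun setT g by apply/measurable_EFinP; exact: measurable_int ig.
have := @integrableZl _ (measurableTypeR R) R leb setT measurableT B _ ig.
apply: le_integrable => //.
  by apply/measurable_EFinP; exact: measurable_funM.
move=> x _ /=; rewrite lee_fin !normrM mulrC ler_wpM2r//.
exact: le_trans (kB x) (ler_norm B).
Qed.

Lemma itv_bounded_integrable k (B : R) : measurable_fun setT k -> (forall x, `|k x| <= B) ->
  leb.-integrable I (EFin \o k).
Proof.
move=> mk kB; apply: (@measurable_bounded_integrable _ (measurableTypeR R) R leb) => //.
- apply: (@le_lt_trans _ _ (leb I)) => //; have := @lebesgue_measure_itv R `]0, T[ => ->/=.
  by case: ifP => _; rewrite ltry.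
- exact: measurable_funTS.
- by exists B; split; rewrite ?num_real// => r Br x _ /=; apply: le_trans (kB x) (ltW Br).
Qed.

(** The lemma of du Bois-Reymond. Testing with primitives of mean-zero functions shows that [K], the
    difference of [f] and the primitive of [q], is orthogonal to these functions. Hence [K - C],
    with [C] the mean of [K] weighted by a fixed bump [psi0], is orthogonal to every bump. *)
Lemma weak_derivative_primitive f q : 0 < T ->
  leb.-integrable setT (EFin \o f) -> leb.-integrable setT (EFin \o q) ->
  (forall t, ~ I t -> f t = 0 /\ q t = 0) ->
  (forall phi, test_fun I (phi : R^o -> R^o) ->
     \int[leb]_t (derive1 (phi : R^o -> R^o) t * f t) = - \int[leb]_t (phi t * q t)) ->
  exists C, {ae leb, forall t, I t -> f t = C + \int[leb]_(s in `[0, t]) q s}.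
Proof.
move=> T0 jf jq fq0 weak.
have mq : measurable_fun setT q by apply/measurable_EFinP; exact: measurable_int jq.
have mf : measurable_fun setT f by apply/measurable_EFinP; exact: measurable_int jf.
have itail s : leb.-integrable `[s, +oo[ (EFin \o q) by exact: integrableS jq.
pose Q t := \int[leb]_(s in `[0, t]) q s.
pose S := \int[leb]_s q s.
have tailE t : I t -> tail_integral q t = S - Q t.
  rewrite /= in_itv/= => /andP[t0 tT].
  have -> : Q t = \int[leb]_(s in `]-oo, t[) q s.
    rewrite Rintegral_itv_bndo_bndc; last exact: integrableS jq.
    rewrite /Q Rintegral_mkcond [RHS]Rintegral_mkcond; apply: eq_Rintegral => s _.
    rewrite !patchE !mem_setE !in_itv/=; case: (leP 0 s) => //= s0.
    have [|_ ->] := fq0 s; last by case: ifP.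
    by rewrite /= in_itv/= => /andP[? _]; lra.
  have hU : [set: R] = `]-oo, t[ `|` `[t, +oo[.
    by apply/seteqP; split=> // s _ /=; rewrite !in_itv/= andbT; case: (ltP s t); [left|right].
  rewrite /S hU Rintegral_setU//; [by rewrite addrAC subrr add0r|by rewrite -hU|].
  apply/disj_set2P; rewrite -subset0 => s /= [].
  by rewrite !in_itv/= andbT => ? ?; lra.
have [n0 c0N] : exists n, \int[leb]_t bump n (T / 3) (T - T / 3) t != 0.
  by apply: bump_integral_neq0; lra.
set psi0 := bump n0 (T / 3) (T - T / 3); set c0 := \int[leb]_t _ in c0N.
have mQ : measurable_fun I (Q : R -> R).
  apply: (@measurable_funS _ _ (measurableTypeR R) (measurableTypeR R) `[0, T]%classic) => //.
    by apply: subset_itv; rewrite bnd_simp.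
  apply: subspace_continuous_measurable_fun => //.
  apply: parameterized_integral_continuous; first exact: ltW.
  exact: integrableS jq.
pose QI := Q \_ I.
have mQI : measurable_fun setT QI.
  exact: (@measurable_restrictT _ _ (measurableTypeR R) (measurableTypeR R) I Q (measurable_itv _)).1 mQ.
pose B := \int[leb]_s `|q s|.
have QB x : `|QI x| <= B.
  rewrite /QI; have [Ix|Ix] := pselect (I x); last first.
    by rewrite patch0// normr0; apply: Rintegral_ge0.
  rewrite patch1//; apply: (le_trans (le_normr_Rintegral _ _)) => //.
    exact: integrableS jq.
  rewrite /B Rintegral_mkcond; apply: le_Rintegral => //.
  - by rewrite -restrict_EFin; apply/integrable_restrict => //; rewrite setTI; apply: integrableS (integrable_norm jq).
  - exact: integrable_norm jq.
  - by move=> y _; rewrite patchE; case: ifP => _; [exact: lexx|exact: normr_ge0].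
pose K x := f x - QI x.
have bb n a b x : `|bump n a b x| <= 1.
  by have /andP[x0 x1] := bump_bounds n a b x; rewrite ger0_norm.
have jQ n a b : leb.-integrable setT (EFin \o (fun x => bump n a b x * QI x)).
  by apply: (integrable_mulr_bounded _ _ QB) => //; exact: bump_integrable.
have jF n a b : leb.-integrable setT (EFin \o (fun x => bump n a b x * f x)).
  rewrite (_ : (fun x => _) = fun x => f x * bump n a b x); last by apply/funext => x; rewrite mulrC.
  by apply: (integrable_mulr_bounded _ _ (bb n a b)) => //; exact: bump_measurable.
have jK n a b : leb.-integrable setT (EFin \o (fun x => bump n a b x * K x)).
  rewrite (_ : (fun x => _) = fun x => bump n a b x * f x - bump n a b x * QI x); last first.
    by apply/funext => x; rewrite mulrBr.
  by have := integrableB measurableT (jF n a b) (jQ n a b).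
pose C := (\int[leb]_t (psi0 t * K t)) / c0.
have key n a b : 0 < a -> a < b -> b < T ->
    \int[leb]_t (bump n a b t * K t) = C * \int[leb]_t bump n a b t.
  move=> a0 ab bT; set psi := bump n a b.
  pose lam := (\int[leb]_t psi t) / c0.
  pose g t := psi t + (- lam) * psi0 t.
  have ipsi : leb.-integrable setT (EFin \o psi) by exact: bump_integrable.
  have ipsi0 : leb.-integrable setT (EFin \o psi0) by exact: bump_integrable.
  have split k : leb.-integrable setT (EFin \o (fun x => psi x * k x)) ->
     leb.-integrable setT (EFin \o (fun x => psi0 x * k x)) ->
     leb.-integrable setT (EFin \o (fun x => g x * k x)) /\
     \int[leb]_t (g t * k t) = \int[leb]_t (psi t * k t) - lam * \int[leb]_t (psi0 t * k t).
    move=> i1 i2.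
    have i3 : leb.-integrable setT (EFin \o (fun x => (- lam) * (psi0 x * k x))).
      by have := @integrableZl _ (measurableTypeR R) R leb setT measurableT (- lam) _ i2.
    have gE : (fun x => g x * k x) = (fun x => psi x * k x + (- lam) * (psi0 x * k x)).
      by apply/funext => x; rewrite /g; ring.
    rewrite gE; split; first by have := integrableD measurableT i1 i3.
    by rewrite RintegralD// RintegralZl// mulNr.
  have [ig1 g1] : leb.-integrable setT (EFin \o (fun x => g x * 1)) /\ \int[leb]_t (g t * 1) = 0.
    have [] := split (fun=> 1).
    - by under [X in _.-integrable _ (_ \o X)]eq_fun do rewrite mulr1.
    - by under [X in _.-integrable _ (_ \o X)]eq_fun do rewrite mulr1.
    move=> ? ->; split=> //.
    under eq_Rintegral do rewrite mulr1; under [X in _ - _ * X]eq_Rintegral do rewrite mulr1.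
    by rewrite /lam divfK// subrr.
  have {}ig1 : leb.-integrable setT (EFin \o g).
    by move: ig1; under [X in _.-integrable _ (_ \o X)]eq_fun do rewrite mulr1.
  have {}g1 : \int[leb]_t g t = 0.
    by move: g1; under eq_Rintegral do rewrite mulr1.
  have gI x : g x != 0 -> Num.min a (T / 3) <= x <= Num.max b (T - T / 3).
    move=> gx; have : (psi x != 0) || (psi0 x != 0).
      rewrite -negb_and; apply: contra gx => /andP[/eqP p0 /eqP p1].
      by rewrite /g p0 p1 mulr0 addr0.
    rewrite !bump_eq0 ge_min le_max.
    by case/orP => /andP[/ltW -> /ltW ->]; rewrite ?orbT.
  have gI' x : g x != 0 -> I x.
    move=> /gI/andP[x0 x1]; rewrite /= in_itv/=; apply/andP; split.
      by apply: lt_le_trans x0; rewrite lt_min a0/=; lra.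
    by apply: le_lt_trans x1 _; rewrite gt_max bT/=; lra.
  have [tg dg] : test_fun I (head_integral g : R^o -> R^o) /\
      derive1 (head_integral g : R^o -> R^o) = g.
    apply: (head_integral_test _ _ _ _ gI) => //.
    - have sb n' a' b' : smooth_class (bump n' a' b' : R^o -> R^o).
        apply: (@bump_smooth_class R R^o id id); first by move=> x; exact: cvg_id.
        by move=> h v x; rewrite addrC.
      by apply: (sc_add (sb _ _ _)); apply: (sc_mul (sc_cst _ (- lam)) (sb _ _ _)).
    - by rewrite lt_min a0/=; lra.
    - by rewrite gt_max bT/=; lra.
  have := weak _ tg; rewrite dg fubini_primitive//.
  have [jgQ gQE] := split QI (jQ _ _ _) (jQ _ _ _).
  have [jgF gFE] := split f (jF _ _ _) (jF _ _ _).
  have [jgK gKE] := split K (jK _ _ _) (jK _ _ _).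
  (* The total mass [S] in the tail integral drops out because [g] has mean zero. *)
  have -> : \int[leb]_s (g s * tail_integral q s) = - \int[leb]_s (g s * QI s).
    transitivity (\int[leb]_s (S * g s - g s * QI s)).
      apply: eq_Rintegral => x _; have [->|gx] := eqVneq (g x) 0; first by rewrite !mul0r mulr0 subr0.
      by have Ix := gI' _ gx; rewrite (tailE _ Ix) /QI (patch1 _ Ix) mulrBr mulrC.
    rewrite RintegralB// ?RintegralZl// ?g1 ?mulr0 ?sub0r//.
    by have := @integrableZl _ (measurableTypeR R) R leb setT measurableT S _ ig1.
  rewrite opprK => gfQ.
  have gK0 : \int[leb]_t (g t * K t) = 0.
    rewrite (_ : (fun t => _) = fun t => g t * f t - g t * QI t); last first.
      by apply/funext => x; rewrite mulrBr.
    by rewrite RintegralB// gfQ subrr.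
  move/eqP: gKE; rewrite gK0 eq_sym subr_eq0 => /eqP ->.
  by rewrite /lam /C; move: (\int[leb]_t _) (\int[leb]_t _) c0^-1 => x y z; ring.
have jKC : leb.-integrable I (EFin \o (fun x => K x - C)).
  have j1 : leb.-integrable I (EFin \o f) by exact: integrableS jf.
  have j2 : leb.-integrable I (EFin \o QI) by apply: itv_bounded_integrable QB.
  have j3 : leb.-integrable I (EFin \o (fun=> C)).
    by apply: (@itv_bounded_integrable _ `|C|) => //; exact: measurable_cst.
  have j4 := @integrableB _ (measurableTypeR R) R leb I (measurable_itv _) _ _ j1 j2.
  by have := @integrableB _ (measurableTypeR R) R leb I (measurable_itv _) _ _ j4 j3.
have p : {ae leb, forall t, I t -> K t - C = 0}.
  apply: bump_ae0 => // n a b a0 ab bT.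
  transitivity (\int[leb]_t (bump n a b t * K t - C * bump n a b t)).
    rewrite Rintegral_mkcond; apply: eq_Rintegral => x _.
    have [Ix|Ix] := pselect (I x); first by rewrite patch1//; ring.
    rewrite patch0//; have [->|] := eqVneq (bump n a b x) 0; first by rewrite mul0r mulr0 subrr.
    rewrite bump_eq0 => /andP[ax xb]; case: Ix; rewrite /= in_itv/= (lt_trans a0 ax)/=.
    exact: lt_trans bT.
  have ib := bump_integrable n a b.
  rewrite RintegralB//; last by have := @integrableZl _ (measurableTypeR R) R leb setT measurableT C _ ib.
  by rewrite key// RintegralZl// subrr.
exists C; apply: filterS p => t Kt /[dup] It /Kt; rewrite /K /QI patch1//.
by move/eqP; rewrite subr_eq0 subr_eq => /eqP.
Qed.

End time.

Record seminormed (R : realType) (X : Defs.space R) : Prop := Seminormed {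
  sn_0 : member X 0;
  sn_lin : forall (c : R) (x y : X), member X x -> member X y -> member X (c *: x + y);
  sn_ge0 : forall x : X, 0 <= snorm X x }.

Record bounded_form (R : realType) (X : Defs.space R) (l : X -> R) (C : R) : Prop := BoundedForm {
  bf_lin : forall (c : R) (x y : X), member X x -> member X y -> l (c *: x + y) = c * l x + l y;
  bf_bound : forall x : X, member X x -> `|l x| <= C * snorm X x }.

Lemma cvg0_near (R : realType) (u : nat -> R) : u n @[n --> \oo] --> (0 : R) ->
  forall e, 0 < e -> \forall n \near \oo, `|u n| <= e.
Proof. by move=> /cvgrPdist_le h e e0; apply: filterS (h e e0) => n; rewrite sub0r normrN. Qed.

(** * Vector-valued functions of time seen through bounded linear forms *)

Section scalarization.
Context (R : realType) (X : Defs.space R) (T : R).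
Hypothesis SX : seminormed X.
Variables (l : X -> R) (C : R).
Hypothesis lC : bounded_form l C.
Local Notation leb := (@lebesgue_measure R).
Local Notation I := (`]0, T[%classic : set R).
Implicit Types (x y : X) (u w : R -> X) (f g q : R -> R).

Lemma snZ (c : R) x : member X x -> member X (c *: x).
Proof. by move=> mx; rewrite -[_ *: x]addr0; apply: sn_lin => //; exact: sn_0. Qed.

Lemma snB x y : member X x -> member X y -> member X (x - y).
Proof. by move=> mx my; rewrite addrC -scaleN1r; exact: sn_lin. Qed.

Lemma bf0 : l 0 = 0.
Proof.
by have := bf_lin lC 1 (sn_0 SX) (sn_0 SX); rewrite scaler0 addr0 mul1r => /eqP; rewrite -subr_eq subrr eq_sym => /eqP.
Qed.

Lemma bfZ (c : R) x : member X x -> l (c *: x) = c * l x.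
Proof. by move=> mx; rewrite -[_ *: x]addr0 (bf_lin lC)// ?bf0 ?addr0//; exact: sn_0. Qed.

Lemma bfB x y : member X x -> member X y -> l (x - y) = l x - l y.
Proof. by move=> mx my; rewrite addrC -scaleN1r (bf_lin lC)// mulN1r addrC. Qed.

Lemma bf_sum (J : finType) (c : J -> R) (x : J -> X) : (forall i, member X (x i)) ->
  member X (\sum_i c i *: x i) /\ l (\sum_i c i *: x i) = \sum_i c i * l (x i).
Proof.
move=> mx; elim/big_rec2: _ => [|i r y _ [my ly]]; first by split; [exact: sn_0|exact: bf0].
by split; [exact: sn_lin|rewrite (bf_lin lC)// ly].
Qed.

(** The constant |C| + 1, unlike [C], is surely positive and can be divided by. *)
Lemma bf_boundD x y : member X x -> member X y -> `|l x - l y| <= (`|C| + 1) * snorm X (x - y).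
Proof.
move=> mx my; rewrite -bfB//; apply: (le_trans (bf_bound lC (snB mx my))).
by apply: ler_wpM2r; [exact: sn_ge0|apply: (le_trans (ler_norm C)); rewrite lerDl].
Qed.

Let form_sm (s : simple_map X) t : R := \sum_i \1_(sm_set (s := s) i) t * l (sm_val (s := s) i).

Let form_sm_measurable s : measurable_fun setT (form_sm s).
Proof.
apply: measurable_sum => i; apply: measurable_funM => //.
exact: measurable_indic (@sm_measurable _ _ s i).
Qed.

Let form_sm_eval s t : member X (sm_eval s t) /\ l (sm_eval s t) = form_sm s t.
Proof. by apply: bf_sum => i; exact: sm_mem. Qed.

Let form_sm_integral s :
  leb.-integrable I (EFin \o form_sm s) /\ \int[leb]_(t in I) form_sm s t = l (sm_integral T s).
Proof.
have iI A : measurable A -> leb.-integrable I (EFin \o (\1_A : R -> R)) /\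
    \int[leb]_(t in I) (\1_A t : R) = fine (leb (A `&` I)).
  move=> mA; split; last by rewrite /Rintegral integral_indic.
  apply: (@itv_bounded_integrable _ _ _ 1); first exact: measurable_indic mA.
  by move=> x; rewrite indicE; case: (_ \in _); rewrite /= ?normr1 ?normr0.
have -> : l (sm_integral T s) = \sum_i fine (leb (sm_set (s := s) i `&` I)) * l (sm_val (s := s) i).
  by apply: (bf_sum _ _).2 => i; exact: sm_mem.
rewrite /form_sm; elim: (index_enum _) => [|i r [ir Er]].
  rewrite big_nil (_ : (fun _ => _) = cst 0); last by apply/funext => t; rewrite big_nil.
  by split; [exact: integrable0|rewrite /Rintegral integral0].
have [ii Ei] := iI _ (@sm_measurable _ _ s i).
have ji : leb.-integrable I (EFin \o (fun t => \1_(sm_set (s := s) i) t * l (sm_val (s := s) i))).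
  by have := @integrableZr _ (measurableTypeR R) R leb I (measurable_itv _) (l (sm_val (s := s) i)) _ ii.
rewrite big_cons (_ : (fun _ => _) = fun t => \1_(sm_set (s := s) i) t * l (sm_val (s := s) i) +
    \sum_(j <- r) \1_(sm_set (s := s) j) t * l (sm_val (s := s) j)); last by apply/funext => t; rewrite big_cons.
split; first by have := @integrableD _ (measurableTypeR R) R leb I (measurable_itv _) _ _ ji ir.
by rewrite RintegralD// RintegralZr// Ei Er.
Qed.

(** A Borel version of [l] composed with [u], extended by 0; the composition is meaningful only
    where [u] takes values in the space, which is almost everywhere. *)
Definition represents f u := [/\ measurable_fun setT f, forall t, ~ I t -> f t = 0 &
  {ae leb, forall t, I t -> member X (u t) /\ l (u t) = f t}].

(** The form of the approximating simple maps converges almost everywhere; their upper limit is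
    measurable whether or not they converge at a given point. *)
Lemma strongly_measurable_form u : strongly_measurable T u -> exists f, represents f u.
Proof.
move=> [mu [s su]].
pose f t := fine (limn_esup (fun n => (form_sm (s n) t)%:E)).
have mf : measurable_fun setT f.
  apply: measurableT_comp; first exact: fine_measurable.
  by apply: measurable_fun_limn_esup => n; apply/measurable_EFinP; exact: form_sm_measurable.
exists (f \_ I); split.
- exact: (@measurable_restrictT _ _ (measurableTypeR R) (measurableTypeR R) I f (measurable_itv _)).1 (measurable_funTS mf).
- by move=> t It; rewrite patch0.
- apply: filterS2 mu su => t mt st It; split; first exact: mt.
  rewrite patch1//; have mut := mt It; have {}st := st It.
  have : form_sm (s n) t @[n --> \oo] --> l (u t).
    apply/cvgrPdist_le => e e0.
    have C0 : 0 < `|C| + 1 by apply: ltr_wpDl.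
    have := cvg0_near st (_ : 0 < e / (`|C| + 1)); rewrite divr_gt0// => /(_ isT).
    apply: filterS => n; rewrite ger0_norm ?sn_ge0// => h.
    have [ms <-] := form_sm_eval (s n) t.
    by apply: (le_trans (bf_boundD mut ms)); rewrite mulrC -ler_pdivlMr.
  move=> h; have h' : (fun n => (form_sm (s n) t)%:E) n @[n --> \oo] --> (l (u t))%:E.
    by apply: cvg_EFin => //; exact: nearW.
  by rewrite /f (cvg_limn_einf_sup h').2.
Qed.

(** The form commutes with the integral of simple maps, and the error is at most |C| + 1 times the
    integral of norms in the definition of the Bochner integral. *)
Lemma bochner_integral_form u y f : bochner_integral T u y -> represents f u ->
  leb.-integrable I (EFin \o f) /\ \int[leb]_(t in I) f t = l y.
Proof.
move=> [_ my [s [s0 sy]]] [mf _ fu].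
have C0 : 0 < `|C| + 1 by apply: ltr_wpDl.
have Cge : 0 <= `|C| + 1 by exact: ltW.
pose e n := (\int[leb]_(t in I) (snorm X (u t - sm_eval (s n) t))%:E)%E.
have bound n : (\int[leb]_(t in I) `|(f t - form_sm (s n) t)%:E| <= (`|C| + 1)%:E * e n)%E.
  rewrite -lee_pdivrMl//.
  have mk : measurable_fun I (fun t => `|(f t - form_sm (s n) t)%:E|%E).
    apply: measurableT_comp => //; apply/measurable_EFinP; apply: measurable_funTS.
    by apply: measurable_funB => //; exact: form_sm_measurable.
  rewrite -ge0_integralZl_EFin//.
  (* This function agrees almost everywhere with the measurable difference and lies everywhere below
     the norm bound, which may fail to be measurable. *)
  pose k t := if `|f t - form_sm (s n) t| <= (`|C| + 1) * snorm X (u t - sm_eval (s n) t)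
              then `|f t - form_sm (s n) t| else 0.
  have k0 t : 0 <= k t by rewrite /k; case: ifP.
  rewrite -(@ge0_ae_eq_integral_nonmeas _ (measurableTypeR R) R leb I (fun t => ((`|C| + 1)^-1 * k t)%:E)) //.
  - apply: ge0_le_integral_nonmeas => t It; first by rewrite lee_fin mulr_ge0// invr_ge0.
    by rewrite lee_fin ler_pdivrMl// /k; case: ifP => // _; rewrite mulr_ge0// sn_ge0.
  - by apply: emeasurable_funM => //; exact: measurable_cst.
  - by move=> t It; rewrite lee_fin mulr_ge0// invr_ge0.
  - apply: filterS fu => t h /h[mt lt].
    rewrite /= EFinM; congr (_ * _)%E; congr EFin; rewrite /k.
    have [ms <-] := form_sm_eval (s n) t.
    by rewrite -lt bf_boundD.
(* The first of these integrals may be infinite; from [N] on, [f] differs from a simple function by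
   an integrable one. *)
have [N _ eN] : \forall n \near \oo, (e n < 1)%E.
  have := s0; move/fine_cvgP => [h1 h2].
  have h20 : (0 : R) < 2^-1 by rewrite invr_gt0.
  apply: filterS2 h1 (cvg0_near h2 h20) => n en1 /= en2.
  by rewrite -[e n]fineK// lte_fin (le_lt_trans (ler_norm _))// (le_lt_trans en2)// invf_lt1// ltr1n.
have jd n : (N <= n)%N -> leb.-integrable I (EFin \o (fun t => f t - form_sm (s n) t)).
  move=> Nn; apply/integrableP; split.
    by apply/measurable_EFinP/measurable_funTS; apply: measurable_funB => //; exact: form_sm_measurable.
  apply: (le_lt_trans (bound n)); rewrite lte_mul_pinfty ?lee_fin//.
  exact: lt_trans (eN n Nn) (ltry _).
have jf : leb.-integrable I (EFin \o f).
  have := @integrableD _ (measurableTypeR R) R leb I (measurable_itv _) _ _ (jd N (leqnn N)) (form_sm_integral (s N)).1.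
  by congr (_.-integrable _ _); apply/funext => t /=; rewrite -EFinD subrK.
split=> //.
have lim1 : \int[leb]_(t in I) form_sm (s n) t @[n --> \oo] --> \int[leb]_(t in I) f t.
  apply/cvgrPdist_le => eps eps0; have := s0; move/fine_cvgP => [h1 h2].
  have := cvg0_near h2 (_ : 0 < eps / (`|C| + 1)); rewrite divr_gt0// => /(_ isT).
  apply: filterS3 h1 (nbhs_infty_ge N) => n en1 Nn /= en2.
  have [jn _] := form_sm_integral (s n).
  rewrite -RintegralB//; apply: (le_trans (le_normr_Rintegral _ (jd n Nn))) => //.
  rewrite -lee_fin /Rintegral fineK; last first.
    by have := integrable_norm (jd n Nn); exact: integrable_fin_num.
  apply: (le_trans (bound n)); rewrite -[e n]fineK// -EFinM lee_fin mulrC -ler_pdivlMr//.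
  exact: le_trans (ler_norm _) en2.
have lim2 : \int[leb]_(t in I) form_sm (s n) t @[n --> \oo] --> l y.
  apply/cvgrPdist_le => eps eps0.
  have := cvg0_near sy (_ : 0 < eps / (`|C| + 1)); rewrite divr_gt0// => /(_ isT).
  apply: filterS => n; rewrite ger0_norm ?sn_ge0// => h.
  have ms : member X (sm_integral T (s n)).
    by apply: (bf_sum _ _).1 => i; exact: sm_mem.
  rewrite (form_sm_integral (s n)).2 distrC.
  by apply: (le_trans (bf_boundD ms my)); rewrite mulrC -ler_pdivlMr.
exact: cvg_unique lim1 lim2.
Qed.

Definition norm_rep g u := leb.-integrable setT (EFin \o g) /\
  {ae leb, forall t, I t -> snorm X (u t) = g t}.

Lemma represents_integrable f g u : represents f u -> norm_rep g u ->
  leb.-integrable setT (EFin \o f).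
Proof.
move=> [mf f0 fu] [ig gu].
have mg : measurable_fun setT g by apply/measurable_EFinP; exact: measurable_int ig.
apply/integrableP; split; first exact/measurable_EFinP.
have mfe : measurable_fun setT (fun t => (`|f t|%:E : \bar R)).
  by apply/measurable_EFinP; exact: measurableT_comp.
apply: (@le_lt_trans _ _ (\int[leb]_t ((`|C| + 1) * `|g t|)%:E)%E).
  apply: ae_ge0_le_integral => //.
  - apply/measurable_EFinP; apply: measurable_funM => //; exact: measurableT_comp.
  apply: filterS2 fu gu => t h1 h2 _ /=; rewrite lee_fin.
  have [It|It] := pselect (I t); last by rewrite f0// normr0 mulr_ge0// addr_ge0.
  have [mt <-] := h1 It; rewrite -(h2 It) (ger0_norm (sn_ge0 SX _)).
  apply: (le_trans (bf_bound lC mt)); apply: ler_wpM2r; first exact: sn_ge0.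
  by apply: (le_trans (ler_norm C)); rewrite lerDl.
under eq_integral do rewrite EFinM.
rewrite ge0_integralZl_EFin//; last by apply/measurable_EFinP; exact: measurableT_comp.
by have /integrableP[_ ioo] := ig; rewrite lte_mul_pinfty// ?lee_fin ?addr_ge0.
Qed.

(** Applying [l] to both Bochner integrals gives a weak derivative of real functions, hence a
    primitive. The constant and the null set depend on [l]. *)
Lemma weak_time_derivative_form u w f q gu gw : 0 < T -> weak_time_derivative T u w ->
  represents f u -> represents q w -> norm_rep gu u -> norm_rep gw w ->
  exists c, {ae leb, forall t, I t -> l (u t) = c + \int[leb]_(s in `[0, t]) q s}.
Proof.
move=> T0 uw rf rq nu nw.
have [mf f0 fu] := rf; have [mq q0 qw] := rq.
have jf := represents_integrable rf nu; have jq := represents_integrable rq nw.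
have [c hc] : exists c, {ae leb, forall t, I t -> f t = c + \int[leb]_(s in `[0, t]) q s}.
  apply: weak_derivative_primitive => //; first by move=> t It; split; [exact: f0|exact: q0].
  move=> phi tphi; have [y [uy wy]] := uw phi tphi.
  have [sphi _ _] := tphi.
  have cphi : continuous (phi : R^o -> R^o) by have [] := sphi [::].
  have cdphi : continuous (derive1 (phi : R^o -> R^o)).
    rewrite (_ : derive1 _ = 'D_1 (phi : R^o -> R^o)); last by apply/funext => x; exact: derive1E.
    by have [] := sphi [:: 1].
  have mphi : measurable_fun setT phi by exact: continuous_measurable_fun.
  have mdphi : measurable_fun setT (derive1 (phi : R^o -> R^o)) by exact: continuous_measurable_fun.
  have r1 : represents (fun t => derive1 (phi : R^o -> R^o) t * f t) (fun t => derive1 (phi : R^o -> R^o) t *: u t).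
    split; first exact: measurable_funM.
    - by move=> t It; rewrite f0// mulr0.
    - by apply: filterS fu => t h /h[mt <-]; split; [exact: snZ|exact: bfZ].
  have r2 : represents (fun t => phi t * q t) (fun t => phi t *: w t).
    split; first exact: measurable_funM.
    - by move=> t It; rewrite q0// mulr0.
    - by apply: filterS qw => t h /h[mt <-]; split; [exact: snZ|exact: bfZ].
  have [_ e1] := bochner_integral_form uy r1; have [_ e2] := bochner_integral_form wy r2.
  have toI k : (forall t, ~ I t -> k t = 0) -> \int[leb]_t k t = \int[leb]_(t in I) k t.
    move=> k0; rewrite [RHS]Rintegral_mkcond; apply: eq_Rintegral => t _.
    by have [It|It] := pselect (I t); [rewrite patch1|rewrite patch0// k0].
  rewrite !toI; last 2 first.
  - by move=> t It; rewrite q0// mulr0.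
  - by move=> t It; rewrite f0// mulr0.
  rewrite e1 e2; have [_ my _] := uy.
  by rewrite -scaleN1r bfZ// mulN1r opprK.
exists c; apply: filterS2 fu hc => t h1 h2 It.
by have [_ ->] := h1 It; exact: h2.
Qed.

End scalarization.

(** * Function spaces on the domain *)

Section row_measure.
Context (R : realType) (n : nat).
Local Notation mu := (lebesgue_row R n).

(** Measurability refers to the product sigma-algebra, so an open set is written as a countable
    union of boxes with rational corners. *)
Lemma open_row_measurable (U : set 'rV[R]_n) : open U -> measurable U.
Proof.
move=> oU.
pose B (q : 'rV[rat]_n * 'rV[rat]_n) : set 'rV[R]_n :=
  box (fun i => ratr (q.1 ord0 i)) (fun i => ratr (q.2 ord0 i)).
pose F k := if unpickle k is Some q then if `[< B q `<=` U >] then B q else set0 else set0.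
have -> : U = \bigcup_k F k.
  apply/seteqP; split=> [x Ux|x [k _]]; last first.
    by rewrite /F; case: unpickle => // q; case: asboolP => // h /h.
  have [e /= e0 eU] := (nbhs_ballP _ _).1 (open_nbhs_nbhs (conj oU Ux)).
  have /choice[a ha] : forall i, exists q : rat, x ord0 i - e < ratr q < x ord0 i.
    move=> i; have [|q] := @rat_in_itvoo R (x ord0 i - e) (x ord0 i); first by rewrite ltrBlDr ltrDl.
    by rewrite in_itv/= => h; exists q.
  have /choice[b hb] : forall i, exists q : rat, x ord0 i < ratr q < x ord0 i + e.
    move=> i; have [|q] := @rat_in_itvoo R (x ord0 i) (x ord0 i + e); first by rewrite ltrDl.
    by rewrite in_itv/= => h; exists q.
  exists (pickle (\row_i a i, \row_i b i)) => //; rewrite /F pickleK.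
  rewrite asboolT => [i|y By].
    by rewrite /= !mxE; have /andP[_ ->] := ha i; have /andP[-> _] := hb i.
  apply: eU; split=> // i j; rewrite (ord1 i); have := By j; rewrite /= !mxE => /andP[h1 h2].
  have /andP[h3 h4] := ha j; have /andP[h5 h6] := hb j.
  by rewrite /ball/= ltr_norml; apply/andP; split; lra.
apply: bigcupT_measurable => k; rewrite /F; case: unpickle => // q.
by case: asboolP => // _; exact: measurable_box.
Qed.

Lemma continuous_row_measurable (f : 'rV[R]_n -> R^o) : continuous f -> measurable_fun setT (f : 'rV[R]_n -> R).
Proof.
move=> cf; apply: (@measurability _ _ _ _ _ _ (@RGenOInfty.G R)); first exact: RGenOInfty.measurableE.
move=> _ [_ [r ->] <-]; rewrite setTI; apply: open_row_measurable.
have -> : f @^-1` `]r, +oo[ = f @^-1` [set y : R^o | r < y].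
  by apply/seteqP; split=> x /=; rewrite in_itv/= andbT.
by apply: open_comp => [x _|]; [exact: cf|exact: (@open_gt R r)].
Qed.

Lemma measurable_cbox (a b : 'I_n -> R) : measurable (cbox a b).
Proof.
rewrite -[cbox a b]setCK; apply: measurableC; apply: open_row_measurable.
by apply: closed_openC; exact: closed_cbox.
Qed.

End row_measure.

(** Induction along the recursive construction of the measure. Finiteness on cubes makes bounded
    measurable functions square-integrable on a bounded open set. *)
Lemma lebesgue_row_cube (R : realType) n (M : R) :
  (lebesgue_row R n (@cbox R n (fun=> - M)%R (fun=> M)) < +oo)%E.
Proof.
elim: n => [|n IH].
  by rewrite /= /dirac/= indicE; case: (_ \in _); rewrite ltry.
rewrite [lebesgue_row _ _]/= /image_measure/= /pushforward.
apply: (@le_lt_trans _ _ ((lebesgue_row R n \x @lebesgue_measure R)%E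
   ((@cbox R n (fun=> - M) (fun=> M)) `*` `[- M, M]%classic))).
  apply: le_measure; rewrite ?inE.
  - rewrite -[X in measurable X]setTI; apply: measurable_row_cons => //; exact: measurable_cbox.
  - by apply: measurableX; [exact: measurable_cbox|exact: measurable_itv].
  - move=> [x t] /= h; split=> [i|] /=.
      by have := h (lift ord0 i); rewrite /row_cons mxE liftK.
    by have := h ord0; rewrite /row_cons mxE unlift_none/= in_itv.
rewrite product_measure1E//; [|exact: measurable_cbox].
have leb_fin : (@lebesgue_measure R `[(- M)%R, M]%classic < +oo)%E.
  have := @lebesgue_measure_itv R `[- M, M] => ->/=.
  by case: ifP => _; rewrite ltry.
by rewrite lte_mul_pinfty// ge0_fin_numE.
Qed.

Section domain.
Context (R : realType) (d : nat) (Omega : set 'rV[R]_d).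
Hypotheses (oO : open Omega) (bO : bounded_set Omega).
Local Notation mu := (lebesgue_row R d).
Implicit Types (f phi : 'rV[R]_d -> R^o).

Lemma domain_measurable : measurable Omega. Proof. exact: open_row_measurable. Qed.

Lemma domain_finite : (mu Omega < +oo)%E.
Proof.
have [N [_ hN]] := bO; pose M := `|N| + 2.
have sub : Omega `<=` @cbox R d (fun=> - M) (fun=> M).
  move=> x Ox i; have xN : `|x| <= `|N| + 1 by apply: hN => //; apply: le_lt_trans (ler_norm N) _; rewrite ltrDl.
  have : ball (0 : 'rV[R]_d) M x.
    by rewrite -ball_normE /= sub0r normrN (le_lt_trans xN)// /M ltrD2l ltr1n.
  move=> [_ /(_ ord0 i)]; rewrite /ball/= mxE sub0r normrN ltr_norml => /andP[h1 h2].
  by rewrite !ltW.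
apply: le_lt_trans (lebesgue_row_cube d M); apply: le_measure; rewrite ?inE//.
  exact: domain_measurable.
exact: measurable_cbox.
Qed.

Lemma l2_bounded (u : 'rV[R]_d -> R) (C : R) : measurable_fun setT u -> (forall x, Omega x -> `|u x| <= C) -> l2 mu Omega u.
Proof.
move=> mu' uC; have mO := domain_measurable.
have mr (k : 'rV[R]_d -> R) : measurable_fun setT k -> measurable_fun setT (k \_ Omega).
  move=> mk; apply: (@measurable_restrictT _ _ _ (measurableTypeR R) Omega k mO).1.
  by apply: (@measurable_funS _ _ _ _ setT) => //.
apply/l2P; split; first exact: mr.
apply: (int_on_le (g := fun=> C ^+ 2)).
- by apply: mr; exact: measurable_funX.
- rewrite /int_on -restrict_EFin; apply/(integrable_mkcond _ mO).1.
  apply/integrableP; split; first exact: measurable_cst.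
  have c0 : (0 <= (C ^+ 2)%:E :> \bar R)%E by rewrite lee_fin sqr_ge0.
  under eq_integral do rewrite /= ger0_norm ?sqr_ge0//.
  by rewrite integral_cst// lte_mul_pinfty// domain_finite.
- move=> x Ox; rewrite normrX lerXn2r ?nnegrE ?uC//.
  exact: le_trans (uC x Ox).
Qed.

Lemma closure_support_nbhs f x : ~ closure [set y | f y != 0] x -> \forall y \near x, f y = 0.
Proof.
move=> h; have : nbhs x (~` closure [set y | f y != 0]).
  by apply: open_nbhs_nbhs; split=> //; apply: closed_openC; exact: closed_closure.
apply: filterS => y hy; apply: contrapT => /eqP fy; apply: hy; exact: subset_closure.
Qed.

Lemma test_fun_derive phi v : test_fun Omega phi -> test_fun Omega ('D_v phi).
Proof.
move=> [sphi cphi Ophi].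
have sub : closure [set x | 'D_v phi x != 0] `<=` closure [set x | phi x != 0].
  rewrite [X in _ `<=` X](closure_id _).1; last exact: closed_closure.
  apply: closure_subset => x /= dx; apply: contrapT => /closure_support_nbhs h.
  have h' : \near x, phi x = cst 0 x by exact: h.
  by move: dx; rewrite (near_eq_derive v h') derive_cst eqxx.
split.
- move=> s; have := sphi (rcons s v); rewrite foldr_rcons; apply.
- by apply: (subclosed_compact _ cphi sub); exact: closed_closure.
- exact: subset_trans sub Ophi.
Qed.

Lemma test_fun_l2 phi : test_fun Omega phi -> l2 mu Omega phi.
Proof.
move=> [sphi cphi Ophi]; have cp : continuous phi by have [] := sphi [::].
have [N [_ hN]] : bounded_set (phi @` closure [set x | phi x != 0]).
  by apply: compact_bounded; apply: continuous_compact => //; exact: continuous_subspaceT.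
apply: (l2_bounded (C := `|N| + 1)); first exact: continuous_row_measurable.
move=> x _; have [->|fx] := eqVneq (phi x) 0; first by rewrite normr0 addr_ge0.
apply: (hN (`|N| + 1)); first by apply: le_lt_trans (ler_norm N) _; rewrite ltrDl.
by exists x => //; exact: subset_closure.
Qed.

End domain.

Section inner_space.
Context (R : realType) (X : Defs.space R) (B : X -> X -> R).
Hypothesis si : semi_inner (member X) B.
Hypothesis snE : forall x, member X x -> snorm X x = sinorm B x.

Lemma inner_seminormed : (forall x : X, 0 <= snorm X x) -> seminormed X.
Proof. by move=> sn0; split; [exact: si_0 si|exact: si_lin si|]. Qed.

Lemma inner_form y : member X y -> bounded_form (fun x => B x y) (sinorm B y).
Proof.
move=> my; split=> [c x z mx mz|x mx]; first exact: (si_linl si).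
by rewrite snE// mulrC; exact: (si_cs si).
Qed.

End inner_space.

Section spaces.
Context (R : realType) (d : nat) (Omega : set 'rV[R]_d).
Hypotheses (oO : open Omega) (bO : bounded_set Omega).
Local Notation mu := (lebesgue_row R d).
Local Notation L2 := (L2 Omega).
Local Notation L2vec := (L2vec Omega).
Local Notation Linf := (Lebesgue Omega +oo%E).
Local Notation H1 := (H1 Omega).
Local Notation H10 := (H10 Omega).
Local Notation Hm1 := (Hm1 Omega).
Local Notation ip := (ip Omega).
Local Notation ipvec := (ipvec Omega).
Local Notation grad := (grad Omega).

Lemma L2_si : semi_inner (member L2) ip.
Proof.
split.
- exact: l2_0.
- by move=> k x y mx my; apply: l2D => //; exact: l2Z.
- by move=> x y; apply: eq_Rintegral => z _; rewrite mulrC.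
- move=> k x y z mx my mz; rewrite /Defs.ip.
  rewrite -(IonZ k (l2_mul mx mz)) -(IonD (int_onZ k (l2_mul mx mz)) (l2_mul my mz)).
  by apply: eq_Rintegral => t _; rewrite /= mulrDl mulrA.
- by move=> x; apply: Ion_ge0 => z _; rewrite -expr2 sqr_ge0.
Qed.

Lemma L2_snorm_ge0 (u : L2) : 0 <= snorm L2 u.
Proof. by rewrite fine_ge0// Lnorm_ge0. Qed.

Lemma L2_snorm u : member L2 u -> snorm L2 u = sinorm ip u.
Proof.
move=> mu'; apply/eqP; rewrite -(@eqrXn2 _ 2)// ?L2_snorm_ge0 ?sinorm_ge0//.
by rewrite (sinorm2 L2_si) fine_Lnorm2.
Qed.

Lemma ipvecE g q : member L2vec g -> member L2vec q ->
  ipvec g q = \sum_i ip (fun x => g x 0 i) (fun x => q x 0 i).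
Proof.
move=> mg mq; rewrite /Defs.ipvec; elim: (index_enum _) => [|i r IH].
  rewrite big_nil; under eq_Rintegral do rewrite big_nil.
  by rewrite /Rintegral integral0.
have int s : int_on mu Omega (fun x => \sum_(j <- s) g x 0 j * q x 0 j).
  elim: s => [|j s h].
    rewrite (_ : (fun _ => _) = fun=> 0 * 0); last by apply/funext => x; rewrite big_nil mulr0.
    by apply: l2_mul; exact: l2_0.
  rewrite (_ : (fun _ => _) = fun x => g x 0 j * q x 0 j + \sum_(j <- s) g x 0 j * q x 0 j).
    by apply: int_onD => //; apply: l2_mul; [exact: mg|exact: mq].
  by apply/funext => x; rewrite big_cons.
rewrite big_cons -IH -(IonD (l2_mul (mg i) (mq i)) (int r)).
by apply: eq_Rintegral => x _; rewrite big_cons.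
Qed.

Lemma L2vec_si : semi_inner (member L2vec) ipvec.
Proof.
have lin (k : R) (x y : L2vec) : member L2vec x -> member L2vec y -> member L2vec (k *: x + y).
  move=> mx my i; have := si_lin L2_si k (mx i) (my i).
  by congr (member L2 _); apply/funext => z; rewrite /= !mxE.
split=> //.
- move=> i; have := si_0 L2_si; congr (member L2 _).
  by apply/funext => z; rewrite /= mxE.
- by move=> x y; apply: eq_Rintegral => z _; apply: eq_bigr => i _; rewrite mulrC.
- move=> k x y z mx my mz; rewrite !ipvecE//; last exact: lin.
  rewrite mulr_sumr -big_split; apply: eq_bigr => i _ /=.
  rewrite -(si_linl L2_si k (mx i) (my i) (mz i)); congr (ip _ _).
  by apply/funext => t; rewrite /= !mxE.
- move=> x; apply: Ion_ge0 => z _; apply: sumr_ge0 => i _; by rewrite -expr2 sqr_ge0.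
Qed.

Lemma L2vec_snorm g : member L2vec g -> snorm L2vec g = sinorm ipvec g.
Proof.
move=> mg; rewrite -[LHS]/(Num.sqrt (\sum_i snorm L2 (fun x => g x 0 i) ^+ 2)) /sinorm ipvecE//.
congr Num.sqrt; apply: eq_bigr => i _.
by rewrite (L2_snorm (mg i)) (sinorm2 L2_si).
Qed.

Lemma L2vec_seminormed : seminormed L2vec.
Proof. by apply: (inner_seminormed L2vec_si) => x; exact: sqrtr_ge0. Qed.

Lemma L2_ae0 u : member L2 u -> sinorm ip u = 0 -> {ae mu, forall x, Omega x -> u x = 0}.
Proof.
move=> mu' u0; apply: l2_ae0 => //.
by transitivity (ip u u) => //; rewrite -(sinorm2 L2_si) u0 expr0n.
Qed.

Lemma L2vec_ae0 g : member L2vec g -> sinorm ipvec g = 0 -> {ae mu, forall x, Omega x -> g x = 0}.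
Proof.
move=> mg g0.
have h i : {ae mu, forall x, Omega x -> g x 0 i = 0}.
  apply: (L2_ae0 (mg i)); apply/eqP; rewrite -sqrf_eq0 (sinorm2 L2_si); apply/eqP.
  have s0 : \sum_j ip (fun x => g x 0 j) (fun x => g x 0 j) = 0.
    by rewrite -ipvecE// -(sinorm2 L2vec_si) g0 expr0n.
  by apply: (psumr_eq0P _ s0) => // j _; exact: (si_ge0 L2_si).
have : {ae mu, forall x i, Omega x -> g x 0 i = 0}.
  have : {ae mu, forall x (k : nat) (i : 'I_d), i = k :> nat -> Omega x -> g x 0 i = 0}.
    apply/ae_foralln => k; case: (ltnP k d) => [kd|dk]; last first.
      by apply: nearW => x i ik; have := ltn_ord i; rewrite ik ltnNge dk.
    apply: filterS (h (Ordinal kd)) => x hx i ik; rewrite (_ : i = Ordinal kd)//.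
    exact: val_inj.
  by apply: filterS => x hx i Ox; exact: hx (erefl _) Ox.
by apply: filterS => x hx Ox; apply/rowP => i; rewrite hx// mxE.
Qed.

Lemma sinorm_ip_ae0 u w : member L2 u -> member L2 w -> {ae mu, forall x, Omega x -> u x = w x} ->
  sinorm ip (u - w) = 0.
Proof.
move=> mu' mw uw; have muw := siB L2_si mu' mw.
rewrite /sinorm /Defs.ip ae_Ion0 ?sqrtr0//; last first.
  by apply: filterS uw => x h /h e; rewrite /= !fctE /= e subrr mulr0.
by apply/measurable_EFinP; exact: (measurable_int mu (l2_mul muw muw)).
Qed.

(** Cauchy-Schwarz against the constant 1, which is in L^2 because the set is bounded. *)
Lemma l1_bound (u : 'rV[R]_d -> R) : l2 mu Omega u -> int_on mu Omega u /\
  \int[mu]_(x in Omega) `|u x| <= sinorm ip (fun=> 1) * sinorm ip u.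
Proof.
move=> lu; have l1 : l2 mu Omega (fun=> 1).
  by apply: (l2_bounded oO bO (C := 1)) => // x _; rewrite normr1.
have iu := l2_mul lu l1; split.
  by move: iu; congr int_on; apply/funext => x; rewrite mulr1.
have -> : \int[mu]_(x in Omega) `|u x| = ip (fun=> 1) (fun x => `|u x|).
  by apply: eq_Rintegral => x _; rewrite mul1r.
apply: le_trans (si_le L2_si l1 (l2_norm lu)) _.
rewrite ler_wpM2l ?sinorm_ge0// le_eqVlt; apply/orP; left; apply/eqP; congr Num.sqrt.
by apply: eq_Rintegral => x _; rewrite -!expr2 real_normK ?num_real.
Qed.

Lemma Linf_lin (c : R) (x y : Linf) : member Linf x -> member Linf y -> member Linf (c *: x + y).
Proof.
move=> mx my; have [_ cl] := Lfun_submod_closed mu (leey _ : (1 <= +oo)%E).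
rewrite /= (_ : _ \_ _ = c *: ((x : 'rV[R]_d -> R) \_ Omega) + ((y : 'rV[R]_d -> R) \_ Omega)).
  exact: cl.
apply/funext => z; rewrite !fctE !patchE; case: ifP => // _.
by rewrite addr0 [RHS]mulr0.
Qed.

Lemma Linf_seminormed : seminormed Linf.
Proof.
split; last by move=> x; rewrite fine_ge0// Lnorm_ge0.
- have [l0 _] := Lfun_addr_closed mu (leey _ : (1 <= +oo)%E).
  rewrite /= (_ : _ \_ _ = 0)//; apply/funext => x.
  by rewrite patchE; case: ifP.
- exact: Linf_lin.
Qed.

Lemma Linf_mul (u : Linf) (y : 'rV[R]_d -> R) : member Linf u -> l2 mu Omega y ->
  int_on mu Omega (fun x => u x * y x) /\
  `|\int[mu]_(x in Omega) (u x * y x)| <= snorm Linf u * \int[mu]_(x in Omega) `|y x|.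
Proof.
move=> mu' ly; have [iy _] := l1_bound ly.
have [mu1 fn] : measurable_fun setT (u \_ Omega) /\ ('N[mu]_+oo [EFin \o (u \_ Omega)] < +oo)%E.
  by move: mu'; rewrite /= inE => /andP[/[!inE]/= h1 h2].
set S := snorm Linf u; have S0 : 0 <= S := sn_ge0 Linf_seminormed u.
have uae : {ae mu, forall x, `|(u \_ Omega) x| <= S}.
  have fin : ('N[mu]_+oo [EFin \o (u \_ Omega)])%E \is a fin_num by rewrite ge0_fin_numE// Lnorm_ge0.
  have SE : S%:E = ('N[mu]_+oo [EFin \o (u \_ Omega)])%E by rewrite /S /= fineK.
  (* The supremum norm is an essential supremum only for a nonzero measure; for the zero measure
     every bound holds almost everywhere. *)
  have [m0|m0] := ltP 0%E (mu [set: 'rV[R]_d]).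
    have := ess_sup_ge mu (abse \o (EFin \o (u \_ Omega))); apply: filterS => x.
    by rewrite -lee_fin SE unlock m0.
  exists setT; split=> //; apply/eqP; rewrite eq_le m0/=; exact: measure_ge0.
set f := fun x => u x * y x.
have fE : f \_ Omega = (fun x => (u \_ Omega) x * (y \_ Omega) x).
  by rewrite (patch_map2 Omega (op := *%R)) ?mulr0.
have mf : measurable_fun setT (f \_ Omega).
  by rewrite fE; apply: measurable_funM => //; exact: l2_measurable ly.
have iSy : int_on mu Omega (fun x => S * `|y x|) by apply: int_onZ; exact: int_on_norm.
have le : (\int[mu]_x `|((f \_ Omega) x)%:E| <= (S * \int[mu]_(x in Omega) `|y x|)%:E)%E.
  rewrite -(IonZ S (int_on_norm iy)) Rintegral_mkcond /Rintegral fineK; last exact: integrable_fin_num iSy.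
  have Sy0 x : 0 <= ((fun x => S * `|y x|) \_ Omega) x.
    by rewrite patchE; case: ifP => // _; rewrite mulr_ge0.
  apply: ae_ge0_le_integral => //.
  - by apply: measurableT_comp => //; exact/measurable_EFinP.
  - by move=> x _; rewrite lee_fin.
  - exact: (measurable_int mu iSy).
  - apply: filterS uae => x ux _; rewrite /= lee_fin fE (patch_map Omega (op := fun r => S * `|r|)) ?normr0 ?mulr0//.
    by rewrite normrM ler_wpM2r.
have iof : int_on mu Omega f.
  by apply/integrableP; split; [exact/measurable_EFinP|exact: le_lt_trans le (ltry _)].
split=> //; apply: (le_trans (Ion_norm iof)).
rewrite -lee_fin Rintegral_mkcond /Rintegral fineK; last exact: integrable_fin_num (int_on_norm iof).
apply: le_trans le; rewrite le_eqVlt; apply/orP; left; apply/eqP; apply: eq_integral => x _.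
by rewrite (patch_map Omega (op := Num.norm)) ?normr0.
Qed.

(** The constant is the L^1 norm of [y]: it will meet a remainder quadratic in h - H, whose L^1 norm
    the entropy controls. *)
Lemma Linf_form (y : 'rV[R]_d -> R) : l2 mu Omega y ->
  bounded_form (X := Linf) (fun u => \int[mu]_(x in Omega) (u x * y x))
    (\int[mu]_(x in Omega) `|y x|).
Proof.
move=> ly; split=> [c u w mu' mw|u mu']; last by rewrite mulrC; exact: (Linf_mul mu' ly).2.
have [iu _] := Linf_mul mu' ly; have [iw _] := Linf_mul mw ly.
rewrite -(IonZ c iu) -(IonD (int_onZ c iu) iw).
by apply: eq_Rintegral => x _; rewrite mulrDl mulrA.
Qed.

End spaces.

(** * Weak gradients, the space H^1_0 and its dual *)

Section gradients.
Context (R : realType) (d : nat) (Omega : set 'rV[R]_d).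
Hypotheses (oO : open Omega) (bO : bounded_set Omega).
Local Notation mu := (lebesgue_row R d).
Local Notation L2 := (L2 Omega).
Local Notation L2vec := (L2vec Omega).
Local Notation H1 := (H1 Omega).
Local Notation H10 := (H10 Omega).
Local Notation Hm1 := (Hm1 Omega).
Local Notation ip := (ip Omega).
Local Notation ipvec := (ipvec Omega).
Local Notation grad := (grad Omega).
Local Notation siL := (L2_si Omega).
Local Notation siV := (L2vec_si Omega).
Implicit Types (u w : 'rV[R]_d -> R^o) (g q : 'rV[R]_d -> 'rV[R]_d).

Lemma weak_gradient_unique u g q : member L2vec g -> member L2vec q ->
  weak_gradient Omega u g -> weak_gradient Omega u q -> sinorm ipvec (g - q) = 0.
Proof.
move=> mg mq wg wq; have mgq := siB siV mg mq.
rewrite /sinorm ipvecE// big1 ?sqrtr0// => i _; apply: ae_Ion0.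
  by apply/measurable_EFinP; exact: (measurable_int mu (l2_mul (mgq i) (mgq i))).
have : {ae mu, forall x, Omega x -> g x 0 i - q x 0 i = 0}.
  have lk : l2 mu Omega (fun x => g x 0 i - q x 0 i) by apply: l2B; [exact: mg|exact: mq].
  apply: (test_fun_ae0 oO); first exact: (l1_bound oO bO lk).1.
  move=> phi tphi; have lphi := test_fun_l2 oO bO tphi.
  transitivity (\int[mu]_(x in Omega) (g x 0 i * phi x - q x 0 i * phi x)).
    by apply: eq_Rintegral => x _; rewrite mulrBl.
  rewrite (IonB (l2_mul (mg i) lphi) (l2_mul (mq i) lphi)).
  by have := wg phi tphi i; rewrite (wq phi tphi i) => /oppr_inj ->; rewrite subrr.
by apply: filterS => x h /h e; rewrite /= !fctE !mxE e mulr0.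
Qed.

Lemma weak_gradient_lin (c : R) u w g q : member L2 u -> member L2 w ->
  member L2vec g -> member L2vec q ->
  weak_gradient Omega u g -> weak_gradient Omega w q -> weak_gradient Omega (c *: u + w) (c *: g + q).
Proof.
move=> mu' mw mg mq wg wq phi tphi i.
have lp := test_fun_l2 oO bO tphi.
have ld := test_fun_l2 oO bO (test_fun_derive (delta_mx 0 i) tphi).
transitivity (c * \int[mu]_(x in Omega) (u x * 'D_(delta_mx 0 i) phi x) +
    \int[mu]_(x in Omega) (w x * 'D_(delta_mx 0 i) phi x)).
  rewrite -(IonZ c (l2_mul mu' ld)) -(IonD (int_onZ c (l2_mul mu' ld)) (l2_mul mw ld)).
  by apply: eq_Rintegral => x _; rewrite /= mulrA -mulrDl.
rewrite wg// wq// mulrN -opprD; congr (- _).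
rewrite -(IonZ c (l2_mul (mg i) lp)) -(IonD (int_onZ c (l2_mul (mg i) lp)) (l2_mul (mq i) lp)).
by apply: eq_Rintegral => x _; rewrite /= !mxE mulrA -mulrDl.
Qed.

Lemma gradP u : (exists g, member L2vec g /\ weak_gradient Omega u g) ->
  member L2vec (grad u) /\ weak_gradient Omega u (grad u).
Proof. by move=> [g hg]; have := @xgetPex _ (cst 0) [set g | member L2vec g /\ weak_gradient Omega u g]; apply; exists g. Qed.

Lemma weak_gradientZ (c : R) u : member L2 u ->
  (exists g, member L2vec g /\ weak_gradient Omega u g) ->
  exists g, member L2vec g /\ weak_gradient Omega (c *: u) g.
Proof.
move=> lu [g [mg wg]]; exists (c *: g); split; first exact: (siZ siV).
have w0 : weak_gradient Omega (0 : 'rV[R]_d -> R^o) 0.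
  move=> phi tphi i; rewrite /Rintegral integral0_eq ?integral0_eq ?oppr0// => x _.
    by rewrite mxE mul0r.
  by rewrite mul0r.
have := weak_gradient_lin c lu (si_0 siL) mg (si_0 siV) wg w0.
by rewrite !addr0.
Qed.

Lemma L2vec_snorm_grad u : snorm L2vec (grad u) = sinorm ipvec (grad u).
Proof.
apply: L2vec_snorm; have [h|h] := pselect (exists g, member L2vec g /\ weak_gradient Omega u g).
  by have [] := gradP h.
rewrite /Defs.grad xgetPN; first exact: (si_0 siV).
by move=> g hg; apply: h; exists g.
Qed.

(** [grad] is a choice among representatives, so that only its norm is known to scale. If [u] has no
    weak gradient, neither has its nonzero multiple, and both choices are the default 0. *)
Lemma snorm_gradZ (c : R) u : c != 0 -> member L2 u ->
  snorm L2vec (grad (c *: u)) = `|c| * snorm L2vec (grad u).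
Proof.
move=> c0 lu; rewrite !L2vec_snorm_grad.
have lcu : member L2 (c *: u) := siZ siL c lu.
have [h|h] := pselect (exists g, member L2vec g /\ weak_gradient Omega u g).
  have [mg wg] := gradP h; have [mq wq] := gradP (weak_gradientZ c lu h).
  have w0 : weak_gradient Omega (0 : 'rV[R]_d -> R^o) 0.
    move=> phi tphi i; rewrite /Rintegral integral0_eq ?integral0_eq ?oppr0// => x _.
      by rewrite mxE mul0r.
    by rewrite mul0r.
  have := weak_gradient_lin c lu (si_0 siL) mg (si_0 siV) wg w0; rewrite !addr0 => wcg.
  have mcg := siZ siV c mg.
  have := sinorm_dist siV mq mcg; rewrite (weak_gradient_unique mq mcg wq wcg).
  by rewrite normr_le0 subr_eq0 (sinormZ siV)// => /eqP.
have z v : ~ (exists g, member L2vec g /\ weak_gradient Omega v g) -> sinorm ipvec (grad v) = 0.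
  move=> hv; rewrite /Defs.grad xgetPN; last by move=> g hg; apply: hv; exists g.
  by rewrite /sinorm (si0l siV (si_0 siV)) sqrtr0.
rewrite !z ?mulr0// => /(weak_gradientZ c^-1 lcu).
by rewrite scalerA mulVf// scale1r.
Qed.

Lemma snorm_H1Z (c : R) u : c != 0 -> member L2 u -> snorm H1 (c *: u) = `|c| * snorm H1 u.
Proof.
move=> c0 lu; rewrite -[LHS]/(Num.sqrt (snorm L2 (c *: u) ^+ 2 + snorm L2vec (grad (c *: u)) ^+ 2)).
rewrite -[snorm H1 u]/(Num.sqrt (snorm L2 u ^+ 2 + snorm L2vec (grad u) ^+ 2)).
rewrite snorm_gradZ// (L2_snorm (siZ siL c lu)) (L2_snorm lu) (sinormZ siL)//.
by rewrite !exprMn -mulrDr sqrtrM ?sqr_ge0// sqrtr_sqr normr_id.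
Qed.

Lemma test_funZ (c : R) (phi : 'rV[R]_d -> R^o) : c != 0 -> test_fun Omega phi -> test_fun Omega (c *: phi).
Proof.
move=> c0 [sphi cphi Ophi].
have E : [set x | (c *: phi) x != 0] = [set x | phi x != 0].
  by apply/seteqP; split=> x /=; rewrite mulf_eq0 negb_or c0.
split; [|by rewrite E..] => s.
pose D := foldr (fun e (h : 'rV[R]_d -> R^o) => 'D_e h).
have DZ s' : D (c *: phi) s' = c *: D phi s'.
  elim: s' => //= e s' ->; apply/funext => x; rewrite deriveZ//.
  by have [_] := sphi s'; apply.
rewrite -/(D _ _) DZ; have [h1 h2] := sphi s; split=> [x|x e].
  have k1 : D phi s y @[y --> x] --> D phi s x by exact: h1.
  exact: (cvgZ (cvg_cst c) k1).
exact: derivableZ.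
Qed.

Lemma H10Z (c : R) u : c != 0 -> member H10 u ->
  member H10 (c *: u) /\ snorm H10 (c *: u) = `|c| * snorm H10 u.
Proof.
move=> c0 [[lu hu] au]; have sE : snorm H10 (c *: u) = `|c| * snorm H10 u by exact: (snorm_H1Z c0 lu).
split; last exact: sE.
split; first by split; [exact: (siZ siL c lu)|exact: (weak_gradientZ c lu hu)].
have c1 : 0 < `|c| by rewrite normr_gt0.
move=> e e0; have [phi tphi h] := au (e / `|c|) (divr_gt0 e0 c1).
exists (c *: phi); first exact: test_funZ.
have lup : member L2 (u - phi) by exact: l2B lu (test_fun_l2 oO bO tphi).
by rewrite -scalerBr (snorm_H1Z c0 lup) mulrC -ltr_pdivlMr.
Qed.

Lemma H10_L2 u : member H10 u -> member L2 u.
Proof. by case=> [[]]. Qed.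

Lemma H10_grad u : member H10 u -> member L2vec (grad u).
Proof. by move=> [[_ /gradP[]]]. Qed.

Lemma H10_snorm2 u : member H10 u -> snorm H10 u ^+ 2 = ip u u + ipvec (grad u) (grad u).
Proof.
move=> hu; have lu := H10_L2 hu; have lg := H10_grad hu.
rewrite -[snorm H10 u]/(Num.sqrt (snorm L2 u ^+ 2 + snorm L2vec (grad u) ^+ 2)).
by rewrite sqr_sqrtr ?addr_ge0 ?sqr_ge0// (L2_snorm lu) (L2vec_snorm lg) (sinorm2 siL) (sinorm2 siV).
Qed.

Lemma H10_snorm_ge0 u : 0 <= snorm H10 u. Proof. exact: sqrtr_ge0. Qed.

Lemma H10_le u : member H10 u -> sinorm ip u <= snorm H10 u /\ sinorm ipvec (grad u) <= snorm H10 u.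
Proof.
move=> hu; have e := H10_snorm2 hu.
have h0 := si_ge0 siL u; have h1 := si_ge0 siV (grad u).
by split; rewrite -(@ler_pXn2r _ 2)// ?nnegrE ?sinorm_ge0 ?H10_snorm_ge0// e
  ?(sinorm2 siL) ?(sinorm2 siV) ?lerDl ?lerDr.
Qed.

Lemma Hm1_seminormed : seminormed Hm1.
Proof.
split.
- split=> [c u w _ _|]; first by rewrite /= mulr0 addr0.
  by exists 0 => u _; rewrite mul0r normr0.
- move=> c F G [lF [CF bF]] [lG [CG bG]]; split=> [k u w mu' mw|].
    rewrite -[LHS]/(c * F (k *: u + w) + G (k *: u + w)) lF// lG//.
    rewrite -[RHS]/(k * (c * F u + G u) + (c * F w + G w)).
    by move: (F u) (F w) (G u) (G w) => x y z t; ring.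
  exists (`|c| * CF + CG) => u mu'; apply: (le_trans (ler_normD _ _)).
  by rewrite mulrDl lerD ?bG// normrM -mulrA ler_wpM2l// bF.
- move=> F; rewrite -[snorm Hm1 F]/(sup [set `|F u| | u in [set u | member H10 u /\ snorm H10 u <= 1]]).
  set S := (X in sup X); have [hs|/sup_out ->//] := pselect (has_sup S).
  have [[r Sr] ub] := hs; apply: (le_trans _ (ub_le_sup ub Sr)).
  by case: Sr => u _ <-.
Qed.

(** The supremum defining the dual norm is evaluated at the normalized vector; a vector of zero norm
    is killed by the bound that makes [F] a member. *)
Lemma Hm1_eval (F : Hm1) u : member Hm1 F -> member H10 u -> `|F u| <= snorm H10 u * snorm Hm1 F.
Proof.
move=> [lF [C bF]] hu; have F0 := sn_ge0 Hm1_seminormed F.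
have [u0|u0] := eqVneq (snorm H10 u) 0.
  by rewrite u0 mul0r (le_trans (bF u hu))// u0 mulr0.
have up : 0 < snorm H10 u by rewrite lt0r u0 H10_snorm_ge0.
have u1 : (snorm H10 u)^-1 != 0 by rewrite invr_eq0.
have [hv sv] := H10Z u1 hu; set v := _ *: u in hv sv.
(* Linearity is available for combinations [c *: u + w], so k u is written as (k - 1) u + u. *)
have FZ (k : R) : F (k *: u) = k * F u.
  have -> : k *: u = (k - 1) *: u + u by rewrite scalerBl scale1r subrK.
  by rewrite lF// /GRing.scale/= mulrBl mul1r subrK.
have v1 : snorm H10 v = 1 by rewrite sv ger0_norm ?mulVf// invr_ge0 ltW.
have C0 w : member H10 w -> snorm H10 w <= 1 -> `|F w| <= `|C|.
  move=> hw w1; apply: (le_trans (bF w hw)); apply: (@le_trans _ _ (`|C| * snorm H10 w)).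
    by apply: ler_wpM2r; [exact: H10_snorm_ge0|exact: ler_norm].
  exact: ler_piMr.
have : `|F v| <= snorm Hm1 F.
  apply: ub_le_sup; last by exists v => //; split=> //; rewrite v1.
  by exists `|C| => _ [w [hw w1] <-]; exact: C0.
rewrite /v FZ normrM (gtr0_norm (_ : 0 < (snorm H10 u)^-1)) ?invr_gt0//.
by rewrite ler_pdivrMl.
Qed.

Lemma Hm1_form u : member H10 u -> bounded_form (X := Hm1) (fun F => F u) (snorm H10 u).
Proof.
by move=> hu; split=> [c F G _ _|F mF] //; exact: Hm1_eval.
Qed.

End gradients.

(** * Primitives and continuity in time *)

Lemma near_within_eps (R : realType) (f : R -> R) (A : set R) (x l : R) :
  f y @[y --> within A (nbhs x)] --> l ->
  forall e, 0 < e -> exists2 d, 0 < d & forall y, A y -> `|x - y| < d -> `|l - f y| <= e.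
Proof.
move=> /cvgrPdist_le h e e0; have /nbhs_ballP[d /= d0 dP] := h e e0.
by exists d => // y Ay xy; exact: (dP y xy Ay).
Qed.

(** Compactness in the form of near-coverings: one radius serves near every point of the interval,
    and the triangle inequality through the centre gives the bound. *)
Lemma heine (R : realType) (D : R -> R -> R) (s t : R) :
  (forall x y z, s <= x <= t -> s <= y <= t -> s <= z <= t -> D x y <= D z x + D z y) ->
  (forall x, s <= x <= t -> forall e, 0 < e -> exists2 d, 0 < d &
     forall y, s <= y <= t -> `|x - y| < d -> D x y <= e) ->
  forall e, 0 < e -> exists2 d, 0 < d &
    forall x y, s <= x <= t -> s <= y <= t -> `|x - y| < d -> D x y <= e.
Proof.
move=> tri cont e e0.
have /compact_near_coveringP cov := @segment_compact R s t.
pose P (d x : R) := s <= x <= t -> forall y, s <= y <= t -> `|x - y| < d -> D x y <= e.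
have h : \forall d \near (0 : R)^'+, `[s, t]%classic `<=` P d.
  apply: cov => x; rewrite /= in_itv/= => xst.
  have e2 : 0 < e / 2 by lra.
  have [d d0 dP] := cont x xst _ e2.
  have d2 : 0 < d / 2 by lra.
  exists (ball x (d / 2), [set d' | d' < d / 2]) => /=.
    by split; [exact: nbhsx_ballx|exact: nbhs_right_lt].
  move=> [x' d'] /= [xx' dd'] x'st y yst x'y.
  have h1 : D x x' <= e / 2 by apply: dP => //; apply: lt_trans xx' _; lra.
  have h2 : D x y <= e / 2.
    apply: dP => //; rewrite -(subrKA x') (le_lt_trans (ler_normD _ _))//.
    have := xx'; rewrite /ball/= => ?; lra.
  by have := tri x' y x x'st yst xst; lra.
have [d [d0 dP]] : exists d : R, 0 < d /\ `[s, t]%classic `<=` P d.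
  have hp : \forall d \near (0 : R)^'+, 0 < d by exact: nbhs_right_gt.
  near (0 : R)^'+ => d; exists d; split; near: d => //.
exists d => // x y xst yst xy; exact: (dP x).
Unshelve. all: by end_near. Qed.

Section primitive.
Context (R : realType) (T : R).
Hypothesis T0 : 0 < T.
Local Notation leb := (@lebesgue_measure R).
Local Notation I := (`]0, T[%classic : set R).
Implicit Types (f g k : R -> R).

Definition prim g t := \int[leb]_(s in `[0, t]) g s.

Lemma primB g s t : leb.-integrable setT (EFin \o g) -> 0 <= s -> s <= t ->
  prim g t - prim g s = \int[leb]_(r in `[s, t]) g r.
Proof.
move=> ig s0 st.
have i1 : leb.-integrable `[0, t] (EFin \o g) by exact: integrableS ig.
have := @Rintegral_itvB _ g (BLeft 0) (BRight t) s i1.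
rewrite !bnd_simp => /(_ s0 st) ->.
by apply: Rintegral_itv_obnd_cbnd; exact: integrableS ig.
Qed.

Lemma prim_ge0 g s t : (forall x, 0 <= g x) -> leb.-integrable setT (EFin \o g) -> 0 <= s -> s <= t ->
  prim g s <= prim g t.
Proof.
by move=> g0 ig s0 st; rewrite -subr_ge0 primB//; apply: Rintegral_ge0.
Qed.

Lemma prim_ucont g : leb.-integrable setT (EFin \o g) -> ucont (prim g) 0 T.
Proof.
move=> ig; apply: heine => [x y z _ _ _|x xT e e0].
  by rewrite -(subrKA (prim g z)) (distrC (prim g z) (prim g x)); exact: ler_normD.
have ig' : leb.-integrable `[0, T] (EFin \o g) by exact: integrableS ig.
have /subspace_continuousP := parameterized_integral_continuous (ltW T0) ig'.
move=> /(_ x); rewrite /= in_itv/= => /(_ xT) /near_within_eps /(_ e e0)[d d0 dP].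
by exists d => // y yT xy; apply: dP => //; rewrite /= in_itv.
Qed.

(** Cauchy-Schwarz, from the nonnegative integral of (g - m)^2 with [m] the mean of [g]. *)
Lemma prim_sqr g s t : leb.-integrable setT (EFin \o g) ->
  leb.-integrable setT (EFin \o (fun x => g x ^+ 2)) -> 0 <= s -> s <= t ->
  (prim g t - prim g s) ^+ 2 <= (t - s) * (prim (fun x => g x ^+ 2) t - prim (fun x => g x ^+ 2) s).
Proof.
move=> ig ig2 s0; rewrite [in X in X -> _]le_eqVlt => /orP[/eqP <-|st].
  by rewrite !subrr mul0r expr0n.
rewrite (primB ig s0 (ltW st)) (primB ig2 s0 (ltW st)).
set J := \int[leb]_(r in `[s, t]) g r; set J2 := \int[leb]_(r in `[s, t]) (g r ^+ 2).
have st0 : 0 < t - s by rewrite subr_gt0.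
have i1 : leb.-integrable `[s, t] (EFin \o g) by exact: integrableS ig.
have i2 : leb.-integrable `[s, t] (EFin \o (fun x => g x ^+ 2)) by exact: integrableS ig2.
pose m := J / (t - s).
have cI (c : R) : leb.-integrable `[s, t] (EFin \o (fun=> c)) /\ \int[leb]_(r in `[s, t]) c = c * (t - s).
  split; first by apply: continuous_itv_integrable => x; exact: cvg_cst.
  rewrite Rintegral_cst//; congr (_ * _); transitivity (fine (leb `[s, t]%classic)) => //.
  by have := @lebesgue_measure_itv R `[s, t] => ->/=; rewrite lte_fin st.
have [i3 e3] := cI (m ^+ 2).
have i4 : leb.-integrable `[s, t] (EFin \o (fun x => (2 * m) * g x)).
  by have := @integrableZl _ (measurableTypeR R) R leb `[s, t]%classic (measurable_itv _) (2 * m) _ i1.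
have i5 : leb.-integrable `[s, t] (EFin \o (fun x => g x ^+ 2 - 2 * m * g x)).
  by have := @integrableB _ (measurableTypeR R) R leb `[s, t]%classic (measurable_itv _) _ _ i2 i4.
have : 0 <= \int[leb]_(r in `[s, t]) (g r ^+ 2 - 2 * m * g r + m ^+ 2).
  apply: Rintegral_ge0 => x _; rewrite (_ : _ + _ = (g x - m) ^+ 2) ?sqr_ge0//; ring.
rewrite RintegralD// RintegralB// RintegralZl// e3 -/J -/J2.
have -> : J2 - 2 * m * J + m ^+ 2 * (t - s) = J2 - J ^+ 2 / (t - s).
  by rewrite /m; field; exact: lt0r_neq0.
by rewrite subr_ge0 ler_pdivrMr// mulrC.
Qed.

Variable G : set R.
Hypothesis GI : {ae leb, forall t, I t -> G t}.

Lemma ae_prim_le f g s t : leb.-integrable setT (EFin \o f) -> leb.-integrable setT (EFin \o g) ->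
  0 <= s -> s <= t -> t <= T -> (forall r, G r -> s < r < t -> f r <= g r) ->
  prim f t - prim f s <= prim g t - prim g s.
Proof.
move=> jf jg s0 st tT fg; rewrite !primB//.
have toO h : leb.-integrable setT (EFin \o h) -> \int[leb]_(r in `[s, t]) h r = \int[leb]_(r in `]s, t[) h r.
  move=> ih; rewrite -Rintegral_itv_obnd_cbnd; last exact: integrableS ih.
  by rewrite -Rintegral_itv_bndo_bndc//; exact: integrableS ih.
rewrite !toO// -subr_ge0.
have if' : leb.-integrable `]s, t[ (EFin \o f) by exact: integrableS jf.
have ig' : leb.-integrable `]s, t[ (EFin \o g) by exact: integrableS jg.
rewrite -RintegralB//.
have mh : measurable_fun setT (fun x => g x - f x).
  by apply: measurable_funB; apply/measurable_EFinP; [exact: measurable_int jg|exact: measurable_int jf].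
rewrite (_ : \int[leb]_(r in _) _ = \int[leb]_(r in `]s, t[) `|g r - f r|); first exact: Rintegral_ge0.
congr fine; apply: ae_eq_integral => //.
- by apply/measurable_EFinP; exact: measurable_funTS.
- by apply/measurable_EFinP/measurable_funTS; exact: measurableT_comp.
apply: filterS GI => r Gr; rewrite /= in_itv/= => /andP[sr rt].
rewrite ger0_norm// subr_ge0 fg ?sr//; apply: Gr.
by rewrite /= in_itv/= (le_lt_trans s0 sr) (lt_le_trans rt tT).
Qed.

(** If [k] exceeded its mean at every point of [G], then [k] minus its mean would be positive almost
    everywhere with integral zero. The lemma selects times that lie in the conull set and at which a
    norm is under control. *)
Lemma average_point k s t : leb.-integrable setT (EFin \o k) -> 0 <= s -> s < t -> t <= T ->
  exists r, [/\ G r, s < r < t & (t - s) * k r <= prim k t - prim k s].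
Proof.
move=> ik s0 st tT; apply: contrapT => h.
set J := prim k t - prim k s in h.
have st0 : 0 < t - s by rewrite subr_gt0.
have mO : measurable (`]s, t[%classic : set (measurableTypeR R)) by exact: measurable_itv.
have i1 : leb.-integrable `]s, t[ (EFin \o k) by exact: integrableS ik.
have i2 : leb.-integrable `]s, t[ (EFin \o (fun x => (t - s) * k x)).
  by have := @integrableZl _ (measurableTypeR R) R leb `]s, t[%classic mO (t - s) _ i1.
have i3 : leb.-integrable `]s, t[ (EFin \o (fun=> J)).
  apply: (@integrableS _ (measurableTypeR R) R leb `[s, t]%classic) => //.
    by apply: subset_itv; rewrite bnd_simp.
  by apply: continuous_itv_integrable => x; exact: cvg_cst.
have i4 : leb.-integrable `]s, t[ (EFin \o (fun x => (t - s) * k x - J)).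
  by have := @integrableB _ (measurableTypeR R) R leb `]s, t[%classic mO _ _ i2 i3.
have pos r : G r -> `]s, t[%classic r -> 0 < (t - s) * k r - J.
  rewrite /= in_itv/= => Gr rst; rewrite subr_gt0 ltNge; apply/negP => le; apply: h.
  by exists r.
have int0 : \int[leb]_(r in `]s, t[) ((t - s) * k r - J) = 0.
  rewrite RintegralB// RintegralZl// Rintegral_cst//.
  have -> : fine (leb `]s, t[%classic) = t - s.
    by have := @lebesgue_measure_itv R `]s, t[ => ->/=; rewrite lte_fin st.
  have -> : \int[leb]_(r in `]s, t[) k r = J.
    rewrite Rintegral_itv_bndo_bndc// Rintegral_itv_obnd_cbnd; last exact: integrableS ik.
    by rewrite /J primB// ltW.
  by rewrite mulrC subrr.
have GO : {ae leb, forall r, `]s, t[%classic r -> G r}.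
  apply: filterS GI => r Gr; rewrite /= in_itv/= => /andP[sr rt]; apply: Gr.
  by rewrite /= in_itv/= (le_lt_trans s0 sr) (lt_le_trans rt tT).
have int1 : (\int[leb]_(r in `]s, t[) `|((t - s) * k r - J)%:E| = 0)%E.
  transitivity (\int[leb]_(r in `]s, t[) ((t - s) * k r - J)%:E)%E.
    apply: ae_eq_integral => //.
    - by apply: measurableT_comp => //; exact: measurable_int i4.
    - exact: measurable_int i4.
    by apply: filterS GO => r Gr ro; rewrite /= gtr0_norm// pos//; exact: Gr.
  by rewrite -[LHS]fineK; [congr EFin|exact: integrable_fin_num i4].
have /(ae_eq_integral_abs leb mO) := measurable_int leb i4.
move=> /iffLR /(_ int1) h1.
have : leb `]s, t[%classic = 0%E.
  have : {ae leb, forall r, ~ `]s, t[%classic r}.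
    apply: filterS2 h1 GO => r e Gr ro; have := pos r (Gr ro) ro.
    by have := e ro => /= -[->]; rewrite ltxx.
  move=> [N [mN N0 sN]]; apply/eqP; rewrite eq_le measure_ge0 andbT -N0.
  by apply: le_measure; rewrite ?inE// => r ro; apply: sN => /=; exact.
have := @lebesgue_measure_itv R `]s, t[ => ->/=; rewrite lte_fin st => /eqP.
by rewrite -EFinB eqe gt_eqF.
Qed.

Lemma conull_dense : dense_in G 0 T.
Proof.
move=> x y x0 xy yT.
have [|r [Gr /andP[? ?] _]] := @average_point (fun=> 0) x y _ x0 xy yT.
  by have := @integrable0 _ (measurableTypeR R) R leb setT.
by exists r.
Qed.

End primitive.

(** * Continuity into a Hilbert space from bounds in duality *)

Section hilbert_continuity.
Context (R : realType) (V : lmodType R) (A : set V) (B : V -> V -> R).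
Hypothesis si : semi_inner A B.
Variables (T : R) (G : set R) (u : R -> V) (q sg m : R -> R).
Hypothesis Au : forall x, G x -> A (u x).
Hypothesis q0 : forall x, G x -> 0 <= q x.
Hypothesis uq : forall x y r, G x -> G y -> G r -> 0 <= x -> x < y -> y <= T ->
  `|B (u y - u x) (u r)| <= (sg y - sg x) * q r.
Hypothesis sg_mono : forall x y, 0 <= x -> x <= y -> y <= T -> sg x <= sg y.
Hypothesis sg_m : forall x y, 0 <= x -> x <= y -> y <= T -> (sg y - sg x) ^+ 2 <= (y - x) * (m y - m x).
Hypothesis m_mono : forall x y, 0 <= x -> x <= y -> y <= T -> m x <= m y.
Hypothesis q_m : forall x y, 0 <= x -> x < y -> y <= T ->
  exists r, [/\ G r, x < r < y & (y - x) * q r ^+ 2 <= m y - m x].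

Let young (x y e : R) : 0 < e -> 2 * (x * y) <= x ^+ 2 / e + e * y ^+ 2.
Proof.
move=> e0; rewrite -subr_ge0 (_ : _ - _ = (x / e - y) ^+ 2 * e); last by field; rewrite gt_eqF.
by rewrite mulr_ge0 ?sqr_ge0// ltW.
Qed.

(** u x - u s is expanded around u y - u s, and the square of u y - u x is dropped. The remaining
    products are duality pairings, bounded by the increment of [sg] times [q]. *)
Let step s x y : G s -> G x -> G y -> 0 <= x -> x < y -> y <= T ->
  B (u y - u s) (u y - u s) <= B (u x - u s) (u x - u s) + 2 * ((sg y - sg x) * q y) + 2 * ((sg y - sg x) * q s).
Proof.
move=> Gs Gx Gy x0 xy yT; have [As Ax Ay] := And3 (Au Gs) (Au Gx) (Au Gy).
have Ayx := siB si Ay Ax; have Ays := siB si Ay As; have Axs := siB si Ax As.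
have e : B (u x - u s) (u x - u s) = B (u y - u s) (u y - u s) - 2 * B (u y - u x) (u y - u s) + B (u y - u x) (u y - u x).
  have -> : u x - u s = (u y - u s) - (u y - u x) by rewrite opprB [RHS]addrC subrKA.
  by rewrite -[LHS](sinorm2 si) -(gram_sinorm si Ays Ayx) (si_sym si (u y - u s) (u y - u x)); ring.
have := uq Gx Gy Gy x0 xy yT; have := uq Gx Gy Gs x0 xy yT.
have := si_ge0 si (u y - u x); move: e; rewrite (siBr si Ay As Ayx) !ler_norml.
by move: (B _ _) (B _ _) (B _ _) (B _ _) (B _ _) => b1 b2 b3 b4 b5 -> h /andP[h1 h2] /andP[h3 h4]; lra.
Qed.

(** In each of N + 1 cells a time is chosen at which [q] is controlled by the increment of [m], and
    [step] is summed along these times. Young's inequality with weight [eta] costs 2 Dm for the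
    increments of [sg], since consecutive times are at most 2 eta apart, and Dm for [q]. The terms
    with [q s] cost another Dm and (t - s) (q s)^2. *)
Lemma partition_bound s t : G s -> G t -> 0 <= s -> s < t -> t <= T ->
  B (u t - u s) (u t - u s) <= 4 * (m t - m s) + (t - s) * q s ^+ 2.
Proof.
move=> Gs Gt s0 st tT; set Q := q t + q s; set Dm := m t - m s.
have Dm0 : 0 <= Dm by rewrite subr_ge0 m_mono// ltW.
have Q1 : 0 < 1 + Q ^+ 2 by rewrite ltr_pwDl// sqr_ge0.
apply: ler_eps => e' e'0; set e := e' / (1 + Q ^+ 2); have e0 : 0 < e by exact: divr_gt0.
(* This [N] yields [eta * Dm <= e ^+ 2], which makes the last step small: it ends at [t], where
   [q t] is not controlled, but it is short. *)
have [N hN] := exists_natr_gt ((t - s) * Dm / e ^+ 2).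
have N0 : 0 < N.+1%:R :> R by rewrite ltr0n.
set eta := (t - s) / N.+1%:R.
have st0 : 0 < t - s by rewrite subr_gt0.
have eta0 : 0 < eta by exact: divr_gt0.
have etaN : eta * N.+1%:R = t - s by rewrite divfK// gt_eqF.
have etaD : eta * Dm <= e ^+ 2.
  rewrite /eta mulrAC ler_pdivrMr// [leRHS]mulrC -ler_pdivrMr ?exprn_gt0//.
  by apply: (le_trans (ltW hN)); rewrite ler_nat.
have claim k : (k <= N.+1)%N -> exists x, [/\ G x, s + eta * k%:R - eta <= x, s <= x, x <= s + eta * k%:R &
    B (u x - u s) (u x - u s) <= 2 * (m x - m s) + (m (s + eta * k%:R) - m s) + 2 * (q s * (sg x - sg s))].
  elim: k => [_|k IH kN].
    exists s; rewrite mulr0 addr0 !subrr mulr0 !mulr0 !addr0; split => //; first by lra.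
    by rewrite (si0l si (si_0 si)).
  have [x [Gx x1 sx x2 hx]] := IH (ltnW kN).
  have kE : s + eta * k.+1%:R = s + eta * k%:R + eta by rewrite -natr1 mulrDr mulr1 addrA.
  have kT : s + eta * k.+1%:R <= t.
    by rewrite -lerBrDl -etaN; apply: ler_wpM2l; [exact: ltW|rewrite ler_nat].
  move: kT hx x1 x2; rewrite kE; set a := s + eta * k%:R => kT hx x1 x2.
  have a0 : 0 <= a by rewrite (le_trans (le_trans s0 sx)).
  have [||y [Gy /andP[ay yb] hy]] := @q_m a (a + eta) a0; [lra|lra|].
  exists y; split => //; [lra|lra|lra|].
  have xy : x < y by lra.
  have [x0 yT] : 0 <= x /\ y <= T by split; lra.
  have := step Gs Gx Gy x0 xy yT.
  have := young (sg y - sg x) (q y) eta0.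
  have := sg_m x0 (ltW xy) yT; have := m_mono x0 (ltW xy) yT.
  have := m_mono s0 sx (ltW (lt_le_trans xy yT)).
  have e1 : a + eta - a = eta by lra.
  move: hy; rewrite e1 => hy.
  move: (B _ _) (B _ _) hx => b1 b2 hx h1 h2 h3 h4 h5.
  have h6 : (sg y - sg x) ^+ 2 / eta <= 2 * (m y - m x).
    rewrite ler_pdivrMr// (le_trans h3)// mulrAC ler_wpM2r ?subr_ge0//; lra.
  by move: h4 h5 hx hy h6; move: ((sg y - sg x) ^+ 2 / eta) (eta * q y ^+ 2) => z1 z2; lra.
have [x [Gx x1 sx x2 hx]] := claim N.+1 (leqnn _).
move: hx x1 x2; rewrite etaN (addrC s) subrK => hx x1 x2.
have sxt : x <= t by [].
have x0 : 0 <= x by lra.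
have fin : B (u t - u s) (u t - u s) <= B (u x - u s) (u x - u s) + e * (1 + Q ^+ 2).
  move: sxt; rewrite [in X in X -> _]le_eqVlt => /orP[/eqP ->|xt].
    by rewrite lerDl mulr_ge0// ltW.
  have := step Gs Gx Gt x0 xt tT; have := young (sg t - sg x) Q e0.
  have h3 := sg_m x0 (ltW xt) tT; have h4 := m_mono s0 sx (ltW (lt_le_trans xt tT)).
  have h5 := m_mono x0 (ltW xt) tT.
  have h6 : (sg t - sg x) ^+ 2 / e <= e.
    rewrite ler_pdivrMr// -expr2 (le_trans h3)// (le_trans _ etaD)// ler_pM//; rewrite /Dm; lra.
  move: (B _ _) (B _ _) => b1 b2; rewrite /Q mulrDr mulrDr (mulrDr e 1) mulr1.
  by move: ((sg t - sg x) ^+ 2 / e) h6 => z1; lra.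
have h1 := young (sg x - sg s) (q s) st0.
have h2 : (sg x - sg s) ^+ 2 / (t - s) <= Dm.
  have h3 := m_mono s0 sx (le_trans sxt tT); have h4 := m_mono x0 sxt tT.
  rewrite ler_pdivrMr// (le_trans (sg_m s0 sx (le_trans sxt tT)))// mulrC ler_pM//; rewrite /Dm; lra.
have h5 := m_mono x0 sxt tT.
move: fin; rewrite /e divfK ?gt_eqF// => fin; rewrite -/Dm.
move: fin hx h1 h2; rewrite (mulrC (q s)) -/Dm; move: (B _ _) (B _ _) ((sg x - sg s) ^+ 2 / (t - s)) ((t - s) * q s ^+ 2) => b1 b2 z1 z2.
rewrite /Dm; lra.
Qed.

Hypothesis mU : ucont m 0 T.

(** Two times are compared through an earlier time [s] at which [q] is controlled, which is why
    times near 0 are excluded. Each comparison costs at most 6 small increments and has to stay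
    below (e / 2)^2: hence 24. *)
Lemma hilbert_ucont s0 e : 0 < s0 -> 0 < e -> exists2 d, 0 < d &
  forall x y, G x -> G y -> s0 <= x <= T -> s0 <= y <= T -> `|x - y| < d -> sinorm B (u x - u y) <= e.
Proof.
move=> s00 e0; have e24 : 0 < e ^+ 2 / 24 by rewrite divr_gt0// exprn_gt0.
have [d1 d10 md] := mU e24.
pose d := Num.min (d1 / 3) (s0 / 2).
have d0 : 0 < d by rewrite lt_min !divr_gt0.
have [dd1 dds] : d <= d1 / 3 /\ d <= s0 / 2 by rewrite /d !ge_min !lexx orbT.
have main x y : G x -> G y -> s0 <= x -> x <= y -> y <= T -> y - x < d -> sinorm B (u x - u y) <= e.
  move=> Gx Gy sx xy yT yx.
  have [|||s [Gs /andP[s1 s2] hs]] := @q_m (x - d) x; [lra|lra|lra|].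
  have As := Au Gs.
  have bound z : G z -> x <= z -> z <= y -> sinorm B (u z - u s) <= e / 2.
    move=> Gz xz zy; have Az := Au Gz.
    have e2 : 0 <= e / 2 by lra.
    rewrite -(@ler_pXn2r _ 2)// ?nnegrE ?sinorm_ge0// (sinorm2 si).
    have [p1 p2 p3 p4] : [/\ 0 <= s, s < z, z <= T & 0 <= x - d] by split; lra.
    apply: (le_trans (partition_bound Gs Gz p1 p2 p3)).
    have i1 : 0 <= z <= T by apply/andP; split; lra.
    have i2 : 0 <= x - d <= T by apply/andP; split; lra.
    have i3 : `|z - (x - d)| < d1 by rewrite ger0_norm; lra.
    have := md _ _ i1 i2 i3; rewrite ler_norml => /andP[_ hm].
    have hm1 : m (x - d) <= m s by apply: m_mono; lra.
    have hm2 : m x <= m z by apply: m_mono; lra.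
    have q2 : (z - s) * q s ^+ 2 <= 2 * (m x - m (x - d)).
      apply: (@le_trans _ _ (2 * d * q s ^+ 2)).
        by rewrite ler_wpM2r ?sqr_ge0//; lra.
      by rewrite -mulrA ler_pM2l//; move: hs; rewrite opprB addrCA subrr addr0.
    have e4 : (e / 2) ^+ 2 = 6 * (e ^+ 2 / 24) by field.
    by rewrite e4; lra.
  have Ax := Au Gx; have Ay := Au Gy.
  have -> : u x - u y = (u x - u s) - (u y - u s) by rewrite opprB addrA subrK.
  apply: (le_trans (sinormB si (siB si Ax As) (siB si Ay As))).
  by have := bound x Gx (lexx x) xy; have := bound y Gy xy (lexx y); lra.
exists d => // x y Gx Gy /andP[sx xT] /andP[sy yT]; case: (leP x y) => [xy|/ltW yx].
  by rewrite distrC ger0_norm ?subr_ge0// => h; exact: main.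
rewrite ger0_norm ?subr_ge0// => h.
by rewrite (sinormC si (Au Gx) (Au Gy)); exact: main.
Qed.

End hilbert_continuity.

Section prim_linear.
Context (R : realType).
Local Notation leb := (@lebesgue_measure R).
Implicit Types (f g : R -> R).

Lemma integrable_setT_lin (c : R) f g : leb.-integrable setT (EFin \o f) -> leb.-integrable setT (EFin \o g) ->
  leb.-integrable setT (EFin \o (fun x => c * f x + g x)).
Proof.
move=> jf jg; have j := @integrableZl _ (measurableTypeR R) R leb setT measurableT c _ jf.
by have := @integrableD _ (measurableTypeR R) R leb setT measurableT _ _ j jg.
Qed.

Lemma prim_lin (c : R) f g t : leb.-integrable setT (EFin \o f) -> leb.-integrable setT (EFin \o g) ->
  prim (fun x => c * f x + g x) t = c * prim f t + prim g t.
Proof.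
move=> jf jg.
have if' : leb.-integrable `[0, t] (EFin \o f) by exact: integrableS jf.
have ig' : leb.-integrable `[0, t] (EFin \o g) by exact: integrableS jg.
have j : leb.-integrable `[0, t] (EFin \o (fun x => c * f x)).
  by have := @integrableZl _ (measurableTypeR R) R leb `[0, t]%classic (measurable_itv _) c _ if'.
by rewrite /prim RintegralD// RintegralZl.
Qed.

End prim_linear.

Section arithmetic.
Context (R : realFieldType).

Lemma cell_arith (s t T x y a r a' d d' d1 d2 : R) : 0 <= s -> t <= T -> s <= x -> x < a -> a < a' -> a' <= t ->
  a - x < d -> a' - a < d' -> a < r -> r < a' -> x < y -> y < a -> y < x + d' ->
  d <= d1 / 2 -> d <= d2 / 2 -> d' <= d ->
  [/\ [/\ s <= y, y < r, r <= t, 0 <= y & r <= T],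
      [/\ r - y < d1, `|a - r| < d', `|x - y| < d', `|r - a| < d' & `|y - x| < d'],
      [/\ s <= a <= t, s <= x <= t, s <= y <= t & s <= r <= t],
      [/\ 0 <= a <= T, 0 <= x <= T, 0 <= y <= T & 0 <= r <= T] &
      `|(a - x) - (r - y)| <= d' /\ forall z, y <= z -> z <= r -> 0 <= z <= T /\ `|z - a| < d2].
Proof.
move=> h1 h2 h3 h4 h5 h6 h7 h8 h9 h10 h11 h12 h13 h14 h15 h16.
have n (z1 z2 e : R) : z1 - z2 < e -> z2 - z1 < e -> `|z1 - z2| < e.
  by move=> ? ?; rewrite ltr_norml; apply/andP; split; lra.
split.
- by split; lra.
- by split; [lra|apply: n; lra|apply: n; lra|apply: n; lra|apply: n; lra].
- by split; apply/andP; split; lra.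
- by split; apply/andP; split; lra.
- split; first by apply: ltW; apply: n; lra.
  by move=> z z1 z2; split; [apply/andP; split; lra|apply: n; lra].
Qed.

Lemma weight_arith (W th b p : R) : 0 <= W -> 0 < th -> 0 <= 2 * b -> 0 <= p ->
  2 + (W + th + 2 * b) * p <= (1 + p) * (2 + W + th + 2 * b).
Proof. lra. Qed.

Lemma split_arith (b e z1 z2 z3 z4 : R) : b * (z2 - z1) <= b * (e - - e) ->
  - (b * (z3 - z4 + z1 - z2)) <= - (b * (z3 - z4)) + 2 * b * e.
Proof. lra. Qed.

Lemma pointwise_arith (ra rx rr ry iw X1 X2 Y1 Y2 P1 P2 K1 K2 F eta W th b pn : R) :
  rr - ry <= - iw - Y1 + K1 -> ra - rr <= eta -> - eta <= rx - ry -> - P1 <= iw - X1 ->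
  - X1 <= - X2 + eta * (W * pn) -> P1 <= P2 + th * eta * pn -> - Y1 <= - Y2 + 2 * b * (eta * pn) ->
  eta * (2 + (W + th + 2 * b) * pn) <= F -> K1 <= K2 -> ra - rx <= - X2 - Y2 + P2 + K2 + F.
Proof. lra. Qed.

Lemma energy_arith (a a' x b th th' C z1 z2 z3 z4 z5 z6 z7 z8 z9 z10 z11 z12 z13 : R) :
  (a' - a) * (z1 - z2) <= (a' - a) * (- (a - x) * z7 - b * (z7 - z8) + th * (a - x) * z9
    + (z12 - z13) * (C + th) + th' * (1 + z9)) ->
  (a' - a) * (- ((a - x) + b) * z7 + (b * z8 + ((th * (a - x) + th') * z9 + 0))) <=
    - ((a - x) + b) * (z3 - z4) + b * (z5 - z6) + (th * (a - x) + th') * (z11 - z10) ->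
  0 <= th * (a - x) * (a' - a) ->
  (a' - a) * (z1 - z2) <= - (a - x) * (z3 - z4) - b * (z3 - z4 - z5 + z6)
    + th * (a - x) * (a' + z11 - (a + z10)) + (a' - a) * (z12 - z13) * (C + th)
    + th' * (a' + z11 - (a + z10)).
Proof. lra. Qed.

End arithmetic.

(** * The energy inequality in an abstract Hilbert space *)

Section energy.
Context (R : realType) (V : lmodType R) (A : set V) (B : V -> V -> R).
Hypothesis si : semi_inner A B.
Local Notation leb := (@lebesgue_measure R).
Variables (T : R) (G : set R).
Local Notation I := (`]0, T[%classic : set R).
Hypothesis T0 : 0 < T.
Hypothesis GI : {ae leb, forall t, I t -> G t}.
Variables (w p : R -> V) (pn : R -> R).
Hypothesis Aw : forall x, A (w x).
Hypothesis Ap : forall r, G r -> A (p r).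
Hypothesis pn_int : leb.-integrable setT (EFin \o pn).
Hypothesis pn2_int : leb.-integrable setT (EFin \o (fun x => pn x ^+ 2)).
Hypothesis pn0 : forall x, 0 <= pn x.
Hypothesis p_pn : forall r, G r -> sinorm B (p r) <= pn r.
Hypothesis wp : forall c, A c -> exists f, [/\ leb.-integrable setT (EFin \o f),
  {ae leb, forall t, I t -> B c (p t) = f t} &
  forall x y, 0 <= x -> x <= y -> y <= T -> B c (w y - w x) = prim f y - prim f x].

(** Tested with the increment itself, the square of its norm is at most this norm times the
    increment of the primitive of [pn]; no vector-valued integral is formed. *)
Lemma w_dist x y : 0 <= x -> x <= y -> y <= T -> sinorm B (w y - w x) <= prim pn y - prim pn x.
Proof.
move=> x0 xy yT; set c := w y - w x; have Ac : A c := siB si (Aw y) (Aw x).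
have [f [jf fE fw]] := wp Ac; have c0 := sinorm_ge0 B c.
have := fw x y x0 xy yT; rewrite -/c -(sinorm2 si) => cE.
have Z : leb.-integrable setT (EFin \o (fun=> 0 : R)).
  by have := @integrable0 _ (measurableTypeR R) R leb setT.
have jp := integrable_setT_lin (sinorm B c) pn_int Z.
have G' : {ae leb, forall t, I t -> G t /\ B c (p t) = f t}.
  by apply: filterS2 GI fE => t h1 h2 It; split; [exact: h1|exact: h2].
have : prim f y - prim f x <= prim (fun r => sinorm B c * pn r + 0) y - prim (fun r => sinorm B c * pn r + 0) x.
  apply: (ae_prim_le G') => // r [Gr <-] _; rewrite addr0.
  by apply: (le_trans (si_le si Ac (Ap Gr))); rewrite ler_wpM2l// p_pn.
rewrite !prim_lin// opprD addrACA -mulrBr.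
have -> : prim (fun=> 0 : R) y - prim (fun=> 0) x = 0.
  by rewrite (primB Z)// /Rintegral integral0.
rewrite addr0 -cE expr2 => h; have [->|cn] := eqVneq (sinorm B c) 0.
  by rewrite subr_ge0; exact: prim_ge0.
by rewrite -(@ler_pM2l _ (sinorm B c))// lt0r cn.
Qed.

Let P2 := prim (fun x => pn x ^+ 2).

Lemma w_dist2 x y : 0 <= x -> x <= y -> y <= T -> sinorm B (w x - w y) ^+ 2 <= (y - x) * (P2 y - P2 x).
Proof.
move=> x0 xy yT; apply: le_trans (prim_sqr pn_int pn2_int x0 xy).
have h := w_dist x0 xy yT; have n0 := sinorm_ge0 B (w x - w y).
by rewrite lerXn2r ?nnegrE// ?(sinormC si (Aw x) (Aw y))// (le_trans _ h)// sinorm_ge0.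
Qed.

Lemma w_ucont e : 0 < e -> exists2 d, 0 < d &
  forall x y, 0 <= x <= T -> 0 <= y <= T -> `|x - y| < d -> sinorm B (w x - w y) <= e.
Proof.
move=> e0; have [d d0 dP] := prim_ucont T0 pn_int e0; exists d => // x y.
wlog xy : x y / x <= y => [hw xT yT h|].
  have [|/ltW yx] := leP x y; first by move=> xy; exact: hw.
  by rewrite (sinormC si (Aw x) (Aw y)); apply: hw => //; rewrite distrC.
move=> xT yT; rewrite distrC => h; have := dP _ _ yT xT h.
rewrite (sinormC si (Aw x) (Aw y)) => /(le_trans (ler_norm _)); apply: le_trans.
by apply: w_dist => //; [case/andP: xT|case/andP: yT].
Qed.

Variables (r0 k : R -> R) (Iw : R -> R -> R) (s t b C : R).
Hypothesis (s0 : 0 <= s) (st : s < t) (tT : t <= T) (Gs : G s) (Gt : G t).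
Hypothesis (b0 : 0 <= b) (C0 : 0 <= C).
Hypothesis k_mono : forall x y, s <= x -> x <= y -> y <= t -> k x <= k y.
Hypothesis r_ucont : ucont_on G r0 s t.
Hypothesis IwP : forall y r c e, G r -> 0 <= y -> y < r -> r <= T -> A c -> 0 <= e ->
  (forall x, y <= x <= r -> sinorm B (w x - c) <= e) ->
  `|Iw y r - (r - y) * B c (p r)| <= e * (r - y) * sinorm B (p r).
Hypothesis r_step : forall th, 0 < th -> exists2 d, 0 < d &
  forall y r, G y -> G r -> s <= y -> y < r -> r <= t -> r - y < d ->
    r0 r - r0 y <= - Iw y r - b * B (w r - w y) (p r) + (k r - k y) * (C + th).

(** [r_step] links times of [G] only. Here [y] is a time of [G] just after [x], and [r] ranges over
    the cell (a, a'); replacing [y] by [x] and [r] by [a], except inside [p r] and [pn r] and with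
    [k r] enlarged to [k a'], costs [th' * (1 + pn r)]. The bound can then be averaged over the
    cell. *)
Let pointwise rt th : 0 < th ->
  (forall e, 0 < e -> exists2 d, 0 < d & forall x y, s <= x <= t -> G y -> s <= y <= t ->
     `|x - y| < d -> `|rt x - r0 y| <= e) ->
  exists2 d, 0 < d & forall th', 0 < th' -> exists2 d', 0 < d' &
    forall x a a', s <= x -> x < a -> a < a' -> a' <= t -> a - x < d -> a' - a < d' ->
    forall r, G r -> a < r < a' ->
      rt a - rt x <= - (a - x) * B (w a) (p r) - b * (B (w a) (p r) - B (w x) (p r))
        + th * (a - x) * pn r + (k a' - k x) * (C + th) + th' * (1 + pn r).
Proof.
move=> th0 rtP; have [d1 d10 d1P] := r_step th0; have [d2 d20 d2P] := w_ucont th0.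
have [W W0 WP] : exists2 W, 0 <= W & forall x, s <= x <= t -> sinorm B (w x) <= W.
  exists (sinorm B (w s) + (prim pn t - prim pn s)).
    by rewrite addr_ge0 ?sinorm_ge0// subr_ge0 prim_ge0// ltW.
  move=> x /andP[sx xt]; rewrite -[w x](subrK (w s)) addrC.
  apply: (le_trans (sinormD si (Aw s) (siB si (Aw x) (Aw s)))); rewrite lerD2l.
  apply: (le_trans (w_dist s0 sx (le_trans xt tT))); rewrite lerD2r.
  by apply: prim_ge0 => //; exact: le_trans sx.
pose d := Num.min d1 d2 / 2.
have d0 : 0 < d by rewrite divr_gt0// lt_min d10.
have [dd1 dd2] : d <= d1 / 2 /\ d <= d2 / 2 by rewrite /d !ler_pM2r ?invr_gt0// !ge_min !lexx orbT.
(* [eta] bounds the error of each replacement, and [K] adds up the coefficients with which it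
   enters, those of 1 and of [pn r] alike. *)
exists d => // th' th'0; pose K := 2 + W + th + 2 * b; pose eta := th' / K.
have bb : 0 <= 2 * b by rewrite mulr_ge0.
have K0 : 0 < K by rewrite /K; move: W0 th0 bb; move: (2 * b) => z W0 th0 bb; lra.
have eta0 : 0 < eta by exact: divr_gt0.
have [e1 e10 e1P] := rtP _ eta0; have [e2 e20 e2P] := w_ucont eta0.
pose d' := Num.min (Num.min e1 e2) (Num.min eta d).
have d'0 : 0 < d' by rewrite !lt_min e10 e20 eta0 d0.
have [q1 q2 q3 q4] : [/\ d' <= e1, d' <= e2, d' <= eta & d' <= d].
  by split; rewrite /d' !ge_min lexx ?orbT.
exists d' => // x a a' sx xa aa' a't axd a'ad r Gr /andP[ar ra'].
have [ss st' tt] : [/\ 0 <= s, s < t & t <= T] by [].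
have c1 : 0 <= x by exact: le_trans sx.
have c2 : x < Num.min a (x + d') by rewrite lt_min xa ltrDl.
have c3 : Num.min a (x + d') <= T by rewrite ge_min (le_trans (ltW aa') (le_trans a't tt)).
have [y [Gy xy yy]] := conull_dense GI c1 c2 c3.
move: yy; rewrite lt_min => /andP[ya yx].
have Ax := Aw x; have Aa := Aw a; have Ay := Aw y; have Ar := Aw r; have Apr := Ap Gr.
have pr := p_pn Gr; have pr0 := sinorm_ge0 B (p r).
have [[sy yr rt_ y0 rT] [ryd ar' xy' ra_ yx_] [ast xst yst rst] [aT xT yT rT'] [dif0 zP]] :=
  cell_arith ss tt sx xa aa' a't axd a'ad ar ra' xy ya yx dd1 dd2 q4.
have h1 := d1P y r Gy Gr sy yr rt_ ryd.
have h2 : `|rt a - r0 r| <= eta by apply: e1P => //; exact: lt_le_trans q1.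
have h3 : `|rt x - r0 y| <= eta by apply: e1P => //; exact: lt_le_trans q1.
have h4 : `|Iw y r - (r - y) * B (w a) (p r)| <= th * (r - y) * sinorm B (p r).
  by apply: IwP => //; [exact: ltW|move=> z /andP[z1 z2]; have [zT za] := zP z z1 z2; exact: d2P].
have cs (c : V) e : A c -> sinorm B c <= e -> `|B c (p r)| <= e * pn r.
  by move=> Ac ce; apply: (le_trans (si_cs si Ac Apr)); apply: ler_pM => //; exact: sinorm_ge0.
have h5 : `|B (w a) (p r)| <= W * pn r by apply: cs => //; exact: WP.
have h6 : `|B (w r - w a) (p r)| <= eta * pn r.
  by apply: cs; [exact: (siB si)|apply: e2P => //; exact: lt_le_trans q2].
have h7 : `|B (w y - w x) (p r)| <= eta * pn r.
  by apply: cs; [exact: (siB si)|apply: e2P => //; exact: lt_le_trans q2].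
have E : B (w r - w y) (p r) = (B (w a) (p r) - B (w x) (p r)) + B (w r - w a) (p r) - B (w y - w x) (p r).
  by rewrite !(siBl si)//; ring.
have k1 : (k r - k y) * (C + th) <= (k a' - k x) * (C + th).
  apply: ler_wpM2r; first by rewrite addr_ge0// ltW.
  have [a'0 sy'] : s <= a' /\ r <= a' by split; [exact: le_trans sy (ltW (lt_trans yr ra'))|exact: ltW].
  by apply: lerB; apply: k_mono => //; [exact: (andP rst).1|exact: ltW|exact: (andP yst).2].
have dif : `|(a - x) - (r - y)| <= eta by exact: le_trans q3.
have t1 : - ((r - y) * B (w a) (p r)) <= - ((a - x) * B (w a) (p r)) + eta * (W * pn r).
  have : `|((a - x) - (r - y)) * B (w a) (p r)| <= eta * (W * pn r) by rewrite normrM ler_pM.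
  rewrite ler_norml mulrBl => /andP[_]; move: (eta * _) (_ * B (w a) _) (_ * B (w a) _) => u1 u2 u3 h.
  by rewrite -lerBlDl opprK addrC.
have t2 : th * (r - y) * sinorm B (p r) <= th * (a - x) * pn r + th * eta * pn r.
  rewrite -mulrDl; apply: ler_pM => //.
    by rewrite mulr_ge0 ?subr_ge0 ?ltW.
  rewrite -mulrDr ler_pM2l//; move: dif; rewrite ler_norml => /andP[+ _].
  by rewrite lerBrDr addrC lerBlDr.
have t3 : - (b * B (w r - w y) (p r)) <= - (b * (B (w a) (p r) - B (w x) (p r))) + 2 * b * (eta * pn r).
  rewrite E; move: h6 h7; rewrite !ler_norml => /andP[h6 _] /andP[_ h7].
  exact: split_arith (ler_wpM2l b0 (lerB h7 h6)).
have t4 : eta * (2 + (W + th + 2 * b) * pn r) <= th' * (1 + pn r).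
  rewrite /eta -mulrA ler_pM2l// mulrC ler_pdivrMr// /K.
  exact: weight_arith.
move: h1 h2 h3 h4; rewrite !ler_norml => h1 /andP[_ h2] /andP[h3 _] /andP[h4 _].
by rewrite mulNr; exact: pointwise_arith h1 h2 h3 h4 t1 t2 t3 t4 k1.
Qed.

(** Averaging over a cell turns the pairings of [w a] and [w x] with [p r] into pairings with w a' -
    w a, so that [energy_step] applies to the Gram function of [w]. *)
Lemma energy_core : r0 t + B (w t) (w t) / 2 <= r0 s + B (w s) (w s) / 2 + C * (k t - k s).
Proof.
have Gd : dense_in G s t.
  by move=> x y sx xy yt; apply: (conull_dense GI) => //; [exact: le_trans sx|exact: le_trans tT].
have [rt rtP] := ucont_extension Gd st r_ucont.
have rtE x : G x -> s <= x <= t -> rt x = r0 x.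
  move=> Gx xst; apply/eqP; rewrite -subr_eq0 -normr_le0; apply: ler_eps => e e0; rewrite add0r.
  by have [d d0] := rtP e e0; apply => //; rewrite subrr normr0.
have [sin tin] : s <= s <= t /\ s <= t <= t by rewrite !lexx (ltW st).
rewrite -(rtE t Gt tin) -(rtE s Gs sin).
have sub x : s <= x <= t -> 0 <= x <= T.
  by move=> /andP[? ?]; apply/andP; split; [exact: le_trans s0 _|exact: le_trans tT].
have nE x y : gram (fun x y => B (w x) (w y)) x y = sinorm B (w x - w y) ^+ 2.
  by rewrite -(gram_sinorm si).
(* The summand [x] in the third function absorbs the 1 in the error [th' * (1 + pn r)], whose
   integral over a cell is a' - a. *)
apply: (@energy_step R rt k (fun x => x + prim pn x) P2 (fun x y => B (w x) (w y)) s t b C) => //.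
- by move=> x y; exact: si_sym si _ _.
- by move=> x y; rewrite nE sqr_ge0.
- move=> x y sx xy yt; have x0 := le_trans s0 sx; split; first exact: k_mono.
    by rewrite lerD// prim_ge0.
  by apply: prim_ge0 => // z; exact: sqr_ge0.
- move=> x y sx xy yt; rewrite nE; apply: w_dist2 => //; [exact: le_trans sx|exact: le_trans tT].
- move=> e e0; have e2 : 0 < e / 2 by lra.
  have [d d0 dP] := rtP _ e2; exists (d / 2); first by lra.
  move=> x y xst yst xy; have d2 : 0 < d / 2 by lra.
  have [z [Gz zst xz]] := dense_in_ball Gd st xst d2.
  have h1 : `|rt x - r0 z| <= e / 2 by apply: dP => //; lra.
  have h2 : `|rt y - r0 z| <= e / 2.
    apply: dP => //; rewrite -(subrKA x) (le_lt_trans (ler_normD _ _))// distrC; lra.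
  by rewrite -(subrKA (r0 z)) (le_trans (ler_normD _ _))// (distrC (r0 z)); lra.
- move=> e e0; pose W := sinorm B (w s) + (prim pn t - prim pn s).
  have W0 : 0 <= W by rewrite addr_ge0 ?sinorm_ge0// subr_ge0 prim_ge0// ltW.
  have WP x : s <= x <= t -> sinorm B (w x) <= W.
    move=> /andP[sx xt]; rewrite -[w x](subrK (w s)) addrC.
    apply: (le_trans (sinormD si (Aw s) (siB si (Aw x) (Aw s)))); rewrite lerD2l.
    apply: (le_trans (w_dist s0 sx (le_trans xt tT))); rewrite lerD2r.
    by apply: prim_ge0 => //; exact: le_trans sx.
  have W1 : 0 < 2 * W + 1 by lra.
  have [d d0 dP] := w_ucont (divr_gt0 e0 W1); exists d => // x y xst yst xy.
  rewrite -!(sinorm2 si) subr_sqr normrM.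
  have h1 := le_trans (sinorm_dist si (Aw x) (Aw y)) (dP _ _ (sub _ xst) (sub _ yst) xy).
  have h2 : `|sinorm B (w x) + sinorm B (w y)| <= 2 * W + 1.
    by rewrite ger0_norm ?addr_ge0 ?sinorm_ge0//; have := WP _ xst; have := WP _ yst; lra.
  by apply: (le_trans (ler_pM _ _ h1 h2)) => //; rewrite divfK// gt_eqF.
- move=> e e0; have [d d0 dP] := prim_ucont T0 pn2_int e0; exists d => // x y xst yst.
  by apply: dP; exact: sub.
move=> th th0; have [d d0 dP] := pointwise th0 rtP; exists d => // th' th'0.
have [d' d'0 {}dP] := dP th' th'0; exists d' => // x a a' sx xa aa' a't axd a'ad.
have {}dP := dP x a a' sx xa aa' a't axd a'ad.
have [fa [ja faE fa_w]] := wp (Aw a); have [fx [jx fxE fx_w]] := wp (Aw x).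
have [a0 a'T] : 0 <= a /\ a' <= T by split; [exact: le_trans s0 (le_trans sx (ltW xa))|exact: le_trans tT].
have Z : leb.-integrable setT (EFin \o (fun=> 0 : R)).
  by have := @integrable0 _ (measurableTypeR R) R leb setT.
(* The part of the bound that depends on [r]; at some good [r] in the cell it is at most its
   mean. *)
pose h r := - ((a - x) + b) * fa r + (b * fx r + ((th * (a - x) + th') * pn r + 0)).
have j1 := integrable_setT_lin (th * (a - x) + th') pn_int Z.
have j2 := integrable_setT_lin b jx j1.
have jh : leb.-integrable setT (EFin \o h) by exact: integrable_setT_lin ja j2.
have G' : {ae leb, forall r, I r -> [/\ G r, B (w a) (p r) = fa r & B (w x) (p r) = fx r]}.
  by apply: filterS3 GI faE fxE => r h1 h2 h3 Ir; split; [exact: h1|exact: h2|exact: h3].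
have [r [[Gr e1 e2] rin hr]] := average_point G' jh a0 aa' a'T.
have := dP r Gr rin; rewrite e1 e2 => hp.
have p0 : prim (fun=> 0 : R) a' - prim (fun=> 0) a = 0.
  by rewrite (primB Z a0 (ltW aa')) /Rintegral integral0.
have hE : prim h a' - prim h a = - ((a - x) + b) * (prim fa a' - prim fa a) + b * (prim fx a' - prim fx a)
   + (th * (a - x) + th') * (prim pn a' - prim pn a).
  rewrite /h !(prim_lin _ _ ja j2) !(prim_lin _ _ jx j1) !(prim_lin _ _ pn_int Z).
  by move: p0 => /eqP; rewrite subr_eq0 => /eqP ->; ring.
have sBr c y z : A c -> B c (w y - w z) = B c (w y) - B c (w z).
  by move=> Ac; exact: (siBr si (Aw y) (Aw z) Ac).
have := fa_w _ _ a0 (ltW aa') a'T; have := fx_w _ _ a0 (ltW aa') a'T; rewrite !sBr// => ex ea.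
move: hr; rewrite hE -ea -ex /h => hr.
have aa0 : 0 < a' - a by rewrite subr_gt0.
have mul := ler_wpM2l (ltW aa0) hp.
apply: energy_arith mul hr _.
by rewrite mulr_ge0 ?mulr_ge0// ltW// subr_gt0.
Qed.

End energy.

(** * Data of a weak solution *)

Section time_forms.
Context (R : realType) (X : Defs.space R) (T : R).
Hypothesis SX : seminormed X.
Hypothesis T0 : 0 < T.
Local Notation leb := (@lebesgue_measure R).
Local Notation I := (`]0, T[%classic : set R).
Implicit Types (u w uc : R -> X) (f g : R -> R).

Let integrable_patch g : leb.-integrable I (EFin \o g) -> leb.-integrable setT (EFin \o (g \_ I)).
Proof.
move=> ig; rewrite -restrict_EFin.
by apply/(@integrable_mkcond _ (measurableTypeR R) R leb I _ (measurable_itv _)).1.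
Qed.

Lemma Lp1_rep u : (forall x : X, 0 <= snorm X x) -> bochner_Lp T 1%:E u -> exists g, norm_rep T g u /\ forall t, 0 <= g t.
Proof.
move=> sn [[mu _] [g /Lfun1_integrable ig gu]]; exists ((fun t => `|g t|) \_ I); split; last first.
  by move=> t; rewrite patchE; case: ifP.
split.
  apply: integrable_patch; apply: (@integrableS _ (measurableTypeR R) R leb setT) => //.
  exact: integrable_norm ig.
apply: filterS gu => t gt It; rewrite patch1// -(gt It) ger0_norm//; exact: sn.
Qed.

Lemma Lp2_rep u : (forall x : X, 0 <= snorm X x) -> bochner_Lp T 2%:E u -> exists g, [/\ norm_rep T g u,
  leb.-integrable setT (EFin \o (fun t => g t ^+ 2)) & forall t, 0 <= g t].
Proof.
move=> sn [[mu _] [g g2 gu]]; have ig2 := Lfun2_integrable_sqr g2.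
have mg : measurable_fun setT g by move: g2; rewrite inE => /andP[/[!inE]].
exists ((fun t => `|g t|) \_ I); split; last first.
- by move=> t; rewrite patchE; case: ifP.
- rewrite (_ : (fun t => _) = ((fun t => g t ^+ 2) \_ I)); last first.
    apply/funext => t; rewrite !patchE; case: ifP => _; last by rewrite expr0n.
    by rewrite real_normK ?num_real.
  by apply: integrable_patch; apply: (@integrableS _ (measurableTypeR R) R leb setT).
split; last first.
  by apply: filterS gu => t gt It; rewrite patch1// -(gt It) ger0_norm//; exact: sn.
apply: integrable_patch.
have i1 : leb.-integrable I (EFin \o (fun=> 1)).
  by apply: (@itv_bounded_integrable _ _ _ 1) => // x; rewrite normr1.
have i2 : leb.-integrable I (EFin \o (fun t => g t ^+ 2)) by exact: integrableS ig2.
have i3 := @integrableD _ (measurableTypeR R) R leb I (measurable_itv _) _ _ i1 i2.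
apply: (@le_integrable _ (measurableTypeR R) R leb I (measurable_itv _) _ _ _ _ i3).
  by apply/measurable_EFinP; apply: measurable_funTS; exact: measurableT_comp.
move=> t It /=; rewrite lee_fin normr_id [leRHS]ger0_norm ?addr_ge0 ?sqr_ge0//.
have := sqr_ge0 (`|g t| - 1); rewrite sqrrB1 real_normK ?num_real//.
have := sqr_ge0 (g t); move: (g t ^+ 2) `|g t| => y x; lra.
Qed.

Lemma continuous_eq (f g : R -> R) (G : set R) : {ae leb, forall t, I t -> G t} ->
  (forall x, 0 <= x <= T -> forall e, 0 < e -> exists2 d, 0 < d &
     forall y, 0 <= y <= T -> `|x - y| < d -> `|f x - f y| <= e) ->
  (forall x, 0 <= x <= T -> forall e, 0 < e -> exists2 d, 0 < d &
     forall y, 0 <= y <= T -> `|x - y| < d -> `|g x - g y| <= e) ->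
  (forall x, G x -> f x = g x) -> forall x, 0 <= x <= T -> f x = g x.
Proof.
move=> GI cf cg fg x xT; apply/eqP; rewrite -subr_eq0 -normr_le0; apply: ler_eps => e e0.
have e2 : 0 < e / 2 by lra.
have [d1 d10 h1] := cf x xT _ e2; have [d2 d20 h2] := cg x xT _ e2.
have d0 : 0 < Num.min d1 d2 by rewrite lt_min d10.
have [z [Gz zT]] := dense_in_ball (conull_dense GI) T0 xT d0.
rewrite lt_min => /andP[xz1 xz2]; rewrite add0r -(subrKA (f z)) (le_trans (ler_normD _ _))//.
have := h1 z zT xz1; have := h2 z zT xz2; rewrite -(fg z Gz) (distrC (f z) (g x)); lra.
Qed.

Lemma continuous_form uc (l : X -> R) C : bochner_C T uc -> bounded_form l C ->
  forall x, 0 <= x <= T -> forall e, 0 < e -> exists2 d, 0 < d &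
    forall y, 0 <= y <= T -> `|x - y| < d -> `|l (uc x) - l (uc y)| <= e.
Proof.
move=> cu lC x xT e e0; have [|mx hx] := cu x; first by rewrite in_itv.
have C0 : 0 < `|C| + 1 by apply: ltr_wpDl.
have [d d0 dP] := near_within_eps hx (divr_gt0 e0 C0); exists d => // y yT xy.
have [|my _] := cu y; first by rewrite in_itv.
rewrite distrC; apply: (le_trans (bf_boundD SX lC my mx)).
have := dP y; rewrite /= in_itv/= => /(_ yT xy).
by rewrite sub0r normrN ger0_norm ?(sn_ge0 SX)// ler_pdivlMr// mulrC.
Qed.

(** The identity with a primitive holds almost everywhere and both sides are continuous, so it holds
    on [0, T]; since the primitive vanishes at 0, the constant is the initial value. *)
Lemma continuous_repr_form u w uc (l : X -> R) C gu gw : bounded_form l C ->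
  weak_time_derivative T u w -> strongly_measurable T u -> strongly_measurable T w ->
  norm_rep T gu u -> norm_rep T gw w -> continuous_repr T u uc ->
  exists f, [/\ represents T l f w, leb.-integrable setT (EFin \o f) &
    forall t, 0 <= t <= T -> l (uc t) = l (uc 0) + prim f t].
Proof.
move=> lC uw su sw nu nw [cu eu].
have [f0 rf0] := strongly_measurable_form SX lC su; have [f rf] := strongly_measurable_form SX lC sw.
have [c hc] := weak_time_derivative_form SX lC T0 uw rf0 rf nu nw.
have jf := represents_integrable SX lC rf nw.
exists f; split=> //.
have [mu _] := su.
have uE : {ae leb, forall t, I t -> l (uc t) = c + prim f t}.
  apply: filterS3 hc eu mu => t h1 h2 h3 It; rewrite /prim -h1//.
  have [|mt _] := cu t; first by move: It; rewrite /= !in_itv/= => /andP[/ltW -> /ltW ->].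
  apply/eqP; rewrite -subr_eq0 -normr_le0 (le_trans (bf_boundD SX lC mt (h3 It)))//.
  by rewrite (h2 It) mulr0.
have main : forall t, 0 <= t <= T -> l (uc t) = c + prim f t.
  apply: (@continuous_eq _ _ [set t | l (uc t) = c + prim f t] uE) => //.
    exact: continuous_form lC.
  move=> x xT e e0; have [d d0 dP] := prim_ucont T0 jf e0; exists d => // y yT xy.
  by rewrite opprD addrACA subrr add0r; exact: dP.
have z0 : (0 : R) <= (0 : R) <= T by rewrite lexx ltW.
move=> t tT; rewrite (main _ tT) (main _ z0).
have -> : prim f 0 = 0.
  by rewrite /prim set_itv1 /Rintegral integral_set1.
by rewrite addr0.
Qed.

End time_forms.

Section clip.
Context (R : realType) (T : R).
Hypothesis T0 : 0 < T.
Local Notation leb := (@lebesgue_measure R).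
Local Notation I := (`]0, T[%classic : set R).

Definition clip (t : R) : R := Num.max 0 (Num.min t T).

Lemma clip_itv t : 0 <= clip t <= T.
Proof. by rewrite /clip le_max lexx/= ge_max ltW// ge_min lexx orbT. Qed.

Lemma clip_id t : 0 <= t <= T -> clip t = t.
Proof. by move=> /andP[t0 tT]; rewrite /clip (min_idPl tT) (max_idPr t0). Qed.

Lemma clip_dist x y : `|clip x - clip y| <= `|x - y|.
Proof.
wlog xy : x y / x <= y => [hw|].
  have [|/ltW yx] := leP x y; first exact: hw.
  by rewrite distrC (distrC x); exact: hw.
rewrite distrC (distrC x) (ger0_norm (_ : 0 <= y - x)) ?subr_ge0//.
have TT := T0; rewrite ler_norml /clip.
by case: (leP x T) => xT; case: (leP y T) => yT; rewrite ?(max_idPr (ltW T0));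
  case: (leP 0 x) => x0; case: (leP 0 y) => y0; apply/andP; split; lra.
Qed.

Lemma prim0 (f : R -> R) : prim f 0 = 0.
Proof. by rewrite /prim set_itv1 /Rintegral integral_set1. Qed.

Lemma ae_prim_eq (f g : R -> R) t : leb.-integrable setT (EFin \o f) -> leb.-integrable setT (EFin \o g) ->
  0 <= t -> t <= T -> {ae leb, forall r, I r -> f r = g r} -> prim f t = prim g t.
Proof.
move=> jf jg t0 tT fg; apply/eqP; rewrite eq_le.
have h1 : prim f t - prim f 0 <= prim g t - prim g 0.
  by apply: (@ae_prim_le _ T [set r | f r = g r]) => // r /= -> _.
have h2 : prim g t - prim g 0 <= prim f t - prim f 0.
  by apply: (@ae_prim_le _ T [set r | f r = g r]) => // r /= -> _.
by move: h1 h2; rewrite !prim0 !subr0 => -> ->.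
Qed.

Lemma prim_patch (f : R -> R) t : 0 <= t -> t <= T -> prim (f \_ `[0, T]) t = prim f t.
Proof.
move=> t0 tT; apply: eq_Rintegral => r; rewrite inE/= in_itv/= => /andP[r0 rt].
by rewrite patchE mem_set//= in_itv/= r0 (le_trans rt tT).
Qed.

End clip.

Section solution.
Context (R : realType) (d : nat) (Omega : set 'rV[R]_d) (T : R).
Local Notation leb := (@lebesgue_measure R).
Local Notation I := (`]0, T[%classic : set R).
Local Notation L2 := (L2 Omega).
Local Notation L2vec := (L2vec Omega).
Local Notation H10 := (H10 Omega).
Local Notation Hm1 := (Hm1 Omega).
Local Notation ip := (ip Omega).
Local Notation ipvec := (ipvec Omega).
Local Notation grad := (grad Omega).
Local Notation siL := (L2_si Omega).
Local Notation siV := (L2vec_si Omega).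

(* A weak solution (v, h) at the times of a conull set G: v is replaced by a continuous
   representative extended by constants outside [0, T], nabla h by - v', and the second equation
   is integrated in time; n is the norm of v' in L^2 and q that of nu(h) in H^1_0. *)
Record solution_data (b : R) (nu : R -> R) (h0 : 'rV[R]_d -> R^o) (vc : R -> 'rV[R]_d -> 'rV[R]_d)
    (h : R -> 'rV[R]_d -> R^o) (G : set R) (dv : R -> 'rV[R]_d -> 'rV[R]_d) (n q : R -> R) : Prop := SolutionData {
  sd_G : {ae leb, forall t, I t -> G t};
  sd_vc : forall t, member L2vec (vc t);
  sd_cont : forall c, member L2vec c -> continuous (fun t => ipvec c (vc t));
  sd_n : leb.-integrable setT (EFin \o n);
  sd_n2 : leb.-integrable setT (EFin \o (fun t => n t ^+ 2));
  sd_n0 : forall t, 0 <= n t;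
  sd_dv : forall t, G t -> member L2vec (dv t) /\ sinorm ipvec (dv t) = n t;
  sd_vdv : forall c, member L2vec c -> exists f, [/\ leb.-integrable setT (EFin \o f),
    {ae leb, forall t, I t -> ipvec c (dv t) = f t} &
    forall x y, 0 <= x -> x <= y -> y <= T -> ipvec c (vc y - vc x) = prim f y - prim f x];
  sd_q : leb.-integrable setT (EFin \o q);
  sd_q2 : leb.-integrable setT (EFin \o (fun t => q t ^+ 2));
  sd_q0 : forall t, 0 <= q t;
  sd_h : forall t, G t -> [/\ member H10 (h t), member H10 (nu \o h t) & snorm H10 (nu \o h t) = q t];
  sd_grad : forall t c, G t -> member L2vec c -> ipvec c (grad (h t)) = - ipvec c (dv t);
  sd_nu : forall t xi, G t -> 0 <= t <= T -> member H10 xi ->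
    ip (nu \o h t) xi = ip (nu \o h0) xi + \int[leb]_(r in `[0, t]) ipvec (grad xi) (vc r)
      + b * ipvec (grad xi) (vc t - vc 0) }.

Hypotheses (oO : open Omega) (bO : bounded_set Omega) (T0 : 0 < T).

Lemma L2_to_Hm1_member u : member L2 u -> member Hm1 (L2_to_Hm1 Omega u).
Proof.
move=> mu; split=> [c x y hx hy|].
  by rewrite /L2_to_Hm1 (siDr siL (siZ siL c (H10_L2 hx)) (H10_L2 hy) mu) (siZr siL c (H10_L2 hx) mu).
exists (sinorm ip u) => x hx; apply: (le_trans (si_cs siL mu (H10_L2 hx))).
by apply: ler_wpM2l; [exact: sinorm_ge0|exact: (H10_le hx).1].
Qed.

(** [G] collects all properties that hold at almost every time. The first equation replaces b nabla
    h by - b v' in the second, so that integration in time leaves only [v] and its increment. *)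
Lemma solution_dataP (a b M : R) v0 h0 v h vc : (forall u, member L2 u -> member L2 (nu a M \o u)) ->
  weak_solution a b M Omega T v0 h0 v h -> continuous_repr (X := L2vec) T v vc ->
  exists G dv n q, solution_data b (nu a M) h0 (fun t => vc (clip T t)) h G dv n q.
Proof.
move=> nuL2 [[_ mh0] _ [_ hH10 nuH10] [dv [dnu [v_dv nu_dnu eqs]]] [_ [uc uc_repr uc0]]] vcP.
have [vL2 dvL2 wv] := v_dv; have [nuLm dnuLm wnu] := nu_dnu.
have SV := L2vec_seminormed Omega.
have [gv [rv _ _]] := Lp2_rep (sn_ge0 SV) vL2.
have [n [rn n2 n0]] := Lp2_rep (sn_ge0 SV) dvL2.
have [gnu [rnu _ _]] := Lp2_rep (sn_ge0 (Hm1_seminormed Omega)) nuLm.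
have [gdnu [rdnu _ _]] := Lp2_rep (sn_ge0 (Hm1_seminormed Omega)) dnuLm.
have [q [rq q2 q0]] : exists g, [/\ norm_rep (X := H10) T g (fun t => nu a M \o h t),
    leb.-integrable setT (EFin \o (fun t => g t ^+ 2)) & forall t, 0 <= g t].
  by apply: Lp2_rep nuH10; exact: H10_snorm_ge0.
have [svL _] := vL2; have [sdvL _] := dvL2; have [snuL _] := nuLm; have [sdnuL _] := dnuLm.
have [[mhH _] _] := hH10; have [[mnuH _] _] := nuH10.
have [cvc evc] := vcP; have [cuc euc] := uc_repr.
have [mdv _] := sdvL; have [mv _] := svL; have [mnuL _] := snuL.
pose w t := vc (clip T t).
have mw t : member L2vec (w t) by have [|] := cvc (clip T t); rewrite ?in_itv ?clip_itv.
have mvc t : 0 <= t <= T -> member L2vec (vc t) by move=> tT; have [|] := cvc t; rewrite ?in_itv.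
pose G t := [/\ [/\ I t, member L2vec (dv t), snorm L2vec (dv t) = n t & snorm L2vec (vc t - v t) = 0],
  [/\ member H10 (h t), member H10 (nu a M \o h t), snorm H10 (nu a M \o h t) = q t & member L2vec (v t)],
  snorm Hm1 (uc t - L2_to_Hm1 Omega (nu a M \o h t)) = 0 &
  (forall phi, member L2vec phi -> ipvec (dv t) phi + ipvec (grad (h t)) phi = 0) /\
  (forall xi, member H10 xi -> dnu t xi - ipvec (v t) (grad xi) + b * ipvec (grad (h t)) (grad xi) = 0)].
have GI : {ae leb, forall t, I t -> G t}.
  have h1 : {ae leb, forall t, I t -> [/\ I t, member L2vec (dv t), snorm L2vec (dv t) = n t & snorm L2vec (vc t - v t) = 0]}.
    by apply: filterS3 mdv rn.2 evc => t e1 e2 e3 It; split; [|exact: e1|exact: e2|exact: e3].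
  have h2 : {ae leb, forall t, I t -> [/\ member H10 (h t), member H10 (nu a M \o h t), snorm H10 (nu a M \o h t) = q t & member L2vec (v t)]}.
    have h3 : {ae leb, forall t, I t -> member H10 (h t) /\ member H10 (nu a M \o h t)}.
      by apply: filterS2 mhH mnuH => t e1 e2 It; split; [exact: e1|exact: e2].
    by apply: filterS3 h3 rq.2 mv => t e1 e2 e3 It; have [? ?] := e1 It; split=> //; [exact: e2|exact: e3].
  have h3 : {ae leb, forall t, I t -> snorm Hm1 (uc t - L2_to_Hm1 Omega (nu a M \o h t)) = 0 /\
    ((forall phi, member L2vec phi -> ipvec (dv t) phi + ipvec (grad (h t)) phi = 0) /\
     (forall xi, member H10 xi -> dnu t xi - ipvec (v t) (grad xi) + b * ipvec (grad (h t)) (grad xi) = 0))}.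
    by apply: filterS2 euc eqs => t e1 e2 It; split; [exact: e1|exact: e2].
  by apply: filterS3 h1 h2 h3 => t e1 e2 e3 It; have [? ?] := e3 It; split=> //; [exact: e1|exact: e2].
have vdv c : member L2vec c -> exists f, [/\ leb.-integrable setT (EFin \o f),
    {ae leb, forall t, I t -> ipvec c (dv t) = f t} &
    forall x y, 0 <= x -> x <= y -> y <= T -> ipvec c (w y - w x) = prim f y - prim f x].
  move=> mc; have form := inner_form siV (@L2vec_snorm _ _ Omega) mc.
  have [f [[mf f0 fE] jf fP]] := continuous_repr_form SV T0 form wv svL sdvL rv rn vcP.
  exists f; split=> //.
    by apply: filterS fE => t e It; have [_ <-] := e It; exact: (si_sym siV).
  move=> x y x0 xy yT; rewrite /w !clip_id ?x0 ?(le_trans x0 xy)//= ?(le_trans xy yT)//.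
  have xT : 0 <= x <= T by rewrite x0 (le_trans xy yT).
  have yT' : 0 <= y <= T by rewrite yT (le_trans x0 xy).
  rewrite (siBr siV (mvc _ yT') (mvc _ xT) mc) !(si_sym siV c) (fP y yT') (fP x xT).
  by rewrite opprD addrACA subrr add0r.
have wcont c : member L2vec c -> continuous (fun t => ipvec c (w t)).
  move=> mc; have form := inner_form siV (@L2vec_snorm _ _ Omega) mc.
  move=> x; apply/cvgrPdist_le => e e0.
  have [dd dd0 ddP] := continuous_form SV cvc form (clip_itv T0 x) e0.
  near=> y; rewrite !(si_sym siV c); apply: ddP; first exact: clip_itv.
  apply: (le_lt_trans (clip_dist T0 x y)); near: y.
  by have := @nbhsx_ballx _ _ x dd dd0.
exists G, dv, n, q; split=> //.
- exact: rn.1.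
- by move=> t [[_ m1 m2 _] _ _ _]; rewrite -(L2vec_snorm m1).
- exact: rq.1.
- by move=> t [_ [m1 m2 m3 _] _ _].
- move=> t c [_ [m1 _ _ _] _ [e1 _]] mc.
  by have := e1 c mc; rewrite !(si_sym siV c) => /eqP; rewrite addrC addr_eq0 => /eqP.
move=> t xi Gt tT hxi.
have form := Hm1_form oO bO hxi.
have [f [[mf f0 fE] jf fP]] := continuous_repr_form (Hm1_seminormed Omega) T0 form wnu snuL sdnuL rnu rdnu uc_repr.
have z0 : (0 : R) <= (0 : R) <= T by rewrite lexx ltW.
(* Zero distance in H^{-1} means equality on every [xi]; this identifies the continuous
   representative at [t] and at 0. *)
have ucE r F : 0 <= r <= T -> member Hm1 F -> snorm Hm1 (uc r - F) = 0 -> uc r xi = F xi.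
  move=> rT mF r0; have [|mu _] := cuc r; first by rewrite in_itv.
  have md := snB (Hm1_seminormed Omega) mu mF.
  apply/eqP; rewrite -subr_eq0 -normr_le0.
  by have := Hm1_eval oO bO md hxi; rewrite r0 mulr0.
have [_ [_ hnu _ _] e1 _] := Gt.
have <- : uc t xi = ip (nu a M \o h t) xi.
  exact: (ucE t _ tT (L2_to_Hm1_member (H10_L2 hnu)) e1).
have <- : uc 0 xi = ip (nu a M \o h0) xi.
  exact: (ucE 0 _ z0 (L2_to_Hm1_member (nuL2 _ mh0)) uc0).
rewrite (fP t tT) -addrA; congr (_ + _).
have mg := H10_grad hxi; have [f2 [jf2 f2E f2P]] := vdv _ mg.
have [t0 tT'] := andP tT.
have w0 : clip T t = t by exact: clip_id.
have -> : ipvec (grad xi) (vc (clip T t) - vc (clip T 0)) = prim f2 t.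
  by rewrite (f2P 0 t)// prim0 subr0.
pose k r := ipvec (grad xi) (w r).
have ck : continuous k by exact: wcont.
(* [k] is constant beyond [0, T], hence in general not integrable on the line; cutting it off leaves
   its primitive on [0, T] unchanged. *)
have jk : leb.-integrable setT (EFin \o (k \_ `[0, T])).
  rewrite -restrict_EFin.
  apply/(@integrable_mkcond _ (measurableTypeR R) R leb `[0, T]%classic _ (measurable_itv _)).1.
  exact: continuous_itv_integrable.
rewrite -/(prim k t) -(prim_patch k t0 tT') addrC -prim_lin//.
apply: (@ae_prim_eq R T) => //; first exact: integrable_setT_lin.
apply: filterS3 fE GI f2E => r r1 r2 r3 Ir; have [_ <-] := r1 Ir; have {}r3 := r3 Ir.
have [[_ mdvr _ evr] [hr _ _ mvr] _ [eq1 eq2]] := r2 Ir.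
have rT : 0 <= r <= T by move: Ir; rewrite /= in_itv/= => /andP[/ltW -> /ltW ->].
have -> : (k \_ `[0, T]) r = ipvec (v r) (grad xi).
  rewrite patchE mem_set/= ?in_itv//= /k /w clip_id// (si_sym siV).
  apply/eqP; rewrite -subr_eq0 -(siBl siV (mvc _ rT) mvr mg) -normr_le0.
  have md := siB siV (mvc _ rT) mvr.
  by rewrite (le_trans (si_cs siV md mg))// -(L2vec_snorm md) evr mul0r.
rewrite -r3 (si_sym siV (grad xi)).
have := eq1 _ mg => /eqP; rewrite addr_eq0 => /eqP ->.
have := eq2 _ hxi => /eqP; rewrite addr_eq0 subr_eq => /eqP ->.
by rewrite mulrN.
Unshelve. all: by end_near. Qed.

End solution.

Lemma rate_arith (R : realFieldType) (A b x y N1 N2 M1 M2 Q1 Q2 : R) : x <= y -> Q1 <= Q2 ->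
  (N2 - N1) ^+ 2 <= (y - x) * (M2 - M1) ->
  (A * y + b * N2 - (A * x + b * N1)) ^+ 2 <=
  (y - x) * (2 * A ^+ 2 * y + 2 * b ^+ 2 * M2 + Q2 - (2 * A ^+ 2 * x + 2 * b ^+ 2 * M1 + Q1)).
Proof.
move=> xy hq hn.
have h1 := ler_wpM2l (mulr_ge0 (ler0n _ 2) (sqr_ge0 b)) hn.
have h2 : 0 <= (y - x) * (Q2 - Q1) by rewrite mulr_ge0// subr_ge0.
have h3 := sqr_ge0 (A * (y - x) - b * (N2 - N1)).
move: h1 h2 h3; clear; lra.
Qed.

(** * Estimates for one solution *)

Section single_solution.
Context (R : realType) (d : nat) (Omega : set 'rV[R]_d) (T : R).
Local Notation leb := (@lebesgue_measure R).
Local Notation mu := (lebesgue_row R d).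
Local Notation I := (`]0, T[%classic : set R).
Local Notation L2 := (L2 Omega).
Local Notation L2vec := (L2vec Omega).
Local Notation H10 := (H10 Omega).
Local Notation ip := (ip Omega).
Local Notation ipvec := (ipvec Omega).
Local Notation grad := (grad Omega).
Local Notation siL := (L2_si Omega).
Local Notation siV := (L2vec_si Omega).
Hypotheses (oO : open Omega) (bO : bounded_set Omega) (T0 : 0 < T).
Variables (a delta L : R) (nu m Psi : R -> R).
Hypothesis law : cutoff_law a delta L nu m Psi.

Lemma nu_L2 u : member L2 u -> member L2 (nu \o u).
Proof.
move=> mu'; apply: (l2_lip (L := L)) => //.
- by move=> x; exact: (law_nu_continuous law).
- exact: law_0 law.
- exact: ltW (L_gt0 law).
- by move=> x; have := law_nu_lip law x 0; rewrite (law_0 law) !subr0.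
Qed.

Lemma nu_dist u w : member L2 u -> member L2 w ->
  sinorm ip ((nu \o u) - (nu \o w) : L2) <= L * sinorm ip (u - w) /\
  delta * sinorm ip (u - w) <= sinorm ip ((nu \o u) - (nu \o w) : L2).
Proof.
move=> lu lw; have L0 := ltW (L_gt0 law); have d0 := ltW (law_d0 law).
have l1 := siB siL lu lw; have l2 := siB siL (nu_L2 lu) (nu_L2 lw).
have sq (k : R) x y : 0 <= k -> member L2 x -> member L2 y ->
    (forall z, Omega z -> `|x z| <= k * `|y z|) -> sinorm ip x <= k * sinorm ip y.
  move=> k0 lx ly xy.
  rewrite -(@ler_pXn2r _ 2)// ?nnegrE ?mulr_ge0 ?sinorm_ge0// exprMn !(sinorm2 siL).
  rewrite /Defs.ip -(IonZ (k ^+ 2) (l2_mul ly ly)); apply: Ion_le; first exact: l2_mul.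
    exact: int_onZ (l2_mul ly ly).
  move=> z Oz; rewrite -!expr2 -(real_normK (num_real (x z))) -(real_normK (num_real (y z))) -exprMn.
  by rewrite lerXn2r ?nnegrE ?mulr_ge0//; exact: xy.
split; first by apply: sq => // z _; exact: (law_nu_lip law).
rewrite mulrC -ler_pdivlMr ?(law_d0 law)// mulrC; apply: sq => //; first by rewrite invr_ge0.
by move=> z _; rewrite ler_pdivlMl ?(law_d0 law)//; exact: (law_nu_lower law).
Qed.

Variables (b : R) (h0 : 'rV[R]_d -> R^o) (vc dv : R -> 'rV[R]_d -> 'rV[R]_d)
  (h : R -> 'rV[R]_d -> R^o) (G : set R) (n q : R -> R).
Hypothesis b0 : 0 <= b.
Hypothesis sd : solution_data Omega T b nu h0 vc h G dv n q.

Lemma sd_hL2 t : G t -> member L2 (h t).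
Proof. by move=> /(sd_h sd)[/H10_L2]. Qed.

Lemma sd_vdist x y : 0 <= x -> x <= y -> y <= T -> sinorm ipvec (vc y - vc x) <= prim n y - prim n x.
Proof.
apply: (w_dist siV (sd_G sd) (w := vc) (p := dv)) => //.
- exact: sd_vc sd.
- by move=> r /(sd_dv sd)[].
- exact: sd_n sd.
- exact: sd_n0 sd.
- by move=> r /(sd_dv sd)[_ ->].
- exact: sd_vdv sd.
Qed.

Definition vbound := sinorm ipvec (vc 0) + prim n T.

Lemma prim_n_ge0 t : 0 <= t -> 0 <= prim n t.
Proof. by move=> t0; rewrite -(prim0 n); apply: prim_ge0 => //; [exact: sd_n0 sd|exact: sd_n sd]. Qed.

Lemma vbound_ge0 : 0 <= vbound.
Proof. by rewrite addr_ge0 ?sinorm_ge0// prim_n_ge0// ltW. Qed.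

Lemma sd_vbound t : 0 <= t -> t <= T -> sinorm ipvec (vc t) <= vbound.
Proof.
move=> t0 tT; rewrite -[vc t](subrK (vc 0)) addrC.
apply: (le_trans (sinormD siV (sd_vc sd 0) (siB siV (sd_vc sd t) (sd_vc sd 0)))).
rewrite lerD2l (le_trans (sd_vdist (lexx 0) t0 tT))// prim0 subr0.
by apply: prim_ge0 => //; [exact: sd_n0 sd|exact: sd_n sd].
Qed.

Definition flux c x y := \int[leb]_(r in `[x, y]) ipvec c (vc r) + b * ipvec c (vc y - vc x).

Lemma sd_incr x y xi : G x -> G y -> 0 <= x -> x <= y -> y <= T -> member H10 xi ->
  ip ((nu \o h y) - (nu \o h x) : L2) xi = flux (grad xi) x y.
Proof.
move=> Gx Gy x0 xy yT hxi.
have lx := nu_L2 (sd_hL2 Gx); have ly := nu_L2 (sd_hL2 Gy); have mg := H10_grad hxi.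
have xT : 0 <= x <= T by rewrite x0 (le_trans xy).
have yT' : 0 <= y <= T by rewrite yT (le_trans x0).
rewrite (siBl siL ly lx (H10_L2 hxi)) (sd_nu sd Gx xT hxi) (sd_nu sd Gy yT' hxi).
rewrite /flux (Rintegral_itv_cat (sd_cont sd mg) x0 xy).
have sB y' z : ipvec (grad xi) (vc y' - vc z) = ipvec (grad xi) (vc y') - ipvec (grad xi) (vc z).
  exact: (siBr siV (sd_vc sd y') (sd_vc sd z) mg).
by rewrite !sB; ring.
Qed.

Lemma flux_bound c x y : member L2vec c -> 0 <= x -> x <= y -> y <= T ->
  `|flux c x y| <= (vbound * (y - x) + b * (prim n y - prim n x)) * sinorm ipvec c.
Proof.
move=> mc x0 xy yT; rewrite mulrDl; apply: (le_trans (ler_normD _ _)); apply: lerD.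
  have hb s : x <= s <= y -> - (vbound * sinorm ipvec c) <= ipvec c (vc s) <= vbound * sinorm ipvec c.
    move=> /andP[xs sy]; rewrite -ler_norml (le_trans (si_cs siV mc (sd_vc sd s)))// mulrC.
    by rewrite ler_wpM2r ?sinorm_ge0// sd_vbound ?(le_trans x0 xs) ?(le_trans sy yT).
  have /andP[h1 h2] := Rintegral_itv_bounds (sd_cont sd mc) xy hb.
  by rewrite ler_norml (mulrAC vbound) -mulNr h1 h2.
rewrite normrM (ger0_norm b0) -mulrA ler_wpM2l//.
apply: (le_trans (si_cs siV mc (siB siV (sd_vc sd y) (sd_vc sd x)))).
by rewrite mulrC ler_wpM2r ?sinorm_ge0// sd_vdist.
Qed.

(** Its increments bound the increments of nu(h) in H^{-1}. *)
Definition rate t := vbound * t + b * prim n t.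

(** Made so that its increment times y - x dominates the squared increment of [rate], by (A + B)^2
    <= 2 A^2 + 2 B^2, while it also dominates the integral of q^2. *)
Definition modulus t := 2 * vbound ^+ 2 * t + 2 * b ^+ 2 * prim (fun s => n s ^+ 2) t
  + prim (fun s => q s ^+ 2) t.

Let n2_mono x y : 0 <= x -> x <= y -> prim (fun s => n s ^+ 2) x <= prim (fun s => n s ^+ 2) y.
Proof. by move=> x0 xy; apply: prim_ge0 => // [s|]; [exact: sqr_ge0|exact: sd_n2 sd]. Qed.

Let q2_mono x y : 0 <= x -> x <= y -> prim (fun s => q s ^+ 2) x <= prim (fun s => q s ^+ 2) y.
Proof. by move=> x0 xy; apply: prim_ge0 => // [s|]; [exact: sqr_ge0|exact: sd_q2 sd]. Qed.

Let n_mono x y : 0 <= x -> x <= y -> prim n x <= prim n y.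
Proof. by move=> x0 xy; apply: prim_ge0 => //; [exact: sd_n0 sd|exact: sd_n sd]. Qed.

Lemma rate_mono x y : 0 <= x -> x <= y -> y <= T -> rate x <= rate y.
Proof.
by move=> x0 xy yT; rewrite lerD// ler_wpM2l// ?vbound_ge0// n_mono.
Qed.

Lemma rate_modulus x y : 0 <= x -> x <= y -> y <= T ->
  (rate y - rate x) ^+ 2 <= (y - x) * (modulus y - modulus x).
Proof.
move=> x0 xy yT; apply: rate_arith => //; first exact: q2_mono.
exact: prim_sqr (sd_n sd) (sd_n2 sd) x0 xy.
Qed.

Lemma modulus_mono x y : 0 <= x -> x <= y -> y <= T -> modulus x <= modulus y.
Proof.
move=> x0 xy yT; rewrite /modulus !lerD ?q2_mono// ler_wpM2l ?n2_mono// mulr_ge0 ?sqr_ge0//.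
Qed.

Lemma modulus_point x y : 0 <= x -> x < y -> y <= T ->
  exists r, [/\ G r, x < r < y & (y - x) * q r ^+ 2 <= modulus y - modulus x].
Proof.
move=> x0 xy yT.
have [r [Gr xr hr]] := average_point (sd_G sd) (sd_q2 sd) x0 xy yT.
exists r; split=> //; apply: (le_trans hr).
have h1 := ler_wpM2l (mulr_ge0 (ler0n _ 2) (sqr_ge0 vbound)) (ltW xy).
have h2 := ler_wpM2l (mulr_ge0 (ler0n _ 2) (sqr_ge0 b)) (n2_mono x0 (ltW xy)).
rewrite /modulus; lra.
Qed.

Lemma modulus_ucont : ucont modulus 0 T.
Proof.
move=> e e0.
pose A := 2 * vbound ^+ 2 + 1; pose B := 2 * b ^+ 2 + 1.
have A0 : 0 < A by rewrite ltr_wpDl// mulr_ge0 ?sqr_ge0.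
have B0 : 0 < B by rewrite ltr_wpDl// mulr_ge0 ?sqr_ge0.
have e3 : 0 < e / 3 by lra.
have [d1 d10 h1] := prim_ucont T0 (sd_n2 sd) (divr_gt0 e3 B0).
have [d2 d20 h2] := prim_ucont T0 (sd_q2 sd) e3.
exists (Num.min (e / 3 / A) (Num.min d1 d2)); first by rewrite !lt_min d10 d20 divr_gt0.
move=> x y xT yT; rewrite !lt_min => /andP[h3 /andP[h4 h5]].
have {h4}h4 := h1 x y xT yT h4; have {h5}h5 := h2 x y xT yT h5.
have -> : modulus x - modulus y = 2 * vbound ^+ 2 * (x - y) +
  2 * b ^+ 2 * (prim (fun s => n s ^+ 2) x - prim (fun s => n s ^+ 2) y) +
  (prim (fun s => q s ^+ 2) x - prim (fun s => q s ^+ 2) y) by rewrite /modulus; ring.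
rewrite (_ : e = e / 3 + e / 3 + e / 3); last by field.
apply: (le_trans (ler_normD _ _)); apply: lerD => //.
have nA : 0 <= 2 * vbound ^+ 2 by rewrite mulr_ge0 ?sqr_ge0.
have nB : 0 <= 2 * b ^+ 2 by rewrite mulr_ge0 ?sqr_ge0.
apply: (le_trans (ler_normD _ _)).
rewrite (normrM (2 * vbound ^+ 2)) (normrM (2 * b ^+ 2)) (ger0_norm nA) (ger0_norm nB); apply: lerD.
  move: h3; rewrite ltr_pdivlMr// mulrC => /ltW; apply: le_trans; rewrite ler_wpM2r//.
  by rewrite /A lerDl.
move: h4; rewrite ler_pdivlMr// mulrC; apply: le_trans; rewrite ler_wpM2r//.
by rewrite /B lerDl.
Qed.

Let uq x y r : G x -> G y -> G r -> 0 <= x -> x < y -> y <= T ->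
  `|ip ((nu \o h y) - (nu \o h x) : L2) (nu \o h r)| <= (rate y - rate x) * q r.
Proof.
move=> Gx Gy Gr x0 xy yT; have [_ hr qr] := sd_h sd Gr.
rewrite (sd_incr Gx Gy x0 (ltW xy) yT hr).
apply: (le_trans (flux_bound (H10_grad hr) x0 (ltW xy) yT)).
have -> : vbound * (y - x) + b * (prim n y - prim n x) = rate y - rate x by rewrite /rate; ring.
rewrite ler_wpM2l ?subr_ge0 ?rate_mono// ?(ltW xy)//.
by rewrite -qr; exact: (H10_le hr).2.
Qed.

Lemma nu_partition s t : G s -> G t -> 0 <= s -> s < t -> t <= T ->
  ip ((nu \o h t) - (nu \o h s) : L2) ((nu \o h t) - (nu \o h s) : L2) <= 4 * (modulus t - modulus s) + (t - s) * q s ^+ 2.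
Proof.
apply: (@partition_bound _ _ _ _ siL T G (fun t => nu \o h t : L2) q rate modulus) => //.
- by move=> x Gx; exact: nu_L2 (sd_hL2 Gx).
- exact: rate_modulus.
- exact: modulus_mono.
- exact: modulus_point.
Qed.

(** The partition argument gives continuity of nu(h); [h] inherits it because [nu] shrinks distances
    by no more than the factor [delta], hence the threshold [delta * e]. *)
Lemma h_ucont s0 e : 0 < s0 -> 0 < e -> exists2 d, 0 < d &
  forall x y, G x -> G y -> s0 <= x <= T -> s0 <= y <= T -> `|x - y| < d ->
    sinorm ip ((nu \o h x) - (nu \o h y) : L2) <= e /\ sinorm ip (h x - h y) <= e.
Proof.
move=> s00 e0; have dl0 := law_d0 law.
have e1 : 0 < Num.min e (delta * e) by rewrite lt_min e0 mulr_gt0.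
have hu := @hilbert_ucont _ _ _ _ siL T G (fun t => nu \o h t : L2) q rate modulus.
have [||||||d0 d00 dP] := hu _ _ _ _ _ _ s0 _ s00 e1.
- by move=> x Gx; exact: nu_L2 (sd_hL2 Gx).
- by move=> x y r; exact: uq.
- exact: rate_modulus.
- exact: modulus_mono.
- exact: modulus_point.
- exact: modulus_ucont.
exists d0 => // x y Gx Gy xT yT xy; have := dP x y Gx Gy xT yT xy.
rewrite le_min => /andP[-> he]; split=> //.
rewrite -(ler_pM2l dl0); apply: le_trans he.
exact: (nu_dist (sd_hL2 Gx) (sd_hL2 Gy)).2.
Qed.

End single_solution.

(** * The relative entropy on L^2 *)

(** A pointwise limit of continuous functions, which at 0 gives the default value 0 of the
    inverse. *)
Lemma measurable_inv (R : realType) : measurable_fun setT (fun x : R => x^-1).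
Proof.
apply: (@measurable_fun_cvg _ (measurableTypeR R) R setT (fun n x => x / (x ^+ 2 + n.+1%:R^-1))) => [n|x _].
  apply: continuous_measurable_fun => x; apply: cvgM; first exact: cvg_id.
  apply: cvgV; last by apply: cvgD; [apply: cvgM; exact: cvg_id|exact: cvg_cst].
  by rewrite gt_eqF// ltr_wpDl ?sqr_ge0// invr_gt0.
have [->|x0] := eqVneq x 0; first by rewrite invr0; under eq_fun do rewrite mul0r; exact: cvg_cst.
have -> : x^-1 = x / (x ^+ 2 + 0) by field.
apply: cvgM; first exact: cvg_cst.
apply: cvgV; first by rewrite addr0 sqrf_eq0.
by apply: cvgD; [exact: cvg_cst|exact: cvg_harmonic].
Qed.

Lemma entropy_dist_arith (R : realFieldType) (L u w u' w' P P' Q Q' nu1 nu1' nw nw' : R) : 0 <= L ->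
  `|P - P'| <= L * (`|u| + `|u'|) * `|u - u'| -> `|Q - Q'| <= L * (`|w| + `|w'|) * `|w - w'| ->
  `|nu1 - nw| <= L * (`|u| + `|w|) -> `|nu1 - nu1'| <= L * `|u - u'| -> `|nw - nw'| <= L * `|w - w'| ->
  `|(P - Q - w * (nu1 - nw)) - (P' - Q' - w' * (nu1' - nw'))| <=
  2 * L * ((`|u| + `|u'| + `|w| + `|w'|) * (`|u - u'| + `|w - w'|)).
Proof.
move=> L0 h1 h2 h3 h4 h5.
have -> : (P - Q - w * (nu1 - nw)) - (P' - Q' - w' * (nu1' - nw')) =
  (P - P') - (Q - Q') - ((w - w') * (nu1 - nw)) - (w' * (nu1 - nu1')) + (w' * (nw - nw')) by ring.
have h6 : `|(w - w') * (nu1 - nw)| <= `|w - w'| * (L * (`|u| + `|w|)) by rewrite normrM ler_wpM2l.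
have h7 : `|w' * (nu1 - nu1')| <= `|w'| * (L * `|u - u'|) by rewrite normrM ler_wpM2l.
have h8 : `|w' * (nw - nw')| <= `|w'| * (L * `|w - w'|) by rewrite normrM ler_wpM2l.
do 4! [apply: (le_trans (ler_normD _ _)); rewrite ?normrN -?lerBrDr].
move: h1 h2 h6 h7 h8; rewrite ?opprB.
have := normr_ge0 u; have := normr_ge0 u'; have := normr_ge0 w; have := normr_ge0 w'.
have := normr_ge0 (u - u'); have := normr_ge0 (w - w').
move: `|u| `|u'| `|w| `|w'| `|u - u'| `|w - w'| `|P - P'| `|Q - Q'| `|(w - w') * (nu1 - nw)| `|w' * (nu1 - nu1')| `|w' * (nw - nw')|.
clear - L0; move=> x x' y y' p q z1 z2 z3 z4 z5 q0 p0 y'0 y0 x'0 x0 h1 h2 h3 h4 h5.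
have [a1 a2 a3 a4] : [/\ 0 <= L * (x * p), 0 <= L * (x' * p), 0 <= L * (y * p) & 0 <= L * (y' * p)].
  by rewrite !mulr_ge0.
have [b1 b2 b3 b4] : [/\ 0 <= L * (x * q), 0 <= L * (x' * q), 0 <= L * (y * q) & 0 <= L * (y' * q)].
  by rewrite !mulr_ge0.
lra.
Qed.

Section entropy_space.
Context (R : realType) (d : nat) (Omega : set 'rV[R]_d).
Local Notation mu := (lebesgue_row R d).
Local Notation L2 := (L2 Omega).
Local Notation ip := (ip Omega).
Local Notation siL := (L2_si Omega).
Hypotheses (oO : open Omega) (bO : bounded_set Omega).
Variables (a delta L : R) (nu m Psi : R -> R).
Hypothesis law : cutoff_law a delta L nu m Psi.
Implicit Types (u w : L2).
Local Notation ent := (entropy nu Psi).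

Definition RE (u w : 'rV[R]_d -> R) : R := \int[mu]_(x in Omega) ent (u x) (w x).

Lemma ent00 : ent 0 0 = 0.
Proof. by rewrite /entropy !subrr mul0r subr0. Qed.

Lemma ent_int u w : member L2 u -> member L2 w -> int_on mu Omega (fun x => ent (u x) (w x)).
Proof.
move=> lu lw; have luw := siB siL lu lw.
have [_ i2] := (l2P _ _ _).1 luw.
apply: (int_on_le (g := fun x => L * (u x - w x) ^+ 2)) => //; last 2 first.
- exact: int_onZ i2.
- move=> x _; rewrite ger0_norm; first exact: (entropy_le law).
  exact: (entropy_ge0 law).
rewrite (patch_map2 Omega (op := ent) u w ent00).
have mU := l2_measurable lu; have mW := l2_measurable lw.
have mc (k : R -> R) (f : 'rV[R]_d -> R) : continuous k -> measurable_fun setT f -> measurable_fun setT (fun x => k (f x)).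
  by move=> ck mf; apply: measurableT_comp => //; exact: continuous_measurable_fun.
have cn : continuous nu by move=> x; exact: (law_nu_continuous law).
have cp : continuous (Psi \o nu) by move=> x; exact: (law_Psi_continuous law).
rewrite /entropy; apply: measurable_funB; first apply: measurable_funB.
- exact: (mc (Psi \o nu)).
- exact: (mc (Psi \o nu)).
- by apply: measurable_funM => //; apply: measurable_funB; exact: mc.
Qed.

Lemma RE_ge0 u w : 0 <= RE u w.
Proof. by apply: Ion_ge0 => x _; exact: (entropy_ge0 law). Qed.

Lemma RE_le u w : member L2 u -> member L2 w -> RE u w <= L * sinorm ip (u - w) ^+ 2.
Proof.
move=> lu lw; have luw := siB siL lu lw; rewrite (sinorm2 siL) -(IonZ L (l2_mul luw luw)).
apply: Ion_le; [exact: ent_int|exact: int_onZ (l2_mul luw luw)|move=> x _].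
by rewrite -expr2; exact: (entropy_le law).
Qed.

Lemma RE_ge u w : member L2 u -> member L2 w -> delta / 2 * sinorm ip (u - w) ^+ 2 <= RE u w.
Proof.
move=> lu lw; have luw := siB siL lu lw; rewrite (sinorm2 siL) -(IonZ _ (l2_mul luw luw)).
apply: Ion_le; [exact: int_onZ (l2_mul luw luw)|exact: ent_int|move=> x _].
by rewrite -expr2; exact: (entropy_ge law).
Qed.

Lemma sinorm_abs u : member L2 u -> sinorm ip (fun x => `|u x|) = sinorm ip u.
Proof.
by move=> lu; congr Num.sqrt; apply: eq_Rintegral => x _; rewrite -!expr2 real_normK ?num_real.
Qed.

Lemma ent_dist (x y x' y' : R) : `|ent x y - ent x' y'| <=
  2 * L * ((`|x| + `|x'| + `|y| + `|y'|) * (`|x - x'| + `|y - y'|)).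
Proof.
have L0 := ltW (L_gt0 law).
have lipP z z' : `|Psi (nu z) - Psi (nu z')| <= L * (`|z| + `|z'|) * `|z - z'|.
  have /andP[h1 h2] := law_Psi law z' z; have h3 := law_nu_lip law z z'.
  have bnd (c : R) : `|c * (nu z - nu z')| <= `|c| * (L * `|z - z'|) by rewrite normrM ler_wpM2l.
  have := bnd z; have := bnd z'; rewrite !ler_norml => /andP[a1 a2] /andP[a3 a4].
  have p0 : 0 <= L * `|z - z'| by rewrite mulr_ge0.
  have q1 := mulr_ge0 (normr_ge0 z) p0; have q2 := mulr_ge0 (normr_ge0 z') p0.
  by apply/andP; split; lra.
apply: entropy_dist_arith => //; try exact: (law_nu_lip law).
apply: (le_trans (law_nu_lip law x y)); rewrite ler_wpM2l//.
by rewrite (le_trans (ler_normB _ _)).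
Qed.

(** The density is Lipschitz with a constant growing linearly, so by Cauchy-Schwarz [RE] is
    Lipschitz on bounded sets of L^2. *)
Lemma RE_dist u w u' w' : member L2 u -> member L2 w -> member L2 u' -> member L2 w' ->
  `|RE u w - RE u' w'| <= 2 * L *
    ((sinorm ip u + sinorm ip u' + sinorm ip w + sinorm ip w') * (sinorm ip (u - u') + sinorm ip (w - w'))).
Proof.
move=> lu lw lu' lw'; have L0 := ltW (L_gt0 law).
have i1 := ent_int lu lw; have i2 := ent_int lu' lw'.
pose A : L2 := fun x => `|u x| + `|u' x| + `|w x| + `|w' x|.
pose C : L2 := fun x => `|u x - u' x| + `|w x - w' x|.
have [nu1 nu2 nu3 nu4] : [/\ member L2 (fun x => `|u x|), member L2 (fun x => `|u' x|), member L2 (fun x => `|w x|) & member L2 (fun x => `|w' x|)].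
  by split; exact: l2_norm.
have du := siB siL lu lu'; have dw := siB siL lw lw'.
have [d1 d2] : member L2 (fun x => `|u x - u' x|) /\ member L2 (fun x => `|w x - w' x|).
  by split; [exact: (l2_norm du)|exact: (l2_norm dw)].
have n12 := siD siL nu1 nu2; have n123 := siD siL n12 nu3; have lA : member L2 A := siD siL n123 nu4.
have lC : member L2 C := siD siL d1 d2.
have iAC := int_onZ (2 * L) (l2_mul lA lC).
rewrite /RE -(IonB i1 i2); apply: (le_trans (Ion_norm (int_onB i1 i2))).
apply: (@le_trans _ _ (2 * L * ip A C)).
  rewrite /Defs.ip -(IonZ _ (l2_mul lA lC)); apply: Ion_le => //; first exact: int_on_norm (int_onB i1 i2).
  by move=> x _; exact: ent_dist.
rewrite ler_wpM2l ?mulr_ge0//; apply: (le_trans (si_le siL lA lC)); apply: ler_pM; rewrite ?sinorm_ge0//.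
- apply: (le_trans (sinormD siL n123 nu4)); rewrite (sinorm_abs lw') lerD2r.
  apply: (le_trans (sinormD siL n12 nu3)); rewrite (sinorm_abs lw) lerD2r.
  by apply: (le_trans (sinormD siL nu1 nu2)); rewrite (sinorm_abs lu) (sinorm_abs lu').
- by apply: (le_trans (sinormD siL d1 d2)); rewrite -(sinorm_abs du) -(sinorm_abs dw).
Qed.

Definition quot (h H h' H' : L2) : L2 := fun x => entropy_quot nu (h x) (H x) (h' x) (H' x).

(** Difference quotients of [nu] are at most [L]. Membership in L^2 makes the quotient admissible as
    a test function for the increment of [H]. *)
Lemma quot_L2 h H h' H' : member L2 h -> member L2 H -> member L2 h' -> member L2 H' ->
  member L2 (quot h H h' H').
Proof.
move=> lh lH lh' lH'; have L0 := ltW (L_gt0 law).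
have l1 := l2_norm (siB siL lh' lH'); have l2 := l2_norm (siB siL (nu_L2 law lH') (nu_L2 law lh)).
apply: (l2_le (w := fun x => L * `|h' x - H' x| + `|nu (H' x) - nu (h x)|)); last 2 first.
- exact: l2D (l2Z L l1) l2.
- move=> x _; rewrite [leRHS]ger0_norm ?addr_ge0 ?mulr_ge0// /quot /entropy_quot mulrDl.
  apply: (le_trans (ler_normD _ _)); rewrite !normrM normfV.
  have [->|n] := eqVneq (H' x) (H x); first by rewrite !subrr !normr0 !mulr0 !mul0r !add0r addr_ge0// mulr_ge0.
  have n0 : 0 < `|H' x - H x| by rewrite normr_gt0 subr_eq0.
  apply: lerD; last by rewrite mulrAC divff ?mul1r// gt_eqF.
  rewrite -mulrA mulrC ler_wpM2r// ler_pdivrMr//; exact: (law_nu_lip law).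
rewrite (_ : _ \_ _ = fun x => entropy_quot nu ((h \_ Omega) x) ((H \_ Omega) x) ((h' \_ Omega) x) ((H' \_ Omega) x)); last first.
  apply/funext => x; rewrite !patchE; case: ifP => // _.
  by rewrite /entropy_quot !subrr mul0r addr0 mul0r.
have [m1 m2 m3 m4] := And4 (l2_measurable lh) (l2_measurable lH) (l2_measurable lh') (l2_measurable lH').
have mc (f : 'rV[R]_d -> R) : measurable_fun setT f -> measurable_fun setT (fun x => nu (f x)).
  move=> mf; apply: measurableT_comp => //; apply: continuous_measurable_fun => x; exact: (law_nu_continuous law).
apply: measurable_funM.
  by apply: measurable_funD; apply: measurable_funM; apply: measurable_funB => //; exact: mc.
by apply: (measurableT_comp (@measurable_inv R)); exact: measurable_funB.
Qed.

Lemma RE_step h H h' H' : member L2 h -> member L2 H -> member L2 h' -> member L2 H' ->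
  RE h' H' - RE h H <= ip (((nu \o h') - (nu \o h)) - ((nu \o H') - (nu \o H)) : L2) (h' - H')
    + ip (H' - H) (quot h H h' H').
Proof.
move=> lh lH lh' lH'; have lq := quot_L2 lh lH lh' lH'.
have l1 := siB siL (siB siL (nu_L2 law lh') (nu_L2 law lh)) (siB siL (nu_L2 law lH') (nu_L2 law lH)).
have l2 := siB siL lh' lH'; have l3 := siB siL lH' lH.
rewrite /RE -(IonB (ent_int lh' lH') (ent_int lh lH)) /Defs.ip -(IonD (l2_mul l1 l2) (l2_mul l3 lq)).
apply: Ion_le.
- exact: int_onB (ent_int lh' lH') (ent_int lh lH).
- exact: int_onD (l2_mul l1 l2) (l2_mul l3 lq).
move=> x _; have := entropy_step law (h x) (H x) (h' x) (H' x).
by rewrite -entropy_quotE (mulrC (h' x - H' x)).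
Qed.

(** The rate a / delta arises here: a/2 |h' - H'|^2 is a / delta times delta/2 |h' - H'|^2, which
    the entropy density dominates. The other terms are small for nearby times. *)
Lemma quot_l1 h H h' H' : member L2 h -> member L2 H -> member L2 h' -> member L2 H' ->
  \int[mu]_(x in Omega) `|quot h H h' H' x| <= a / delta * RE h' H' +
    (a / 2 * (sinorm ip (H' - H) * sinorm ip (h' - H')) + sinorm ip (fun=> 1) * sinorm ip ((nu \o h') - (nu \o h) : L2)).
Proof.
move=> lh lH lh' lH'; have lq := quot_L2 lh lH lh' lH'.
have a0 := law_a0 law; have d0 := law_d0 law.
have l2 := siB siL lh' lH'; have l3 := siB siL lH' lH; have l4 := siB siL (nu_L2 law lh') (nu_L2 law lh).
have [n2 n3] := conj (l2_norm l2) (l2_norm l3).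
have [iN hN] := l1_bound oO bO l4.
have iE := ent_int lh' lH'.
pose g1 x := a / delta * ent (h' x) (H' x).
pose g2 x := a / 2 * (`|(H' - H) x| * `|(h' - H') x|).
have i1 : int_on mu Omega g1 := int_onZ (a / delta) iE.
have i2 : int_on mu Omega g2 := int_onZ (a / 2) (l2_mul n3 n2).
have i3 := int_on_norm iN.
apply: (@le_trans _ _ (\int[mu]_(x in Omega) (g1 x + (g2 x + `|((nu \o h') - (nu \o h) : L2) x|)))).
  apply: Ion_le; [exact: int_on_norm (l1_bound oO bO lq).1|exact: int_onD i1 (int_onD i2 i3)|move=> x _].
  apply: (le_trans (entropy_quot_le law _ _ _ _)); rewrite -addrA; apply: lerD; last first.
    by rewrite /g2 -mulrA.
  rewrite /g1; have := entropy_ge law (h' x) (H' x) => he.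
  have -> : a / 2 * (h' x - H' x) ^+ 2 = a / delta * (delta / 2 * (h' x - H' x) ^+ 2).
    by field; rewrite gt_eqF.
  by apply: ler_wpM2l => //; rewrite divr_ge0// ltW.
rewrite (IonD i1 (int_onD i2 i3)) (IonD i2 i3) (IonZ _ iE) (IonZ _ (l2_mul n3 n2)).
rewrite lerD2l; apply: lerD => //; rewrite ler_wpM2l ?divr_ge0 ?(ltW a0)//.
by apply: (le_trans (si_le siL n3 n2)); rewrite !sinorm_abs.
Qed.

End entropy_space.

(** * Comparison of two solutions *)

Lemma mid_arith (R : realFieldType) (x y x' y' d1 T : R) : 0 < x -> x < y -> y <= T -> 0 < d1 ->
  x < x' -> x' < (x + y) / 2 -> x' < x + d1 -> (x + y) / 2 < y' -> y - d1 < y' -> y' < y ->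
  [/\ x / 2 <= x <= T, x / 2 <= y <= T, x / 2 <= x' <= T & x / 2 <= y' <= T] /\
    (`|x' - x| < d1 /\ `|y - y'| < d1).
Proof.
move=> *; split; first by split; apply/andP; split; lra.
by split; rewrite ger0_norm; lra.
Qed.

Lemma flux_arith (R : realFieldType) (b A1 A2 A3 A4 x1 x2 x3 x4 : R) :
  - (A1 + b * x1) - - (A2 + b * x2) - (- (A3 + b * x3) - - (A4 + b * x4)) =
  - (A1 - A2 - (A3 - A4)) - b * (x1 - x2 - (x3 - x4)).
Proof. ring. Qed.

Lemma band_arith (R : realFieldType) (J l c e P : R) : (c - e * P) * l <= J -> J <= (c + e * P) * l ->
  `|J - l * c| <= e * l * P.
Proof. by move=> h1 h2; rewrite ler_norml; apply/andP; split; lra. Qed.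

Lemma sum3_arith (R : realFieldType) (z1 z2 z3 z4 z5 e : R) : z1 <= e / 2 -> z3 <= e / 2 ->
  z2 <= z4 -> z4 <= z5 -> z1 + z2 + z3 <= z5 + e.
Proof. lra. Qed.

(** [nu_partition] from the fixed time [s] bounds |nu(h t) - nu(h s)|^2 by [X], uniformly in [t]. *)
Lemma h_bounded (R : realType) d (Omega : set 'rV[R]_d) (T a delta L : R) (nu m Psi : R -> R)
    (b : R) h0 vc dv h (G : set R) n q s : 0 < T -> cutoff_law a delta L nu m Psi -> 0 <= b ->
  solution_data Omega T b nu h0 vc h G dv n q -> G s -> 0 <= s ->
  exists2 B, 0 <= B & forall t, G t -> s <= t <= T -> sinorm (ip Omega) (h t) <= B.
Proof.
move=> T0 law b0 sd Gs s0; have siL := L2_si Omega; have dl0 := law_d0 law.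
pose X := 4 * (modulus Omega T b vc n q T - modulus Omega T b vc n q s) + T * q s ^+ 2.
pose B := sinorm (ip Omega) (h s) + (`|X| + 1) / delta.
have B0 : 0 <= (`|X| + 1) / delta by rewrite divr_ge0 ?addr_ge0// ltW.
exists B; first by rewrite addr_ge0 ?sinorm_ge0.
move=> t Gt /andP[]; rewrite [in X in X -> _]le_eqVlt => /orP[/eqP <- _|st tT].
  by rewrite lerDl.
have lt' := sd_hL2 sd Gt; have ls := sd_hL2 sd Gs.
rewrite -[h t](subrK (h s)) addrC; apply: (le_trans (sinormD siL ls (siB siL lt' ls))).
rewrite lerD2l ler_pdivlMr// mulrC; apply: (le_trans (nu_dist law lt' ls).2).
have h1 := nu_partition T0 law b0 sd Gs Gt s0 st tT.
set y := sinorm _ _; have y2 : y ^+ 2 <= `|X|.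
  rewrite (sinorm2 siL); apply: (le_trans h1); apply: le_trans (ler_norm _); rewrite /X.
  apply: lerD; last by rewrite ler_wpM2r ?sqr_ge0// lerBlDr (le_trans tT)// lerDl.
  by rewrite ler_pM2l// lerD2r; apply: (modulus_mono sd) => //; exact: le_trans (ltW st).
have := sqr_ge0 (y - 1); move: y2; move: `|X| => z; rewrite sqrrB1 => y2 y3.
have y0 : 0 <= y ^+ 2 by exact: sqr_ge0.
lra.
Qed.

Section two_solutions.
Context (R : realType) (d : nat) (Omega : set 'rV[R]_d) (T : R).
Local Notation leb := (@lebesgue_measure R).
Local Notation mu := (lebesgue_row R d).
Local Notation I := (`]0, T[%classic : set R).
Local Notation L2 := (L2 Omega).
Local Notation L2vec := (L2vec Omega).
Local Notation H10 := (H10 Omega).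
Local Notation ip := (ip Omega).
Local Notation ipvec := (ipvec Omega).
Local Notation grad := (grad Omega).
Local Notation siL := (L2_si Omega).
Local Notation siV := (L2vec_si Omega).
Hypotheses (oO : open Omega) (bO : bounded_set Omega) (T0 : 0 < T).
Variables (a delta L : R) (nu m Psi : R -> R).
Hypothesis law : cutoff_law a delta L nu m Psi.
Variables (b : R).
Hypothesis b0 : 0 <= b.
Variables (h0 H0 : 'rV[R]_d -> R^o) (vc Vc dv dV : R -> 'rV[R]_d -> 'rV[R]_d)
  (h H : R -> 'rV[R]_d -> R^o) (G1 G2 : set R) (n1 q1 n2 q2 : R -> R).
Hypothesis sd1 : solution_data Omega T b nu h0 vc h G1 dv n1 q1.
Hypothesis sd2 : solution_data Omega T b nu H0 Vc H G2 dV n2 q2.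

(* H in W^{1,1}(0, T; L^oo), with kn the norm of H_t, tested against functions in L^2. *)
Variable kn : R -> R.
Hypothesis kn_int : leb.-integrable setT (EFin \o kn).
Hypothesis kn0 : forall t, 0 <= kn t.
Hypothesis H_kn : forall y, member L2 y -> exists c f, [/\ leb.-integrable setT (EFin \o f),
  {ae leb, forall t, I t -> ip (H t) y = c + prim f t} &
  {ae leb, forall t, I t -> `|f t| <= (\int[mu]_(x in Omega) `|y x|) * kn t}].

(** Times are strictly positive because continuity of [h] and [H] is known only away from 0. *)
Definition good : set R := [set t | [/\ G1 t, G2 t & 0 < t < T]].

Lemma good_ae : {ae leb, forall t, I t -> good t}.
Proof.
apply: filterS2 (sd_G sd1) (sd_G sd2) => t g1 g2 It.
by split; [exact: g1|exact: g2|move: It; rewrite /= in_itv].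
Qed.

Lemma good_itv t : good t -> 0 <= t <= T.
Proof. by move=> [_ _ /andP[/ltW -> /ltW ->]]. Qed.

Lemma good_h t : good t -> member L2 (h t).
Proof. by move=> [g _ _]; exact: (sd_hL2 sd1 g). Qed.

Lemma good_H t : good t -> member L2 (H t).
Proof. by move=> [_ g _]; exact: (sd_hL2 sd2 g). Qed.

Let K := prim kn.

Lemma K_mono x y : 0 <= x -> x <= y -> K x <= K y.
Proof. by move=> x0 xy; exact: prim_ge0. Qed.

(** The pairing of [H] with [eta] is a primitive off a null set that depends on [eta], whereas [eta]
    will itself depend on [x] and [y]. The bound is therefore proved at nearby times outside that
    set and carried over by continuity of [H] in L^2. *)
Lemma kappa_bound x y eta : good x -> good y -> x < y -> member L2 eta ->
  `|ip (H y - H x) eta| <= (K y - K x) * \int[mu]_(z in Omega) `|eta z|.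
Proof.
move=> Gx Gy xy leta; set J := \int[mu]_(z in Omega) `|eta z|.
have J0 : 0 <= J by apply: Ion_ge0 => z _.
have [c [f [jf fE fb]]] := H_kn leta.
have Z : leb.-integrable setT (EFin \o (fun=> 0 : R)).
  by have := @integrable0 _ (measurableTypeR R) R leb setT.
have G'ae : {ae leb, forall t, I t -> good t /\ ip (H t) eta = c + prim f t}.
  by apply: filterS2 good_ae fE => t g1 g2 It; split; [exact: g1|exact: g2].
have inner x' y' : good x' -> good y' -> ip (H x') eta = c + prim f x' -> ip (H y') eta = c + prim f y' -> x' <= y' ->
    `|ip (H y' - H x') eta| <= (K y' - K x') * J.
  move=> Gx' Gy' ex ey xy'.
  have [[x0 _] [_ yT]] := (andP (good_itv Gx'), andP (good_itv Gy')).
  have jk := integrable_setT_lin J kn_int Z; have jn := integrable_setT_lin (-1) jf Z.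
  have up : prim f y' - prim f x' <= prim (fun r => J * kn r + 0) y' - prim (fun r => J * kn r + 0) x'.
    apply: (ae_prim_le fb) => // r /= hr _; rewrite addr0.
    exact: le_trans (ler_norm _) hr.
  have dn : prim (fun r => -1 * f r + 0) y' - prim (fun r => -1 * f r + 0) x' <=
      prim (fun r => J * kn r + 0) y' - prim (fun r => J * kn r + 0) x'.
    apply: (ae_prim_le fb) => // r /= hr _; rewrite !addr0 mulN1r.
    by apply: le_trans hr; rewrite -normrN ler_norm.
  move: up dn; rewrite !(prim_lin _ _ kn_int Z) !(prim_lin _ _ jf Z).
  rewrite (siBl siL (good_H Gy') (good_H Gx') leta) ex ey ler_norml -/(K y') -/(K x').
  have -> : prim (fun=> 0 : R) y' = prim (fun=> 0) x'.
    by apply/eqP; rewrite -subr_eq0 (primB Z x0 xy') /Rintegral integral0.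
  move: (prim (fun=> 0) x') (prim f y') (prim f x') (K y') (K x') => z z1 z2 k1 k2 up dn.
  by apply/andP; split; lra.
have [/andP[x0 xT] /andP[y0 yT]] := (good_itv Gx, good_itv Gy).
have xp : 0 < x by case: Gx => _ _ /andP[].
apply: ler_eps => e e0; have N0 := sinorm_ge0 ip eta.
have N1 : 0 < 2 * (sinorm ip eta + 1) by lra.
have [|d1 d10 hd] := h_ucont T0 law b0 sd2 (s0 := x / 2) _ (divr_gt0 e0 N1); first by lra.
pose mid := (x + y) / 2.
have dn := conull_dense G'ae.
(* The midpoint separates [x'] from [y'], so that they stay in order. *)
have [||x' [[Gx' ex] xx' x'm]] := dn x (Num.min mid (x + d1)) x0.
- by rewrite lt_min /mid ltrDl d10 andbT; lra.
- by rewrite ge_min /mid; apply/orP; left; lra.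
have ym : Num.max mid (y - d1) < y by rewrite gt_max /mid ltrBlDr ltrDl d10 andbT; lra.
have ym0 : 0 <= Num.max mid (y - d1) by rewrite le_max /mid; apply/orP; left; lra.
have [y' [[Gy' ey] my' yy']] := dn _ _ ym0 ym yT.
move: x'm my'; rewrite lt_min gt_max => /andP[x1 x2] /andP[y1 y2].
have x'y' : x' <= y' by rewrite ltW// (lt_trans x1 y1).
have [[gx _] [gy _]] : (G2 x /\ True) /\ (G2 y /\ True) by case: Gx; case: Gy.
have [[gx' _] [gy' _]] : (G2 x' /\ True) /\ (G2 y' /\ True) by case: Gx'; case: Gy'.
have [[i1 i2 i3 i4] [j1 j2]] := mid_arith xp xy yT d10 xx' x1 x2 y1 y2 yy'.
have [_ dx] := hd x' x gx' gx i3 i1 j1.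
have [_ dy] := hd y y' gy gy' i2 i4 j2.
have [lHx lHy lHx' lHy'] := And4 (good_H Gx) (good_H Gy) (good_H Gx') (good_H Gy').
have -> : ip (H y - H x) eta = ip (H y - H y') eta + ip (H y' - H x') eta + ip (H x' - H x) eta.
  by rewrite !(siBl siL)//; ring.
have b1 : `|ip (H y - H y') eta| <= e / 2.
  apply: (le_trans (si_cs siL (siB siL lHy lHy') leta)).
  apply: (@le_trans _ _ (e / (2 * (sinorm ip eta + 1)) * (sinorm ip eta + 1))).
    by apply: ler_pM; rewrite ?sinorm_ge0// lerDl.
  by rewrite invfM mulrA divfK// gt_eqF// ltr_pwDr.
have b2 : `|ip (H x' - H x) eta| <= e / 2.
  apply: (le_trans (si_cs siL (siB siL lHx' lHx) leta)).
  apply: (@le_trans _ _ (e / (2 * (sinorm ip eta + 1)) * (sinorm ip eta + 1))).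
    by apply: ler_pM; rewrite ?sinorm_ge0// lerDl.
  by rewrite invfM mulrA divfK// gt_eqF// ltr_pwDr.
have b3 := inner x' y' Gx' Gy' ex ey x'y'.
have b4 : (K y' - K x') * J <= (K y - K x) * J.
  have [/andP[x'0 _] /andP[y'0 _]] := (good_itv Gx', good_itv Gy').
  by apply: ler_wpM2r => //; apply: lerB; apply: K_mono => //; exact: ltW.
apply: (le_trans (ler_normD _ _)); apply: (le_trans (lerD (ler_normD _ _) (lexx _))).
exact: sum3_arith b1 b2 b3 b4.
Qed.

Let w t : 'rV[R]_d -> 'rV[R]_d := vc t - Vc t.
Let p t : 'rV[R]_d -> 'rV[R]_d := dv t - dV t.

Lemma w_mem t : member L2vec (w t).
Proof. exact: (siB siV (sd_vc sd1 t) (sd_vc sd2 t)). Qed.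

Lemma p_mem t : good t -> member L2vec (p t).
Proof. by move=> [/(sd_dv sd1)[m1 _] /(sd_dv sd2)[m2 _] _]; exact: (siB siV m1 m2). Qed.

Lemma w_cont c : member L2vec c -> continuous (fun t => ipvec c (w t)).
Proof.
move=> mc; rewrite (_ : (fun t => _) = fun t => ipvec c (vc t) - ipvec c (Vc t)).
  by move=> t; apply: cvgB; [exact: (sd_cont sd1 mc)|exact: (sd_cont sd2 mc)].
by apply/funext => t; exact: (siBr siV (sd_vc sd1 t) (sd_vc sd2 t) mc).
Qed.

Definition Iw y r := \int[leb]_(t in `[y, r]) ipvec (p r) (w t).

(** The test function is taken at the later time [r], where the first equation gives nabla (h - H) =
    - p. [h r] and [H r] are tested one at a time, and the four fluxes are recombined by
    bilinearity. *)
Lemma flux_grad y r : good y -> good r -> y < r ->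
  ip (((nu \o h r) - (nu \o h y)) - ((nu \o H r) - (nu \o H y)) : L2) (h r - H r) =
  - Iw y r - b * ipvec (w r - w y) (p r).
Proof.
move=> Gy Gr yr; have [g1y g2y _] := Gy; have [g1r g2r _] := Gr.
have [/andP[y0 _] /andP[_ rT]] := (good_itv Gy, good_itv Gr); have yr' := ltW yr.
have [hr _ _] := sd_h sd1 g1r; have [Hr _ _] := sd_h sd2 g2r.
have [mdv _] := sd_dv sd1 g1r; have [mdV _] := sd_dv sd2 g2r.
have l1 := siB siL (nu_L2 law (good_h Gr)) (nu_L2 law (good_h Gy)).
have l2 := siB siL (nu_L2 law (good_H Gr)) (nu_L2 law (good_H Gy)).
rewrite (siBl siL l1 l2 (siB siL (good_h Gr) (good_H Gr))).
rewrite (siBr siL (good_h Gr) (good_H Gr) l1) (siBr siL (good_h Gr) (good_H Gr) l2).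
rewrite (sd_incr law sd1 g1y g1r y0 yr' rT hr) (sd_incr law sd1 g1y g1r y0 yr' rT Hr).
rewrite (sd_incr law sd2 g2y g2r y0 yr' rT hr) (sd_incr law sd2 g2y g2r y0 yr' rT Hr).
have ii c : member L2vec c -> leb.-integrable `[y, r] (EFin \o (fun t => ipvec c (vc t))) /\
    leb.-integrable `[y, r] (EFin \o (fun t => ipvec c (Vc t))).
  by move=> mc; split; apply: continuous_itv_integrable; [exact: (sd_cont sd1 mc)|exact: (sd_cont sd2 mc)].
have [i1 i2] := ii _ mdv; have [i3 i4] := ii _ mdV.
have fl (u : R -> L2vec) (g g' : L2vec) : (forall t, member L2vec (u t)) -> member L2vec g' ->
    leb.-integrable `[y, r] (EFin \o (fun t => ipvec g' (u t))) ->
    (forall c, member L2vec c -> ipvec c g = - ipvec c g') ->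
    flux Omega b u g y r = - (\int[leb]_(t in `[y, r]) ipvec g' (u t) + b * ipvec g' (u r - u y)).
  move=> mu' mg' ig' gg; rewrite /flux opprD -mulrN; congr (_ + _ * _); last first.
    by rewrite !(si_sym siV _ (u r - u y)); apply: gg; exact: (siB siV).
  rewrite -mulN1r -RintegralZl//; apply: eq_Rintegral => t _.
  by rewrite mulN1r (si_sym siV g) (gg _ (mu' t)) (si_sym siV).
rewrite (fl _ _ _ (sd_vc sd1) mdv i1 (fun c => @sd_grad _ _ _ _ _ _ _ _ _ _ _ _ _ sd1 r c g1r)).
rewrite (fl _ _ _ (sd_vc sd1) mdV i3 (fun c => @sd_grad _ _ _ _ _ _ _ _ _ _ _ _ _ sd2 r c g2r)).
rewrite (fl _ _ _ (sd_vc sd2) mdv i2 (fun c => @sd_grad _ _ _ _ _ _ _ _ _ _ _ _ _ sd1 r c g1r)).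
rewrite (fl _ _ _ (sd_vc sd2) mdV i4 (fun c => @sd_grad _ _ _ _ _ _ _ _ _ _ _ _ _ sd2 r c g2r)).
have bil (c1 c2 : L2vec) : member L2vec c1 -> member L2vec c2 ->
    ipvec (p r) (c1 - c2) = (ipvec (dv r) c1 - ipvec (dV r) c1) - (ipvec (dv r) c2 - ipvec (dV r) c2).
  move=> m1 m2; rewrite (siBr siV m1 m2 (siB siV mdv mdV)).
  by rewrite (siBl siV mdv mdV m1) (siBl siV mdv mdV m2).
have -> : Iw y r = (\int[leb]_(t in `[y, r]) ipvec (dv r) (vc t) - \int[leb]_(t in `[y, r]) ipvec (dV r) (vc t)) -
   (\int[leb]_(t in `[y, r]) ipvec (dv r) (Vc t) - \int[leb]_(t in `[y, r]) ipvec (dV r) (Vc t)).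
  have j1 := @integrableB _ (measurableTypeR R) R leb `[y, r]%classic (measurable_itv _) _ _ i1 i3.
  have j2 := @integrableB _ (measurableTypeR R) R leb `[y, r]%classic (measurable_itv _) _ _ i2 i4.
  rewrite -RintegralB// -RintegralB// -RintegralB//.
  by apply: eq_Rintegral => t _; rewrite bil//; [exact: (sd_vc sd1)|exact: (sd_vc sd2)].
have -> : w r - w y = (vc r - vc y) - (Vc r - Vc y) by rewrite /w !opprB addrACA [RHS]addrACA; congr (_ + _); exact: addrC.
have m1 := siB siV (sd_vc sd1 r) (sd_vc sd1 y); have m2 := siB siV (sd_vc sd2 r) (sd_vc sd2 y).
by rewrite (si_sym siV _ (p r)) (bil _ _ m1 m2); exact: flux_arith.
Qed.

(** [kappa_bound] with the quotient as test function trades the increment of [H] for that of [K]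
    times the L^1 norm of the quotient. *)
Lemma RE_increment y r : good y -> good r -> y < r ->
  RE Omega nu Psi (h r) (H r) - RE Omega nu Psi (h y) (H y) <=
  - Iw y r - b * ipvec (w r - w y) (p r) + (K r - K y) * (a / delta * RE Omega nu Psi (h r) (H r) +
    (a / 2 * (sinorm ip (H r - H y) * sinorm ip (h r - H r)) +
     sinorm ip (fun=> 1) * sinorm ip ((nu \o h r) - (nu \o h y) : L2))).
Proof.
move=> Gy Gr yr; have [lhy lHy lhr lHr] := And4 (good_h Gy) (good_H Gy) (good_h Gr) (good_H Gr).
have [/andP[y0 _] _] := (good_itv Gy, good_itv Gr).
apply: (le_trans (RE_step law lhy lHy lhr lHr)); rewrite (flux_grad Gy Gr yr) lerD2l.
have lq := quot_L2 law lhy lHy lhr lHr.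
apply: (le_trans (ler_norm _)); apply: (le_trans (kappa_bound Gy Gr yr lq)).
apply: ler_wpM2l; first by rewrite subr_ge0; exact: K_mono (ltW yr).
exact: (quot_l1 oO bO law lhy lHy lhr lHr).
Qed.

Let pn t := n1 t + n2 t.

Lemma pn_int : leb.-integrable setT (EFin \o pn).
Proof.
by have := @integrableD _ (measurableTypeR R) R leb setT measurableT _ _ (sd_n sd1) (sd_n sd2).
Qed.

Lemma pn2_int : leb.-integrable setT (EFin \o (fun t => pn t ^+ 2)).
Proof.
have i1 := integrable_setT_lin 2 (sd_n2 sd1) (sd_n2 sd1); have i2 := integrable_setT_lin 2 (sd_n2 sd2) i1.
have mp : measurable_fun setT pn by apply/measurable_EFinP; exact: measurable_int pn_int.
apply: (@le_integrable _ (measurableTypeR R) R leb setT measurableT _ _ _ _ i2).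
  by apply/measurable_EFinP; exact: measurable_funX.
move=> t _ /=; rewrite lee_fin ger0_norm ?sqr_ge0// [leRHS]ger0_norm; last first.
  have s2 z : 0 <= z ^+ 2 := sqr_ge0 (z : R); have := s2 (n1 t); have := s2 (n2 t); lra.
rewrite /pn; have := sqr_ge0 (n1 t - n2 t); have := sqr_ge0 (n1 t).
by move: (n1 t) (n2 t) => x y; lra.
Qed.

Lemma Iw_bound y r c e : good r -> 0 <= y -> y < r -> r <= T -> member L2vec c -> 0 <= e ->
  (forall x, y <= x <= r -> sinorm ipvec (w x - c) <= e) ->
  `|Iw y r - (r - y) * ipvec c (p r)| <= e * (r - y) * sinorm ipvec (p r).
Proof.
move=> Gr y0 yr rT mc e0 we; have mp := p_mem Gr; set P := sinorm ipvec (p r).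
have hb x : y <= x <= r -> ipvec c (p r) - e * P <= ipvec (p r) (w x) <= ipvec c (p r) + e * P.
  move=> /we wx; have mwc := siB siV (w_mem x) mc.
  have : `|ipvec (w x - c) (p r)| <= e * P.
    by apply: (le_trans (si_cs siV mwc mp)); rewrite ler_wpM2r ?sinorm_ge0.
  rewrite (siBl siV (w_mem x) mc mp) (si_sym siV (w x)) ler_norml => /andP[? ?].
  by apply/andP; split; lra.
have /andP[h1 h2] := Rintegral_itv_bounds (w_cont mp) (ltW yr) hb.
exact: band_arith h1 h2.
Qed.

Lemma wp_form c : member L2vec c -> exists f, [/\ leb.-integrable setT (EFin \o f),
  {ae leb, forall t, I t -> ipvec c (p t) = f t} &
  forall x y, 0 <= x -> x <= y -> y <= T -> ipvec c (w y - w x) = prim f y - prim f x].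
Proof.
move=> mc; have [f1 [j1 e1 d1]] := sd_vdv sd1 mc; have [f2 [j2 e2 d2]] := sd_vdv sd2 mc.
exists (fun t => -1 * f2 t + f1 t); split.
- exact: integrable_setT_lin.
- apply: filterS3 good_ae e1 e2 => t gt h1 h2 It; have [/(sd_dv sd1)[m1 _] /(sd_dv sd2)[m2 _] _] := gt It.
  by rewrite (siBr siV m1 m2 mc) (h1 It) (h2 It) mulN1r addrC.
move=> x y x0 xy yT; rewrite !(prim_lin _ _ j2 j1).
have m1 := siB siV (sd_vc sd1 y) (sd_vc sd1 x); have m2 := siB siV (sd_vc sd2 y) (sd_vc sd2 x).
have -> : w y - w x = (vc y - vc x) - (Vc y - Vc x).
  by rewrite /w !opprB addrACA [RHS]addrACA; congr (_ + _); exact: addrC.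
by rewrite (siBr siV m1 m2 mc) d1// d2//; ring.
Qed.

Local Notation E r := (RE Omega nu Psi (h r) (H r)).

(** From [s] on, [h] and [H] are bounded in L^2, so the Lipschitz bound on bounded sets applies; [X]
    is the resulting constant plus 1. *)
Lemma RE_ucont s t : good s -> t <= T -> ucont_on good (fun r => E r) s t.
Proof.
move=> Gs tT e e0; have [g1 g2 _] := Gs; have /andP[s0 _] := good_itv Gs.
have [B1 B10 hB1] := h_bounded T0 law b0 sd1 g1 s0; have [B2 B20 hB2] := h_bounded T0 law b0 sd2 g2 s0.
have L0 := L_gt0 law; have sp : 0 < s by case: Gs => _ _ /andP[].
pose X := 2 * L * ((B1 + B1 + B2 + B2) * 2) + 1.
have X0 : 0 < X by rewrite ltr_wpDl// !mulr_ge0 ?addr_ge0// ltW.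
have [d1 d10 hd1] := h_ucont T0 law b0 sd1 sp (divr_gt0 e0 X0).
have [d2 d20 hd2] := h_ucont T0 law b0 sd2 sp (divr_gt0 e0 X0).
exists (Num.min d1 d2); first by rewrite lt_min d10.
move=> x y Gx Gy /andP[sx xt] /andP[sy yt]; rewrite lt_min => /andP[xy1 xy2].
have [[gx1 gx2 _] [gy1 gy2 _]] := (Gx, Gy).
have xT : s <= x <= T by rewrite sx (le_trans xt tT).
have yT : s <= y <= T by rewrite sy (le_trans yt tT).
have [_ e1] := hd1 x y gx1 gy1 xT yT xy1; have [_ e2] := hd2 x y gx2 gy2 xT yT xy2.
have [lhx lHx lhy lHy] := And4 (good_h Gx) (good_H Gx) (good_h Gy) (good_H Gy).
apply: (le_trans (RE_dist law lhx lHx lhy lHy)).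
apply: (@le_trans _ _ (2 * L * ((B1 + B1 + B2 + B2) * (e / X + e / X)))).
  rewrite ler_pM2l ?mulr_gt0//; apply: ler_pM; rewrite ?addr_ge0 ?sinorm_ge0//; last exact: lerD.
  by rewrite !lerD ?hB1 ?hB2.
have -> : 2 * L * ((B1 + B1 + B2 + B2) * (e / X + e / X)) = e * ((2 * L * ((B1 + B1 + B2 + B2) * 2)) / X) by ring.
by rewrite ger_pMr// ler_pdivrMr// mul1r /X lerDl.
Qed.

Lemma pn_ge0 t : 0 <= pn t.
Proof. by rewrite addr_ge0// ?(sd_n0 sd1) ?(sd_n0 sd2). Qed.

Lemma p_pn r : good r -> sinorm ipvec (p r) <= pn r.
Proof.
move=> [/(sd_dv sd1)[m1 e1] /(sd_dv sd2)[m2 e2] _].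
by rewrite /pn -e1 -e2; exact: (sinormB siV m1 m2).
Qed.

(** With [S] a bound of the entropy, the factor of K r - K y in [RE_increment] is at most
    [a / delta * S] plus terms that continuity of nu(h) and of [H] makes smaller than [th]. *)
Lemma energy_interval s t S : good s -> good t -> s < t -> 0 <= S ->
  (forall r, good r -> s <= r <= t -> E r <= S) ->
  E t + ipvec (w t) (w t) / 2 <= E s + ipvec (w s) (w s) / 2 + a / delta * S * (K t - K s).
Proof.
move=> Gs Gt st S0 ES; have [g1 g2 _] := Gs.
have [/andP[s0 _] /andP[_ tT]] := (good_itv Gs, good_itv Gt).
have [B1 B10 hB1] := h_bounded T0 law b0 sd1 g1 s0; have [B2 B20 hB2] := h_bounded T0 law b0 sd2 g2 s0.
have [a0 dl0] := (law_a0 law, law_d0 law); have sp : 0 < s by case: Gs => _ _ /andP[].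
have [pn0 ppn] := (pn_ge0, p_pn).
have aS0 : 0 <= a / delta * S by rewrite mulr_ge0// divr_ge0// ltW.
have kmono x y : s <= x -> x <= y -> y <= t -> K x <= K y.
  by move=> sx xy _; apply: K_mono => //; exact: le_trans sx.
apply: (@energy_core R _ _ _ siV T good T0 good_ae w p pn w_mem p_mem pn_int pn2_int pn0 ppn wp_form
  (fun r => E r) K Iw s t b (a / delta * S) s0 st tT Gs Gt b0 aS0 kmono (RE_ucont Gs tT) Iw_bound).
move=> th th0; pose C1 := sinorm ip (fun=> 1).
have C10 : 0 <= C1 by exact: sinorm_ge0.
pose Z := a / 2 * (B1 + B2) + C1 + 1.
have aB0 : 0 <= a / 2 * (B1 + B2) by rewrite mulr_ge0 ?addr_ge0// divr_ge0// ltW.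
have Z0 : 0 < Z by rewrite ltr_wpDl// addr_ge0.
have [d1 d10 hd1] := h_ucont T0 law b0 sd1 sp (divr_gt0 th0 Z0).
have [d2 d20 hd2] := h_ucont T0 law b0 sd2 sp (divr_gt0 th0 Z0).
exists (Num.min d1 d2); first by rewrite lt_min d10.
move=> y r Gy Gr sy yr rt; rewrite lt_min => /andP[ry1 ry2].
have [[gy1 gy2 _] [gr1 gr2 _]] := (Gy, Gr).
have sr : s <= r by exact: le_trans sy (ltW yr).
have yT : s <= y <= T by rewrite sy (le_trans (ltW yr) (le_trans rt tT)).
have rT : s <= r <= T by rewrite sr (le_trans rt tT).
have nry : `|r - y| = r - y by rewrite ger0_norm// subr_ge0 ltW.
have [|e1 _] := hd1 r y gr1 gy1 rT yT; first by rewrite nry.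
have [|_ e2] := hd2 r y gr2 gy2 rT yT; first by rewrite nry.
apply: (le_trans (RE_increment Gy Gr yr)); rewrite lerD2l; apply: ler_wpM2l.
  by rewrite subr_ge0 K_mono ?(le_trans s0 sy)// ltW.
apply: lerD; first by rewrite ler_wpM2l ?ES ?sr// divr_ge0// ltW.
have zr : sinorm ip (h r - H r) <= B1 + B2.
  apply: (le_trans (sinormB siL (good_h Gr) (good_H Gr))).
  by rewrite lerD ?hB1 ?hB2.
apply: (@le_trans _ _ (a / 2 * (th / Z * (B1 + B2)) + C1 * (th / Z))).
  apply: lerD; last by rewrite ler_wpM2l.
  by rewrite ler_wpM2l ?divr_ge0 ?(ltW a0)// ler_pM ?sinorm_ge0.
have -> : a / 2 * (th / Z * (B1 + B2)) + C1 * (th / Z) = th * ((a / 2 * (B1 + B2) + C1) / Z) by ring.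
by rewrite ger_pMr// ler_pdivrMr// mul1r /Z lerDl.
Qed.

Lemma energy_gronwall s t : good s -> good t -> s < t ->
  E t + ipvec (w t) (w t) / 2 <= (E s + ipvec (w s) (w s) / 2) * expR (a / delta * (K t - K s)).
Proof.
move=> Gs Gt st; have [g1 g2 _] := Gs.
have [/andP[s0 _] /andP[_ tT]] := (good_itv Gs, good_itv Gt).
have [B1 B10 hB1] := h_bounded T0 law b0 sd1 g1 s0; have [B2 B20 hB2] := h_bounded T0 law b0 sd2 g2 s0.
have [a0 dl0] := (law_a0 law, law_d0 law); have L0 := L_gt0 law.
have E0 r : 0 <= E r by exact: (RE_ge0 law).
have W0 r : 0 <= ipvec (w r) (w r) / 2 by rewrite divr_ge0// (si_ge0 siV).
apply: (@gronwall_on R good (fun r => E r + ipvec (w r) (w r) / 2) K s t (a / delta)) => //.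
- by rewrite divr_ge0// ltW.
- by move=> x y sx xy yt; apply: (conull_dense good_ae) => //; [exact: le_trans sx|exact: le_trans tT].
- by move=> x _ _; rewrite addr_ge0.
- pose W := vbound Omega T vc n1 + vbound Omega T Vc n2.
  exists (L * (B1 + B2) ^+ 2 + W ^+ 2 / 2) => x Gx /andP[sx xt].
  have xT : s <= x <= T by rewrite sx (le_trans xt tT).
  have [gx1 gx2 _] := Gx; have x0 := le_trans s0 sx; have xT' := le_trans xt tT.
  apply: lerD.
    apply: (le_trans (RE_le law (good_h Gx) (good_H Gx))); rewrite ler_pM2l//.
    rewrite lerXn2r ?nnegrE ?sinorm_ge0 ?addr_ge0//.
    apply: (le_trans (sinormB siL (good_h Gx) (good_H Gx))).
    by rewrite lerD ?hB1 ?hB2.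
  rewrite ler_pM2r ?invr_gt0// -(sinorm2 siV) lerXn2r ?nnegrE ?sinorm_ge0//.
    by rewrite addr_ge0// ?(vbound_ge0 T0 sd1) ?(vbound_ge0 T0 sd2).
  apply: (le_trans (sinormB siV (sd_vc sd1 x) (sd_vc sd2 x))).
  have v1 : sinorm ipvec (vc x) <= vbound Omega T vc n1 by exact: (sd_vbound sd1 x0 xT').
  have v2 : sinorm ipvec (Vc x) <= vbound Omega T Vc n2 by exact: (sd_vbound sd2 x0 xT').
  exact: lerD v1 v2.
- by move=> x y sx xy _; apply: K_mono => //; exact: le_trans sx.
- move=> e e0; have [d' d0 dP] := prim_ucont T0 kn_int e0; exists d' => // x y /andP[sx xt] /andP[sy yt].
  by apply: dP; rewrite ?(le_trans s0 sx) ?(le_trans xt tT) ?(le_trans s0 sy) ?(le_trans yt tT).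
move=> x y S Gx Gy sx xy yt S0 ES.
rewrite mulrAC; apply: energy_interval => // r Gr xr.
by apply: le_trans (ES r Gr xr); rewrite lerDl.
Qed.

End two_solutions.

(** [P] is at most of order tau^(1/2) and [q1], [q2] at most of order tau^(-1/2): the powers of
    [tau] cancel in the products. *)
Lemma layer_arith (R : realFieldType) (s b T P q1 q2 Q1 Q2 tau A k : R) : 0 < s -> s < tau -> tau <= T -> 0 <= b ->
  0 <= P -> 0 <= Q1 -> Q1 <= q1 -> 0 <= Q2 -> Q2 <= q2 ->
  P ^+ 2 <= tau * A -> tau * (2 * q1 ^+ 2 + 2 * q2 ^+ 2) <= k ->
  (s + b) * P * Q1 + (s + b) * P * Q2 <= (T + b) * (A + k).
Proof.
move=> s0 st tT b0 P0 Q10 h1 Q20 h2 hP hk; have t0 := lt_trans s0 st.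
have q0 : 0 <= q1 + q2 by lra.
have e1 : P * (q1 + q2) <= A + k.
  rewrite -(ler_pM2l t0).
  have -> : tau * (P * (q1 + q2)) = P * (tau * (q1 + q2)) by ring.
  have hs : 0 <= (P - tau * (q1 + q2)) ^+ 2 by exact: sqr_ge0.
  have hd : 0 <= tau ^+ 2 * (q1 - q2) ^+ 2 by apply: mulr_ge0; exact: sqr_ge0.
  have hA : 0 <= tau * A by apply: le_trans hP; exact: sqr_ge0.
  have hk0 : 0 <= tau * (2 * q1 ^+ 2 + 2 * q2 ^+ 2).
    by apply: mulr_ge0; [exact: ltW|apply: addr_ge0; apply: mulr_ge0 => //; exact: sqr_ge0].
  have hk' : tau * (tau * (2 * q1 ^+ 2 + 2 * q2 ^+ 2)) <= tau * k by rewrite ler_pM2l.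
  have hk1 : 0 <= tau * k by apply: mulr_ge0; [exact: ltW|exact: le_trans hk0 hk].
  have e2 : tau * (tau * (2 * q1 ^+ 2 + 2 * q2 ^+ 2)) = (tau * (q1 + q2)) ^+ 2 + tau ^+ 2 * (q1 - q2) ^+ 2.
    by ring.
  have e3 : (P - tau * (q1 + q2)) ^+ 2 = P ^+ 2 + (tau * (q1 + q2)) ^+ 2 - 2 * (P * (tau * (q1 + q2))) by ring.
  rewrite [leRHS]mulrDr; move: (P * _) (tau ^+ 2 * _) ((tau * _) ^+ 2) e2 e3 hd hk' hs => z1 z2 z3 -> ->.
  by move: (P ^+ 2) (tau * A) (tau * k) hA hk1 hP => *; lra.
have AK : 0 <= A + k by apply: le_trans e1; exact: mulr_ge0.
rewrite -mulrDr -mulrA; apply: (@le_trans _ _ ((s + b) * (A + k))); last by rewrite ler_wpM2r//; lra.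
apply: ler_wpM2l; first by lra.
apply: le_trans e1; apply: ler_wpM2l => //; exact: lerD.
Qed.

Lemma half_sum (R : realFieldType) (x y e : R) : x <= e / 2 -> y <= e / 2 -> x + y <= e.
Proof. lra. Qed.

Lemma layer_sum (R : realFieldType) (E W X T A Z : R) : 0 <= W -> 0 <= Z -> E <= X * Z -> W <= T * A ->
  T * A <= T * Z -> E + W / 2 <= (X + T + 1) * Z.
Proof. by rewrite !mulrDl mul1r; move: (X * Z) (T * A) (T * Z) => *; lra. Qed.

(** * Energy near the initial time *)

Section initial_layer.
Context (R : realType) (d : nat) (Omega : set 'rV[R]_d) (T : R).
Local Notation leb := (@lebesgue_measure R).
Local Notation I := (`]0, T[%classic : set R).
Local Notation L2 := (L2 Omega).
Local Notation L2vec := (L2vec Omega).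
Local Notation H10 := (H10 Omega).
Local Notation ip := (ip Omega).
Local Notation ipvec := (ipvec Omega).
Local Notation grad := (grad Omega).
Local Notation siL := (L2_si Omega).
Local Notation siV := (L2vec_si Omega).
Hypothesis T0 : 0 < T.
Variables (a delta L : R) (nu m Psi : R -> R).
Hypothesis law : cutoff_law a delta L nu m Psi.
Variables (b : R).
Hypothesis b0 : 0 <= b.
Variables (h0 H0 : 'rV[R]_d -> R^o) (vc Vc dv dV : R -> 'rV[R]_d -> 'rV[R]_d)
  (h H : R -> 'rV[R]_d -> R^o) (G1 G2 : set R) (n1 q1 n2 q2 : R -> R).
Hypothesis sd1 : solution_data Omega T b nu h0 vc h G1 dv n1 q1.
Hypothesis sd2 : solution_data Omega T b nu H0 Vc H G2 dV n2 q2.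
Hypothesis w00 : sinorm ipvec (vc 0 - Vc 0) = 0.
Hypothesis nu_h0 : forall xi, member H10 xi -> ip (nu \o h0) xi = ip (nu \o H0) xi.
Local Notation good := (good T G1 G2).
Let w t : 'rV[R]_d -> 'rV[R]_d := vc t - Vc t.
Let pn t := n1 t + n2 t.

Let w_mem t : member L2vec (w t).
Proof. exact: (siB siV (sd_vc sd1 t) (sd_vc sd2 t)). Qed.

Lemma w_incr x : 0 <= x -> x <= T -> sinorm ipvec (w x - w 0) <= prim pn x.
Proof.
move=> x0 xT.
have := (@w_dist R _ _ _ siV T good (good_ae sd1 sd2) w (fun t => dv t - dV t) pn w_mem (p_mem sd1 sd2)
  (pn_int sd1 sd2) (pn_ge0 sd1 sd2) (p_pn sd1 sd2) (wp_form sd1 sd2) 0 x (lexx 0) x0 xT).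
by rewrite prim0 subr0.
Qed.

Lemma w_prim x : 0 <= x -> x <= T -> sinorm ipvec (w x) <= prim pn x.
Proof.
move=> x0 xT; rewrite -[w x](subrK (w 0)).
apply: (le_trans (sinormD siV (siB siV (w_mem x) (w_mem 0)) (w_mem 0))).
by rewrite [sinorm _ (w 0)]w00 addr0 w_incr.
Qed.

(** The initial values cancel on [xi], so the difference is a flux of [w]; as [w] starts from 0, its
    norm on (0, s) is at most the primitive of [pn]. *)
Lemma layer_form s xi : good s -> member H10 xi ->
  `|ip ((nu \o h s) - (nu \o H s) : L2) xi| <= (s + b) * prim pn s * sinorm ipvec (grad xi).
Proof.
move=> Gs hxi; have [g1 g2 _] := Gs; have sT := good_itv Gs; have /andP[s0 sT'] := sT.
have mg := H10_grad hxi; set N := sinorm _ _; have N0 : 0 <= N by exact: sinorm_ge0.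
rewrite (siBl siL (nu_L2 law (good_h sd1 Gs)) (nu_L2 law (good_H sd2 Gs)) (H10_L2 hxi)).
rewrite (sd_nu sd1 g1 sT hxi) (sd_nu sd2 g2 sT hxi) nu_h0//.
have i1 := @continuous_itv_integrable R _ 0 s (sd_cont sd1 mg).
have i2 := @continuous_itv_integrable R _ 0 s (sd_cont sd2 mg).
have mono : forall x y, 0 <= x -> x <= y -> prim pn x <= prim pn y.
  by move=> x y; apply: prim_ge0; [exact: pn_ge0 sd1 sd2|exact: pn_int sd1 sd2].
have -> (A X1 X2 Y1 Y2 : R) : A + X1 + b * Y1 - (A + X2 + b * Y2) = (X1 - X2) + b * (Y1 - Y2) by ring.
rewrite -RintegralB//.
rewrite -(siBr siV (siB siV (sd_vc sd1 s) (sd_vc sd1 0)) (siB siV (sd_vc sd2 s) (sd_vc sd2 0)) mg).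
have -> : vc s - vc 0 - (Vc s - Vc 0) = w s - w 0.
  by rewrite /w !opprB addrACA [RHS]addrACA; congr (_ + _); exact: addrC.
rewrite mulrDl mulrDl; apply: (le_trans (ler_normD _ _)); apply: lerD; last first.
  rewrite normrM (ger0_norm b0) -mulrA ler_wpM2l// mulrC.
  apply: (le_trans (si_cs siV mg (siB siV (w_mem s) (w_mem 0)))).
  by rewrite mulrC [leRHS]mulrC ler_wpM2l// w_incr.
have hb x : 0 <= x <= s -> - (prim pn s * N) <= ipvec (grad xi) (w x) <= prim pn s * N.
  move=> /andP[x0 xs]; rewrite -ler_norml (le_trans (si_cs siV mg (w_mem x)))// mulrC.
  by rewrite ler_wpM2r// (le_trans (w_prim x0 (le_trans xs sT')))// mono.
have /andP[e1 e2] := Rintegral_itv_bounds (w_cont sd1 sd2 mg) s0 hb.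
rewrite (_ : \int[leb]_(x in `[0, s]) _ = \int[leb]_(x in `[0, s]) ipvec (grad xi) (w x)).
  by move: e1 e2; rewrite subr0 ler_norml => e1 e2; apply/andP; split; lra.
by apply: eq_Rintegral => x _; rewrite (siBr siV (sd_vc sd1 x) (sd_vc sd2 x) mg).
Qed.

(** Pairing nu(h) - nu(H), known to be small in H^{-1}, with itself needs bounds in H^1_0. At a time
    [s] in (0, tau) where [k] is at most its mean, these bounds are a vanishing quantity times
    tau^(-1/2), and the H^{-1} distance is at most of order tau^(1/2). *)
Lemma initial_layer e t : 0 < e -> 0 < t -> exists s, [/\ good s, s < t &
  RE Omega nu Psi (h s) (H s) + ipvec (w s) (w s) / 2 <= e].
Proof.
move=> e0 tp; have TT := T0; have bb := b0.
have [dl0 L0] := (law_d0 law, L_gt0 law).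
pose k r := 2 * q2 r ^+ 2 + 2 * q1 r ^+ 2.
have ik : leb.-integrable setT (EFin \o k).
  have Z : leb.-integrable setT (EFin \o (fun=> 0 : R)).
    by have := @integrable0 _ (measurableTypeR R) R leb setT.
  have j1 := integrable_setT_lin 2 (sd_q2 sd1) Z; have j2 := integrable_setT_lin 2 (sd_q2 sd2) j1.
  by rewrite (_ : k = fun r => 2 * q2 r ^+ 2 + (2 * q1 r ^+ 2 + 0))//; apply/funext => r; rewrite addr0.
have ip1 := pn_int sd1 sd2; have ip2 := pn2_int sd1 sd2.
pose C := L / delta ^+ 2 * (T + b) + T + 1.
have Ld : 0 < L / delta ^+ 2 by rewrite divr_gt0// exprn_gt0.
have C1 : 0 <= L / delta ^+ 2 * (T + b) by rewrite mulr_ge0 ?addr_ge0 ?(ltW T0) ?(ltW Ld).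
have C0 : 0 < C by rewrite /C; lra.
have ee : 0 < e / C / 2 by rewrite !divr_gt0.
have [d1 d10 hd1] := prim_ucont T0 ik ee; have [d2 d20 hd2] := prim_ucont T0 ip2 ee.
pose tau := Num.min (Num.min t T) (Num.min d1 d2) / 2.
have m0 : 0 < Num.min (Num.min t T) (Num.min d1 d2) by rewrite !lt_min tp T0 d10 d20.
have tau0 : 0 < tau by rewrite divr_gt0.
have : tau < Num.min (Num.min t T) (Num.min d1 d2) by rewrite /tau ltr_pdivrMr// ltr_pMr// ltr1n.
rewrite !lt_min => /andP[/andP[taut tauT] /andP[tau1 tau2]].
have [s [Gs /andP[s0 st] hs]] := average_point (good_ae sd1 sd2) ik (lexx 0) tau0 (ltW tauT).
exists s; split=> //; first exact: lt_trans taut.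
have tauT' := ltW tauT; have tau0' := ltW tau0.
have itv0 : (0 : R) <= (0 : R) <= T by rewrite lexx ltW.
have itvt : 0 <= tau <= T by rewrite tau0'.
have n0 : `|tau - 0| = tau by rewrite subr0 ger0_norm.
have := hd1 tau 0 itvt itv0; rewrite n0 => /(_ tau1); rewrite prim0 subr0 => K1.
have := hd2 tau 0 itvt itv0; rewrite n0 => /(_ tau2); rewrite prim0 subr0 => K2.
have {K1}K1 := le_trans (ler_norm _) K1; have {K2}K2 := le_trans (ler_norm _) K2.
move: hs; rewrite prim0 !subr0 => hs.
have [lh lH] := (good_h sd1 Gs, good_H sd2 Gs); have [g1 g2 _] := Gs.
have [_ nh qh] := sd_h sd1 g1; have [_ nH qH] := sd_h sd2 g2.
have s0' := ltW s0; have sT : s <= T := le_trans (ltW st) tauT'.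
set A := prim (fun r => (n1 r + n2 r) ^+ 2) tau in K2.
have P0 : 0 <= prim pn s.
  by rewrite -(prim0 pn); apply: prim_ge0 => //; exact: pn_ge0 sd1 sd2.
have AA : prim (fun r => pn r ^+ 2) s <= A.
  by apply: prim_ge0 => //; [move=> r; exact: sqr_ge0|exact: ltW].
have hP : prim pn s ^+ 2 <= tau * A.
  have := @prim_sqr R pn 0 s ip1 ip2 (lexx 0) s0'; rewrite !prim0 !subr0 => hP.
  apply: (le_trans hP); apply: ler_pM => //; last exact: ltW.
  by rewrite -(prim0 (fun r => pn r ^+ 2)); apply: prim_ge0 => // r; exact: sqr_ge0.
set y := sinorm ip ((nu \o h s) - (nu \o H s) : L2).
have y2 : y ^+ 2 <= (T + b) * (A + prim k tau).
  have [lnh lnH] := (nu_L2 law lh, nu_L2 law lH).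
  have lu := siB siL lnh lnH.
  rewrite (sinorm2 siL) (siBr siL lnh lnH lu).
  apply: (le_trans (ler_norm _)); apply: (le_trans (ler_normB _ _)).
  apply: (le_trans (lerD (layer_form Gs nh) (layer_form Gs nH))).
  apply: (@layer_arith R s b T (prim pn s) (q1 s) (q2 s) _ _ tau) => //.
  - exact: sinorm_ge0.
  - by rewrite -qh; exact: (H10_le nh).2.
  - exact: sinorm_ge0.
  - by rewrite -qH; exact: (H10_le nH).2.
  - by rewrite [_ + 2 * _]addrC.
have hE : RE Omega nu Psi (h s) (H s) <= L / delta ^+ 2 * y ^+ 2.
  apply: (le_trans (RE_le law lh lH)); rewrite -mulrA ler_pM2l// mulrC -expr_div_n.
  rewrite lerXn2r ?nnegrE ?divr_ge0 ?sinorm_ge0 ?(ltW dl0)// ler_pdivlMr// mulrC.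
  exact: (nu_dist law lh lH).2.
have hw : ipvec (w s) (w s) <= T * A.
  rewrite -(sinorm2 siV); apply: (@le_trans _ _ (prim pn s ^+ 2)).
    by rewrite lerXn2r ?nnegrE ?sinorm_ge0// w_prim.
  apply: (le_trans hP); rewrite ler_wpM2r//.
  by rewrite -(pmulr_rge0 _ tau0); apply: le_trans hP; exact: sqr_ge0.
have k0 : 0 <= prim k tau.
  by rewrite -(prim0 k); apply: prim_ge0 => // r; rewrite addr_ge0// mulr_ge0// sqr_ge0.
have A0 : 0 <= A by rewrite -(pmulr_rge0 _ tau0); apply: le_trans hP; exact: sqr_ge0.
have hE' : RE Omega nu Psi (h s) (H s) <= L / delta ^+ 2 * (T + b) * (A + prim k tau).
  by apply: (le_trans hE); rewrite -[leRHS]mulrA (ler_pM2l Ld).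
have w0 := si_ge0 siV (w s).
apply: (@le_trans _ _ (C * (A + prim k tau))); last first.
  apply: (@le_trans _ _ (C * (e / C))); last by rewrite mulrCA divff ?mulr1// gt_eqF.
  by rewrite (ler_pM2l C0); exact: half_sum.
have TA : T * A <= T * (A + prim k tau) by rewrite ler_pM2l// lerDl.
by apply: layer_sum hE' hw TA => //; exact: addr_ge0.
Qed.

End initial_layer.

(** * From almost all times to all times *)

Section preliminaries.
Context (R : realType).
Local Notation leb := (@lebesgue_measure R).

Lemma ae_neq (c : R) : {ae leb, forall t, t <> c}.
Proof.
exists [set c]; split; [exact: measurable_set1|exact: lebesgue_measure_set1|].
by move=> x /= /contrapT.
Qed.

(** [f] will be the norm of a vector-valued function and may fail to be measurable. The endpoints
    are null, so equality in the open interval is enough. *)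
Lemma Rintegral_prim (T : R) (f g : R -> R) t : (forall x, 0 <= f x) -> (forall x, 0 <= g x) ->
  measurable_fun setT g -> {ae leb, forall x, `]0, T[%classic x -> f x = g x} -> t <= T ->
  \int[leb]_(x in `[0, t]) f x = prim g t.
Proof.
move=> f0 g0 mg fg tT; congr fine.
apply: (@ge0_ae_eq_integral_nonmeas _ (measurableTypeR R) R leb) => //.
- by apply/measurable_EFinP; exact: measurable_funTS.
- by move=> x _; rewrite lee_fin.
- by move=> x _; rewrite lee_fin.
apply: filterS3 fg (ae_neq 0) (ae_neq t) => x fgx x0 xt; rewrite /= in_itv/= => /andP[h0 ht].
rewrite fgx//= in_itv/= lt_neqAle h0 andbT eq_sym; apply/andP; split; first exact/eqP.
by apply: lt_le_trans tT; rewrite lt_neqAle ht andbT; exact/eqP.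
Qed.

Lemma inner_cont (X : Defs.space R) (B : X -> X -> R) (T : R) (uc : R -> X) :
  (forall x, member X x -> snorm X x = sinorm B x) -> semi_inner (member X) B -> bochner_C T uc ->
  forall x, 0 <= x <= T -> member X (uc x) /\ forall e, 0 < e -> exists2 d, 0 < d &
    forall y, 0 <= y <= T -> `|x - y| < d -> sinorm B (uc y - uc x) <= e.
Proof.
move=> snE si cu x xT; have [|mx hx] := cu x; first by rewrite in_itv.
split=> // e e0; have [d d0 dP] := near_within_eps hx e0; exists d => // y yT xy.
have [|my _] := cu y; first by rewrite in_itv.
rewrite -(snE _ (siB si my mx)); apply: le_trans (dP y _ xy); last by rewrite /= in_itv.
by rewrite sub0r normrN ler_norm.
Qed.

(** Good times [s] near 0 and [y] near [t] are inserted, and [F] is continuous; for the exponent,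
    monotonicity of [K] gives K y - K s <= K t. *)
Lemma gronwall_limit (T c : R) (G : set R) (F K : R -> R) : 0 < T -> 0 <= c -> dense_in G 0 T ->
  (forall x, 0 <= x <= T -> forall e, 0 < e -> exists2 d, 0 < d &
    forall y, 0 <= y <= T -> `|x - y| < d -> `|F y - F x| <= e) ->
  (forall x, 0 <= x -> 0 <= K x) -> (forall x y, 0 <= x -> x <= y -> K x <= K y) ->
  (forall x, 0 <= F x) ->
  (forall s t, G s -> G t -> s < t -> F t <= F s * expR (c * (K t - K s))) ->
  forall t, 0 < t <= T -> F t <= F 0 * expR (c * K t).
Proof.
move=> T0 c0 dG Fc K0 Km F0 FG t /andP[t0 tT]; apply: ler_eps => e e0.
pose X := expR (c * K t); have X0 : 0 < X by exact: expR_gt0.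
have e1 : 0 < e / (X + 1) by rewrite divr_gt0// addr_gt0.
have tT' : 0 <= t <= T by rewrite ltW.
have [d1 d10 h1] := Fc t tT' _ e1.
have [|d2 d20 h2] := Fc 0 _ _ e1; first by rewrite lexx ltW.
have t2 : 0 <= t / 2 by rewrite divr_ge0// ltW.
have mt : Num.max (t / 2) (t - d1) < t by rewrite gt_max ltrBlDr ltrDl d10 andbT; lra.
have [|y [Gy yl yt]] := dG _ t _ mt tT; first by rewrite le_max t2.
have mt2 : 0 < Num.min (t / 2) d2 by rewrite lt_min d20 andbT divr_gt0.
have [|s [Gs s0 sl]] := dG 0 _ (lexx 0) mt2; first by rewrite ge_min; apply/orP; left; lra.
move: yl sl; rewrite gt_max lt_min => /andP[y2 yd] /andP[s2 sd].
have s0' := ltW s0; have y0 : 0 <= y by rewrite ltW// (le_lt_trans t2).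
have sy := lt_trans s2 y2.
have a1 : `|F y - F t| <= e / (X + 1).
  apply: h1; first by rewrite y0 (le_trans (ltW yt)).
  by rewrite ger0_norm ?subr_ge0 ?(ltW yt)// ltrBlDr addrC -ltrBlDr.
have a2 : `|F s - F 0| <= e / (X + 1).
  apply: h2; first by rewrite s0' (le_trans (ltW s2))// ltW// (lt_le_trans _ tT)// ltr_pdivrMr// ltr_pMr// ltr1n.
  by rewrite sub0r normrN ger0_norm.
have b1 := FG s y Gs Gy sy.
have b2 : F s * expR (c * (K y - K s)) <= (F 0 + e / (X + 1)) * X.
  apply: ler_pM; [exact: F0|exact: expR_ge0| |].
    by have := le_trans (ler_norm _) a2; rewrite lerBlDr addrC.
  rewrite ler_expR ler_wpM2l// lerBlDr (le_trans (Km _ _ y0 (ltW yt)))// lerDl; exact: K0.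
have b3 : F t <= F y + e / (X + 1).
  by have := le_trans (ler_norm _) (eq_ind _ (fun z => z <= _) a1 _ (distrC _ _)); rewrite lerBlDr addrC.
have ee : e = e / (X + 1) * X + e / (X + 1) by rewrite -[X in _ + X]mulr1 -mulrDr divfK// gt_eqF// addr_gt0.
by apply: (le_trans b3); rewrite [X in _ <= _ + X]ee addrA lerD2r (le_trans b1)// (le_trans b2)// mulrDl.
Qed.

End preliminaries.

(** Pairing with [y] is a bounded form on L^infinity. The constant and the null sets depend on [y],
    the majorant [kn] does not. *)
Lemma W11_form (R : realType) d (Omega : set 'rV[R]_d) (T : R)
    (H Ht : R -> Lebesgue Omega +oo%E) : open Omega -> bounded_set Omega -> 0 < T ->
  bochner_W1p (X := Lebesgue Omega +oo%E) T 1%:E H Ht ->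
  exists kn, [/\ (@lebesgue_measure R).-integrable setT (EFin \o kn), forall t, 0 <= kn t,
    {ae @lebesgue_measure R, forall t, `]0, T[%classic t -> snorm (Lebesgue Omega +oo%E) (Ht t) = kn t} &
    forall y, member (L2 Omega) y -> exists c f, [/\ (@lebesgue_measure R).-integrable setT (EFin \o f),
      {ae @lebesgue_measure R, forall t, `]0, T[%classic t -> ip Omega (H t) y = c + prim f t} &
      {ae @lebesgue_measure R, forall t, `]0, T[%classic t ->
         `|f t| <= (\int[lebesgue_row R d]_(x in Omega) `|y x|) * kn t}]].
Proof.
move=> oO bO T0 [H1 Ht1 wd]; have S := Linf_seminormed Omega.
have [g [rg _]] := Lp1_rep (sn_ge0 S) H1; have [kn [rk kn0]] := Lp1_rep (sn_ge0 S) Ht1.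
exists kn; split; [exact: rk.1|exact: kn0|exact: rk.2|].
move=> y ly; have lf := Linf_form oO bO ly.
have [f rf] := strongly_measurable_form S lf H1.1; have [q rq] := strongly_measurable_form S lf Ht1.1.
have [c hc] := weak_time_derivative_form S lf T0 wd rf rq rg rk.
exists c, q; split.
- exact: (represents_integrable S lf rq rk).
- exact: hc.
have [_ _ hq] := rq; apply: filterS2 hq rk.2 => t h1 h2 It; have [mt <-] := h1 It.
by rewrite -(h2 It); exact: (bf_bound lf mt).
Qed.

Lemma square_dist_arith (R : realFieldType) (x y e : R) : 0 <= x -> 0 <= y -> `|y - x| <= e -> e <= 1 ->
  `|y ^+ 2 / 2 - x ^+ 2 / 2| <= e * (x + 1).
Proof.
move=> x0 y0 h e1; rewrite -mulrBl subr_sqr -mulrA normrM.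
apply: ler_pM => //; rewrite ger0_norm ?divr_ge0 ?addr_ge0//.
have := le_trans (ler_norm _) h; lra.
Qed.

Section zero_distance.
Context (R : realType) (V : lmodType R) (A : set V) (B : V -> V -> R).
Hypothesis si : semi_inner A B.

Lemma sinorm0_chain x y x' y' : A x -> A y -> A x' -> A y' -> sinorm B (x - x') = 0 ->
  sinorm B (y - y') = 0 -> sinorm B (x' - y') = 0 -> sinorm B (x - y) = 0.
Proof.
move=> Ax Ay Ax' Ay' hx hy hxy; apply/eqP; rewrite eq_le sinorm_ge0 andbT.
have -> : x - y = (x' - y') + ((x - x') - (y - y')).
  by rewrite opprB (addrC (x - x')) addrA subrKA addrC subrKA.
have [s1 s2 s3] := And3 (siB si Ax' Ay') (siB si Ax Ax') (siB si Ay Ay').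
apply: (le_trans (sinormD si s1 (siB si s2 s3))); rewrite hxy add0r.
by apply: (le_trans (sinormB si s2 s3)); rewrite hx hy addr0.
Qed.

End zero_distance.

Lemma sinorm_ipvec_ae0 (R : realType) d (Omega : set 'rV[R]_d) (g q : L2vec Omega) :
  member (L2vec Omega) g -> member (L2vec Omega) q ->
  {ae lebesgue_row R d, forall x, Omega x -> g x = q x} -> sinorm (ipvec Omega) (g - q) = 0.
Proof.
move=> mg mq gq; have mgq := siB (L2vec_si Omega) mg mq.
rewrite /sinorm (ipvecE mgq mgq) big1 ?sqrtr0// => i _.
rewrite -(sinorm2 (L2_si Omega)).
have -> : (fun x => (g - q) x 0 i) = (fun x => g x 0 i : R^o) - (fun x => q x 0 i : R^o) :> L2 Omega.
  by apply/funext => x; rewrite !fctE /= !mxE.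
rewrite (sinorm_ip_ae0 (mg i) (mq i)) ?expr0n//.
by apply: filterS gq => x h /h ->.
Qed.

Section stability.
Context (R : realType) (d : nat) (Omega : set 'rV[R]_d) (T : R).
Local Notation leb := (@lebesgue_measure R).
Local Notation mu := (lebesgue_row R d).
Local Notation I := (`]0, T[%classic : set R).
Local Notation L2 := (L2 Omega).
Local Notation L2vec := (L2vec Omega).
Local Notation H10 := (H10 Omega).
Local Notation ip := (ip Omega).
Local Notation ipvec := (ipvec Omega).
Local Notation siL := (L2_si Omega).
Local Notation siV := (L2vec_si Omega).
Hypotheses (oO : open Omega) (bO : bounded_set Omega) (T0 : 0 < T).
Variables (a delta L : R) (nu m Psi : R -> R).
Hypothesis law : cutoff_law a delta L nu m Psi.
Variables (b : R).
Hypothesis b0 : 0 <= b.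
Variables (h0 H0 : 'rV[R]_d -> R^o) (vc Vc dv dV : R -> 'rV[R]_d -> 'rV[R]_d)
  (h H : R -> 'rV[R]_d -> R^o) (G1 G2 : set R) (n1 q1 n2 q2 : R -> R).
Hypothesis sd1 : solution_data Omega T b nu h0 vc h G1 dv n1 q1.
Hypothesis sd2 : solution_data Omega T b nu H0 Vc H G2 dV n2 q2.
Variable kn : R -> R.
Hypothesis kn_int : leb.-integrable setT (EFin \o kn).
Hypothesis kn0 : forall t, 0 <= kn t.
Hypothesis H_kn : forall y, member L2 y -> exists c f, [/\ leb.-integrable setT (EFin \o f),
  {ae leb, forall t, I t -> ip (H t) y = c + prim f t} &
  {ae leb, forall t, I t -> `|f t| <= (\int[mu]_(x in Omega) `|y x|) * kn t}].
Local Notation good := (good T G1 G2).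
Let w t : 'rV[R]_d -> 'rV[R]_d := vc t - Vc t.
Let K0 x : 0 <= x -> 0 <= prim kn x.
Proof. by move=> x0; have := prim_ge0 kn0 kn_int (lexx 0) x0; rewrite prim0. Qed.

(** The Gronwall estimate starts at a time of the initial layer with energy at most e / X, where [X]
    is the growth factor from 0 to [t], which bounds the one from any later start. *)
Lemma zero_energy t : sinorm ipvec (w 0) = 0 ->
  (forall xi, member H10 xi -> ip (nu \o h0) xi = ip (nu \o H0) xi) -> good t ->
  sinorm ip (h t - H t) = 0 /\ sinorm ipvec (w t) = 0.
Proof.
move=> w0 nu_h0 Gt; have [_ _ /andP[t0 tT]] := Gt; have t0' := ltW t0.
have [a0 dl0] := (law_a0 law, law_d0 law); have ad : 0 <= a / delta by rewrite divr_ge0// ltW.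
pose X := expR (a / delta * prim kn t); have X0 : 0 < X by exact: expR_gt0.
have E0 x : 0 <= RE Omega nu Psi (h x) (H x) by exact: RE_ge0 law _ _.
have W0 x : 0 <= ipvec (w x) (w x) / 2 by rewrite divr_ge0// (si_ge0 siV).
have small : RE Omega nu Psi (h t) (H t) + ipvec (w t) (w t) / 2 <= 0.
  apply: ler_eps => e e0; rewrite add0r.
  have [s [Gs st hs]] := initial_layer T0 law b0 sd1 sd2 w0 nu_h0 (divr_gt0 e0 X0) t0.
  have /andP[s0 _] := good_itv Gs.
  apply: (le_trans (energy_gronwall oO bO T0 law b0 sd1 sd2 kn_int kn0 H_kn Gs Gt st)).
  have -> : e = e / X * X by rewrite divfK// gt_eqF.
  apply: ler_pM hs _; [by apply: addr_ge0; [exact: E0|exact: W0]|exact: expR_ge0|].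
  by rewrite ler_expR ler_wpM2l// lerBlDr lerDl K0.
have eh : delta / 2 * sinorm ip (h t - H t) ^+ 2 <= 0.
  apply: (le_trans (RE_ge law (good_h sd1 Gt) (good_H sd2 Gt))).
  by apply: le_trans small; rewrite lerDl.
have ew : ipvec (w t) (w t) / 2 <= 0 by apply: le_trans small; rewrite lerDr.
split; apply/eqP; rewrite -sqrf_eq0 eq_le sqr_ge0 andbT.
  by rewrite -(pmulr_rle0 _ (divr_gt0 dl0 (ltr0Sn R 1))).
by rewrite (sinorm2 siV) -(pmulr_lle0 _ (x := 2^-1)) ?invr_gt0.
Qed.

Variables (hc Hc : R -> 'rV[R]_d -> R^o).
Hypothesis hcP : continuous_repr (X := L2) T h hc.
Hypothesis HcP : continuous_repr (X := L2) T H Hc.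
Let F x := ipvec (w x) (w x) / 2 + RE Omega nu Psi (hc x) (Hc x).

Lemma repr_energy_cont x : 0 <= x <= T -> forall e, 0 < e -> exists2 d, 0 < d &
    forall y, 0 <= y <= T -> `|x - y| < d -> `|F y - F x| <= e.
Proof.
move=> xT e e0; have L0 := L_gt0 law.
have [lh hh] := inner_cont (@L2_snorm _ _ Omega) siL hcP.1 xT.
have [lH hH] := inner_cont (@L2_snorm _ _ Omega) siL HcP.1 xT.
have mw t : member L2vec (w t) by exact: (siB siV (sd_vc sd1 t) (sd_vc sd2 t)).
pose N := sinorm ip (hc x) + sinorm ip (Hc x) + 1.
have N0 : 0 <= N by rewrite !addr_ge0 ?sinorm_ge0.
pose C := sinorm ipvec (w x) + 1 + 2 * L * (2 * N * 2).
have C0 : 0 < C.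
  by apply: ltr_pwDl; rewrite ?ltr_wpDl ?sinorm_ge0// !mulr_ge0// ltW.
(* With [eta <= 1] the norms near [x] exceed those at [x] by at most 1, which makes the Lipschitz
   constant of the entropy uniform. *)
pose eta := Num.min 1 (e / C).
have eta0 : 0 < eta by rewrite lt_min ltr01 divr_gt0.
have eta1 : eta <= 1 by rewrite ge_min lexx.
have etaC : eta * C <= e by rewrite -ler_pdivlMr// ge_min lexx orbT.
have [d1 d10 p1] := hh _ eta0; have [d2 d20 p2] := hH _ eta0.
have [d3 d30 p3] := @w_ucont R _ _ _ siV T good T0 (good_ae sd1 sd2) w (fun t => dv t - dV t)
  (fun t => n1 t + n2 t) mw (p_mem sd1 sd2) (pn_int sd1 sd2) (pn_ge0 sd1 sd2) (p_pn sd1 sd2)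
  (wp_form sd1 sd2) eta eta0.
exists (Num.min d1 (Num.min d2 d3)); first by rewrite !lt_min d10 d20.
move=> y yT; rewrite !lt_min => /and3P[y1 y2 y3].
have e1 := p1 y yT y1; have e2 := p2 y yT y2.
have e3 : sinorm ipvec (w y - w x) <= eta by apply: p3 => //; rewrite distrC.
have [lhy _] := inner_cont (@L2_snorm _ _ Omega) siL hcP.1 yT.
have [lHy _] := inner_cont (@L2_snorm _ _ Omega) siL HcP.1 yT.
have g1 : sinorm ip (hc y) <= sinorm ip (hc x) + 1.
  rewrite -lerBlDl; apply: (le_trans (ler_norm _)); apply: (le_trans (sinorm_dist siL lhy lh)).
  exact: le_trans e1 eta1.
have g2 : sinorm ip (Hc y) <= sinorm ip (Hc x) + 1.
  rewrite -lerBlDl; apply: (le_trans (ler_norm _)); apply: (le_trans (sinorm_dist siL lHy lH)).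
  exact: le_trans e2 eta1.
apply: le_trans etaC; rewrite /F opprD addrACA mulrDr; apply: (le_trans (ler_normD _ _)); apply: lerD.
  rewrite -!(sinorm2 siV); apply: square_dist_arith; rewrite ?sinorm_ge0//.
  exact: le_trans (sinorm_dist siV (mw y) (mw x)) e3.
apply: (le_trans (RE_dist law lhy lHy lh lH)).
have -> : eta * (2 * L * (2 * N * 2)) = 2 * L * (2 * N * (eta + eta)) by ring.
rewrite ler_pM2l ?mulr_gt0//; apply: ler_pM; rewrite ?addr_ge0 ?sinorm_ge0//; last exact: lerD.
rewrite /N; move: g1 g2; move: (sinorm _ (hc y)) (sinorm _ (Hc y)) (sinorm _ (hc x)) (sinorm _ (Hc x)).
by move=> z1 z2 z3 z4 *; lra.
Qed.

Lemma repr_energy t : 0 <= t <= T -> F t <= F 0 * expR (a / delta * prim kn t).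
Proof.
move=> /andP[]; rewrite [in X in X -> _]le_eqVlt => /orP[/eqP <- _|t0 tT].
  by rewrite prim0 mulr0 expR0 mulr1.
have [a0 dl0] := (law_a0 law, law_d0 law); have ad : 0 <= a / delta by rewrite divr_ge0// ltW.
pose G s := good s /\ (snorm L2 (hc s - h s) = 0 /\ snorm L2 (Hc s - H s) = 0).
have Gae : {ae leb, forall s, I s -> G s}.
  by apply: filterS3 (good_ae sd1 sd2) hcP.2 HcP.2 => s g1 g2 g3 Is; split; [exact: g1|split; [exact: g2|exact: g3]].
(* At these times the representatives are at zero distance from [h] and [H], and by [RE_dist] the
   entropy does not see the change. *)
have FE s : G s -> F s = RE Omega nu Psi (h s) (H s) + ipvec (w s) (w s) / 2.
  move=> [Gs [hs Hs]]; rewrite addrC /F; congr (_ + _); apply/eqP; rewrite -subr_eq0 -normr_le0.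
  have sT := good_itv Gs; have [lh lH] := (good_h sd1 Gs, good_H sd2 Gs).
  have [lhc _] := inner_cont (@L2_snorm _ _ Omega) siL hcP.1 sT.
  have [lHc _] := inner_cont (@L2_snorm _ _ Omega) siL HcP.1 sT.
  apply: (le_trans (RE_dist law lhc lHc lh lH)).
  rewrite -(L2_snorm (siB siL lhc lh)) -(L2_snorm (siB siL lHc lH)).
  by rewrite [X in _ * (X + _)]hs [X in _ * (_ + X)]Hs addr0 !mulr0.
apply: (gronwall_limit (T := T) (G := G)) => //.
- exact: conull_dense.
- exact: repr_energy_cont.
- by move=> x y; exact: prim_ge0.
- by move=> x; rewrite addr_ge0// ?divr_ge0 ?(si_ge0 siV)// (RE_ge0 law).
- move=> s r Gs Gr sr; rewrite !FE//.
  exact: (energy_gronwall oO bO T0 law b0 sd1 sd2 kn_int kn0 H_kn Gs.1 Gr.1 sr).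
by rewrite t0.
Qed.

End stability.

Theorem theorem4p2 (R : realType) (d : nat) (Omega : set 'rV[R]_d) (T a b M : R)
    (hd : (1 <= d <= 3)%N) (hOmega : bounded_lipschitz_domain Omega)
    (hT : 0 < T) (ha : 0 < a) (hb : 0 < b) (hM : 0 < M < a^-1)
    (v0 V0 : 'rV[R]_d -> 'rV[R]_d) (h0 H0 : 'rV[R]_d -> R)
    (v V : R -> 'rV[R]_d -> 'rV[R]_d) (h H : R -> 'rV[R]_d -> R)
    (vh_sol : weak_solution a b M Omega T v0 h0 v h)
    (VH_sol : weak_solution a b M Omega T V0 H0 V H)
    (Ht : R -> 'rV[R]_d -> R)
    (H_W11 : bochner_W1p (X := Lebesgue Omega +oo%E) T 1%:E H Ht) :
  (forall (vc Vc : R -> 'rV[R]_d -> 'rV[R]_d) (hc Hc : R -> 'rV[R]_d -> R),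
    continuous_repr (X := L2vec Omega) T v vc ->
    continuous_repr (X := L2vec Omega) T V Vc ->
    continuous_repr (X := L2 Omega) T h hc ->
    continuous_repr (X := L2 Omega) T H Hc ->
    forall t : R, 0 <= t <= T ->
      2^-1 * (snorm (L2vec Omega) (vc t - Vc t)) ^+ 2
        + rel_entropy a M Omega (hc t) (Hc t)
      <= (2^-1 * (snorm (L2vec Omega) (vc 0 - Vc 0)) ^+ 2
            + rel_entropy a M Omega (hc 0) (Hc 0))
         * expR (a / (1 - a * M)
                 * \int[@lebesgue_measure R]_(s in `[0, t])
                     snorm (Lebesgue Omega +oo%E) (Ht s)))
  /\
  ({ae lebesgue_row R d, forall x, Omega x -> v0 x = V0 x} ->
   {ae lebesgue_row R d, forall x, Omega x -> h0 x = H0 x} ->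
   {ae @lebesgue_measure R, forall t, `]0, T[%classic t ->
     {ae lebesgue_row R d, forall x, Omega x -> v t x = V t x /\ h t x = H t x}}).
Proof.
have /andP[M0 aM'] := hM; have aM : a * M < 1 by rewrite mulrC -ltr_pdivlMr// div1r.
have law := cutoff_lawP ha M0 aM; have [_ oO _ bO _] := hOmega.
have [siL siV] := (L2_si Omega, L2vec_si Omega).
have nuL2 u : member (L2 Omega) u -> member (L2 Omega) (nu a M \o u) by exact: nu_L2 law _.
have [kn [kn_int kn0 knE H_kn]] := W11_form oO bO hT H_W11.
have vcont (u uc : R -> L2vec Omega) x : continuous_repr T u uc -> 0 <= x <= T -> member (L2vec Omega) (uc x).
  by move=> [cu _] xT; have [|] := cu x; rewrite ?in_itv.
split=> [vc Vc hc Hc vcP VcP hcP HcP t tT|v00 h00].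
  have [G1 [dv [n1 [q1 sd1]]]] := solution_dataP oO bO hT nuL2 vh_sol vcP.
  have [G2 [dV [n2 [q2 sd2]]]] := solution_dataP oO bO hT nuL2 VH_sol VcP.
  have := repr_energy oO bO hT law (ltW hb) sd1 sd2 kn_int kn0 H_kn hcP HcP tT.
  have T00 : (0 : R) <= (0 : R) <= T by rewrite lexx ltW.
  rewrite !clip_id//.
  have wE x : 0 <= x <= T ->
      ipvec Omega (vc x - Vc x) (vc x - Vc x) / 2 = 2^-1 * snorm (L2vec Omega) (vc x - Vc x) ^+ 2.
    move=> xT; rewrite (L2vec_snorm (siB siV (vcont _ _ _ vcP xT) (vcont _ _ _ VcP xT))).
    by rewrite (sinorm2 siV) mulrC.
  have mkn : measurable_fun setT kn by apply/measurable_EFinP; exact: measurable_int kn_int.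
  have Ht0 s : 0 <= snorm (Lebesgue Omega +oo%E) (Ht s) by exact: (sn_ge0 (Linf_seminormed Omega)).
  by have /andP[_ tT'] := tT; rewrite !wE// (Rintegral_prim Ht0 kn0 mkn knE tT').
(* For uniqueness the representatives of [v] and [V] are those that carry the initial values; [h]
   and [H] are compared directly at good times. *)
have [[mv0 mh0] vLp _ _ [[vc vcP vc0] _]] := vh_sol.
have [[mV0 mH0] VLp _ _ [[Vc VcP Vc0] _]] := VH_sol.
have [G1 [dv [n1 [q1 sd1]]]] := solution_dataP oO bO hT nuL2 vh_sol vcP.
have [G2 [dV [n2 [q2 sd2]]]] := solution_dataP oO bO hT nuL2 VH_sol VcP.
have T00 : (0 : R) <= (0 : R) <= T by rewrite lexx ltW.
have [mvc0 mVc0] := (vcont _ _ _ vcP T00, vcont _ _ _ VcP T00).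
have w0 : sinorm (ipvec Omega) (vc (clip T 0) - Vc (clip T 0)) = 0.
  rewrite clip_id//; apply: (sinorm0_chain siV mvc0 mVc0 mv0 mV0).
  - by rewrite -(L2vec_snorm (siB siV mvc0 mv0)).
  - by rewrite -(L2vec_snorm (siB siV mVc0 mV0)).
  - exact: sinorm_ipvec_ae0.
have nu_h0 xi : member (H10 Omega) xi -> ip Omega (nu a M \o h0) xi = ip Omega (nu a M \o H0) xi.
  move=> /(@H10_L2 _ _ _ _) lxi; have [l1 l2] := (nuL2 _ mh0, nuL2 _ mH0).
  apply/eqP; rewrite -subr_eq0 -(siBl siL l1 l2 lxi) -normr_le0.
  apply: (le_trans (si_cs siL (siB siL l1 l2) lxi)); rewrite (sinorm_ip_ae0 l1 l2) ?mul0r//.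
  by apply: filterS h00 => x e /e /= ->.
have mem (u uc : R -> L2vec Omega) : bochner_Lp T +oo%E u -> continuous_repr T u uc ->
    {ae @lebesgue_measure R, forall t, `]0, T[%classic t ->
      member (L2vec Omega) (u t) /\ snorm (L2vec Omega) (uc t - u t) = 0}.
  by move=> [[mu _] _] [_ eu]; apply: filterS2 mu eu => t e1 e2 It; split; [exact: e1|exact: e2].
apply: filterS3 (good_ae sd1 sd2) (mem _ _ vLp vcP) (mem _ _ VLp VcP) => t e1 e2 e3 It.
have [Gt [mv ev] [mV eV]] := And3 (e1 It) (e2 It) (e3 It); have tT := good_itv Gt.
have [hE wE] := zero_energy oO bO hT law (ltW hb) sd1 sd2 kn_int kn0 H_kn w0 nu_h0 Gt.
rewrite !clip_id// in wE.
have [mvc mVc] := (vcont _ _ _ vcP tT, vcont _ _ _ VcP tT).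
have vV : sinorm (ipvec Omega) (v t - V t) = 0.
  apply: (sinorm0_chain siV mv mV mvc mVc) => //.
  - by rewrite (sinormC siV mv mvc) -(L2vec_snorm (siB siV mvc mv)).
  - by rewrite (sinormC siV mV mVc) -(L2vec_snorm (siB siV mVc mV)).
have := L2_ae0 (siB siL (good_h sd1 Gt) (good_H sd2 Gt)) hE.
have := L2vec_ae0 (siB siV mv mV) vV.
apply: filterS2 => x {}e1 {}e2 Ox; split; apply/eqP; rewrite -subr_eq0; apply/eqP.
- exact: e1.
- exact: e2.
Qed.
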